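(* Let $m\ge1$ be an integer, let $p_i(\cdot)\in LH\cap\mathcal P$ for $i=1,\dots,m$, and put $\frac1{p(\cdot)}=\sum_{i=1}^m\frac1{p_i(\cdot)}$. Let $1<t<\min_{1\le i\le m}(p_i)_-$, let $\alpha$ be a constant and $q(\cdot)\in\mathcal P_0$ an exponent with $\frac{\alpha}{n}=\frac1{p(\cdot)}-\frac1{q(\cdot)}\in(0,\frac mt)$. Let $\vec\omega=(\omega_1,\dots,\omega_m)\in A_{\vec p(\cdot),q(\cdot)}$ be such that $\vec\omega^{\,t}=(\omega_1^t,\dots,\omega_m^t)\in A_{\frac{\vec p(\cdot)}t,\frac{q(\cdot)}t}$, and put $\omega=\prod_{i=1}^m\omega_i$. Let $\mathscr T_\alpha$ be either $\mathscr M_\alpha$ or $\mathscr I_\alpha$. Then there is a constant $C>0$ such that for every $\vec b=(b_1,\dots,b_m)\in(\mathrm{BMO}(\mathbb R^n))^m$, $$\|\mathscr T_{\alpha,\Sigma\vec b}\|_{L^{p_1(\cdot)}(\omega_1)\times\cdots\times L^{p_m(\cdot)}(\omega_m)\to L^{q(\cdot)}(\omega)}\le C\sum_{i=1}^m\|b_i\|_{\mathrm{BMO}}.$$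
   Context: Exponents: for a measurable $p:\mathbb R^n\to(0,\infty)$ put $p_-=\operatorname{ess\,inf}p$, $p_+=\operatorname{ess\,sup}p$. $\mathcal P$ is the set of measurable $p(\cdot)$ with $1<p_-\le p_+<\infty$; $\mathcal P_0$ the set of measurable $p(\cdot)$ with $0<p_-\le p_+<\infty$. The conjugate exponent is $p'(\cdot)=p(\cdot)/(p(\cdot)-1)$. $p(\cdot)\in LH$ (globally log-Hölder continuous) means there are $C>0$ and $p_\infty>0$ with $|p(x)-p(y)|\le\frac{C}{-\log|x-y|}$ whenever $|x-y|<\frac12$, and $|p(x)-p_\infty|\le\frac{C}{\log(e+|x|)}$ for all $x\in\mathbb R^n$. Spaces: for $p(\cdot)\in\mathcal P_0$, $\|f\|_{L^{p(\cdot)}}=\inf\{\lambda>0:\int_{\mathbb R^n}(|f(x)|/\lambda)^{p(x)}dx\le1\}$, and $\|f\|_{L^{p(\cdot)}(\omega)}=\|\omega f\|_{L^{p(\cdot)}}$. A weight is a locally integrable $\omega:\mathbb R^n\to[0,\infty]$ with $0<\omega<\infty$ a.e.; a multiple weight is an $m$-tuple $\vec\omega$ of weights. For exponents $r_i(\cdot)\in\mathcal P$, $\frac1{r(\cdot)}=\sum_i\frac1{r_i(\cdot)}$, and $s(\cdot)\in\mathcal P_0$ with $\frac1{r(\cdot)}-\frac1{s(\cdot)}=\frac\beta n\in[0,m)$ constant, $\vec v=(v_1,\dots,v_m)\in A_{\vec r(\cdot),s(\cdot)}$ means that, with $v=\prod_iv_i$, $$\sup_{B}|B|^{\frac{\beta}{n}-m}\|v\chi_B\|_{L^{s(\cdot)}}\prod_{i=1}^m\|v_i^{-1}\chi_B\|_{L^{r_i'(\cdot)}}<\infty,$$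 the supremum over all balls $B\subseteq\mathbb R^n$. In $A_{\vec p(\cdot)/t,q(\cdot)/t}$ the exponents are $p_i(\cdot)/t$ and $q(\cdot)/t$ (so $\beta=t\alpha$). $\|b\|_{\mathrm{BMO}}=\sup_B\frac1{|B|}\int_B|b(x)-b_B|dx$, $b_B=\frac1{|B|}\int_Bb$. Operators, for $0<\alpha<mn$ and $\vec f=(f_1,\dots,f_m)$: $$\mathscr M_\alpha(\vec f)(x)=\sup_{r>0}\frac1{|B(x,r)|^{m-\frac{\alpha}{n}}}\prod_{i=1}^m\int_{B(x,r)}|f_i(y_i)|\,dy_i,$$ $$\mathscr I_\alpha(\vec f)(x)=\int_{(\mathbb R^n)^m}\frac{f_1(y_1)\cdots f_m(y_m)}{(|x-y_1|+\cdots+|x-y_m|)^{mn-\alpha}}\,dy_1\cdots dy_m.$$ The commutator is $$\mathscr T_{\alpha,\Sigma\vec b}(\vec f)(x)=\sum_{j=1}^m\mathscr T_\alpha(f_1,\dots,(b_j(x)-b_j)f_j,\dots,f_m)(x),$$ where $x$ is frozen in $b_j(x)$ when $\mathscr T_\alpha$ is applied. The operator norm of an operator $T$ is the least $C$ with $\|T(\vec f)\|_{L^{q(\cdot)}(\omega)}\le C\prod_i\|f_i\|_{L^{p_i(\cdot)}(\omega_i)}$ for all $f_i\in L^{p_i(\cdot)}(\omega_i)$. *)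

(* Defs.v *)
From HB Require Import structures.
From mathcomp Require Import all_boot all_order all_algebra.
From mathcomp Require Import all_classical all_reals all_analysis.
From mathcomp Require Import measurable_realfun ess_sup_inf.

Set Implicit Arguments.
Unset Strict Implicit.
Unset Printing Implicit Defensive.
Import Order.TTheory GRing.Theory Num.Theory.
Import numFieldNormedType.Exports.

Local Open Scope classical_set_scope.
Local Open Scope ring_scope.

Section tuple_measure.
Context d (T : measurableType d) (R : realType).

Definition tuple_cons k (x : T * k.-tuple T) : k.+1.-tuple T :=
  [the k.+1.-tuple T of x.1 :: x.2].

Lemma measurable_tuple_cons k : measurable_fun [set: T * k.-tuple T] (@tuple_cons k).
Proof. by apply: measurable_cons; [exact: measurable_fst|exact: measurable_snd]. Qed.

Section step.
Variable mu : {sigma_finite_measure set T -> \bar R}.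
Variables (k : nat) (nu : {sigma_finite_measure set (k.-tuple T) -> \bar R}).

Definition tuple_measureS : set (k.+1.-tuple T) -> \bar R :=
  pushforward (mu \x nu)%E (@tuple_cons k).

Let tuple_measureS0 : tuple_measureS set0 = 0%E.
Proof. by rewrite /tuple_measureS /pushforward preimage_set0 measure0. Qed.

Let tuple_measureS_ge0 A : (0 <= tuple_measureS A)%E.
Proof.
by rewrite /tuple_measureS /pushforward measure_ge0.
Qed.

Let tuple_measureS_sigma_additive : semi_sigma_additive tuple_measureS.
Proof.
move=> F mF tF mUF; rewrite /tuple_measureS /pushforward preimage_bigcup.
have mcF i : measurable (@tuple_cons k @^-1` F i).
  by rewrite -[X in measurable X]setTI; apply: measurable_tuple_cons.
apply: measure_semi_sigma_additive => //.
- apply/trivIsetP => /= i j _ _ ij; rewrite -preimage_setI.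
  by move/trivIsetP : tF => /(_ _ _ _ _ ij) ->//; rewrite preimage_set0.
- exact: bigcup_measurable.
Qed.

HB.instance Definition _ := isMeasure.Build _ _ _ tuple_measureS
  tuple_measureS0 tuple_measureS_ge0 tuple_measureS_sigma_additive.

Let tuple_measureS_sigma_finite : sigma_finite setT tuple_measureS.
Proof.
pose u (x : k.+1.-tuple T) : T * k.-tuple T := (thead x, [tuple of behead x]).
have mu_ : measurable_fun setT u.
  apply/measurable_fun_pairP; split; last exact: measurable_behead.
  exact: (@measurable_tnth _ T k.+1 ord0).
have uK x : u (tuple_cons x) = x.
  case: x => a b; congr pair => /=.
  exact/val_inj.
have /sigma_finiteP[F [TF ndF Foo]] := sigma_finiteT mu.
have /sigma_finiteP[G [TG ndG Goo]] := sigma_finiteT nu.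
exists (fun i => u @^-1` (F i `*` G i)).
  rewrite -preimage_bigcup -[LHS](preimage_setT u); congr (_ @^-1` _).
  rewrite -setXTT TF TG predeqE => -[x y]; split.
    move=> [/= [i _ Fix] [j _ Gjy]]; exists (maxn i j) => //; split.
    - by move: x Fix; exact/subsetPset/ndF/leq_maxl.
    - by move: y Gjy; exact/subsetPset/ndG/leq_maxr.
  by move=> [i _ []/= ? ?]; split; exists i.
move=> i; have [mF Fi] := Foo i; have [mG Gi] := Goo i; split.
  by rewrite -[X in measurable X]setTI; apply: mu_ => //; exact: measurableX.
rewrite /tuple_measureS /pushforward -comp_preimage.
rewrite (_ : u \o @tuple_cons k = id); last by apply/funext => x; exact: uK.
by rewrite preimage_id product_measure1E// lte_mul_pinfty// ge0_fin_numE.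
Qed.

HB.instance Definition _ := @Measure_isSigmaFinite.Build _ _ _
  tuple_measureS tuple_measureS_sigma_finite.

End step.

(* The k-fold product of mu, transported along T * T^k ~ T^(k+1). *)
Fixpoint tuple_measure (mu : {sigma_finite_measure set T -> \bar R}) (k : nat) :
    {sigma_finite_measure set (k.-tuple T) -> \bar R} :=
  match k with
  | 0 => \d_([tuple] : 0.-tuple T)
  | k'.+1 => tuple_measureS mu (tuple_measure mu k')
  end.

End tuple_measure.

Section euclidean_space.
Variables (R : realType) (n : nat).

(* Lebesgue measure on the Borel sigma-algebra of R^n. *)
Definition borel_leb : {sigma_finite_measure set (n.-tuple (measurableTypeR R)) -> \bar R} :=
  tuple_measure (@lebesgue_measure R) n.

(* R^n with the sigma-algebra of Lebesgue-measurable sets, obtained by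
   Caratheodory's construction, which completes borel_leb. *)
Definition Rn := caratheodory_type (borel_leb^*)%mu.

HB.instance Definition _ := Measurable.on Rn.

Definition leb : set Rn -> \bar R := @completed_measure_extension _ _ _ borel_leb.

HB.instance Definition _ := Measure.on leb.

Let leb_sigma_finite : sigma_finite setT leb.
Proof. exact/completed_measure_extension_sigma_finite/sigma_finiteT. Qed.

HB.instance Definition _ := @Measure_isSigmaFinite.Build _ _ _ leb leb_sigma_finite.

End euclidean_space.

Section euclidean_metric.
Variables (R : realType) (n : nat).
Implicit Types x y : Rn R n.

Definition eucl_norm x : R := Num.sqrt (\sum_(i < n) tnth x i ^+ 2).

Definition eucl_dist x y : R := Num.sqrt (\sum_(i < n) (tnth x i - tnth y i) ^+ 2).

Definition eucl_ball x (r : R) : set (Rn R n) := [set y | eucl_dist x y < r].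

Definition eucl_balls : set (set (Rn R n)) :=
  [set eucl_ball x r | x in [set: Rn R n] & r in [set r : R | 0 < r]].

End euclidean_metric.

Section variable_exponents.
Variables (R : realType) (n : nat).
Local Notation E := (Rn R n).
Local Notation mu := (@leb R n).
Implicit Types p : E -> R.

Definition exp_inf p : \bar R := ess_inf mu (EFin \o p).

Definition exp_sup p : \bar R := ess_sup mu (EFin \o p).

Definition exponent_P0 p : Prop :=
  [/\ measurable_fun setT p, forall x, 0 < p x,
      (0 < exp_inf p)%E, (exp_inf p <= exp_sup p)%E & (exp_sup p < +oo)%E].

Definition exponent_P p : Prop :=
  [/\ measurable_fun setT p, forall x, 0 < p x,
      (1 < exp_inf p)%E, (exp_inf p <= exp_sup p)%E & (exp_sup p < +oo)%E].

Definition conj_exp p : E -> R := fun x => p x / (p x - 1).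

(* For x = y the first bound reads 0 <= 0, since ln 0 = 0 and 0^-1 = 0. *)
Definition log_Holder p : Prop :=
  exists C pinf : R, [/\ 0 < C, 0 < pinf,
    forall x y, eucl_dist x y < 1 / 2 ->
      `|p x - p y| <= C / - ln (eucl_dist x y) &
    forall x, `|p x - pinf| <= C / ln (expR 1 + eucl_norm x)].

(* The exponent p with 1 / p = \sum_i 1 / p_i. *)
Definition harmonic_exp m (p : 'I_m -> E -> R) : E -> R :=
  fun x => (\sum_(i < m) (p i x)^-1)^-1.

Local Open Scope ereal_scope.

(* The infimum of the empty set is +oo. *)
Definition Lnorm_var p (f : E -> \bar R) : \bar R :=
  ereal_inf [set l%:E | l in [set l : R |
    (0 < l)%R /\ \int[mu]_x (`|f x| / l%:E) `^ (p x) <= 1]].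

Definition wLnorm p (w f : E -> \bar R) : \bar R :=
  Lnorm_var p (fun x => w x * f x).

Definition in_wL p (w : E -> \bar R) (f : E -> R) : Prop :=
  measurable_fun setT f /\ wLnorm p w (EFin \o f) < +oo.

End variable_exponents.

Section weights_and_BMO.
Variables (R : realType) (n : nat).
Local Notation E := (Rn R n).
Local Notation mu := (@leb R n).
Local Open Scope ereal_scope.

Definition loc_integrable (f : E -> \bar R) : Prop :=
  measurable_fun setT f /\ forall B, eucl_balls B -> mu.-integrable B f.

Definition is_weight (w : E -> \bar R) : Prop :=
  [/\ forall x, 0 <= w x, loc_integrable w & {ae mu, forall x, 0 < w x < +oo}].

(* The class A_{r,s} for exponents with 1 / r - 1 / s = beta / n,
   where 1 / r = \sum_i 1 / r_i. *)
Definition A_class m (r : 'I_m -> E -> R) (s : E -> R) (beta : R)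
    (v : 'I_m -> E -> \bar R) : Prop :=
  (forall i, is_weight (v i)) /\
  ereal_sup [set mu B `^ (beta / n%:R - m%:R) *
                 Lnorm_var s ((fun x => \prod_(i < m) v i x) \_ B) *
                 \prod_(i < m)
                   Lnorm_var (conj_exp (r i)) ((fun x => (v i x)^-1) \_ B)
            | B in @eucl_balls R n] < +oo.

Definition ball_avg (b : E -> R) (B : set E) : R :=
  ((fine (mu B))^-1 * \int[mu]_(x in B) b x)%R.

Definition BMO_norm (b : E -> R) : \bar R :=
  ereal_sup [set (mu B)^-1 * \int[mu]_(x in B) `|b x - ball_avg b B|%:E
            | B in @eucl_balls R n].

Definition in_BMO (b : E -> R) : Prop :=
  loc_integrable (EFin \o b) /\ BMO_norm b < +oo.

End weights_and_BMO.

Section operators.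
Variables (R : realType) (n m : nat).
Local Notation E := (Rn R n).
Local Notation mu := (@leb R n).
Local Notation operator := (('I_m -> E -> R) -> E -> \bar R).
Local Open Scope ereal_scope.

Definition frac_maximal (alpha : R) : operator := fun f x =>
  ereal_sup [set (\prod_(i < m) \int[mu]_(y in eucl_ball x r) `|f i y|%:E) /
                 mu (eucl_ball x r) `^ (m%:R - alpha / n%:R)
            | r in [set r : R | (0 < r)%R]].

(* Where the integral is not defined (both the positive and the negative part
   have infinite integral) its value is -oo, so that a finite wLnorm entails
   convergence almost everywhere. *)
Definition frac_integral (alpha : R) : operator := fun f x =>
  \int[tuple_measure mu m]_y
    ((\prod_(i < m) f i (tnth y i)) /
     (\sum_(i < m) eucl_dist x (tnth y i)) `^ (m%:R * n%:R - alpha))%R%:E.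

Definition commutator (T : operator) (b : 'I_m -> E -> R) : operator := fun f x =>
  \sum_(j < m) T [eta f with j |-> fun y => (b j x - b j y) * f j y]%R x.

(* The infimum of the empty set is +oo. *)
Definition operator_norm (p : 'I_m -> E -> R) (w : 'I_m -> E -> \bar R)
    (q : E -> R) (u : E -> \bar R) (T : operator) : \bar R :=
  ereal_inf [set c%:E | c in [set c : R | (0 <= c)%R /\
    forall f : 'I_m -> E -> R, (forall i, in_wL (p i) (w i) (f i)) ->
      wLnorm q u (T f) <=
      c%:E * \prod_(i < m) wLnorm (p i) (w i) (EFin \o f i)]].

End operators.

(* Main.v *)
(* Both operators are dominated pointwise by the sum over k of
   |Q|^(-M) \prod_i \int_(3Q) |f_i|, where Q is the dyadic cube of side 2^k
   containing x, 3Q is the union of its neighbours and M = m - alpha / n. In the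
   commutator, |b x - b y| is at most (1 + |b x - b_Q|) (1 + |b y - b_Q|). The
   second factor is integrated against f_j by Hoelder's inequality: the class
   A_(p/t, q/t) gives omega_i^(-1) integrability beyond p_i', and the
   John-Nirenberg inequality absorbs the oscillation into the spare exponent.
   The first factor is integrated against omega^q, which A_(p, q) makes an
   A_infinity weight, so that a weighted John-Nirenberg inequality holds.
   Log-Hoelder continuity allows freezing the exponents on 3Q, up to a factor
   1 + eps, when Q is small or far from the origin; the remaining scales are
   controlled by an explicit integrable majorant. What is left of each f_i is a
   power of the mass over 3Q of an integrable function; since alpha > 0 the sum
   of these powers exceeds 1 / q, and this excess makes the sum over the scales
   converge geometrically. *)
Require Import Defs.
From mathcomp Require Import all_boot all_order all_algebra.
From mathcomp Require Import all_classical all_reals all_analysis.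
From mathcomp Require Import measurable_realfun ess_sup_inf.
From mathcomp Require Import ring lra zify.

Set Implicit Arguments.
Unset Strict Implicit.
Unset Printing Implicit Defensive.
Import Order.TTheory GRing.Theory Num.Theory.
Import numFieldNormedType.Exports.

Local Open Scope classical_set_scope.
Local Open Scope ring_scope.

(** * Integrals of nonnegative functions *)

(** Freezing an exponent usually costs a factor |Q|^(p(x) - p(y)), harmless only for quantities of
    polynomial size. The f_i have no such bound, so for them the loss is taken in the power of the
    mass, with eps tied to the gap alpha / n. The obstacle is then to keep the masses summable,
    since a point lies in 3Q for cubes Q of every scale. With z = |f_i|^(p_i) (normalized) and v =
    |Q|, Hoelder's inequality is used at the reciprocal exponent 1 / p_i + de where v z > 1 and at 1
    / p_i - de where v z <= 1. Either choice leaves a factor of at most min ((v z)^c, (v z)^(-c)),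
    whose sum over the scales is bounded for each fixed z. Summation rests on an inequality for
    sequences: if u_k decays geometrically and theta q > 1, then (sum u_k m_k^theta)^q <= C sum
    u_k^q m_k for 0 < m_k <= 1. Here u_k is the oscillation of b at x divided by the norm of omega
    on Q, and omega^q u_k^q has bounded integral over each Q. In a fixed box around the origin
    exponents cannot be frozen at large scales; an artificial mass on that box pays for the part of
    3Q inside it. *)

Section integral_general.
Context d (T : measurableType d) (R : realType).
Variable mu : {measure set T -> \bar R}.

(** The integral of a nonnegative function is a supremum over the simple functions below it, so
    monotonicity holds without measurability. This matters because the commutator is nowhere shown
    to be measurable. *)
Lemma ge0_le_integral_nomeas (D : set T) (f g : T -> \bar R) :
  (forall x, D x -> 0 <= f x)%E -> (forall x, D x -> f x <= g x)%E ->
  (\int[mu]_(x in D) f x <= \int[mu]_(x in D) g x)%E.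
Proof.
move=> f0 fg.
have g0 x : D x -> (0 <= g x)%E by move=> Dx; exact: le_trans (f0 _ Dx) (fg _ Dx).
rewrite !ge0_integralE//; apply: le_ereal_sup => _ [h hf <-]; exists h => //= x.
apply: le_trans (hf x) _; rewrite /patch; case: ifPn => // /set_mem; exact: fg.
Qed.

(** Absolute continuity of the integral, by truncation: the excess of [|u|] over a high level has
    small integral, and what remains is bounded. *)
Lemma integral_small (D : set T) (u : T -> R) (eta : R) : measurable D ->
  mu.-integrable D (EFin \o u) -> 0 < eta -> 
  exists2 del : R, 0 < del & forall A, measurable A -> A `<=` D ->
    (mu A <= del%:E)%E -> (\int[mu]_(x in A) `|u x|%:E <= eta%:E)%E.
Proof.
move=> mD iu eta0.
have mu_ : measurable_fun D u by apply/measurable_EFinP; exact: measurable_int iu.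
pose g (N : nat) (x : T) : R := Num.max (`|u x| - N%:R) 0.
have mg N : measurable_fun D (EFin \o g N).
  apply/measurable_EFinP; apply: measurable_maxr => //.
  by apply: measurable_funB => //; exact: measurableT_comp.
have cv : {ae mu, forall x, D x -> (EFin \o g N) x @[N --> \oo] --> cst 0%E x}.
  apply/aeW => x Dx; apply/cvg_EFin; first by near=> N.
  apply: cvg_near_cst; near=> N; rewrite /= /g; apply/max_idPr.
  rewrite subr_le0; near: N; exact: nbhs_infty_ger.
have gle : {ae mu, forall x (N : nat), D x -> (`|(EFin \o g N) x| <= (abse \o (EFin \o u)) x)%E}.
  apply/aeW => x N Dx; rewrite lee_fin /g ger0_norm ?le_max ?lexx ?orbT//.
  by rewrite ge_max normr_ge0 andbT lerBlDr lerDl.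
have [_ _ cg] := dominated_convergence mD mg (@measurable_cst _ _ _ _ D 0%E) cv
  (integrable_abse iu) gle.
rewrite integral0 in cg.
have /fine_cvgP[_ /cvgrPdist_le/(_ (eta / 2))] := cg.
have eta20 : 0 < eta / 2 by rewrite divr_gt0.
move=> /(_ eta20) [N0 _ /(_ N0 (leqnn N0))] /=.
have fing : (\int[mu]_(x in D) (EFin \o g N0) x)%E \is a fin_num.
  apply: integrable_fin_num => //.
  apply: (le_integrable mD (mg N0)) iu => x Dx /=.
  rewrite lee_fin /g ger0_norm ?le_max ?lexx ?orbT//.
  by rewrite ge_max normr_ge0 andbT lerBlDr lerDl.
rewrite sub0r normrN ger0_norm; last first.
  by apply/fine_ge0/integral_ge0 => x _; rewrite lee_fin /g le_max lexx orbT.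
rewrite -lee_fin fineK// => gN.
(* The bounded part is at most [N0 + 1], so over [A] it contributes at most [eta / 2]. *)
exists (eta / 2 / (N0%:R + 1)); first by rewrite divr_gt0.
move=> A mA AD muA.
apply: (@le_trans _ _ (\int[mu]_(x in A) ((g N0 x)%:E + (N0%:R + 1)%:E))%E).
  apply: ge0_le_integral_nomeas => x Ax; first by rewrite lee_fin.
  rewrite -EFinD lee_fin /g addrA ler_wpDr//.
  by rewrite -lerBlDr le_max lexx.
rewrite ge0_integralD//; last 2 first.
  - by move=> x Ax; rewrite lee_fin /g le_max lexx orbT.
  - exact: measurable_funS (mg N0).
rewrite integral_cst//.
have -> : eta%:E = ((eta / 2)%:E + (eta / 2)%:E)%E by rewrite -EFinD -splitr.
apply: leeD.
  apply: le_trans gN; apply: ge0_subset_integral => //; first exact: mg.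
  by move=> x Ax; rewrite lee_fin /g le_max lexx orbT.
apply: (@le_trans _ _ ((N0%:R + 1)%:E * (eta / 2 / (N0%:R + 1))%:E)%E).
  by rewrite lee_pmul2l// lte_fin.
by rewrite -EFinM lee_fin mulrCA divff ?mulr1// gt_eqF.
Unshelve. all: by end_near. Qed.

Lemma ge0_integral_setU_le (A B : set T) (f : T -> \bar R) :
  measurable A -> measurable B -> measurable_fun (A `|` B) f ->
  (forall x, (A `|` B) x -> 0 <= f x)%E ->
  (\int[mu]_(x in A `|` B) f x <= \int[mu]_(x in A) f x + \int[mu]_(x in B) f x)%E.
Proof.
move=> mA mB mf f0.
have E : A `|` B = A `|` (B `\` A) by rewrite setUDr setDv setD0.
rewrite E ge0_integral_setU -?E//; last 2 first.
  - exact: measurableD.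
  - by apply/disj_setPS => y [Ay []].
apply: leeD => //; apply: ge0_subset_integral => //.
- exact: measurableD.
- by apply: measurable_funS mf; [exact: measurableU|exact: subsetUr].
- by move=> x Bx; apply: f0; right.
Qed.

Lemma ge0_integral_le_cvg (D : set T) (g : nat -> T -> \bar R) (f : T -> \bar R)
    (C : \bar R) : measurable D -> (forall n, measurable_fun D (g n)) ->
  (forall n x, D x -> 0 <= g n x)%E ->
  (forall x, D x -> {homo g ^~ x : n m / (n <= m)%N >-> (n <= m)%E}) ->
  (forall x, D x -> g n x @[n --> \oo] --> f x) ->
  (forall n, \int[mu]_(x in D) g n x <= C)%E -> (\int[mu]_(x in D) f x <= C)%E.
Proof.
move=> mD mg g0 ndg gf gC.
have -> : (\int[mu]_(x in D) f x = \int[mu]_(x in D) limn (g ^~ x))%E.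
  by apply: eq_integral => x /[!inE] Dx; apply/esym/cvg_lim => //; exact: gf.
apply: cvge_le (cvg_monotone_convergence mD mg g0 ndg).
exact: nearW.
Qed.

Lemma ge0_subset_integral_nomeas (A B : set T) (f : T -> \bar R) : A `<=` B ->
  (forall x, B x -> 0 <= f x)%E -> (\int[mu]_(x in A) f x <= \int[mu]_(x in B) f x)%E.
Proof.
move=> AB f0; rewrite integral_mkcond [leRHS]integral_mkcond.
apply: ge0_le_integral_nomeas => x _; rewrite /patch.
  by case: ifPn => // /set_mem/AB/f0.
case: ifPn => [/set_mem/AB Bx|_]; first by rewrite mem_set.
by case: ifPn => // /set_mem/f0.
Qed.

Lemma ae_le_integral_measl (D : set T) (f g : T -> \bar R) : measurable D ->
  measurable_fun D f -> (forall x, D x -> 0 <= f x)%E -> (forall x, D x -> 0 <= g x)%E ->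
  {ae mu, forall x, D x -> (f x <= g x)%E} ->
  (\int[mu]_(x in D) f x <= \int[mu]_(x in D) g x)%E.
Proof.
move=> mD mf f0 g0 [N [mN N0 hN]].
rewrite (ge0_negligible_integral mN mD mf f0 N0).
apply: le_trans (ge0_subset_integral_nomeas (@subDsetl _ D N) g0).
apply: ge0_le_integral_nomeas => x [Dx nNx]; first exact: f0.
by apply: contra_notP nNx => nfg; apply: hN => /= h; apply: nfg; exact: h.
Qed.

(** Raising [g] to infinity on the exceptional null set makes the inequality hold everywhere; [f] is
    left untouched, so it may fail to be measurable. *)
Lemma ae_le_integral_measr (D : set T) (f g : T -> \bar R) : measurable D ->
  measurable_fun D g -> (forall x, D x -> 0 <= f x)%E -> (forall x, D x -> 0 <= g x)%E ->
  {ae mu, forall x, D x -> (f x <= g x)%E} ->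
  (\int[mu]_(x in D) f x <= \int[mu]_(x in D) g x)%E.
Proof.
move=> mD mg f0 g0 [N [mN N0 hN]].
pose g' x := if x \in N then +oo%E else g x.
have mg' : measurable_fun D g'.
  apply: measurable_fun_if => //.
  - apply: (measurable_fun_bool true); rewrite (_ : _ @^-1` _ = N).
      exact: measurableI.
    by apply/seteqP; split=> x /=; rewrite ?inE => ?; [apply/set_mem|apply/mem_set].
  - exact: measurable_funS mg.
have g'0 x : D x -> (0 <= g' x)%E by rewrite /g'; case: ifP => // _; exact: g0.
apply: (@le_trans _ _ (\int[mu]_(x in D) g' x)%E).
  apply: ge0_le_integral_nomeas => // x Dx; rewrite /g'.
  case: ifPn => [_|/negP xN]; first by rewrite leey.
  by apply: contra_notP xN => nfg; apply/mem_set; apply: hN => /= h; apply: nfg; exact: h.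
rewrite (ge0_negligible_integral mN mD mg' g'0 N0).
rewrite (ge0_negligible_integral mN mD mg g0 N0).
apply: ge0_le_integral_nomeas => x [Dx nNx]; first exact: g'0.
by rewrite /g' memNset.
Qed.

End integral_general.

(** * Dyadic cubes and the John-Nirenberg inequality *)

Section dyadic.
Context d (T : measurableType d) (R : realType) (mu : {measure set T -> \bar R}).
Context (I : countType) (idx : int -> T -> I) (vol : int -> R) (K : R).

(** A dyadic structure is encoded by one index map per scale, and a cube is a fibre: each scale is a
    partition by construction, and nesting is an implication between equalities of indices. *)
Definition dcube k x : set T := [set y | idx k y = idx k x].

(** Unions of cubes of scale [k]. *)
Definition saturated k (G : set T) := forall x y, idx k x = idx k y -> G x -> G y.

Context (idx_meas : forall k v, measurable (idx k @^-1` [set v]))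
  (idx_nest : forall k x y, idx k x = idx k y -> idx (k + 1) x = idx (k + 1) y).

Lemma idx_le j k x y : (j <= k)%R -> idx j x = idx j y -> idx k x = idx k y.
Proof.
move=> jk; have -> : k = j + `|k - j|%N by rewrite gez0_abs ?subr_ge0// subrKC.
elim: `|k - j|%N => [|i IH] h; first by rewrite addr0.
by rewrite -addn1 PoszD addrA; apply: idx_nest; exact: IH.
Qed.

Lemma dcube_refl k x : dcube k x x. Proof. by []. Qed.

Lemma sub_dcube j k x y : (j <= k)%R -> dcube k x y -> dcube j y `<=` dcube k x.
Proof. by move=> jk; rewrite /dcube /= => <- z /=; exact: idx_le. Qed.

Lemma eq_dcube k x y : dcube k x y -> dcube k y = dcube k x.
Proof. by rewrite /dcube /= => ->. Qed.

Lemma saturated_dcube j k x : (j <= k)%R -> saturated j (dcube k x).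
Proof. by move=> jk y z /(idx_le jk) e; rewrite /dcube /= e. Qed.

Lemma saturated_le j k G : (j <= k)%R -> saturated k G -> saturated j G.
Proof. by move=> jk sG x y /(idx_le jk); exact: sG. Qed.

Lemma saturatedI k G H : saturated k G -> saturated k H -> saturated k (G `&` H).
Proof. by move=> sG sH x y e [Gx Hx]; split; [exact: sG Gx|exact: sH Hx]. Qed.

Lemma measurable_saturated k G : saturated k G -> measurable G.
Proof.
move=> sG.
have -> : G = \bigcup_v (G `&` (idx k @^-1` [set v])).
  apply/seteqP; split=> [x Gx|x [v _ []]//]; by exists (idx k x).
apply: countable_bigcupT_measurable => [|v]; first exact: countableP.
have [[x [Gx xv]]|h] := pselect (exists x, G x /\ idx k x = v).
  rewrite (_ : _ `&` _ = idx k @^-1` [set v]) //.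
  apply/seteqP; split=> [y []//|y /= yv]; split=> //.
  by apply: sG Gx; rewrite xv yv.
rewrite (_ : _ `&` _ = set0) //; apply/seteqP; split=> // x [Gx xv].
by apply: h; exists x.
Qed.

Lemma measurable_dcube k x : measurable (dcube k x).
Proof. exact: measurable_saturated (saturated_dcube (lexx k)). Qed.

Lemma measurable_fun_dcube d' (U : measurableType d') (F : T -> U) k :
  (forall x y, idx k x = idx k y -> F x = F y) -> measurable_fun [set: T] F.
Proof.
move=> h _ A mA; rewrite setTI; apply: (@measurable_saturated k) => x y /= e.
by rewrite (h _ _ e).
Qed.

(** Countably many cubes, enumerated by [pickle], make up [G], so a comparison on each of them adds
    up. *)
Lemma integral_saturated_le k G (f g : T -> \bar R) : saturated k G ->
  measurable_fun G f -> measurable_fun G g ->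
  (forall x, G x -> 0 <= f x)%E -> (forall x, G x -> 0 <= g x)%E ->
  (forall x, G x -> \int[mu]_(y in dcube k x) f y <= \int[mu]_(y in dcube k x) g y)%E ->
  (\int[mu]_(y in G) f y <= \int[mu]_(y in G) g y)%E.
Proof.
move=> sG mf mg f0 g0 fg.
pose F i := G `&` [set y | pickle (idx k y) = i].
have sF i : saturated k (F i).
  by apply: saturatedI => // x y /= ->.
have mF i : measurable (F i) by exact: measurable_saturated (sF i).
have GE : G = \bigcup_i F i.
  by apply/seteqP; split=> [x Gx|x [i _ []]//]; exists (pickle (idx k x)).
have tF : trivIset setT F by move=> i j _ _ [x [[_ /= <-] [_ /= <-]]].
have h := ge0_integral_bigcup mu mF.
rewrite GE !h -?GE//.
apply: lee_nneseries => [i _ _|i _]; first by apply: integral_ge0 => x [Gx _]; exact: f0.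
have [[x [Gx xi]]|nx] := pselect (exists x, F i x).
  have -> : F i = dcube k x; last exact: fg.
  apply/seteqP; split=> y.
    by move=> [Gy /= yi]; apply: (pcan_inj pickleK); rewrite xi yi.
  by move=> xy; split => /=; [exact: sG Gx|rewrite xy].
have -> : F i = set0 by apply/seteqP; split=> // x Fx; case: nx; exists x.
by rewrite !integral_set0.
Qed.

Context (vol_gt0 : forall k, 0 < vol k)
  (mu_dcube : forall k x, mu (dcube k x) = (vol k)%:E)
  (approx : forall (k : int) x P (eta : R), measurable P -> P `<=` dcube k x -> 0 < eta ->
    exists (j : int) G, [/\ (j <= k)%R, saturated j G, (mu (P `\` G) <= eta%:E)%E &
      (mu ((G `\` P) `&` dcube k x) <= eta%:E)%E]).

Definition davg (b : T -> R) k x : R :=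
  fine (\int[mu]_(y in dcube k x) (b y)%:E) / vol k.

Lemma davg_eq b k x y : idx k x = idx k y -> davg b k x = davg b k y.
Proof. by rewrite /davg /dcube => ->. Qed.

Lemma integrable_dcubeS b j k x y : mu.-integrable (dcube k x) (EFin \o b) ->
  (j <= k)%R -> dcube k x y -> mu.-integrable (dcube j y) (EFin \o b).
Proof.
move=> ib jk xy; apply: integrableS ib; rewrite ?measurable_dcube//.
- exact: measurable_dcube.
- exact: measurable_dcube.
- exact: sub_dcube.
Qed.

Lemma integrable_dcube_cst k x s : mu.-integrable (dcube k x) (EFin \o cst s).
Proof.
have mc := measurable_dcube k x.
apply/integrableP; split; first exact: measurableT_comp.
rewrite (@eq_integral _ _ _ _ _ (cst `|s|%:E))// integral_cst// mu_dcube.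
by rewrite -EFinM ltry.
Qed.

Lemma integrable_dcubeB b k x s : mu.-integrable (dcube k x) (EFin \o b) ->
  mu.-integrable (dcube k x) (EFin \o (fun y => b y - s)).
Proof.
move=> ib; have -> : EFin \o (fun y => b y - s) = ((EFin \o b) \- cst s%:E)%E.
  by apply/funext => y /=; rewrite EFinB.
apply: integrableB => //; first exact: measurable_dcube.
exact: integrable_dcube_cst.
Qed.

Lemma integral_dcubeB b k x s : mu.-integrable (dcube k x) (EFin \o b) ->
  (\int[mu]_(y in dcube k x) (b y - s)%:E)%E = ((davg b k x - s) * vol k)%:E.
Proof.
move=> ib; have mc := measurable_dcube k x.
under eq_integral do rewrite EFinB.
rewrite (@integralB_EFin _ _ _ mu _ b (cst s))//; last first.
  exact: integrable_dcube_cst.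
have -> : (\int[mu]_(y in dcube k x) (cst s y)%:E = s%:E * mu (dcube k x))%E.
  exact: (integral_cst mu mc s%:E).
rewrite mu_dcube mulrBl /davg divfK ?gt_eqF// EFinB EFinM fineK//.
exact: integrable_fin_num.
Qed.

(** A one-sided Lebesgue differentiation theorem. The set [P] where [b > s] is nearly a union of
    small cubes meeting [D]. The average of [b - s] over each of these is at most 0, so the positive
    part integrates to at most the negative part, which lives off [P]. Absolute continuity makes
    both errors small. *)
Lemma davg_le_ae b k x s (D : set T) : mu.-integrable (dcube k x) (EFin \o b) ->
  measurable D -> D `<=` dcube k x ->
  (forall y j, D y -> (j <= k)%R -> davg b j y <= s) ->
  mu (D `&` [set y | s < b y]) = 0%E.
Proof.
move=> ib mD DQ hD; set Q := dcube k x in DQ *; set P := D `&` _.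
have mQ : measurable Q by exact: measurable_dcube.
have mbQ : measurable_fun Q b by apply/measurable_EFinP; exact: measurable_int ib.
have mP : measurable P.
  have -> : P = D `&` (Q `&` b @^-1` `]s, +oo[).
    apply/seteqP; split=> [y [Dy /= sy]|y [Dy [Qy /=]]]; rewrite ?in_itv/= ?andbT.
      by split=> //; split=> //; exact: DQ.
    by move=> sy; split.
  by apply: measurableI => //; apply: mbQ.
have PQ : P `<=` Q by move=> y [/DQ].
pose u y := b y - s.
have iu : mu.-integrable Q (EFin \o u) by exact: integrable_dcubeB.
have mu_ : measurable_fun Q u by apply/measurable_EFinP; exact: measurable_int iu.
have mau : measurable_fun Q (fun y => `|u y|%:E).
  by apply/measurable_EFinP; exact: measurableT_comp.
pose up := (EFin \o u)^\+%E; pose un := (EFin \o u)^\-%E.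
have mup : measurable_fun Q up by apply: measurable_funepos; exact: measurable_int iu.
have mun : measurable_fun Q un by apply: measurable_funeneg; exact: measurable_int iu.
have upP y : P y -> up y = (u y)%:E.
  move=> [_ /= sy]; rewrite /up funeposE /=; apply/max_idPl.
  by rewrite lee_fin subr_ge0 ltW.
have unP y : P y -> un y = 0%E.
  move=> [_ /= sy]; rewrite /un funenegE /=; apply/max_idPr.
  by rewrite lee_fin oppr_le0 subr_ge0 ltW.
have upn y : (up y <= `|u y|%:E)%E.
  by rewrite /up funeposE /= ge_max !lee_fin normr_ge0 ler_norm.
have unn y : (un y <= `|u y|%:E)%E.
  by rewrite /un funenegE /= ge_max !lee_fin normr_ge0 -normrN ler_norm.
have small eta : 0 < eta -> (\int[mu]_(y in P) `|u y|%:E <= (eta + eta)%:E)%E.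
  move=> eta0; have [del del0 hdel] := integral_small mQ iu eta0.
  have [j [G [jk sG PG GP]]] := approx mP PQ del0.
  (* Cubes of [G] that miss [D] are dropped: averages are controlled only at points of [D]. *)
  pose G' := [set y | [/\ Q y, G y & exists2 z, D z & idx j z = idx j y]].
  have sG' : saturated j G'.
    move=> y z e [Qy Gy [v Dv vy]]; split; first by rewrite /Q /dcube /= -(idx_le jk e)//.
      exact: sG Gy.
    by exists v => //; rewrite vy.
  have mG' : measurable G' := measurable_saturated sG'.
  have G'Q : G' `<=` Q by move=> y [].
  have mPG : measurable (P `\` G') by exact: measurableD.
  have mGP : measurable (G' `\` P) by exact: measurableD.
  have PE : P = (P `\` G') `|` (P `&` G') by rewrite setUC setUIDK.
  have h1 : (\int[mu]_(y in P) `|u y|%:E <=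
      \int[mu]_(y in P `\` G') `|u y|%:E + \int[mu]_(y in G') up y)%E.
    rewrite [in X in (X <= _)%E]PE.
    apply: le_trans (ge0_integral_setU_le _ mPG _ _ _) _ => //.
    - exact: measurableI.
    - by rewrite -PE; exact: measurable_funS mau.
    apply: leeD => //.
    apply: (@le_trans _ _ (\int[mu]_(y in P `&` G') up y)%E).
      apply: ge0_le_integral_nomeas => // y [Py _]; rewrite upP// ger0_norm//.
      by rewrite subr_ge0; case: Py => _ /ltW.
    apply: ge0_subset_integral => //; first exact: measurableI.
      exact: measurable_funS mup.
    by move=> y _; exact: funepos_ge0.
  have h2 : (\int[mu]_(y in G') up y <= \int[mu]_(y in G') un y)%E.
    apply: (integral_saturated_le sG').
    - exact: measurable_funS mup.
    - exact: measurable_funS mun.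
    - by move=> y _; exact: funepos_ge0.
    - by move=> y _; exact: funeneg_ge0.
    move=> y [Qy Gy [z Dz zy]].
    rewrite -sube_le0 -integralE integral_dcubeB; last exact: integrable_dcubeS jk Qy.
    rewrite lee_fin pmulr_lle0// subr_le0 -(davg_eq _ zy); exact: hD.
  have h3 : (\int[mu]_(y in G') un y <= \int[mu]_(y in G' `\` P) `|u y|%:E)%E.
    have E : G' = (G' `\` P) `|` (G' `&` P) by rewrite setUC setUIDK.
    rewrite [in X in (X <= _)%E]E.
    apply: le_trans (ge0_integral_setU_le _ mGP _ _ _) _ => //.
    - exact: measurableI.
    - by rewrite -E; exact: measurable_funS mun.
    - by move=> y _; exact: funeneg_ge0.
    rewrite [X in (_ + X)%E]integral0_eq ?adde0; last by move=> y [_ /unP].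
    by apply: ge0_le_integral_nomeas => // y _; exact: funeneg_ge0.
  apply: le_trans h1 _; rewrite EFinD; apply: leeD.
    apply: hdel => //; first by move=> y [/PQ].
    apply: le_trans PG; rewrite le_measure ?inE//.
      apply: measurableD => //; exact: measurable_saturated sG.
    move=> y [Py nGy]; split=> // Gy; apply: nGy; split=> //; first exact: PQ.
    by exists y => //; case: Py.
  apply: (le_trans h2); apply: (le_trans h3); apply: hdel => //; first by move=> y [/G'Q].
  apply: le_trans GP; rewrite le_measure ?inE//.
    apply: measurableI => //; apply: measurableD => //; exact: measurable_saturated sG.
  by move=> y [[]].
have int0 : (\int[mu]_(y in P) `|(u y)%:E| = 0)%E.
  apply/eqP; rewrite eq_le integral_ge0 ?andbT//.
  apply/lee_addgt0Pr => e e0; rewrite add0e [e]splitr; apply: small; exact: divr_gt0.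
move: int0 => /(ae_eq_integral_abs mu mP).
have muP : measurable_fun P (EFin \o u) by apply/measurable_EFinP; exact: measurable_funS mu_.
move=> /(_ muP) ae0; apply: measure_negligible => //.
apply: negligibleS ae0 => y Py /= /(_ Py) [] /eqP; rewrite subr_eq0 => /eqP by_.
by case: Py => _ /=; rewrite by_ ltxx.
Qed.

Lemma integral_bigcup_le (F : (set T)^nat) (f g : T -> \bar R) :
  (forall i, measurable (F i)) -> trivIset setT F ->
  measurable_fun (\bigcup_i F i) f -> measurable_fun (\bigcup_i F i) g ->
  (forall x, 0 <= f x)%E -> (forall x, 0 <= g x)%E ->
  (forall i, \int[mu]_(y in F i) f y <= \int[mu]_(y in F i) g y)%E ->
  (\int[mu]_(y in \bigcup_i F i) f y <= \int[mu]_(y in \bigcup_i F i) g y)%E.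
Proof.
move=> mF tF mf mg f0 g0 fg; rewrite !ge0_integral_bigcup//.
by apply: lee_nneseries => [i _ _|i _]//; exact: integral_ge0.
Qed.

Context (volS : forall k, vol k = K * vol (k - 1)) (K_ge1 : 1 <= K).
Variable b : T -> R.
Hypothesis mb : measurable_fun [set: T] b.
Hypothesis ib : forall k x, mu.-integrable (dcube k x) (EFin \o b).
Hypothesis osc : forall k x,
  (\int[mu]_(y in dcube k x) `|b y - davg b k x|%:E <= (vol k)%:E)%E.

Lemma davg_vol_le j x a : ((`|davg b j x - a| * vol j)%:E
  <= \int[mu]_(y in dcube j x) `|b y - a|%:E)%E.
Proof.
have mc := measurable_dcube j x.
have -> : (`|davg b j x - a| * vol j)%:E = (`|(davg b j x - a) * vol j|%:E)%E :> \bar R.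
  by rewrite normrM (ger0_norm (ltW (vol_gt0 j))).
rewrite -abse_EFin -integral_dcubeB//.
apply: le_trans (le_abse_integral _ mc _) _ => //.
by apply/measurable_EFinP; apply: measurable_funTS; apply: measurable_funB.
Qed.

(** A child inherits at most the whole oscillation of its parent, and [K] is the ratio of the
    volumes. *)
Lemma davg_child k x y : dcube k x y -> `|davg b (k - 1) y - davg b k x| <= K.
Proof.
move=> xy; have k1 : (k - 1 <= k)%R by rewrite gerBl.
have := le_trans (davg_vol_le (k - 1) y (davg b k x)) _.
move=> /(_ (K * vol (k - 1))%:E); rewrite lee_fin ler_pM2r//; apply.
rewrite -volS; apply: le_trans (osc k x).
apply: ge0_subset_integral => //; rewrite ?measurable_dcube//.
- exact: measurable_dcube.
- exact: measurable_dcube.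
- apply/measurable_EFinP; apply: measurable_funTS; apply: measurableT_comp => //.
  exact: measurable_funB.
- exact: sub_dcube.
Qed.

Lemma davgN k x : davg (fun y => - b y) k x = - davg b k x.
Proof.
rewrite /davg -mulNr; congr (_ / _).
under eq_integral do rewrite EFinN.
by rewrite integralN ?fineN//; apply: integrable_add_def (ib k x); exact: measurable_dcube.
Qed.

(** The one-sided statement is applied to [b] and to [- b]. *)
Lemma davg_near_ae k x (D : set T) (s : R) : measurable D -> D `<=` dcube k x ->
  (forall y j, D y -> (j <= k)%R -> `|davg b j y - davg b k x| <= s) ->
  {ae mu, forall y, D y -> `|b y - davg b k x| <= s}.
Proof.
move=> mD DQ hD; set a := davg b k x.
have mN : measurable_fun [set: T] (fun y => - b y) by exact: measurableT_comp.
have h1 := @davg_le_ae b k x (a + s) D (ib k x) mD DQ.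
have h2 := @davg_le_ae (fun y => - b y) k x (- a + s) D _ mD DQ.
have {}h1 : mu (D `&` [set y | a + s < b y]) = 0%E.
  apply: h1 => y j Dy jk; have := hD y j Dy jk; rewrite ler_norml => /andP[_].
  by rewrite lerBlDl.
have {}h2 : mu (D `&` [set y | - a + s < - b y]) = 0%E.
  apply: h2.
    rewrite (_ : _ \o _ = -%E \o (EFin \o b)%E)//; exact: integrableN.
  move=> y j Dy jk; rewrite davgN; have := hD y j Dy jk; rewrite ler_norml => /andP[+ _].
  by rewrite -/a => h; lra.
have m1 : measurable (D `&` [set y | a + s < b y]).
  by apply: measurableI => //; rewrite -[X in measurable X]setTI;
     apply: (measurable_fun_ltr (measurable_cst _) mb).
have m2 : measurable (D `&` [set y | - a + s < - b y]).
  by apply: measurableI => //; rewrite -[X in measurable X]setTI;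
     apply: (measurable_fun_ltr (measurable_cst _) mN).
exists ((D `&` [set y | a + s < b y]) `|` (D `&` [set y | - a + s < - b y])).
split; first exact: measurableU.
  apply/eqP; rewrite -measure_le0; apply: le_trans (measureU2 _ _ _) _ => //.
  by rewrite /= h1 h2 adde0.
move=> y /= /not_implyP[Dy /negP]; rewrite -ltNge ltr_normr => /orP[h|h].
  by left; split => //=; lra.
by right; split => //=; rewrite -/a in h; lra.
Qed.

Section john_nirenberg.
Variables (V : T -> R) (c : R) (L : int -> T -> Prop) (eps : R).
Hypotheses (V0 : forall y, 0 <= V y) (mV : measurable_fun [set: T] V).
Hypotheses (c0 : 0 < c) (c1 : c < 1) (eps0 : 0 <= eps).
Hypothesis (Ldown : forall j k x y, L k x -> (j <= k)%R -> dcube k x y -> L j y).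
Hypothesis (Vfin : forall k x, L k x -> (\int[mu]_(y in dcube k x) (V y)%:E < +oo)%E).
Hypothesis (Vsmall : forall k x F, L k x -> measurable F -> F `<=` dcube k x ->
  (mu F <= (vol k / 2)%:E)%E ->
  (\int[mu]_(y in F) (V y)%:E <= (1 - c)%:E * \int[mu]_(y in dcube k x) (V y)%:E)%E).
Hypothesis (epsc : expR (eps * (2 + K)) * (1 - c) <= 1 - c / 2).

(** Candidate scales start one below [k], because at scale [k] the deviation from the average is
    0. *)
Let sc (k : int) (i : nat) : int := k - (i.+1)%:Z.

(** Calderon-Zygmund stopping: the points whose first deviation above 2, going down from scale [k],
    occurs at the [i]-th candidate scale. *)
Let stop k x i : set T := dcube k x `&` [set y |
  2 < `|davg b (sc k i) y - davg b k x| /\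
  forall j, (sc k i < j)%R -> (j <= k)%R -> `|davg b j y - davg b k x| <= 2].

Let sc_lt k i : (sc k i < k)%R.
Proof. by rewrite /sc ltrBlDr ltrDl. Qed.

Let saturated_stop k x i : saturated (sc k i) (stop k x i).
Proof.
have lk := ltW (sc_lt k i).
move=> y z e [Qy [h1 h2]]; split; first exact: saturated_dcube e Qy.
split; first by rewrite /= -(davg_eq b e).
by move=> j ij jk; rewrite -(davg_eq b (idx_le (ltW ij) e)); exact: h2.
Qed.

Let mstop k x i : measurable (stop k x i).
Proof. exact: measurable_saturated (@saturated_stop k x i). Qed.

Let trivIset_stop k x : trivIset setT (stop k x).
Proof.
move=> i j _ _ [y [[_ [hi1 hi2]] [_ [hj1 hj2]]]].
case: (ltngtP i j) => // ij; exfalso.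
  have : `|davg b (sc k i) y - davg b k x| <= 2.
    by apply: hj2; [rewrite /sc; lia|exact: ltW].
  by rewrite leNgt hi1.
have : `|davg b (sc k j) y - davg b k x| <= 2.
  by apply: hi2; [rewrite /sc; lia|exact: ltW].
by rewrite leNgt hj1.
Qed.

Let not_stop k x y : dcube k x y -> ~ (\bigcup_i stop k x i) y ->
  forall j, (j <= k)%R -> `|davg b j y - davg b k x| <= 2.
Proof.
move=> Qy nF j jk; rewrite leNgt; apply/negP => h.
have ex : exists i : nat, 2 < `|davg b (sc k i) y - davg b k x|.
  have : (j < k)%R.
    rewrite lt_neqAle jk andbT; apply/negP => /eqP jE; move: h.
    by rewrite jE (davg_eq b Qy) subrr normr0 ltNge ler0n.
  rewrite -subr_gt0 => jk0; exists `|k - j|%N.-1.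
  rewrite /sc prednK ?absz_gt0 ?gt_eqF// gez0_abs ?ltW//.
  by rewrite subKr.
case: (ex_minnP ex) => i hi imin; apply: nF; exists i => //; split=> //; split=> //.
move=> l il lk; rewrite leNgt; apply/negP => hl.
have lk' : (l < k)%R.
  rewrite lt_neqAle lk andbT; apply/negP => /eqP jE; move: hl.
  by rewrite jE (davg_eq b Qy) subrr normr0 ltNge ler0n.
have := imin `|k - l|%N.-1; rewrite /sc prednK; last by lia.
rewrite gez0_abs ?subr_ge0// subKr => /(_ hl); move: il; rewrite /sc; lia.
Qed.

Let mub (a : R) : measurable_fun [set: T] (fun y => `|b y - a|).
Proof. by apply: measurableT_comp => //; exact: measurable_funB. Qed.

(** Chebyshev's inequality: each stopping cube contributes oscillation above twice its volume, and
    the total oscillation is at most [vol k]. *)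
Let mu_stop k x : (mu (\bigcup_i stop k x i) <= (vol k / 2)%:E)%E.
Proof.
have mF : measurable (\bigcup_i stop k x i) by exact: bigcupT_measurable.
have h : (\int[mu]_(y in \bigcup_i stop k x i) 2%:E <=
    \int[mu]_(y in \bigcup_i stop k x i) `|b y - davg b k x|%:E)%E.
  apply: integral_bigcup_le => //.
    by apply/measurable_EFinP; exact: measurable_funTS.
  move=> i; apply: (integral_saturated_le (@saturated_stop k x i)) => //.
    by apply/measurable_EFinP; exact: measurable_funTS.
  move=> y [Qy [h1 _]].
  apply: le_trans (davg_vol_le _ _ _).
  have -> : (\int[mu]_(z in dcube (sc k i) y) 2%:E = 2%:E * mu (dcube (sc k i) y))%E.
    by apply: (integral_cst mu _ 2%:E); exact: measurable_dcube.
  by rewrite mu_dcube -EFinM lee_fin ler_pM2r// ltW.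
have e2 : (\int[mu]_(y in \bigcup_i stop k x i) 2%:E = 2%:E * mu (\bigcup_i stop k x i))%E.
  exact: (integral_cst mu mF 2%:E).
have {}h : (2%:E * mu (\bigcup_i stop k x i) <= (vol k)%:E)%E.
  rewrite -e2; apply: le_trans h _; apply: le_trans (osc k x).
  apply: ge0_subset_integral => //; first exact: measurable_dcube.
  - by apply/measurable_EFinP; exact: measurable_funTS.
  - by move=> y [i _ []].
rewrite -(@lee_pmul2l _ 2%:E)//; apply: le_trans h _.
by rewrite -EFinM lee_fin mulrC divfK.
Qed.

(** The truncation at [lam] gives an a priori bound from which the self-improving estimate can
    start. *)
Let Phi (lam : R) k x y : R := expR (eps * Num.min `|b y - davg b k x| lam) * V y.

Let mPhi (lam : R) k x : measurable_fun [set: T] (fun y => (Phi lam k x y)%:E).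
Proof.
apply/measurable_EFinP; apply: measurable_funM => //.
apply: measurableT_comp => //; apply: measurable_funM => //.
exact: measurable_minr.
Qed.

Let Phi0 (lam : R) k x y : (0 <= (Phi lam k x y)%:E)%E.
Proof. by rewrite lee_fin mulr_ge0// expR_ge0. Qed.

Let mVE D : measurable_fun D (fun y => (V y)%:E).
Proof. by apply/measurable_EFinP; exact: measurable_funTS. Qed.

Let ZV D (M : R) : measurable D -> 0 <= M ->
  (\int[mu]_(y in D) (M%:E * (V y)%:E) = M%:E * \int[mu]_(y in D) (V y)%:E)%E.
Proof. by move=> mD M0; apply: ge0_integralZl => // y _; rewrite lee_fin. Qed.

(** Induction on the number of stopping generations. Off the stopping cubes the deviation is at most
    2. On them the induction hypothesis applies, while their [V]-mass is at most 1 - c of the total;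
    by [epsc] the shift of the average raises this factor to at most 1 - c / 2. *)
Let int_Phi (lam : R) N : forall k x, L k x ->
  (\int[mu]_(y in dcube k x) (Phi lam k x y)%:E <=
   (expR (2 * eps) * (2 / c) + (1 - c / 2) ^+ N * expR (eps * lam))%:E
    * \int[mu]_(y in dcube k x) (V y)%:E)%E.
Proof.
have [c0' c1' epsc'] := And3 c0 c1 epsc.
have c20 : 0 <= 1 - c / 2 by lra.
have C0 : 0 <= expR (2 * eps) * (2 / c) by rewrite mulr_ge0 ?expR_ge0// divr_ge0// ltW.
have CN M : 0 <= expR (2 * eps) * (2 / c) + (1 - c / 2) ^+ M * expR (eps * lam).
  by rewrite addr_ge0// mulr_ge0 ?expR_ge0// exprn_ge0.
elim: N => [|N IH] k x Lk.
  rewrite -ZV//; last exact: measurable_dcube.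
  apply: ge0_le_integral_nomeas => // y _.
  rewrite -EFinM lee_fin ler_wpM2r// expr0 mul1r ler_wpDl//.
  by rewrite ler_expR ler_wpM2l// ge_min lexx orbT.
set Q := dcube k x; have mQ : measurable Q by exact: measurable_dcube.
set F := \bigcup_i stop k x i.
have mF : measurable F by exact: bigcupT_measurable.
have FQ : F `<=` Q by move=> y [i _ []].
set M := expR (eps * (2 + K)) *
  (expR (2 * eps) * (2 / c) + (1 - c / 2) ^+ N * expR (eps * lam)).
have M0 : 0 <= M by rewrite mulr_ge0 ?expR_ge0.
have hF : (\int[mu]_(y in F) (Phi lam k x y)%:E <= M%:E * \int[mu]_(y in F) (V y)%:E)%E.
  rewrite -ZV//.
  apply: integral_bigcup_le => //.
  - exact: measurable_funTS.
  - by apply: measurable_funeM; exact: mVE.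
  - by move=> y; rewrite mule_ge0// lee_fin.
  move=> i; apply: (integral_saturated_le (@saturated_stop k x i)) => //.
  - exact: measurable_funTS.
  - by apply: measurable_funeM; exact: mVE.
  - by move=> y _; rewrite mule_ge0// lee_fin.
  move=> y [Qy [h1 h2]].
  (* The parent of a stopping cube did not stop, so its average deviates by at most 2, and one
     generation costs at most [K]. *)
  have near : `|davg b (sc k i) y - davg b k x| <= 2 + K.
    have scE : sc k i = sc k i + 1 - 1 by rewrite addrK.
    have sk : (sc k i < sc k i + 1)%R by rewrite ltrDl.
    have sk1 : (sc k i + 1 <= k)%R by rewrite /sc -addn1 PoszD opprD addrA subrK gerBl.
    rewrite -(subrKA (davg b (sc k i + 1) y)) addrC; apply: le_trans (ler_normD _ _) _.
    apply: lerD; first exact: h2.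
    by rewrite [X in davg b X y - _]scE; exact: davg_child.
  have Ls : L (sc k i) y := Ldown Lk (ltW (sc_lt k i)) Qy.
  have mc := measurable_dcube (sc k i) y.
  rewrite ZV// /M EFinM -muleA.
  apply: le_trans (lee_wpmul2l _ (IH _ _ Ls)); last by rewrite lee_fin expR_ge0.
  have <- : (\int[mu]_(z in dcube (sc k i) y) ((expR (eps * (2 + K)))%:E *
      (Phi lam (sc k i) y z)%:E) = (expR (eps * (2 + K)))%:E *
      \int[mu]_(z in dcube (sc k i) y) (Phi lam (sc k i) y z)%:E)%E.
    by apply: ge0_integralZl => //; exact: measurable_funTS.
  apply: ge0_le_integral_nomeas => // z _.
  rewrite -EFinM lee_fin /Phi mulrA -expRD ler_wpM2r// ler_expR -mulrDr ler_wpM2l//.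
  have hz : `|b z - davg b k x| <= `|b z - davg b (sc k i) y| + (2 + K).
    rewrite -(subrKA (davg b (sc k i) y)); apply: le_trans (ler_normD _ _) _.
    exact: lerD.
  have K0 : 0 <= 2 + K by rewrite addr_ge0// (le_trans _ K_ge1).
  rewrite ge_min (addrC (2 + K)); case: (leP `|b z - davg b (sc k i) y| lam) => hl.
    by rewrite hz.
  by rewrite addrC lerDr K0 orbT.
have hG : (\int[mu]_(y in Q `\` F) (Phi lam k x y)%:E <=
    (expR (2 * eps))%:E * \int[mu]_(y in Q) (V y)%:E)%E.
  have mG : measurable (Q `\` F) by exact: measurableD.
  apply: (@le_trans _ _ (\int[mu]_(y in Q `\` F) ((expR (2 * eps))%:E * (V y)%:E))%E).
    apply: ae_ge0_le_integral => //.
    - exact: measurable_funTS.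
    - by move=> y _; rewrite -EFinM lee_fin mulr_ge0// expR_ge0.
    - by apply: measurable_funeM; exact: mVE.
    have h := @davg_near_ae k x (Q `\` F) 2 mG (fun y Gy => proj1 Gy)
      (fun y j Gy => not_stop (proj1 Gy) (proj2 Gy) (j := j)).
    apply: filterS h => y hy Gy.
    rewrite -EFinM lee_fin /Phi ler_wpM2r// ler_expR mulrC ler_wpM2r//.
    by rewrite ge_min hy.
  rewrite ZV ?expR_ge0//.
  apply: lee_wpmul2l; first by rewrite lee_fin expR_ge0.
  by apply: ge0_subset_integral => // y _; rewrite lee_fin.
have WF : (\int[mu]_(y in F) (V y)%:E <= (1 - c)%:E * \int[mu]_(y in Q) (V y)%:E)%E.
  exact: Vsmall Lk mF FQ (mu_stop k x).
have QE : Q = (Q `\` F) `|` F by rewrite setUC setDUK.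
rewrite [in X in (X <= _)%E]QE.
apply: le_trans (ge0_integral_setU_le _ _ mF _ _) _ => //.
- exact: measurableD.
- exact: measurable_funTS.
apply: le_trans (leeD hG hF) _.
apply: le_trans (leeD (lexx _) (lee_wpmul2l _ WF)) _; first by rewrite lee_fin.
rewrite muleA -EFinM -ge0_muleDl ?lee_fin ?expR_ge0 ?mulr_ge0//; last by lra.
rewrite -EFinD lee_wpmul2r ?integral_ge0// => [y _|]; first by rewrite lee_fin.
rewrite lee_fin exprS.
have := ler_wpM2r (CN N) epsc.
set A := expR (eps * _); set E := expR (2 * eps).
rewrite /M -/A -/E => hA.
(* [E * (2 / c)] is the fixed point of the recursion Y = E + (1 - c / 2) Y. *)
have : E * (2 / c) * (1 - c / 2) = E * (2 / c) - E.
  by field; rewrite gt_eqF.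
move: hA; set X := (1 - c/2) ^+ N * _; set Y := E * (2 / c) => hA hY.
have -> : (1 - c / 2) * (1 - c / 2) ^+ N * expR (eps * lam) = (1 - c/2) * X by rewrite /X mulrA.
rewrite mulrAC; apply: le_trans (lerD (lexx E) hA) _.
by rewrite mulrDr (mulrC _ Y) hY addrA (addrC E) subrK.
Qed.

(** First [N] tends to infinity with [lam] fixed, which removes the term that depends on the
    truncation; then [lam] tends to infinity by monotone convergence. *)
Lemma john_nirenberg k x : L k x ->
  (\int[mu]_(y in dcube k x) (expR (eps * `|b y - davg b k x|) * V y)%:E <=
   (expR (2 * eps) * (2 / c))%:E * \int[mu]_(y in dcube k x) (V y)%:E)%E.
Proof.
move=> Lk; have mQ := measurable_dcube k x.
set C0 := expR (2 * eps) * (2 / c).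
set w := (\int[mu]_(y in dcube k x) (V y)%:E)%E.
have w0 : (0 <= w)%E by apply: integral_ge0 => y _; rewrite lee_fin.
have wE : w = (fine w)%:E by rewrite fineK// ge0_fin_numE// Vfin.
have bound (lam : R) : (\int[mu]_(y in dcube k x) (Phi lam k x y)%:E <= C0%:E * w)%E.
  apply/lee_addgt0Pr => e e0.
  have r1 : `|1 - c / 2| < 1.
    by have [c0' c1'] := conj c0 c1; rewrite ger0_norm; lra.
  have /cvgrPdist_lt/(_ e e0) [N _ /(_ N (leqnn N))] :
      (fun N => (1 - c / 2) ^+ N * (expR (eps * lam) * fine w)) @ \oo --> (0 : R).
    rewrite -(mul0r (expR (eps * lam) * fine w)); apply: cvgMl; exact: cvg_expr.
  rewrite /= sub0r normrN => /(le_lt_trans (ler_norm _))/ltW hN.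
  apply: le_trans (int_Phi lam N Lk) _.
  rewrite -/w wE -!EFinM -EFinD lee_fin mulrDl lerD2l.
  by rewrite -mulrA.
pose g (n : nat) y := (Phi n%:R k x y)%:E.
have cg y : g n y @[n --> \oo] --> (expR (eps * `|b y - davg b k x|) * V y)%:E.
  apply: cvg_near_cst; near=> n; congr (expR (eps * _) * _)%:E.
  by apply/min_idPl; near: n; exact: nbhs_infty_ger.
apply: (@ge0_integral_le_cvg _ _ _ mu _ g) => //.
- by move=> n; apply: measurable_funTS; exact: mPhi.
- by move=> n y _; exact: Phi0.
- move=> y _ n1 n2 n12; rewrite lee_fin /Phi ler_wpM2r// ler_expR ler_wpM2l//.
by rewrite le_min ge_min lexx /= ge_min ler_nat n12 orbT.
by move=> n; exact: bound.
Unshelve. all: by end_near. Qed.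

End john_nirenberg.

End dyadic.

(** * Integrals of products over tuples *)

Lemma emeasurable_prod d (T : measurableType d) (R : realType) (I : Type)
    (s : seq I) (f : I -> T -> \bar R) (D : set T) :
  (forall i, measurable_fun D (f i)) ->
  measurable_fun D (fun x => \prod_(i <- s) f i x)%E.
Proof.
move=> mf; elim: s => [|i s IH].
  by under eq_fun do rewrite big_nil; exact: measurable_cst.
by under eq_fun do rewrite big_cons; exact: emeasurable_funM.
Qed.

Lemma prode_ge0_seq (R : realDomainType) (I : Type) (s : seq I) (f : I -> \bar R) :
  (forall i, 0 <= f i)%E -> (0 <= \prod_(i <- s) f i)%E.
Proof. by move=> f0; elim/big_ind: _ => // x y; exact: mule_ge0. Qed.

Section tuple_integral.
Context d (T : measurableType d) (R : realType).
Variable mu : {sigma_finite_measure set T -> \bar R}.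

(** Tonelli's theorem, one coordinate at a time along [tuple_cons]. *)
Lemma ge0_integral_tuple_prod k (h : 'I_k -> T -> \bar R) :
  (forall i, measurable_fun [set: T] (h i)) -> (forall i x, 0 <= h i x)%E ->
  (\int[tuple_measure mu k]_y (\prod_(i < k) h i (tnth y i)) =
   \prod_(i < k) \int[mu]_x h i x)%E.
Proof.
elim: k h => [|k IH] h mh h0.
  under eq_integral do rewrite big_ord0.
  by rewrite big_ord0 /= integral_dirac// diracT mul1e.
have mpr (n : nat) (g : 'I_n -> T -> \bar R) : (forall i, measurable_fun [set: T] (g i)) ->
    measurable_fun [set: n.-tuple T] (fun y : n.-tuple T => \prod_(i < n) g i (tnth y i))%E.
  move=> mg; apply: emeasurable_prod => i.
  by apply: measurableT_comp => //; exact: measurable_tnth.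
have p0 (n : nat) (g : 'I_n -> T -> \bar R) (y : n.-tuple T) :
    (forall i x, 0 <= g i x)%E -> (0 <= \prod_(i < n) g i (tnth y i))%E.
  by move=> g0; apply: prode_ge0_seq.
rewrite /= /tuple_measureS.
rewrite ge0_integral_pushforward//=; last 3 first.
- exact: measurable_tuple_cons.
- exact: mpr.
- by move=> y _; exact: p0.
rewrite preimage_setT.
rewrite fubini_tonelli1//=; last 2 first.
- apply: (@measurableT_comp _ _ _ _ _ _ (fun y : k.+1.-tuple T => \prod_(i < k.+1) h i (tnth y i))%E).
    exact: mpr.
  exact: measurable_tuple_cons.
- by move=> y; exact: p0.
rewrite /fubini_F big_ord_recl /=.
pose g i := h (lift ord0 i).
have gE x (y : k.-tuple T) : (\prod_(i < k.+1) h i (tnth (tuple_cons (x, y)) i) =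
   h ord0 x * \prod_(i < k) g i (tnth y i))%E.
  rewrite big_ord_recl; congr (_ * _)%E.
  by apply: eq_bigr => i _; rewrite /tuple_cons /= tnthS.
have inner x : (\int[tuple_measure mu k]_y \prod_(i < k.+1) h i (tnth (tuple_cons (x, y)) i)
    = h ord0 x * \prod_(i < k) \int[mu]_z g i z)%E.
  under eq_integral do rewrite gE.
  rewrite (@ge0_integralZl _ _ _ _ _ _ (fun y : k.-tuple T => \prod_(i < k) g i (tnth y i))%E)//.
  - by rewrite IH// => i; [exact: mh|exact: h0].
  - by apply: mpr => i; exact: mh.
  - by move=> y _; apply: p0 => i; exact: h0.
rewrite (eq_integral (fun x => h ord0 x * \prod_(i < k) \int[mu]_z g i z)%E); last first.
  by move=> x _; exact: inner.
rewrite ge0_integralZr//.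
by apply: prode_ge0_seq => i; apply: integral_ge0 => x _; exact: h0.
Qed.

End tuple_integral.

(** * Cubes and balls in R^n *)

Section dyadic_cubes.
Context (R : realType) (n : nat).
Local Notation E := (Rn R n).
Local Notation mu := (@leb R n).
Implicit Types (x y z : E) (k : int).

Definition side k : R := 2 `^ (k%:~R).

Lemma side_gt0 k : 0 < side k. Proof. exact: powR_gt0. Qed.

Lemma sideD j k : side (j + k) = side j * side k.
Proof. by rewrite /side intrD powRD// pnatr_eq0 implybT. Qed.

Lemma side_le j k : (j <= k)%R -> side j <= side k.
Proof. by move=> jk; apply: ler_powR; rewrite ?ler1n// ler_int. Qed.

Lemma side0 : side 0 = 1. Proof. by rewrite /side powRr0. Qed.

Lemma side1 : side 1 = 2. Proof. by rewrite /side powRr1. Qed.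

Lemma sideN k : side (- k) = (side k)^-1.
Proof. by rewrite /side mulrNz powRN. Qed.

Lemma side_nat (N : nat) : side N%:Z = 2 ^+ N.
Proof. by rewrite /side powR_mulrn. Qed.

Lemma side_small (e : R) : 0 < e -> exists N : nat, side (- N%:Z) <= e.
Proof.
move=> e0; exists (Num.bound e^-1); rewrite sideN side_nat.
rewrite -[e in _ <= e]invrK lef_pV2 ?posrE ?invr_gt0//.
have e1 : 0 <= e^-1 by rewrite invr_ge0 ltW.
have := archi_boundP e1 => /ltW /le_trans; apply.
by rewrite -natrX ler_nat ltnW// ltn_expl.
Qed.

Definition didx k x : {ffun 'I_n -> int} := [ffun i => Num.floor (tnth x i / side k)].

Definition dvol k : R := side k ^+ n.

Lemma dvol_gt0 k : 0 < dvol k. Proof. by rewrite exprn_gt0// side_gt0. Qed.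

Lemma dvolS k : dvol k = 2 ^+ n * dvol (k - 1).
Proof. by rewrite /dvol -exprMn -side1 -sideD addrCA subrr addr0. Qed.

Lemma didx_itv k x i : (didx k x i)%:~R * side k <= tnth x i < (didx k x i + 1)%:~R * side k.
Proof.
rewrite ffunE -ler_pdivlMr ?side_gt0// -ltr_pdivrMr ?side_gt0//.
exact: floor_itv.
Qed.

(** The floor of a / 2 depends on a only through the floor of a. *)
Lemma didx_nest k x y : didx k x = didx k y -> didx (k + 1) x = didx (k + 1) y.
Proof.
move=> /ffunP e; apply/ffunP => i; move: (e i); rewrite !ffunE sideD side1 => {}e.
rewrite !invfM !mulrA; move: (tnth x i / side k) (tnth y i / side k) e => a b e.
apply: floor_def; have := floor_itv (b / 2); set z := Num.floor (b / 2).
rewrite !ler_pdivlMr// !ltr_pdivrMr//.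
have -> : z%:~R * 2 = (z * 2)%:~R :> R by rewrite intrM.
have -> : (z + 1)%:~R * 2 = ((z + 1) * 2)%:~R :> R by rewrite intrM.
by rewrite -!floor_ge_int -!floor_lt_int e.
Qed.

Lemma measurable_Borel (A : set (n.-tuple (measurableTypeR R))) :
  measurable A -> measurable (A : set E).
Proof. exact: caratheodory_measurable_mu_ext. Qed.

Lemma leb_Borel (A : set (n.-tuple (measurableTypeR R))) :
  measurable A -> mu A = borel_leb R n A.
Proof. exact: measurable_mu_extE. Qed.

Lemma measurable_box (A : 'I_n -> set R) : (forall i, measurable (A i)) ->
  measurable ([set y : n.-tuple (measurableTypeR R) | forall i, A i (tnth y i)]).
Proof.
move=> mA; have -> : [set y : n.-tuple (measurableTypeR R) | forall i, A i (tnth y i)]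
    = \bigcap_(i in [set: 'I_n]) ((fun y : n.-tuple (measurableTypeR R) => tnth y i) @^-1` A i).
  by apply/seteqP; split=> y /= h i => [_|]; exact: h.
apply: fin_bigcap_measurable => // i _; rewrite -[X in measurable X]setTI.
by apply: (@measurable_tnth _ (measurableTypeR R) n i) => //; exact: mA.
Qed.

(** The indicator of a box is a product of indicators of one variable, so its integral factors. *)
Lemma leb_box (A : 'I_n -> set R) : (forall i, measurable (A i)) ->
  mu [set y : E | forall i, A i (tnth y i)] = (\prod_(i < n) lebesgue_measure (A i))%E.
Proof.
move=> mA; rewrite leb_Borel ?measurable_box//.
have mB := measurable_box mA; set B := [set _ | _] in mB *.
transitivity (\int[borel_leb R n]_y (\1_B y)%:E)%E.
  by rewrite integral_indic// setIT.
transitivity (\int[borel_leb R n]_y (\prod_(i < n) (\1_(A i) (tnth y i))%:E))%E.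
  apply: eq_integral => y _; rewrite indicE; case: (boolP (y \in B)) => yB.
    by rewrite big1// => i _; rewrite indicE mem_set//; move: yB => /set_mem; exact.
  have [i nAi] : exists i, ~ A i (tnth y i).
    by apply/existsNP => h; move: yB; rewrite mem_set.
  rewrite (bigD1 i)//= indicE memNset//; by rewrite mul0e.
rewrite (@ge0_integral_tuple_prod _ _ _ (@lebesgue_measure R) n
  (fun i s => (\1_(A i) s)%:E)).
- apply: eq_bigr => i _.
  by rewrite (@integral_indic _ _ _ (@lebesgue_measure R) setT measurableT (A i) (mA i)) setIT.
- move=> i; apply/measurable_EFinP; exact: (measurable_indic (mA i)).
- by move=> i s; rewrite lee_fin.
- exact: measurable_box.
Qed.

Definition didx_box k (v : {ffun 'I_n -> int}) (i : 'I_n) : set R :=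
  `[(v i)%:~R * side k, (v i + 1)%:~R * side k[%classic.

Lemma didx_preimage k v : didx k @^-1` [set v] =
  [set y : E | forall i, didx_box k v i (tnth y i)].
Proof.
apply/seteqP; split=> [y <- i|y h]; rewrite /didx_box /= ?in_itv/= ?didx_itv//.
apply/ffunP => i; have := h i; rewrite /didx_box /= in_itv/= => {}h.
rewrite ffunE; apply: floor_def.
by rewrite ler_pdivlMr ?side_gt0// ltr_pdivrMr ?side_gt0.
Qed.

Lemma didx_measurable k v : measurable (didx k @^-1` [set v]).
Proof.
rewrite didx_preimage; apply: measurable_Borel; apply: measurable_box => i.
exact: measurable_itv.
Qed.

Lemma leb_dcube k x : mu (dcube didx k x) = (dvol k)%:E.
Proof.
have -> : dcube didx k x = didx k @^-1` [set didx k x] by [].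
rewrite didx_preimage leb_box; last by move=> i; exact: measurable_itv.
rewrite (eq_bigr (fun=> (side k)%:E)); last first.
  move=> i _; rewrite /didx_box lebesgue_measure_itv /= lte_fin ltr_pM2r ?side_gt0//.
  rewrite ltr_int ltrDl ltr01 -EFinB -mulrBl -intrB addrAC subrr add0r mul1r//.
by rewrite prodEFin prodr_const card_ord.
Qed.

End dyadic_cubes.

(** * Approximation of measurable sets by unions of small cubes *)

Section approximation.
Context (R : realType) (n : nat).
Local Notation E := (Rn R n).
Local Notation mu := (@leb R n).
Local Notation BT := (n.-tuple (measurableTypeR R)).
Variables (k : int) (x : E).
Let Q : set E := dcube (@didx R n) k x.

(** These sets form a sigma-algebra that contains the half-spaces, hence all Borel sets. The error
    is measured inside [Q] only, whose finite measure gives the continuity from above used for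
    countable unions. *)
Let approximable (A : set E) := measurable A /\ forall eta : R, 0 < eta ->
  exists j (G : set E), [/\ (j <= k)%R, saturated (@didx R n) j G &
   (mu ((A `\` G `|` G `\` A) `&` Q) <= eta%:E)%E].

Let mQ : measurable Q.
Proof. exact: (measurable_dcube (@didx_measurable R n) (@didx_nest R n)). Qed.

Let msat j (G : set E) : saturated (@didx R n) j G -> measurable G.
Proof. exact: (measurable_saturated (@didx_measurable R n)). Qed.

Let approximable_saturated j (G : set E) : saturated (@didx R n) j G -> approximable G.
Proof.
move=> sG; split=> [|eta eta0]; first exact: msat sG.
exists (Num.min j k), G; split.
- by rewrite ge_min lexx orbT.
- by apply: (saturated_le (@didx_nest R n) _ sG); rewrite ge_min lexx.
- by rewrite setDv setU0 set0I measure0 lee_fin ltW.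
Qed.

Let approximable0 : approximable set0.
Proof. exact: (@approximable_saturated 0). Qed.

Let approximableC A : approximable A -> approximable (~` A).
Proof.
move=> [mA hA]; split; first exact: measurableC.
move=> eta /hA[j [G [jk sG h]]]; exists j, (~` G); split=> //.
  by move=> y z e nGy Gz; apply: nGy; apply: sG Gz.
have CC (B D : set E) : ~` B `\` ~` D = D `\` B by rewrite !setDE setCK setIC.
by rewrite !CC setUC.
Qed.

Let approximableU A B : approximable A -> approximable B -> approximable (A `|` B).
Proof.
move=> [mA hA] [mB hB]; split; first exact: measurableU.
move=> eta eta0; have e2 : 0 < eta / 2 by rewrite divr_gt0.
have [i [G [ik sG hG]]] := hA _ e2; have [j [H [jk sH hH]]] := hB _ e2.
have mG := msat sG; have mH := msat sH.
exists (Num.min i j), (G `|` H); split.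
- by rewrite ge_min ik.
- have sG' : saturated (@didx R n) (Num.min i j) G.
    by apply: (saturated_le (@didx_nest R n) _ sG); rewrite ge_min lexx.
  have sH' : saturated (@didx R n) (Num.min i j) H.
    by apply: (saturated_le (@didx_nest R n) _ sH); rewrite ge_min lexx orbT.
  by move=> y z e [Gy|Hy]; [left; exact: sG' Gy|right; exact: sH' Hy].
have -> : eta%:E = ((eta / 2)%:E + (eta / 2)%:E)%E by rewrite -EFinD -splitr.
apply: le_trans (leeD hG hH); apply: le_trans (measureU2 _ _ _) => //.
- rewrite le_measure ?inE//.
  + by apply: measurableI => //; apply: measurableU; apply: measurableD; apply: measurableU.
  + by apply: measurableU; apply: measurableI => //; apply: measurableU; exact: measurableD.
  move=> y [[[[Ay|By] nGH]|[[Gy|Hy] nAB]] Qy].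
  + by left; split=> //; left; split=> // Gy; apply: nGH; left.
  + by right; split=> //; left; split=> // Hy; apply: nGH; right.
  + by left; split=> //; right; split=> // Ay; apply: nAB; left.
  + by right; split=> //; right; split=> // By; apply: nAB; right.
- by apply: measurableI => //; apply: measurableU; exact: measurableD.
- by apply: measurableI => //; apply: measurableU; exact: measurableD.
Qed.

Let approximable_bigcup (F : (set E)^nat) : (forall i, approximable (F i)) ->
  approximable (\bigcup_i F i).
Proof.
move=> aF; have mF i : measurable (F i) by case: (aF i).
split; first exact: bigcupT_measurable.
move=> eta eta0; have e2 : 0 < eta / 2 by rewrite divr_gt0.
pose S N := \big[setU/set0]_(i < N) F i.
have aS N : approximable (S N).
  elim: N => [|N IH]; first by rewrite /S big_ord0.
  by rewrite /S big_ord_recr; exact: approximableU.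
have mS N : measurable (S N) by case: (aS N).
pose H N := ((\bigcup_i F i) `\` S N) `&` Q.
have mH N : measurable (H N).
  by apply: measurableI => //; apply: measurableD => //; exact: bigcupT_measurable.
have H0 : \bigcap_N H N = set0.
  apply/seteqP; split=> // y Hy; have [[[i _ Fiy] _] _] := Hy 0%N I.
  have [[_ nS] _] := Hy i.+1 I; apply: nS; rewrite /S -bigcup_mkord.
  by exists i => //=.
have cH : mu (H N) @[N --> \oo] --> 0%E.
  rewrite -(measure0 mu) -H0.
  apply: (@nonincreasing_cvg_mu _ _ _ mu H) => //.
  - apply: (@le_lt_trans _ _ (mu Q)); last by rewrite leb_dcube ltry.
    by rewrite le_measure ?inE//; exact: subIsetr.
  - by rewrite H0.
  move=> i j ij; apply/subsetPset; apply: setSI; apply: setDS.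
  by rewrite /S -!bigcup_mkord; apply: bigcup_sub => l /= li z Flz; exists l => //=; exact: leq_trans ij.
have [N hN] : exists N, (mu (H N) <= (eta / 2)%:E)%E.
  have /fine_cvgP[[N0 _ fin0] /cvgrPdist_le/(_ _ e2)[N1 _ hN]] := cH.
  exists (maxn N0 N1); rewrite -[X in (X <= _)%E]fineK; last by apply: fin0; exact: leq_maxl.
  have := hN _ (leq_maxr N0 N1); rewrite /= sub0r normrN lee_fin.
  exact/le_trans/ler_norm.
have [_ /(_ _ e2)[j [G [jk sG hG]]]] := aS N.
have mG := msat sG.
exists j, G; split=> //.
have -> : eta%:E = ((eta / 2)%:E + (eta / 2)%:E)%E by rewrite -EFinD -splitr.
apply: le_trans (leeD hG hN); apply: le_trans (measureU2 _ _ _) => //.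
  have mU : measurable (\bigcup_i F i) by exact: bigcupT_measurable.
  rewrite le_measure ?inE//.
  + by apply: measurableI => //; apply: measurableU; exact: measurableD.
  + by apply: measurableU => //; apply: measurableI => //; apply: measurableU; exact: measurableD.
  move=> y [[[Fy nGy]|[Gy nFy]] Qy].
    have [Sy|nSy] := pselect (S N y); first by left; split=> //; left.
    by right.
  left; split=> //; right; split=> // Sy; apply: nFy; move: Sy; rewrite /S -bigcup_mkord.
  by move=> [i _ ?]; exists i.
by apply: measurableI => //; apply: measurableU; exact: measurableD.
Qed.

(** The half-space is exhausted by the cubes of side 2^-N that lie strictly to the left of the slab
    containing [a]. *)
Let approximable_ray (i : 'I_n) (a : R) : approximable [set y : E | tnth y i < a].
Proof.
have -> : [set y : E | tnth y i < a] = \bigcup_(N : nat)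
    [set y : E | didx (- N%:Z) y i < Num.floor (a / side R (- N%:Z))].
  apply/seteqP; split=> [y /= ya|y [N _ /=]]; last first.
    rewrite ffunE floor_lt_int => /lt_le_trans/(_ (floor_le _)).
    by rewrite ltr_pM2r// invr_gt0 side_gt0.
  have ay : 0 < a - tnth y i by rewrite subr_gt0.
  have [N hN] := @side_small R _ ay; exists N => //=.
  have s0 := @side_gt0 R (- N%:Z).
  rewrite ffunE -lezD1 floor_ge_int intrD.
  apply: (@le_trans _ _ (tnth y i / side R (- N%:Z) + 1)).
    by rewrite lerD2r floor_le.
  by rewrite ler_pdivlMr// mulrDl divfK ?gt_eqF// mul1r -lerBrDl.
apply: approximable_bigcup => N; apply: (@approximable_saturated (- N%:Z)).
by move=> y z e /=; rewrite e.
Qed.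

Let approximable_Borel (A : set BT) : measurable A -> approximable A.
Proof.
apply: smallest_sub => /=.
  split; [exact: approximable0|by move=> B aB; rewrite setTD; exact: approximableC|].
  exact: approximable_bigcup.
elim/big_ind: _ => // [C D hC hD B [/hC|/hD]//|i _ B [C mC <-{B}]].
rewrite setTI.
have : (@RGenInftyO.G R).-sigma.-measurable C by rewrite -RGenInftyO.measurableE.
move: C {mC}; apply: smallest_sub => /=.
  split.
  - by rewrite preimage_set0; exact: approximable0.
  - by move=> C aC; rewrite setTD preimage_setC; exact: approximableC.
  - by move=> F aF; rewrite preimage_bigcup; exact: approximable_bigcup.
by move=> C [a ->]; exact: approximable_ray.
Qed.

(** A Lebesgue set is covered by a Borel set of nearly the same measure, and the Borel set is
    approximated. *)
Lemma dcube_approx (P : set E) (eta : R) : measurable P -> P `<=` Q -> 0 < eta ->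
    exists j (G : set E), [/\ (j <= k)%R, saturated (@didx R n) j G, (mu (P `\` G) <= eta%:E)%E &
      (mu ((G `\` P) `&` Q) <= eta%:E)%E].
Proof.
move=> mP PQ eta0; have e2 : 0 < eta / 2 by rewrite divr_gt0.
have fP : (mu P < +oo)%E.
  apply: (@le_lt_trans _ _ (mu Q)); last by rewrite leb_dcube ltry.
  by rewrite le_measure ?inE.
have finP : mu P \is a fin_num by rewrite ge0_fin_numE.
(* By construction [mu P] is an infimum over countable Borel covers of [P]. *)
have : (ereal_inf [set (\sum_(0 <= i <oo) borel_leb R n (F i))%E | F in
    @measurable_cover _ BT P] < mu P + (eta / 2)%:E)%E.
  by rewrite -[X in (X < _)%E]/(mu P) lteDl// lte_fin.
move=> /ereal_inf_lt[_ [F [mF PF] <-] hF].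
set B : set E := \bigcup_i F i in PF.
have mBT : measurable (\bigcup_i F i : set BT) by exact: bigcupT_measurable.
have mB : measurable B by exact: measurable_Borel mBT.
have hB : (mu B <= mu P + (eta / 2)%:E)%E.
  apply: le_trans (ltW hF); rewrite leb_Borel//.
  exact: measure_sigma_subadditive.
have [_ /(_ _ e2)[j [G [jk sG hG]]]] := approximable_Borel mBT.
have mG := msat sG.
have hBP : (mu (B `\` P) <= (eta / 2)%:E)%E.
  rewrite measureD//; last by apply: le_lt_trans hB _; rewrite -(fineK finP) -EFinD ltry.
  by rewrite setIidr// leeBlDl.
exists j, G; split=> //.
  apply: (@le_trans _ _ (eta / 2)%:E); last by rewrite lee_fin ler_piMr ?ltW// invf_lt1 ?ltr1n.
  apply: le_trans hG; rewrite le_measure ?inE//.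
  - exact: measurableD.
  - by apply: measurableI => //; apply: measurableU; exact: measurableD.
  by move=> y [Py nGy]; split; [left; split=> //; exact: PF|exact: PQ].
have -> : eta%:E = ((eta / 2)%:E + (eta / 2)%:E)%E by rewrite -EFinD -splitr.
apply: le_trans (leeD hG hBP); apply: le_trans (measureU2 _ _ _) => //.
- rewrite le_measure ?inE//.
  + by apply: measurableI => //; exact: measurableD.
  + by apply: measurableU; [apply: measurableI => //; apply: measurableU|]; exact: measurableD.
  move=> y [[Gy nPy] Qy]; have [By|nBy] := pselect (B y); first by right.
  by left; split=> //; right.
- by apply: measurableI => //; apply: measurableU; exact: measurableD.
- exact: measurableD.
Qed.

End approximation.

(** * Triple cubes and Euclidean balls *)

Section triple_cubes.
Context (R : realType) (n : nat).
Local Notation E := (Rn R n).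
Local Notation mu := (@leb R n).
Local Notation dcube := (dcube (@didx R n)).
Local Notation side := (side R).
Implicit Types (x y z : E) (k : int).

Definition tcube k x : set E :=
  [set y | forall i, `|didx k y i - didx k x i| <= 1].

Lemma tcube_sym k x y : tcube k x y -> tcube k y x.
Proof. by move=> h i; rewrite distrC. Qed.

Lemma sub_dcube_tcube k x : dcube k x `<=` tcube k x.
Proof. by move=> y yx i; rewrite yx subrr normr0. Qed.

Lemma tcube_refl k x : tcube k x x. Proof. exact: sub_dcube_tcube. Qed.

Lemma eq_tcube k x y : dcube k x y -> tcube k y = tcube k x.
Proof. by move=> yx; apply/seteqP; split=> z h i; move: (h i); rewrite yx. Qed.

Lemma saturated_tcube k x : saturated (@didx R n) k (tcube k x).
Proof. by move=> y z e h i; rewrite -e. Qed.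

Lemma measurable_tcube k x : measurable (tcube k x).
Proof. exact: (measurable_saturated (@didx_measurable R n)) (@saturated_tcube k x). Qed.

Lemma measurable_ddcube k x : measurable (dcube k x).
Proof. exact: (measurable_dcube (@didx_measurable R n) (@didx_nest R n)). Qed.

Lemma sub_tcubeS k x y : tcube k x y -> dcube k y `<=` tcube k x.
Proof. by move=> h z /esym e; exact: saturated_tcube e h. Qed.

Lemma leb_tcube k x : mu (tcube k x) = (3 ^+ n * dvol R n k)%:E.
Proof.
pose I (i : 'I_n) : set R :=
  `[(didx k x i - 1)%:~R * side k, (didx k x i + 2)%:~R * side k[%classic.
have -> : tcube k x = [set y : E | forall i, I i (tnth y i)].
  apply/seteqP; split=> y h i; have := didx_itv k y i.
    move=> /andP[h1 h2]; have := h i; rewrite ler_norml => /andP[h3 h4].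
    rewrite /I /= in_itv /=; apply/andP; split.
      by apply: le_trans h1; rewrite ler_pM2r ?side_gt0// ler_int; lia.
    by apply: (lt_le_trans h2); rewrite ler_pM2r ?side_gt0// ler_int; lia.
  have := h i; rewrite /I /= in_itv /= => /andP[h1 h2] /andP[h3 h4].
  have := le_lt_trans h1 h4; have := le_lt_trans h3 h2.
  rewrite !ltr_pM2r ?side_gt0// !ltr_int; move: (didx k x i) (didx k y i) => a b; lia.
rewrite leb_box; last by move=> i; exact: measurable_itv.
rewrite (eq_bigr (fun=> (3 * side k)%:E)); last first.
  move=> i _; rewrite /I lebesgue_measure_itv /= lte_fin ltr_pM2r ?side_gt0//.
  rewrite ltr_int ltrD2l -EFinB -mulrBl -intrB opprD addrACA subrr add0r opprK.
  by rewrite (_ : (-1 < 2 :> int)%R = true).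
by rewrite prodEFin prodr_const card_ord exprMn.
Qed.

(** 3Q consists of 3^n cubes; instead of enumerating them, [phi] is compared on each with the
    constant density that integrates to [C]. *)
Lemma integral_tcube_le k x (phi : E -> \bar R) (C : R) : 0 <= C ->
  measurable_fun [set: E] phi -> (forall y, 0 <= phi y)%E ->
  (forall y, tcube k x y -> \int[mu]_(z in dcube k y) phi z <= C%:E)%E ->
  (\int[mu]_(y in tcube k x) phi y <= (3 ^+ n * C)%:E)%E.
Proof.
move=> C0 mphi phi0 h; have v0 := dvol_gt0 R n k.
have cst_int (D : set E) (s : R) : measurable D -> (\int[mu]_(y in D) s%:E = s%:E * mu D)%E.
  by move=> mD; exact: (integral_cst mu mD s%:E).
have := @integral_saturated_le _ _ _ mu _ _ (@didx_measurable R n) k (tcube k x)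
  phi (cst (C / dvol R n k)%:E) (@saturated_tcube k x).
move=> /(_ _ _ _ _ _)/le_trans; apply.
- exact: measurable_funTS.
- exact: measurable_cst.
- by move=> y _.
- by move=> y _; rewrite lee_fin divr_ge0// ltW.
- move=> y yx; apply: le_trans (h y yx) _.
  rewrite /= cst_int ?leb_dcube; last exact: measurable_ddcube.
  by rewrite -EFinM divfK// gt_eqF.
rewrite /= cst_int ?leb_tcube; last exact: measurable_tcube.
by rewrite -EFinM lee_fin mulrCA divfK ?gt_eqF.
Qed.

Lemma eucl_dist_ge x y i : `|tnth x i - tnth y i| <= eucl_dist x y.
Proof.
rewrite -sqrtr_sqr; apply: ler_wsqrtr; rewrite (bigD1 i)//= lerDl.
by apply: sumr_ge0 => j _; exact: sqr_ge0.
Qed.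

Lemma eucl_dist_le x y (s : R) : 0 <= s -> (forall i, `|tnth x i - tnth y i| <= s) ->
  eucl_dist x y <= n%:R * s.
Proof.
move=> s0 h; have ns0 : 0 <= n%:R * s by rewrite mulr_ge0.
rewrite -[leRHS]ger0_norm// -sqrtr_sqr; apply: ler_wsqrtr.
apply: (@le_trans _ _ (\sum_(i < n) s ^+ 2)).
  by apply: ler_sum => i _; rewrite -real_normK ?num_real// lerXn2r ?nnegrE.
rewrite sumr_const card_ord exprMn -[X in X <= _]mulr_natl; apply: ler_wpM2r; first exact: sqr_ge0.
by rewrite -natrX ler_nat; case: (n) => // l; rewrite expnS leq_pmulr ?expn_gt0.
Qed.

Lemma eucl_norm_ge x i : `|tnth x i| <= eucl_norm x.
Proof.
rewrite -sqrtr_sqr; apply: ler_wsqrtr; rewrite (bigD1 i)//= lerDl.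
by apply: sumr_ge0 => j _; exact: sqr_ge0.
Qed.

Lemma eucl_norm_le x (s : R) : 0 <= s -> (forall i, `|tnth x i| <= s) ->
  eucl_norm x <= n%:R * s.
Proof.
move=> s0 h; have ns0 : 0 <= n%:R * s by rewrite mulr_ge0.
rewrite -[leRHS]ger0_norm// -sqrtr_sqr; apply: ler_wsqrtr.
apply: (@le_trans _ _ (\sum_(i < n) s ^+ 2)).
  by apply: ler_sum => i _; rewrite -real_normK ?num_real// lerXn2r ?nnegrE.
rewrite sumr_const card_ord exprMn -[X in X <= _]mulr_natl; apply: ler_wpM2r; first exact: sqr_ge0.
by rewrite -natrX ler_nat; case: (n) => // l; rewrite expnS leq_pmulr ?expn_gt0.
Qed.

Lemma tcube_coord k x y i : tcube k x y -> `|tnth x i - tnth y i| <= 2 * side k.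
Proof.
move=> /(_ i); rewrite ler_norml => /andP[h3 h4].
have /andP[h1 h2] := didx_itv k x i; have /andP[h5 h6] := didx_itv k y i.
have s0 := side_gt0 R k.
move: (didx k x i) (didx k y i) h1 h2 h3 h4 h5 h6 => a b h1 h2 h3 h4 h5 h6.
have : b%:~R <= a%:~R + 1 :> R by rewrite -intrD1 ler_int; lia.
have : a%:~R <= b%:~R + 1 :> R by rewrite -intrD1 ler_int; lia.
move: h2 h6; rewrite !intrD.
move: (a%:~R : R) (b%:~R : R) h1 h5 => A B h1 h5 h2 h6 h7 h8.
rewrite ler_norml; apply/andP; split; nra.
Qed.

Lemma coord_tcube k x y : (forall i, `|tnth x i - tnth y i| < side k) -> tcube k x y.
Proof.
move=> h i; have := h i; rewrite ltr_norml => /andP[h3 h4].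
have /andP[h1 h2] := didx_itv k x i; have /andP[h5 h6] := didx_itv k y i.
have s0 := side_gt0 R k.
move: (didx k x i) (didx k y i) h1 h2 h3 h4 h5 h6 => a b h1 h2 h3 h4 h5 h6.
have : b%:~R < (a + 2)%:~R :> R.
  rewrite -(ltr_pM2r s0); apply: (le_lt_trans h5).
  by move: h2; rewrite !intrD => h2; lra.
have : a%:~R < (b + 2)%:~R :> R.
  rewrite -(ltr_pM2r s0); apply: (le_lt_trans h1).
  by move: h6; rewrite !intrD => h6; lra.
by rewrite !ltr_int ler_norml; lia.
Qed.

(** Points of 3Q are within 2 n sides of [x]; the extra 1 makes the inclusion in the open ball
    strict. *)
Definition brad k : R := (2 * n%:R + 1) * side k.

Lemma brad_gt0 k : 0 < brad k.
Proof. by rewrite mulr_gt0 ?side_gt0// ltr_wpDl. Qed.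

Lemma tcube_ball k x : tcube k x `<=` eucl_ball x (brad k).
Proof.
move=> y h; rewrite /eucl_ball /=; have s0 := side_gt0 R k.
apply: (@le_lt_trans _ _ (n%:R * (2 * side k))).
  by apply: eucl_dist_le => [|i]; [rewrite mulr_ge0// ltW|exact: tcube_coord].
by rewrite /brad mulrA (mulrC n%:R) ltr_pM2r// ltrDl.
Qed.

Lemma ball_tcube k x : eucl_ball x (side k) `<=` tcube k x.
Proof.
by move=> y h; apply: coord_tcube => i; apply: le_lt_trans h; exact: eucl_dist_ge.
Qed.

Lemma measurable_ball x (r : R) : 0 < r -> measurable (eucl_ball x r).
Proof.
move=> r0; apply: measurable_Borel.
have -> : eucl_ball x r = [set y : n.-tuple (measurableTypeR R) |
    \sum_(i < n) (tnth x i - tnth y i) ^+ 2 < r ^+ 2].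
  apply/seteqP; split=> y /=; rewrite /eucl_ball /= /eucl_dist.
    rewrite -[r in _ < r]ger0_norm ?ltW// -sqrtr_sqr ltr_sqrt ?exprn_gt0//.
  by rewrite -[r in _ -> _ < r]ger0_norm ?ltW// -sqrtr_sqr ltr_sqrt ?exprn_gt0.
rewrite -[X in measurable X]setTI.
apply: (measurable_fun_ltr _ (measurable_cst _)) => //.
apply: measurable_sum => i; apply: measurable_funX; apply: measurable_funB => //.
exact: (@measurable_tnth _ (measurableTypeR R) n i).
Qed.

Lemma leb_ball_le x (r : R) : 0 < r -> (mu (eucl_ball x r) <= ((2 * r) ^+ n)%:E)%E.
Proof.
move=> r0; pose I (i : 'I_n) : set R := `[tnth x i - r, tnth x i + r]%classic.
apply: (@le_trans _ _ (mu [set y : E | forall i, I i (tnth y i)])).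
  rewrite le_measure ?inE//; first exact: measurable_ball.
    by apply: measurable_Borel; apply: measurable_box => i; exact: measurable_itv.
  move=> y h i; rewrite /I /= in_itv /= -ler_distlC.
  by apply: ltW; apply: le_lt_trans h; exact: eucl_dist_ge.
rewrite leb_box; last by move=> i; exact: measurable_itv.
rewrite (eq_bigr (fun=> (2 * r)%:E)); last first.
  move=> i _; rewrite /I lebesgue_measure_itv /= lte_fin.
  rewrite ifT; last by lra.
  by rewrite -EFinB; congr (_%:E); lra.
by rewrite prodEFin prodr_const card_ord.
Qed.

End triple_cubes.

Lemma le_powR (R : realType) (a b e : R) : 0 <= e -> 0 <= a -> a <= b ->
  a `^ e <= b `^ e.
Proof.
move=> e0 a0 ab; apply: ge0_ler_powR => //; rewrite nnegrE//.
exact: le_trans ab.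
Qed.

Lemma measurable_powR2 d (T : measurableType d) (R : realType) (g h : T -> R) :
  measurable_fun [set: T] g -> measurable_fun [set: T] h ->
  measurable_fun [set: T] (fun x => g x `^ h x).
Proof.
move=> mg mh; rewrite /powR.
have meq (u : T -> R) : measurable_fun [set: T] u ->
    measurable_fun [set: T] (fun x => u x == 0).
  by move=> mu; exact: measurable_fun_eqr.
apply: measurable_fun_ifT; first exact: meq.
  have -> : (fun x => (h x == 0)%:R : R) = (fun x => if h x == 0 then 1 else 0).
    by apply/funext => x; case: (h x == 0).
  by apply: measurable_fun_ifT; [exact: meq| |].
apply: measurableT_comp => //; apply: measurable_funM => //.
exact: measurableT_comp.
Qed.

(** * Modulars and Hoelder's inequality *)

Section modular_norm.
Context d (T : measurableType d) (R : realType) (mu : {measure set T -> \bar R}).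
Variables (r f : T -> R).
Hypotheses (mr : measurable_fun [set: T] r) (mf : measurable_fun [set: T] f).
Hypotheses (f0 : forall x, 0 <= f x) (r_gt0 : forall x, 0 < r x).
Implicit Types (A B : set T) (l : R).

Definition modular A l : \bar R := (\int[mu]_(x in A) ((f x / l) `^ r x)%:E)%E.

(** The Luxemburg norm of the restriction of [f] to [A]. In contrast to [Lnorm_var] it takes
    real-valued functions, so that powers can be handled in the reals. *)
Definition mnorm A : \bar R :=
  ereal_inf [set l%:E | l in [set l : R | 0 < l /\ (modular A l <= 1)%E]].

Lemma measurable_modular l D :
  measurable_fun D (fun x => ((f x / l) `^ r x)%:E).
Proof.
apply/measurable_EFinP; apply: measurable_funTS; apply: measurable_powR2 => //.
exact: measurable_funM.
Qed.

Lemma modular_le A l l' : 0 < l -> l <= l' -> (modular A l' <= modular A l)%E.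
Proof.
move=> l0 ll'; have l'0 := lt_le_trans l0 ll'.
apply: ge0_le_integral_nomeas => x _; first by rewrite lee_fin powR_ge0.
rewrite lee_fin; apply: le_powR; first exact: ltW.
  by rewrite divr_ge0// ltW.
by rewrite ler_wpM2l// lef_pV2.
Qed.

Lemma modular_sub A B l : measurable A -> measurable B -> A `<=` B ->
  (modular A l <= modular B l)%E.
Proof.
move=> mA mB AB; apply: ge0_subset_integral => //; first exact: measurable_modular.
by move=> x _; rewrite lee_fin powR_ge0.
Qed.

Lemma mnorm_ge0 A : (0 <= mnorm A)%E.
Proof. by apply: le_ereal_inf_tmp => _ [l [l0 _] <-]; rewrite lee_fin ltW. Qed.

Lemma mnorm_le A l : 0 < l -> (modular A l <= 1)%E -> (mnorm A <= l%:E)%E.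
Proof. by move=> l0 h; apply: ereal_inf_lbound; exists l. Qed.

Lemma modular_le1 A l : (mnorm A < l%:E)%E -> (modular A l <= 1)%E.
Proof.
move=> /ereal_inf_lt[_ [l' [l'0 h] <-]]; rewrite lte_fin => /ltW l'l.
exact: le_trans (modular_le A l'0 l'l) h.
Qed.

Lemma mnorm_sub A B : measurable A -> measurable B -> A `<=` B -> (mnorm A <= mnorm B)%E.
Proof.
move=> mA mB AB; apply: le_ereal_inf => _ [l [l0 h] <-]; exists l => //; split=> //.
exact: le_trans (modular_sub l mA mB AB) h.
Qed.

(** If the norm were 0, every scale would have modular at most 1; since the exponent is at least
    [r0], letting the scale tend to 0 would force the integral of [f] to the power [r] over [A] to
    vanish. *)
Lemma mnorm_gt0 (r0 : R) A : 0 < r0 -> (forall x, r0 <= r x) -> measurable A ->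
  (forall x, A x -> 0 < f x) -> (0 < mu A)%E -> (0 < mnorm A)%E.
Proof.
move=> r00 r0r mA fpos muA; rewrite lt_neqAle mnorm_ge0 andbT; apply/negP => /eqP n0.
have h l : 0 < l -> (modular A l <= 1)%E.
  by move=> l0; apply: modular_le1; rewrite -n0 lte_fin.
have h1 (l : R) : 0 < l <= 1 -> (\int[mu]_(x in A) (f x `^ r x)%:E <= (l `^ r0)%:E)%E.
  move=> /andP[l0 l1]; apply: (@le_trans _ _ ((l `^ r0)%:E * modular A l)%E); last first.
    by rewrite -[leRHS]mule1 lee_pmul2l ?lte_fin ?powR_gt0// h.
  rewrite /modular -ge0_integralZl//; last 3 first.
  - exact: measurable_modular.
  - by move=> x _; rewrite lee_fin powR_ge0.
  - by rewrite lee_fin powR_ge0.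
  apply: ge0_le_integral_nomeas => x _; first by rewrite lee_fin powR_ge0.
  rewrite -EFinM lee_fin powRM ?invr_ge0 ?(ltW l0)// mulrCA ler_peMr ?powR_ge0//.
  rewrite -[l^-1]powR_inv1 ?(ltW l0)// -powRrM mulN1r powRN.
  by rewrite ler_pdivlMr ?powR_gt0// mul1r ger_powR// l0.
have i0 : (\int[mu]_(x in A) `|(f x `^ r x)%:E| = 0)%E.
  apply/eqP; rewrite eq_le integral_ge0// andbT.
  apply/lee_addgt0Pr => e e0; rewrite add0e.
  have -> : (\int[mu]_(x in A) `|(f x `^ r x)%:E| = \int[mu]_(x in A) (f x `^ r x)%:E)%E.
    by apply: eq_integral => x _; rewrite gee0_abs// lee_fin powR_ge0.
  pose l := Num.min 1 (e `^ r0^-1).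
  have l0 : 0 < l by rewrite lt_min ltr01 powR_gt0.
  apply: le_trans (h1 l _) _; first by rewrite l0 ge_min lexx.
  rewrite lee_fin; apply: (@le_trans _ _ ((e `^ r0^-1) `^ r0)).
    by apply: le_powR; rewrite ?(ltW r00) ?(ltW l0)// ge_min lexx orbT.
  by rewrite -powRrM mulVf ?gt_eqF// powRr1// ltW.
have mfr : measurable_fun A (fun x => (f x `^ r x)%:E).
  by apply/measurable_EFinP; apply: measurable_funTS; exact: measurable_powR2.
have /(ae_eq_integral_abs mu mA mfr) ae0 := i0.
suff : mu A = 0%E by move=> A0; rewrite A0 ltxx in muA.
apply: measure_negligible => //; apply: negligibleS ae0 => x Ax /= /(_ Ax) [] /eqP.
by rewrite powR_eq0 => /andP[/eqP fx0 _]; have := fpos x Ax; rewrite fx0 ltxx.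
Qed.

End modular_norm.

Lemma le_powRN (R : realType) (a b e : R) : 0 <= e -> 0 < a -> a <= b -> b `^ (- e) <= a `^ (- e).
Proof.
move=> e0 a0 ab; have b0 := lt_le_trans a0 ab.
by rewrite !powRN lef_pV2 ?posrE ?powR_gt0//; apply: le_powR => //; exact: ltW.
Qed.

Section real_integral.
Context d (T : measurableType d) (R : realType) (mu : {measure set T -> \bar R}).

Lemma integralZl_real (D : set T) (c : R) (f : T -> R) : measurable D -> 0 <= c ->
  measurable_fun [set: T] f -> (forall x, 0 <= f x) ->
  (\int[mu]_(y in D) (c * f y)%:E = c%:E * \int[mu]_(y in D) (f y)%:E)%E.
Proof.
move=> mD c0 mf f0; under eq_integral do rewrite EFinM.
rewrite ge0_integralZl_EFin//; last by apply/measurable_EFinP; exact: measurable_funTS.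
by move=> y _; rewrite lee_fin.
Qed.

Lemma integral_setDE (D F : set T) (f : T -> R) : measurable D -> measurable F ->
  F `<=` D -> measurable_fun [set: T] f -> (forall x, 0 <= f x) ->
  (\int[mu]_(y in D) (f y)%:E =
   \int[mu]_(y in F) (f y)%:E + \int[mu]_(y in D `\` F) (f y)%:E)%E.
Proof.
move=> mD mF FD mf f0; have mG : measurable (D `\` F) by exact: measurableD.
rewrite -{1}(setDUK FD) ge0_integral_setU//.
- by apply/measurable_EFinP; exact: measurable_funTS.
- by move=> y _; rewrite lee_fin.
- by rewrite disj_set2E setDIK.
Qed.

End real_integral.

(** Arithmetic of [V_small]: the whole cube has mass at most [C * l] and the complement keeps at
    least [l * c / C], hence at least the fraction [c / (C * C)] of the whole. *)
Lemma small_part_le (R : realType) (C l c : R) (vQ vF vG mQ mG : \bar R) :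
  1 <= C -> 0 < l -> 0 < c -> (0 <= vF)%E -> (0 <= vG)%E -> (vQ = vF + vG)%E ->
  (vQ <= (C * l)%:E * mQ)%E -> (l%:E * mG <= C%:E * vG)%E -> (c%:E <= mG)%E ->
  (mQ <= 1)%E -> (vF <= (1 - c / (C * C))%:E * vQ)%E.
Proof.
move=> C1 l0 c0 F0 G0 QE hQ hG hc hm; have C0 : 0 < C by apply: lt_le_trans C1.
have CC0 : 0 < C * C by rewrite mulr_gt0.
have {}hQ : (vQ <= (C * l)%:E)%E.
  apply: le_trans hQ _; rewrite -[leRHS]mule1; apply: lee_wpmul2l hm.
  by rewrite lee_fin ltW// mulr_gt0.
have {}hG : ((l * c)%:E <= C%:E * vG)%E.
  apply: le_trans hG; rewrite EFinM; apply: lee_wpmul2l hc.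
  by rewrite lee_fin ltW.
have Qf : vQ \is a fin_num.
  rewrite ge0_fin_numE; last by rewrite QE adde_ge0.
  by apply: le_lt_trans hQ _; rewrite ltry.
have := Qf; rewrite QE fin_numD => /andP[Ff Gf].
move: hQ hG QE F0 G0; rewrite -(fineK Qf) -(fineK Ff) -(fineK Gf) -EFinM -EFinD -EFinM.
rewrite !lee_fin; move: (fine vQ) (fine vF) (fine vG) => Q F G hQ hG [QE] F0 G0.
have h1 : c / (C * C) * Q <= G.
  rewrite mulrAC ler_pdivrMr//; have := ler_wpM2l (ltW c0) hQ.
  have := ler_wpM2l (ltW C0) hG; nra.
by rewrite -QE mulrBl mul1r; lra.
Qed.

(** Arithmetic of [lam_poly] in logarithms: the norms on a cube ([lN]) and on the unit cube ([lN0])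
    are compared through the norm on a common large cube ([lT]) of side logarithm [lJ]. *)
Lemma poly_log_bound (R : realType) (l2 lN0 lN lT lC lk lJ P Lx mx : R) :
  0 <= l2 -> 0 <= lC -> 0 <= P -> 1 <= Lx -> 0 <= mx -> - lk <= mx -> lJ <= l2 + Lx ->
  lN0 + P * (lk - lJ) <= lC + lN -> lT + P * (0 - lJ) <= lC + lN0 -> lN <= lT ->
  `|l2 + lN| <= (l2 + `|lN0| + lC + P * l2 + P) * (Lx + mx).
Proof.
move=> l20 lC0 P0 Lx1 mx0 hk hJ lo up hT.
have a0 := ler_norm lN0; have a1 := ler_norm (- lN0); rewrite normrN in a1.
have an0 := normr_ge0 lN0; rewrite ler_norml; move: (`|lN0|) a0 a1 an0 => an a0 a1 an0.
have Mn : P * lJ <= P * (l2 + Lx) by rewrite ler_wpM2l.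
have Mk : - (P * mx) <= P * lk by rewrite -mulrN ler_wpM2l// lerNl.
have h1 : 0 <= P * l2 by apply: mulr_ge0.
have h2 : 0 <= P * mx by apply: mulr_ge0.
have h5 : 0 <= P * Lx by apply: mulr_ge0 => //; lra.
set c := l2 + an + lC + P * l2; have c0 : 0 <= c by rewrite /c !addr_ge0.
have h3 : c <= c * (Lx + mx) by rewrite ler_peMr//; lra.
have -> : (c + P) * (Lx + mx) = c * (Lx + mx) + P * Lx + P * mx by ring.
rewrite mulrDr in Mn; rewrite mulrBr in lo; rewrite mulrBr in up.
by apply/andP; split; rewrite /c in h3 *; lra.
Qed.

Lemma ln_powR_le (R : realType) (a b c u v e : R) : 0 < a -> 0 < b -> 0 < c -> 0 < u ->
  0 < v -> a * (u / v) `^ e <= b * c -> ln a + e * (ln u - ln v) <= ln b + ln c.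
Proof.
move=> a0 b0 c0 u0 v0 h.
have uv : 0 < (u / v) `^ e by rewrite powR_gt0// divr_gt0.
rewrite -ln_div ?posrE// -ln_powR -lnM ?posrE// -lnM ?posrE//.
by rewrite ler_ln ?posrE ?mulr_gt0.
Qed.

Lemma powR_lt1 (R : realType) (x e : R) : 0 <= x -> x < 1 -> 0 < e -> x `^ e < 1.
Proof.
move=> x0 x1 e0; rewrite -[ltRHS](_ : (1 : R) `^ e = 1); last by rewrite powR1.
by apply: gt0_ltr_powR; rewrite ?nnegrE.
Qed.

Section modular_scaling.
Context d (T : measurableType d) (R : realType) (mu : {measure set T -> \bar R}).
Variables (r f : T -> R).
Hypotheses (mr : measurable_fun [set: T] r) (mf : measurable_fun [set: T] f).
Hypotheses (f0 : forall x, 0 <= f x).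
Local Notation mod := (modular mu r f).

Lemma modular_scale (X : set T) (l K D : R) : measurable X -> 0 < l -> 0 < K -> 0 <= D ->
  (forall x, X x -> K `^ (- r x) <= D) -> (mod X (l * K) <= D%:E * mod X l)%E.
Proof.
move=> mX l0 K0 D0 h; rewrite /modular -ge0_integralZl_EFin//; last 2 first.
- by move=> x _; rewrite lee_fin powR_ge0.
- exact: measurable_modular.
apply: ge0_le_integral_nomeas => x Xx; first by rewrite lee_fin powR_ge0.
rewrite -EFinM lee_fin.
have -> : f x / (l * K) = (f x / l) * K^-1 by rewrite invfM mulrA.
rewrite powRM ?invr_ge0 ?divr_ge0 ?(ltW l0) ?(ltW K0)// mulrC.
apply: ler_wpM2r; first exact: powR_ge0.
rewrite -[K^-1]powR_inv1 ?(ltW K0)// -powRrM mulN1r; exact: h.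
Qed.

Lemma modular_setD (X Y : set T) (l : R) : measurable X -> measurable Y -> Y `<=` X ->
  mod X l = (mod Y l + mod (X `\` Y) l)%E.
Proof.
move=> mX mY YX; have XE : X = Y `|` (X `\` Y) by rewrite setDUK.
rewrite {1}XE /modular ge0_integral_setU//; first exact: measurableD.
- exact: measurable_modular.
- by move=> x _; rewrite lee_fin powR_ge0.
- by rewrite disj_set2E setDIK.
Qed.

End modular_scaling.

Lemma measurable_dist d (T : measurableType d) (R : realType) (b : T -> R) (a : R) :
  measurable_fun [set: T] b -> measurable_fun [set: T] (fun y => `|b y - a|).
Proof. by move=> mb; apply: measurableT_comp => //; exact: measurable_funB. Qed.

Lemma measurable_expR_dist d (T : measurableType d) (R : realType) (b : T -> R) (a e : R) :
  measurable_fun [set: T] b -> measurable_fun [set: T] (fun y => expR (e * `|b y - a|)).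
Proof.
by move=> mb; apply: measurableT_comp => //; apply: measurable_funM => //; exact: measurable_dist.
Qed.

Lemma integral_sub d (T : measurableType d) (R : realType) (mu : {measure set T -> \bar R})
    (X Y : set T) (f : T -> R) : measurable X -> measurable Y -> X `<=` Y ->
  measurable_fun [set: T] f -> (forall z : T, 0 <= f z) ->
  (\int[mu]_(z in X) (f z)%:E <= \int[mu]_(z in Y) (f z)%:E)%E.
Proof.
move=> mA mB AB mf f0; apply: ge0_subset_integral => //.
  by apply/measurable_EFinP; exact: measurable_funTS.
by move=> z _; rewrite lee_fin.
Qed.

Lemma integral_sumR d (T : measurableType d) (R : realType) (mu : {measure set T -> \bar R})
    (X : set T) (I : Type) (r : seq I) (f : I -> T -> R) : measurable X ->
  (forall i, measurable_fun [set: T] (f i)) -> (forall i (z : T), 0 <= f i z) ->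
  (\int[mu]_(z in X) (\sum_(i <- r) f i z)%:E = \sum_(i <- r) \int[mu]_(z in X) (f i z)%:E)%E.
Proof.
move=> mX mf f0; rewrite -ge0_integral_sum//.
- by apply: eq_integral => z _; rewrite sumEFin.
- by move=> i; apply/measurable_EFinP; exact: measurable_funTS.
- by move=> i z _; rewrite lee_fin.
Qed.

Lemma integralDR d (T : measurableType d) (R : realType) (mu : {measure set T -> \bar R})
    (X : set T) (f g : T -> R) : measurable X ->
  measurable_fun [set: T] f -> measurable_fun [set: T] g ->
  (forall z : T, 0 <= f z) -> (forall z : T, 0 <= g z) ->
  (\int[mu]_(z in X) (f z + g z)%:E =
   \int[mu]_(z in X) (f z)%:E + \int[mu]_(z in X) (g z)%:E)%E.
Proof.
move=> mX mf mg f0 g0; under eq_integral do rewrite EFinD.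
rewrite ge0_integralD//.
- by move=> z _; rewrite lee_fin.
- by apply/measurable_EFinP; exact: measurable_funTS.
- by move=> z _; rewrite lee_fin.
- by apply/measurable_EFinP; exact: measurable_funTS.
Qed.

Lemma measurable_absB d (T : measurableType d) (R : realType) (f g : T -> R) :
  measurable_fun [set: T] f -> measurable_fun [set: T] g ->
  measurable_fun [set: T] (fun z => `|f z - g z|).
Proof. by move=> mf mg; apply: measurableT_comp => //; exact: measurable_funB. Qed.

Lemma powRD_gt0 (R : realType) (x a b : R) : 0 < x -> x `^ (a + b) = x `^ a * x `^ b.
Proof. by move=> x0; rewrite powRD// (gt_eqF x0) implybT. Qed.

Lemma prod_powR (R : realType) (I : Type) (s : seq I) (S : R) (th : I -> R) : 0 < S ->
  \prod_(i <- s) S `^ th i = S `^ (\sum_(i <- s) th i).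
Proof.
move=> S0; elim: s => [|i s IH]; first by rewrite !big_nil powRr0.
by rewrite !big_cons IH powRD_gt0.
Qed.

Lemma powR_prod (R : realType) (I : Type) (s : seq I) (f : I -> R) (e : R) :
  (forall i, 0 <= f i) -> (\prod_(i <- s) f i) `^ e = \prod_(i <- s) f i `^ e.
Proof.
move=> f0; elim: s => [|i s IH]; first by rewrite !big_nil powR1.
by rewrite !big_cons powRM ?IH//; apply: prodr_ge0.
Qed.

(** Each base is at most the total [S], and the exponents add up to 1. *)
Lemma young_prod (R : realType) m (X0 t0 : R) (X th : 'I_m -> R) :
  0 < X0 -> (forall i, 0 <= X i) -> 0 <= t0 -> (forall i, 0 <= th i) ->
  t0 + \sum_(i < m) th i = 1 ->
  X0 `^ t0 * \prod_(i < m) X i `^ th i <= X0 + \sum_(i < m) X i.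
Proof.
move=> X00 X1 t00 th0 th1; set S := X0 + _.
have SX : 0 <= \sum_(i < m) X i by apply: sumr_ge0.
have S0 : 0 < S by rewrite ltr_wpDr.
have <- : S `^ t0 * \prod_(i < m) S `^ th i = S.
  by rewrite prod_powR// -powRD_gt0// th1 powRr1// ltW.
apply: ler_pM; rewrite ?powR_ge0 ?prodr_ge0//; first by move=> i _; exact: powR_ge0.
  by apply: le_powR; rewrite ?(ltW X00)// /S lerDl.
apply: ler_prod => i _; rewrite powR_ge0/=; apply: le_powR => //.
rewrite /S (bigD1 i)//= addrCA lerDl addr_ge0 ?(ltW X00)//.
exact: sumr_ge0.
Qed.

Lemma young3 (R : realType) (X Y Z a b c : R) : 0 <= X -> 0 <= Y -> 0 <= Z ->
  0 < a -> 0 < b -> 0 < c -> a + b + c = 1 -> X `^ a * Y `^ b * Z `^ c <= X + Y + Z.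
Proof.
move=> X0 Y0 Z0 a0 b0 c0 abc.
have [S0|S0] := leP (X + Y + Z) 0.
  have -> : X = 0 by lra.
  rewrite powR0 ?gt_eqF// !mul0r; lra.
have {1}<- : (X + Y + Z) `^ a * (X + Y + Z) `^ b * (X + Y + Z) `^ c = X + Y + Z.
  by rewrite -!powRD_gt0// abc powRr1// ltW.
apply: ler_pM; rewrite ?mulr_ge0 ?powR_ge0//; last by apply: le_powR; lra.
by apply: ler_pM; rewrite ?powR_ge0//; apply: le_powR; lra.
Qed.

Section holder.
Context d (T : measurableType d) (R : realType) (mu : {measure set T -> \bar R}).

(** Each function is divided by its scale, [young3] is applied at every point with the exponents of
    that point, and the three modulars are added. *)
Lemma holder3 (D : set T) (B g w : T -> R) (b0 k0 s0 : R) (ta a s : T -> R)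
    (CB Cg Cw : R) : measurable D ->
  measurable_fun [set: T] B -> measurable_fun [set: T] g -> measurable_fun [set: T] w ->
  measurable_fun [set: T] ta -> measurable_fun [set: T] a -> measurable_fun [set: T] s ->
  (forall x, 0 <= B x) -> (forall x, 0 <= g x) -> (forall x, 0 <= w x) ->
  0 < b0 -> 0 < k0 -> 0 < s0 ->
  (forall x, D x -> [/\ 0 < ta x, 0 < a x, 0 < s x &
     (ta x)^-1 + (a x)^-1 + (s x)^-1 = 1]) ->
  (modular mu ta B D b0 <= CB%:E)%E -> (modular mu a g D k0 <= Cg%:E)%E ->
  (modular mu s w D s0 <= Cw%:E)%E ->
  (\int[mu]_(x in D) (B x * g x * w x)%:E <= (b0 * k0 * s0 * (CB + Cg + Cw))%:E)%E.
Proof.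
move=> mD mB mg mw mta ma ms B0 g0 w0 b00 k00 s00 hexp hB hg hw.
apply: (@le_trans _ _ ((b0 * k0 * s0)%:E * (modular mu ta B D b0 + modular mu a g D k0
    + modular mu s w D s0))%E); last first.
  rewrite [X in (_ <= X)%E]EFinM lee_pmul2l ?lte_fin ?mulr_gt0//.
  by rewrite !EFinD !leeD.
have h0 (r f : T -> R) l x : (0 <= ((f x / l) `^ r x)%:E)%E by rewrite lee_fin powR_ge0.
have mm (r f : T -> R) := @measurable_modular _ _ _ r f.
pose f1 x := ((B x / b0) `^ ta x)%:E; pose f2 x := ((g x / k0) `^ a x)%:E.
pose f3 x := ((w x / s0) `^ s x)%:E.
have m1 : measurable_fun D f1 by exact: mm.
have m2 : measurable_fun D f2 by exact: mm.
have m3 : measurable_fun D f3 by exact: mm.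
have m12 : measurable_fun D (fun x => f1 x + f2 x)%E by exact: emeasurable_funD.
have -> : (modular mu ta B D b0 + modular mu a g D k0 + modular mu s w D s0 =
    \int[mu]_(x in D) (f1 x + f2 x + f3 x))%E.
  rewrite ge0_integralD//; [|by move=> x _; rewrite adde_ge0// h0|by move=> x _; exact: h0].
  by rewrite ge0_integralD// => x _; exact: h0.
rewrite -ge0_integralZl//; last 3 first.
- exact: emeasurable_funD.
- by move=> x _; rewrite !adde_ge0// h0.
- by rewrite lee_fin !mulr_ge0// ltW.
apply: ge0_le_integral_nomeas => x Dx; first by rewrite lee_fin !mulr_ge0.
have [ta0 a0 sx0 e1] := hexp x Dx.
rewrite -!EFinD -EFinM lee_fin.
have h := @young3 R ((B x / b0) `^ ta x) ((g x / k0) `^ a x) ((w x / s0) `^ s x)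
  (ta x)^-1 (a x)^-1 (s x)^-1.
have {h} := h (powR_ge0 _ _) (powR_ge0 _ _) (powR_ge0 _ _).
rewrite !invr_gt0 => /(_ ta0 a0 sx0 e1).
rewrite -!powRrM !mulfV ?gt_eqF// !powRr1 ?divr_ge0 ?B0 ?g0 ?w0 ?(ltW b00) ?(ltW k00) ?(ltW s00)//.
move=> h; have -> : B x * g x * w x =
    b0 * k0 * s0 * (B x / b0 * (g x / k0) * (w x / s0)).
  by field; rewrite !gt_eqF.
by rewrite ler_pM2l ?mulr_gt0.
Qed.

(** Hoelder's inequality for the constant 1, written as [om] times the product of the [v i], with
    the exponents [q x * M] and [s i x * M]. Bounding the measure of a set by norms of the weights
    on it is the source of the A_infinity property. *)
Lemma holder_weights m (D : set T) (om q : T -> R) (v s : 'I_m -> T -> R) (M lam : R)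
    (sig : 'I_m -> R) : measurable D ->
  measurable_fun [set: T] om -> measurable_fun [set: T] q ->
  (forall i, measurable_fun [set: T] (v i)) -> (forall i, measurable_fun [set: T] (s i)) ->
  (forall x, 0 < om x) -> (forall i x, 0 < v i x) -> (forall x, 0 < q x) ->
  (forall i x, 0 < s i x) -> 0 < M -> 0 < lam -> (forall i, 0 < sig i) ->
  (forall x, om x * \prod_(i < m) v i x = 1) ->
  (forall x, (q x)^-1 + \sum_(i < m) (s i x)^-1 = M) ->
  (modular mu q om D lam <= 1)%E -> (forall i, modular mu (s i) (v i) D (sig i) <= 1)%E ->
  (mu D <= (m.+1%:R * (lam * \prod_(i < m) sig i) `^ M^-1)%:E)%E.
Proof.
move=> mD mom mq mv ms om0 v0 q0 s0 M0 lam0 sig0 prod1 expM hom hv.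
set c := (lam * \prod_(i < m) sig i) `^ M^-1.
have P0 : 0 < lam * \prod_(i < m) sig i by rewrite mulr_gt0// prodr_gt0.
have c0 : 0 < c by rewrite powR_gt0.
have mm (r f : T -> R) := @measurable_modular _ _ _ r f.
apply: (@le_trans _ _ (c%:E * (modular mu q om D lam +
    \sum_(i < m) modular mu (s i) (v i) D (sig i)))%E); last first.
  rewrite mulrC EFinM lee_pmul2l ?lte_fin// -add1n natrD EFinD leeD//.
  rewrite -[m in leRHS]card_ord -sumr_const -sumEFin.
  by apply: lee_sum => i _; exact: hv.
rewrite /modular -ge0_integral_sum//; last 2 first.
- by move=> i; exact: mm.
- by move=> i x _; rewrite lee_fin powR_ge0.
have msum : measurable_fun D (fun x => \sum_(i < m) ((v i x / sig i) `^ s i x)%:E)%E.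
  by apply: emeasurable_sum => i; exact: mm.
rewrite -ge0_integralD//; last 3 first.
- by move=> x _; rewrite lee_fin powR_ge0.
- exact: mm.
- by move=> x _; apply: sume_ge0 => i _; rewrite lee_fin powR_ge0.
rewrite -ge0_integralZl//; last 3 first.
- by apply: emeasurable_funD => //; exact: mm.
- move=> x _; apply: adde_ge0; rewrite ?lee_fin ?powR_ge0//.
  by apply: sume_ge0 => i _; rewrite lee_fin powR_ge0.
- by rewrite lee_fin ltW.
have -> : (mu D = \int[mu]_(x in D) 1%:E)%E.
  by rewrite (integral_cst mu mD 1%:E) mul1e.
apply: ge0_le_integral_nomeas => x Dx //.
rewrite sumEFin -EFinD -EFinM lee_fin.
have h := @young_prod R m ((om x / lam) `^ q x) (q x * M)^-1
  (fun i => (v i x / sig i) `^ s i x) (fun i => (s i x * M)^-1).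
have ol : 0 < om x / lam by rewrite divr_gt0.
have e1 : (q x * M)^-1 + \sum_(i < m) (s i x * M)^-1 = 1.
  under eq_bigr do rewrite invfM.
  by rewrite invfM -mulr_suml -mulrDl expM divff// gt_eqF.
have t0 : 0 <= (q x * M)^-1 by rewrite invr_ge0 mulr_ge0// ltW.
have t1 i : 0 <= (s i x * M)^-1 by rewrite invr_ge0 mulr_ge0// ltW.
have {h} := h (powR_gt0 _ ol) (fun i => powR_ge0 _ _) t0 t1 e1.
rewrite -powRrM invfM mulrA divff ?gt_eqF// mul1r.
rewrite (eq_bigr (fun i => (v i x / sig i) `^ M^-1)); last first.
  by move=> i _; rewrite -powRrM invfM mulrA divff ?gt_eqF// mul1r.
rewrite -powR_prod; last by move=> i; rewrite divr_ge0// ltW.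
rewrite -powRM ?(ltW ol)//; last by apply: prodr_ge0 => i _; rewrite divr_ge0// ltW.
rewrite prodf_div mulf_div prod1 div1r.
have -> : (lam * \prod_(i < m) sig i)^-1 `^ M^-1 = c^-1.
  by rewrite /c -powR_inv1 ?(ltW P0)// powRAC powR_inv1 ?powR_ge0.
move=> h; rewrite -(ler_pM2l (_ : 0 < c^-1)) ?invr_gt0// mulKf ?gt_eqF// mulr1.
exact: h.
Qed.

End holder.

(** * Integrals over neighbouring cubes *)

Section neighbour_integral.
Context (R : realType) (n : nat).
Local Notation E := (Rn R n).
Local Notation mu := (@leb R n).

Lemma measurable_neighbours k : measurable [set z : E * E | @tcube R n k z.1 z.2].
Proof.
have -> : [set z : E * E | @tcube R n k z.1 z.2] =
    \bigcup_(v in [set: {ffun 'I_n -> int}]) ((@didx R n k @^-1` [set v]) `*`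
      [set y : E | forall i, `|didx k y i - v i| <= 1]).
  apply/seteqP; split => [[x y] /= h|[x y] [v _ [/= <- h]]] //.
  by exists (didx k x).
apply: countable_bigcupT_measurable; first exact: countableP.
move=> v; apply: measurableX; first exact: didx_measurable.
apply: (measurable_saturated (@didx_measurable R n) (k := k)) => x y xy h i.
by rewrite -xy; exact: h.
Qed.

(** Being neighbours is symmetric, so after exchanging the integrals the inner one is the measure of
    a triple cube. *)
Lemma integral_neighbours k (f : E -> R) : measurable_fun [set: E] f -> (forall x, 0 <= f x) ->
  (\int[mu]_x (\int[mu]_(y in tcube k x) (f y)%:E) =
   (3 ^+ n * dvol R n k)%:E * \int[mu]_y (f y)%:E)%E.
Proof.
move=> mf f0; have mt := measurable_neighbours k.
pose h (z : E * E) : \bar R := (f z.2 * \1_[set z : E * E | @tcube R n k z.1 z.2] z)%:E.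
have mh : measurable_fun [set: E * E] h.
  apply/measurable_EFinP; apply: measurable_funM.
    exact: measurableT_comp mf (@measurable_snd _ _ _ _).
  exact: measurable_indic.
have h0 z : (0 <= h z)%E.
  by rewrite lee_fin mulr_ge0// indicE; case: (_ \in _).
have -> : (\int[mu]_x (\int[mu]_(y in tcube k x) (f y)%:E) =
    \int[mu]_x \int[mu]_y h (x, y))%E.
  apply: eq_integral => x _; rewrite integral_mkcond; apply: eq_integral => y _.
  rewrite /h /= patchE indicE; case: ifPn => hy.
    by rewrite mem_set ?mulr1//; exact: set_mem hy.
  by rewrite memNset ?mulr0//= => h'; move: hy; rewrite mem_set.
rewrite (@fubini_tonelli _ _ E E R mu mu h mh h0).
have c0 : 0 <= 3 ^+ n * dvol R n k.
  exact: (mulr_ge0 (exprn_ge0 n (ler0n R 3)) (ltW (dvol_gt0 R n k))).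
rewrite -(integralZl_real mu measurableT c0 mf f0).
apply: eq_integral => y _; rewrite /h /=.
rewrite (eq_integral (fun x => (f y * \1_(tcube k y) x)%:E)); last first.
  move=> x _; congr (_ * _)%:E; rewrite !indicE; congr (_%:R); congr nat_of_bool.
  by apply/idP/idP => /set_mem /= hx; apply/mem_set => /=; exact: tcube_sym.
rewrite (integralZl_real mu measurableT (f0 y)); last 2 first.
- exact: measurable_indic (measurable_tcube _ _).
- by move=> x; rewrite indicE; case: (_ \in _).
rewrite integral_indic ?setIT//; last exact: measurable_tcube.
rewrite [X in (_ * X)%E](_ : _ = (3 ^+ n * dvol R n k)%:E); last exact: leb_tcube.
by rewrite -EFinM mulrC.
Qed.

End neighbour_integral.

(** * Sums along geometrically decaying sequences *)

Section geometric_sequences.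
Variable R : realType.
Implicit Types (rho A th : R) (x u : nat -> R).

Lemma powR_invN (a e : R) : 0 < a -> a^-1 `^ (- e) = a `^ e.
Proof. by move=> a0; rewrite -[a^-1]powR_inv1 ?(ltW a0)// -powRrM mulrNN mul1r. Qed.

Lemma sum_geometric_le rho N : 0 < rho -> rho < 1 ->
  \sum_(j < N) rho ^+ j <= (1 - rho)^-1.
Proof.
move=> r0 r1; have r10 : 0 < 1 - rho by rewrite subr_gt0.
rewrite -[leRHS]mul1r ler_pdivlMr// mulrC -opprB mulNr -subrX1 opprB.
by rewrite lerBlDr lerDl exprn_ge0// ltW.
Qed.

(** From the first index with [x j <= 1] on, the sequence lies below a geometric one. *)
Lemma sum_small_le rho A N x : 0 < rho -> rho < 1 -> 0 <= A -> (forall j, 0 < x j) ->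
  (forall j i, x (j + i)%N <= A * rho ^+ i * x j) ->
  \sum_(j < N) (if x j <= 1 then x j else 0) <= A / (1 - rho).
Proof.
move=> r0 r1 A0; elim: N x => [|N IH] x x0 hx.
  by rewrite big_ord0 divr_ge0// subr_ge0 ltW.
case: (leP (x 0%N) 1) => h; last first.
  rewrite big_ord_recl /= ifN -?ltNge// add0r.
  apply: (IH (x \o S)) => [j|j i] /=; [exact: x0|by rewrite -addSn hx].
apply: (@le_trans _ _ (\sum_(j < N.+1) A * rho ^+ j)).
  apply: ler_sum => j _; have := hx 0%N j; rewrite add0n => hj.
  apply: (@le_trans _ _ (A * rho ^+ j * x 0%N)).
    by case: ifP => // _; apply: le_trans hj; exact/ltW.
  by rewrite ler_piMr// mulr_ge0// exprn_ge0// ltW.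
by rewrite -mulr_sumr ler_wpM2l// sum_geometric_le.
Qed.

(** Seen backwards from the last index with [x j > 1], the sequence grows geometrically, so its
    negative powers are summable. *)
Lemma sum_large_le rho A th0 th1 th N x : 0 < rho -> rho < 1 -> 1 <= A -> 0 < th0 ->
  th0 <= th -> th <= th1 -> (forall j, 0 < x j) ->
  (forall j i, x (j + i)%N <= A * rho ^+ i * x j) ->
  \sum_(j < N) (if x j <= 1 then 0 else x j `^ (- th)) <= A `^ th1 / (1 - rho `^ th0).
Proof.
move=> r0 r1 A1 t0 t0t tt1 x0 hx; have A0 : 0 < A by apply: lt_le_trans A1.
have rt1 : rho `^ th0 < 1 by apply: powR_lt1 => //; exact: ltW.
have rt0 : 0 < rho `^ th0 by rewrite powR_gt0.
have th_0 : 0 < th by apply: lt_le_trans t0t.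
elim: N => [|N IH]; first by rewrite big_ord0 divr_ge0 ?powR_ge0// subr_ge0 ltW.
case: (leP (x N) 1) => h; first by rewrite big_ord_recr /= h addr0.
apply: (@le_trans _ _ (\sum_(j < N.+1) A `^ th1 * (rho `^ th0) ^+ (N - j))).
  apply: ler_sum => j _; case: ifP => _.
    by rewrite mulr_ge0 ?powR_ge0// exprn_ge0// ltW.
  have jN : (j <= N)%N by rewrite -ltnS.
  have := hx j (N - j)%N; rewrite subnKC// => hj.
  have c0 : 0 < A * rho ^+ (N - j) by rewrite mulr_gt0// exprn_gt0.
  apply: (@le_trans _ _ ((A * rho ^+ (N - j)) `^ th)).
    rewrite powRN -powR_inv1 ?powR_ge0// -powRrM mulrN1 powRN.
    rewrite -[leRHS]invrK lef_pV2 ?posrE ?invr_gt0 ?powR_gt0//.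
    rewrite -powR_inv1 ?powR_ge0// -powRrM mulrN1.
    have -> : (A * rho ^+ (N - j)) `^ (- th) = ((A * rho ^+ (N - j))^-1) `^ th.
      by rewrite -[(_ * _)^-1]powR_inv1 ?(ltW c0)// -powRrM mulN1r.
    apply: le_powR; [exact: ltW|by rewrite invr_ge0 ltW|].
    by rewrite -[leLHS]mulr1 mulrC ler_pdivrMr// mulrC; apply: le_trans hj; exact: ltW.
  rewrite powRM ?(ltW A0) ?exprn_ge0 ?(ltW r0)//; apply: ler_pM; rewrite ?powR_ge0//.
    by apply: ler_powR.
  rewrite -(powR_mulrn _ (ltW r0)) -(powR_mulrn _ (ltW rt0)) -!powRrM.
  by rewrite ger_powR ?r0 ?(ltW r1)// mulrC ler_wpM2l.
rewrite -mulr_sumr ler_wpM2l ?powR_ge0//.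
rewrite (reindex_inj rev_ord_inj)/=; apply: le_trans (sum_geometric_le N.+1 rt0 rt1).
apply: ler_sum => j _; rewrite subSS subKn// -ltnS//.
Qed.

Lemma sum_min_le rho A th0 th1 : 0 < rho -> rho < 1 -> 1 <= A -> 0 < th0 ->
  exists2 C : R, 0 < C & forall N x th, th0 <= th -> th <= th1 -> (forall j, 0 < x j) ->
    (forall j i, x (j + i)%N <= A * rho ^+ i * x j) ->
    \sum_(j < N) Num.min (x j) (x j `^ (- th)) <= C.
Proof.
move=> r0 r1 A1 t0; have A0 : 0 < A by apply: lt_le_trans A1.
have rt1 : rho `^ th0 < 1 by apply: powR_lt1 => //; exact: ltW.
exists (A / (1 - rho) + A `^ th1 / (1 - rho `^ th0)).
  by rewrite addr_gt0// divr_gt0 ?powR_gt0// subr_gt0.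
move=> N x th h0 h1 x0 hx.
apply: le_trans (lerD (sum_small_le N r0 r1 (ltW A0) x0 hx)
  (sum_large_le N r0 r1 A1 t0 h0 h1 x0 hx)).
rewrite -big_split /=; apply: ler_sum => j _.
by case: ifP => _; rewrite ?addr0 ?add0r ge_min lexx ?orbT.
Qed.

(** Let tau be the q-th root of the sum on the right and x = u j / tau. From [mm j <= 1] and u_j^q
    m_j <= tau^q, each term on the left is at most tau min (x, x^(1 - q / p)). Since q / p > 1,
    these minima decay geometrically away from x = 1, and [sum_min_le] bounds their sum
    uniformly. *)
Lemma sum_power_le rho A q0 q1 e0 e1 : 0 < rho -> rho < 1 -> 1 <= A ->
  0 < q0 -> 0 < e0 -> exists2 C : R, 0 < C & forall N u (mm : nat -> R) (q p : R),
    q0 <= q -> q <= q1 -> 0 < p -> e0 <= q / p - 1 -> q / p - 1 <= e1 ->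
    (forall j, 0 < u j) ->
    (forall j i, u (j + i)%N <= A * rho ^+ i * u j) ->
    (forall j, 0 < mm j <= 1) ->
    (\sum_(j < N) u j * mm j `^ p^-1) `^ q <= C * \sum_(j < N) u j `^ q * mm j.
Proof.
move=> r0 r1 A1 q00 e00.
have [D D0 hD] := sum_min_le e1 r0 r1 A1 e00.
pose B := Num.max 1 D; have B1 : 1 <= B by rewrite le_max lexx.
exists (B `^ q1); first by rewrite powR_gt0//; exact: lt_le_trans B1.
move=> N u mm q p q0q qq1 p_0 he0 he1 u0 hu hm.
have q_0 : 0 < q by apply: lt_le_trans q0q.
case: N => [|N]; first by rewrite !big_ord0 powR0 ?mulr0// gt_eqF.
set T := \sum_(j < N.+1) u j `^ q * mm j.
have t0 j : 0 < u j `^ q * mm j by rewrite mulr_gt0 ?powR_gt0//; have /andP[] := hm j.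
have T0 : 0 < T.
  rewrite /T big_ord_recl; apply: ltr_pwDl; first exact: t0.
  by apply: sumr_ge0 => j _; exact: ltW.
have hT (j : 'I_N.+1) : u j `^ q * mm j <= T.
  rewrite /T (bigD1 j)//= lerDl; apply: sumr_ge0 => i _; exact: ltW.
pose tau := T `^ q^-1; have tau0 : 0 < tau by rewrite powR_gt0.
pose th := q / p - 1.
have hle (j : 'I_N.+1) : u j * mm j `^ p^-1 <=
    tau * Num.min (u j / tau) ((u j / tau) `^ (- th)).
  have /andP[m0 mC] := hm j; have ut0 : 0 < u j / tau by rewrite divr_gt0.
  rewrite minr_pMr ?(ltW tau0)//.
  rewrite le_min; apply/andP; split.
    have -> : tau * (u j / tau) = u j by rewrite mulrC divfK ?gt_eqF.
    rewrite ler_piMr ?(ltW (u0 j))// -[leRHS](_ : (1 : R) `^ p^-1 = 1); last by rewrite powR1.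
    by apply: le_powR mC; [rewrite invr_ge0 ltW|exact: ltW].
  apply: (@le_trans _ _ (u j * (T * u j `^ (- q)) `^ p^-1)).
    apply: ler_wpM2l; first exact: ltW.
    apply: le_powR; [by rewrite invr_ge0 ltW|exact: ltW|].
    by rewrite powRN ler_pdivlMr ?powR_gt0// mulrC hT.
  rewrite powRM ?powR_ge0 ?(ltW T0)// -powRrM.
  have -> : u j * (T `^ p^-1 * u j `^ (- q * p^-1)) = T `^ p^-1 * u j `^ (- th).
    rewrite mulrCA; congr (_ * _); rewrite -{1}[u j]powRr1 ?(ltW (u0 j))//.
    by rewrite -powRD_gt0//; congr powR; rewrite /th mulNr; ring.
  rewrite powRM ?invr_ge0 ?(ltW (u0 j)) ?(ltW tau0)//.
  rewrite (powR_invN th tau0).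
  have tE : tau * tau `^ th = T `^ p^-1.
    rewrite -{1}[tau]powRr1 ?(ltW tau0)// -powRD_gt0// /tau -powRrM; congr powR.
    by rewrite /th; field; rewrite !gt_eqF.
  have -> : tau * (u j `^ (- th) * tau `^ th) = T `^ p^-1 * u j `^ (- th).
    by rewrite -tE; ring.
  exact: lexx.
have hS : \sum_(j < N.+1) u j * mm j `^ p^-1 <= tau * B.
  apply: (le_trans (ler_sum _ (fun j _ => hle j))).
  rewrite -mulr_sumr ler_wpM2l ?(ltW tau0)//.
  apply: (@le_trans _ _ D); last by rewrite le_max lexx orbT.
  apply: (hD N.+1 (fun j => u j / tau)) => //.
    by move=> j; rewrite divr_gt0.
  by move=> j i; rewrite mulrA ler_pM2r ?invr_gt0.
apply: (@le_trans _ _ ((tau * B) `^ q)).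
  apply: le_powR; [exact: ltW| |exact: hS].
  by apply: sumr_ge0 => j _; rewrite mulr_ge0 ?powR_ge0// ltW.
have B0 : 0 <= B by apply: le_trans B1.
rewrite powRM ?(ltW tau0)// /tau -powRrM mulVf ?gt_eqF// powRr1 ?(ltW T0)// mulrC.
by apply: ler_wpM2r; [exact: ltW|exact: ler_powR].
Qed.

End geometric_sequences.

(** From 1 / P + de = 1 / a follows a = P - P a de: lowering the exponent leaves the modular density
    G^P times a power of it, which v completes to a power of v G^P. *)
Lemma powR_gain (R : realType) (G P a de v rho e : R) : 0 <= G -> 0 < P -> 0 < a ->
  P^-1 + de = a^-1 -> 0 < v -> 0 < rho ->
  (G / (v `^ de * rho `^ e^-1)) `^ a =
  G `^ P * (v * G `^ P) `^ (- (a * de)) * rho^-1 `^ (a / e).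
Proof.
move=> G0 P0 a0 hP v0 r0.
have [->|Gn0] := eqVneq G 0; first by rewrite mul0r !powR0 ?mul0r ?gt_eqF.
have {}G0 : 0 < G by rewrite lt_neqAle eq_sym Gn0.
have Z0 : 0 < G `^ P by rewrite powR_gt0.
have V0 : 0 < v `^ de by rewrite powR_gt0.
have E0 : 0 < rho `^ e^-1 by rewrite powR_gt0.
have iV (u : R) : 0 < u -> u^-1 `^ a = u `^ (- a).
  by move=> u0; rewrite -[u^-1]powR_inv1 ?(ltW u0)// -powRrM mulN1r.
have pG : G `^ a = G `^ P * (G `^ P) `^ (- (a * de)).
  rewrite -powRrM -powRD_gt0//; congr powR.
  have -> : de = a^-1 - P^-1 by rewrite -hP addrAC subrr add0r.
  by field; rewrite !gt_eqF.
rewrite powRM ?invr_ge0 ?(ltW G0) ?mulr_ge0 ?powR_ge0// iV ?mulr_gt0//.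
rewrite powRM ?powR_ge0// -!powRrM pG powRM ?(ltW v0) ?powR_ge0//.
have -> : rho^-1 `^ (a / e) = rho `^ (e^-1 * - a).
  by rewrite -[rho^-1]powR_inv1 ?(ltW r0)// -powRrM; congr powR; ring.
have -> : v `^ (de * - a) = v `^ (- (a * de)) by congr powR; ring.
ring.
Qed.

(** * Variable exponents on a cube *)

Section cube_holder.
Context d (T : measurableType d) (R : realType) (mu : {measure set T -> \bar R}).
Variables (D : set T) (B g w p s : T -> R) (v t de tau : R).
Hypotheses (mD : measurable D) (mB : measurable_fun [set: T] B)
  (mg : measurable_fun [set: T] g) (mw : measurable_fun [set: T] w)
  (mp : measurable_fun [set: T] p) (ms : measurable_fun [set: T] s)
  (B0 : forall x, 0 <= B x) (g0 : forall x, 0 <= g x) (w0 : forall x, 0 <= w x)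
  (p0 : forall x, 0 < p x) (s0 : forall x, 0 < s x)
  (ps : forall x, (p x)^-1 + (s x)^-1 = t^-1)
  (v0 : 0 < v) (tau0 : 0 < tau) (de1 : de < 1 - t^-1)
  (a0 : forall x, 0 < (p x)^-1 + de).

(** The exponent with reciprocal shifted by [de]; [de] is also taken negative, which raises the
    exponent. *)
Definition aexp x := ((p x)^-1 + de)^-1.

Lemma measurable_invr (f : T -> R) : (forall x, 0 < f x) ->
  measurable_fun [set: T] f -> measurable_fun [set: T] (fun x => (f x)^-1).
Proof.
move=> f0 mf; have -> : (fun x => (f x)^-1) = (fun x => f x `^ (- 1)).
  by apply/funext => y; rewrite powR_inv1// ltW.
apply: measurable_powR2 => //.
Qed.

Lemma measurable_aexp : measurable_fun [set: T] aexp.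
Proof.
apply: measurable_invr => //; apply: measurable_funD => //; exact: measurable_invr.
Qed.

Lemma aexp_gt0 x : 0 < aexp x. Proof. by rewrite invr_gt0. Qed.

(** By [ps] the reciprocals [1 - t^-1 - de], [(p x)^-1 + de] and [(s x)^-1] add up to 1; the first
    is the room left for the oscillation [B]. *)
Lemma cube_holder (k0 CB Cg : R) : 0 < k0 ->
  (\int[mu]_(x in D) (B x `^ (1 - t^-1 - de)^-1)%:E <= (CB * v)%:E)%E ->
  (modular mu aexp g D k0 <= Cg%:E)%E -> (modular mu s w D tau <= 1)%E ->
  (\int[mu]_(x in D) (B x * g x * w x)%:E <=
    (v `^ (1 - t^-1 - de) * k0 * tau * (CB + Cg + 1))%:E)%E.
Proof.
move=> k00 hB hg hw; pose r := 1 - t^-1 - de.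
have r0 : 0 < r by rewrite /r; move: de1 => ?; lra.
have b00 : 0 < v `^ r by rewrite powR_gt0.
have mc : measurable_fun [set: T] (fun _ : T => r^-1) by exact: measurable_cst.
apply: (holder3 mD mB mg mw mc measurable_aexp ms B0 g0 w0 b00 k00 tau0 _ _ hg hw).
  move=> x _; split; rewrite ?invr_gt0 ?aexp_gt0 ?s0//.
  by rewrite /aexp !invrK /r -(ps x); ring.
have v10 : 0 <= v^-1 by rewrite invr_ge0 ltW.
rewrite /modular; have -> : CB%:E = (v^-1%:E * (CB * v)%:E)%E.
  by rewrite -EFinM mulrC mulfK ?gt_eqF.
have mBr : measurable_fun [set: T] (fun x => B x `^ r^-1).
  exact: measurable_powR2.
apply: le_trans (lee_wpmul2l _ hB); last by rewrite lee_fin.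
rewrite -(integralZl_real mu mD v10 mBr); last by move=> x; exact: powR_ge0.
apply: ge0_le_integral_nomeas => x _; rewrite lee_fin; first exact: powR_ge0.
rewrite powRM ?invr_ge0 ?(ltW b00)// mulrC.
suff -> : (v `^ r)^-1 `^ r^-1 = v^-1 by [].
rewrite -[(v `^ r)^-1]powR_inv1 ?(ltW b00)// -!powRrM mulN1r mulrN divff ?gt_eqF//.
by rewrite powR_inv1// ltW.
Qed.

Lemma modular_gain (Psi : T -> R) (mm C0 e : R) : 0 < mm -> mm <= C0 -> 0 < e ->
  measurable_fun [set: T] Psi -> (forall x, 0 <= Psi x) ->
  (forall x, D x -> g x `^ p x * (v * g x `^ p x) `^ (- (aexp x * de)) <= Psi x) ->
  (forall x, D x -> aexp x <= e) ->
  (\int[mu]_(x in D) (Psi x)%:E <= mm%:E)%E ->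
  (modular mu aexp g D (v `^ de * (mm / C0) `^ e^-1) <= C0%:E)%E.
Proof.
move=> m0 mC e0 mPsi Psi0 hPsi hae hm.
have C00 : 0 < C0 by apply: lt_le_trans mC.
have Cm0 : 0 <= C0 / mm by rewrite divr_ge0// ltW.
have -> : C0%:E = ((C0 / mm)%:E * mm%:E)%E by rewrite -EFinM divfK// gt_eqF.
apply: le_trans (lee_wpmul2l _ hm); last by rewrite lee_fin.
rewrite -(integralZl_real mu mD Cm0 mPsi Psi0).
apply: ge0_le_integral_nomeas => x Dx; rewrite lee_fin; first exact: powR_ge0.
have ax := aexp_gt0 x; set a := aexp x in ax *.
have rat0 : 0 < (mm / C0) `^ e^-1 by rewrite powR_gt0// divr_gt0.
rewrite (powR_gain e (g0 x) (p0 x) ax) ?divr_gt0//; last by rewrite /a /aexp invrK.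
rewrite invf_div mulrC; apply: ler_pM; rewrite ?powR_ge0 ?mulr_ge0 ?powR_ge0 ?hPsi//.
rewrite -[leRHS]powRr1//; apply: ler_powR.
  by rewrite ler_pdivlMr// mul1r.
by rewrite ler_pdivrMr// mul1r; exact: hae.
Qed.

End cube_holder.

Section good_cubes.
Context d (T : measurableType d) (R : realType) (mu : {measure set T -> \bar R}).
Variables (D : set T) (B g w p s : T -> R) (v t de tau pp : R).
Hypotheses (mD : measurable D) (mB : measurable_fun [set: T] B)
  (mg : measurable_fun [set: T] g) (mw : measurable_fun [set: T] w)
  (mp : measurable_fun [set: T] p) (ms : measurable_fun [set: T] s)
  (B1 : forall x, 1 <= B x) (g0 : forall x, 0 <= g x) (w0 : forall x, 0 <= w x)
  (p1 : forall x, 1 <= p x) (ppp : forall x, p x <= pp) (s0 : forall x, 0 < s x)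
  (ps : forall x, (p x)^-1 + (s x)^-1 = t^-1)
  (v0 : 0 < v) (tau0 : 0 < tau) (de0 : 0 < de) (de1 : de < 1 - t^-1) (depp : de * pp < 1).

Let p0 x : 0 < p x. Proof. exact: lt_le_trans (p1 x). Qed.
Let B0 x : 0 <= B x. Proof. exact: le_trans (B1 x). Qed.

Let aH0 x : 0 < (p x)^-1 + de.
Proof. by rewrite addr_gt0 ?invr_gt0. Qed.

Let aL0 x : 0 < (p x)^-1 + - de.
Proof.
rewrite subr_gt0 -[de]invrK ltf_pV2 ?posrE ?invr_gt0//.
by rewrite -ltf_pV2 ?posrE ?invr_gt0// invrK -[ltRHS]mul1r ltr_pdivlMr//
  (le_lt_trans _ depp)// ler_pM2l.
Qed.

(** Bounds what the shift of the exponent leaves, for both signs: for p >= 1 the product of [aexp]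
    and [de] is at least [de / (1 + de)]. *)
Definition gain X : R := Num.min (X `^ (de / (1 + de))) (X `^ (- (de / (1 + de)))).

Let c0 : 0 < de / (1 + de). Proof. by rewrite divr_gt0// addr_gt0. Qed.

Let aH x : de / (1 + de) <= aexp p de x * de.
Proof.
rewrite [leRHS]mulrC ler_pM2l// /aexp lef_pV2 ?posrE ?aH0 ?addr_gt0//.
by rewrite lerD2r invf_le1.
Qed.

Let aL x : de / (1 + de) <= aexp p (- de) x * de.
Proof.
rewrite [leRHS]mulrC ler_pM2l// /aexp lef_pV2 ?posrE ?aL0 ?addr_gt0//.
have h : (p x)^-1 <= 1 by rewrite invf_le1.
by move: de0 => ?; lra.
Qed.

Lemma good_cube (Psi : T -> R) (mm C0 CB e : R) : 0 < mm -> mm <= C0 -> 0 < e -> 0 <= CB ->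
  measurable_fun [set: T] Psi -> (forall x, 0 <= Psi x) ->
  (forall x, D x -> g x `^ p x * gain (v * g x `^ p x) <= Psi x) ->
  (forall x, D x -> aexp p de x <= e) -> (forall x, D x -> aexp p (- de) x <= e) ->
  (\int[mu]_(x in D) (Psi x)%:E <= mm%:E)%E ->
  (\int[mu]_(x in D) (B x `^ (1 - t^-1 - de)^-1)%:E <= (CB * v)%:E)%E ->
  (modular mu s w D tau <= 1)%E ->
  (\int[mu]_(x in D) (B x * g x * w x)%:E <=
   (2 * (CB + C0 + 1) * (v `^ (1 - t^-1) * tau * (mm / C0) `^ e^-1))%:E)%E.
Proof.
move=> m0 mC e0 CB0 mPsi Psi0 hPsi heH heL hm hB hw.
have C00 : 0 < C0 by apply: lt_le_trans mC.
pose z x := g x `^ p x; have z0 x : 0 <= z x by exact: powR_ge0.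
have mz : measurable_fun [set: T] z by exact: measurable_powR2.
(* Where [v * z x > 1] the shift by [de] leaves a negative power of it, elsewhere the shift by
   [- de] leaves a positive one; both are at most [gain]. *)
pose D0 := D `&` [set x | 1 < v * z x].
have mD0 : measurable D0.
  apply: measurableI => //; rewrite -[X in measurable X]setTI.
  have -> : [set x | 1 < v * z x] = (fun x => v * z x) @^-1` `]1, +oo[%classic.
    by apply/seteqP; split => x /=; rewrite in_itv/= andbT.
  have mvz : measurable_fun [set: T] (fun x => v * z x) by exact: measurable_funM.
  by apply: mvz => //; exact: measurable_itv.
have D0D : D0 `<=` D by move=> x [].
have mD1 : measurable (D `\` D0) by exact: measurableD.
have D1D : D `\` D0 `<=` D by move=> x [].
have mf : measurable_fun [set: T] (fun x => B x * g x * w x).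
  by apply: measurable_funM => //; exact: measurable_funM.
have f0 x : 0 <= B x * g x * w x by rewrite !mulr_ge0.
have hsub (A : set T) (f : T -> R) (c : \bar R) : measurable A -> A `<=` D ->
    measurable_fun [set: T] f -> (forall x, 0 <= f x) ->
    (\int[mu]_(x in D) (f x)%:E <= c)%E -> (\int[mu]_(x in A) (f x)%:E <= c)%E.
  move=> mA AD mf' f0'; apply: le_trans; apply: ge0_subset_integral => //.
    by apply/measurable_EFinP; exact: measurable_funTS.
  by move=> x _; rewrite lee_fin.
rewrite (integral_setDE mu mD mD0 D0D mf f0).
set K := v `^ (1 - t^-1) * tau * (mm / C0) `^ e^-1.
have K0 : 0 < K by rewrite !mulr_gt0 ?powR_gt0 ?divr_gt0.
have -> : 2 * (CB + C0 + 1) * K = (CB + C0 + 1) * K + (CB + C0 + 1) * K by ring.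
have rat0 : 0 < (mm / C0) `^ e^-1 by rewrite powR_gt0 ?divr_gt0.
have mBr (r : R) : measurable_fun [set: T] (fun x => B x `^ r).
  exact: measurable_powR2.
have KE (dd : R) : v `^ (1 - t^-1 - dd) * (v `^ dd * (mm / C0) `^ e^-1) * tau * (CB + C0 + 1) =
    (CB + C0 + 1) * K.
  by rewrite mulrA -powRD_gt0// subrK /K; ring.
rewrite EFinD; apply: leeD.
  rewrite -(KE de); apply: (cube_holder mD0 mB mg mw mp ms B0 g0 w0 p0 s0 ps v0 tau0 de1 aH0).
  - by rewrite mulr_gt0// powR_gt0.
  - by apply: hsub hB => // x; exact: powR_ge0.
  - apply: (modular_gain mD0 g0 p0 v0 aH0 m0 mC e0 mPsi Psi0).
    + move=> x [Dx /= hx]; apply: le_trans (hPsi x Dx); apply: (ler_wpM2l (z0 x)); rewrite /gain.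
      have vz0 : 0 < v * z x by apply: lt_trans hx.
      rewrite le_min; apply/andP; split; apply: ler_powR; rewrite ?(ltW hx)//.
        by apply: (@le_trans _ _ 0); [rewrite oppr_le0 mulr_ge0 ?aexp_ge0// ltW// aexp_gt0|exact: ltW].
      by rewrite lerN2; exact: aH.
    + by move=> x [Dx _]; exact: heH.
    + by apply: hsub hm.
  - exact: le_trans (modular_sub mu ms mw tau mD0 mD D0D) hw.
rewrite -(KE (- de)).
have de1' : - de < 1 - t^-1 by apply: lt_trans de1; move: de0 => ?; lra.
apply: (cube_holder mD1 mB mg mw mp ms B0 g0 w0 p0 s0 ps v0 tau0 de1' aL0).
- by rewrite mulr_gt0// powR_gt0.
(* The shift by [- de] asks for a smaller power of [B], and [B >= 1]. *)
- apply: hsub => //; first by move=> x; exact: powR_ge0.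
  apply: le_trans hB; apply: ge0_le_integral_nomeas => x _; rewrite lee_fin; first exact: powR_ge0.
  apply: ler_powR => //; rewrite lef_pV2 ?posrE.
  + by move: de0 => ?; lra.
  + by rewrite subr_gt0.
  + by rewrite subr_gt0.
- apply: (modular_gain mD1 g0 p0 v0 aL0 m0 mC e0 mPsi Psi0).
  + move=> x [Dx hx]; apply: le_trans (hPsi x Dx); apply: (ler_wpM2l (z0 x)).
    have vz1 : v * z x <= 1 by rewrite leNgt; apply/negP => h; apply: hx.
    (* At 0 every power with nonzero exponent is 0, negative exponents included, so both sides
       vanish. *)
    rewrite mulrN opprK; have [vz0|vzn] := eqVneq (v * z x) 0.
      rewrite -/(z x) vz0 powR0 ?mulf_neq0 ?gt_eqF ?aexp_gt0// /gain !powR0 ?oppr_eq0 ?gt_eqF ?minxx//.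
    have vz0 : 0 < v * z x by rewrite lt_neqAle eq_sym vzn mulr_ge0// ltW.
    rewrite /gain le_min; apply/andP; split; rewrite ger_powR ?vz0//.
    apply: (@le_trans _ _ 0); first by rewrite oppr_le0 ltW.
    by rewrite mulr_ge0 ?(ltW de0)// ltW// aexp_gt0.
  + by move=> x [Dx _]; exact: heL.
  + by apply: hsub hm.
- exact: le_trans (modular_sub mu ms mw tau mD1 mD D1D) hw.
Qed.

End good_cubes.

Section exceptional_cubes.
Context d (T : measurableType d) (R : realType) (mu : {measure set T -> \bar R}).
Variables (D : set T) (B g w p s : T -> R) (v t de tau : R).
Hypotheses (mD : measurable D) (mB : measurable_fun [set: T] B)
  (mg : measurable_fun [set: T] g) (mw : measurable_fun [set: T] w)
  (mp : measurable_fun [set: T] p) (ms : measurable_fun [set: T] s)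
  (B1 : forall x, 1 <= B x) (g0 : forall x, 0 <= g x) (w0 : forall x, 0 <= w x)
  (p1 : forall x, 1 <= p x) (s0 : forall x, 0 < s x)
  (ps : forall x, (p x)^-1 + (s x)^-1 = t^-1)
  (v0 : 0 < v) (tau0 : 0 < tau) (de0 : 0 <= de) (de1 : de < 1 - t^-1).

Let p0 x : 0 < p x. Proof. exact: lt_le_trans (p1 x). Qed.
Let B0 x : 0 <= B x. Proof. exact: le_trans (B1 x). Qed.

Lemma exceptional_cube (c CB : R) : (mu D <= c%:E)%E ->
  (modular mu p g D 1 <= 1)%E ->
  (\int[mu]_(x in D) (B x `^ (1 - t^-1 - de)^-1)%:E <= (CB * v)%:E)%E ->
  (modular mu s w D tau <= 1)%E ->
  (\int[mu]_(x in D) (B x * g x * w x)%:E <=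
   (v `^ (1 - t^-1 - de) * tau * (CB + (c + 1) + 1))%:E)%E.
Proof.
move=> hD hg hB hw.
have a0 x : 0 < (p x)^-1 + de by apply: ltr_pwDl => //; rewrite invr_gt0.
rewrite -[v `^ _]mulr1.
apply: (cube_holder mD mB mg mw mp ms B0 g0 w0 p0 s0 ps v0 tau0 de1 a0 ltr01 hB _ hw).
rewrite EFinD; apply: le_trans (leeD hD hg).
have mz : measurable_fun D (fun x => ((g x / 1) `^ p x)%:E) by exact: measurable_modular.
rewrite -[mu D]mul1e -(integral_cst mu mD) -ge0_integralD//; last first.
  by move=> x _; rewrite lee_fin powR_ge0.
apply: ge0_le_integral_nomeas => x _; first by rewrite lee_fin powR_ge0.
rewrite -EFinD lee_fin; have gx : 0 <= g x / 1 by rewrite divr1.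
have ap : aexp p de x <= p x.
  by rewrite /aexp -[leRHS]invrK lef_pV2 ?posrE ?invr_gt0// lerDl.
have ax : 0 < aexp p de x by rewrite invr_gt0.
case: (leP (g x / 1) 1) => h.
  apply: (@le_trans _ _ 1); last by rewrite lerDl powR_ge0.
  rewrite -[leRHS](_ : (1 : R) `^ aexp p de x = 1); last by rewrite powR1.
  exact: le_powR (ltW ax) gx h.
by apply: (@le_trans _ _ ((g x / 1) `^ p x)); [apply: ler_powR => //; exact: ltW|rewrite lerDr].
Qed.

(** The unshifted exponent, available on every cube but without gain. *)
Lemma any_cube (CB : R) : (modular mu p g D 1 <= 1)%E ->
  (\int[mu]_(x in D) (B x `^ (1 - t^-1 - de)^-1)%:E <= (CB * v)%:E)%E ->
  (modular mu s w D tau <= 1)%E ->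
  (\int[mu]_(x in D) (B x * g x * w x)%:E <=
   (v `^ (1 - t^-1) * tau * (CB + 1 + 1))%:E)%E.
Proof.
move=> hg hB hw; have t10 : 0 < 1 - t^-1 by apply: le_lt_trans de1.
have t10' : 0 < 1 - t^-1 - de by rewrite subr_gt0.
rewrite -[v `^ _]mulr1.
have pE : aexp p 0 = p by apply/funext => x; rewrite /aexp addr0 invrK.
have a0 x : 0 < (p x)^-1 + 0 by rewrite addr0 invr_gt0.
have hB' : (\int[mu]_(x in D) (B x `^ (1 - t^-1)^-1)%:E <= (CB * v)%:E)%E.
  apply: le_trans hB; apply: ge0_le_integral_nomeas => x _; rewrite lee_fin; first exact: powR_ge0.
  by apply: ler_powR => //; rewrite lef_pV2 ?posrE// gerBl.
have := @cube_holder _ T R mu D B g w p s v t 0 tau mD mB mg mw mp ms B0 g0 w0 p0 s0 ps v0 tau0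
  t10 a0 1 CB 1 ltr01.
by rewrite pE subr0 => /(_ hB' hg hw).
Qed.

End exceptional_cubes.

(** * The weight classes in terms of real modulars *)

Lemma mule_lty (R : realDomainType) (x y : \bar R) : (0 < x)%E -> (0 < y)%E ->
  (x * y < +oo)%E -> (x < +oo)%E /\ (y < +oo)%E.
Proof.
move=> x0 y0 h; rewrite !ltey; split; apply: contraTN h => /eqP->.
  by rewrite gt0_mulye// ltxx.
by rewrite gt0_muley// ltxx.
Qed.

Lemma prode_gt0 (R : realDomainType) (I : Type) (s : seq I) (P : pred I) (f : I -> \bar R) :
  (forall i, 0 < f i)%E -> (0 < \prod_(i <- s | P i) f i)%E.
Proof. by move=> f0; elim/big_ind: _ => // x y; exact: mule_gt0. Qed.

Lemma lee_prod (R : realDomainType) (I : Type) (s : seq I) (f g : I -> \bar R) :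
  (forall i, 0 <= f i)%E -> (forall i, f i <= g i)%E ->
  (\prod_(i <- s) f i <= \prod_(i <- s) g i)%E.
Proof.
move=> f0 fg; elim: s => [|i s IH]; first by rewrite !big_nil.
by rewrite !big_cons; apply: lee_pmul => //; exact: prode_ge0_seq.
Qed.

(** If a product of positive factors is finite, so is each factor. Doubling the m + 1 norms gives
    scales strictly above them, where modulars are at most 1, at the price of [2 ^+ m.+1]. *)
Lemma ereal_prod_bound (R : realType) m (a : R) (S ns Ls : \bar R) (ni Li : 'I_m -> \bar R) :
  0 < a -> (0 < ns)%E -> (forall i, 0 < ni i)%E -> (ns <= Ls)%E ->
  (forall i, ni i <= Li i)%E -> (a%:E * Ls * \prod_(i < m) Li i <= S)%E -> (S < +oo)%E ->
  exists lam (sig : 'I_m -> R), [/\ 0 < lam /\ (forall i, 0 < sig i),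
    (ns < lam%:E)%E, forall i, (ni i < (sig i)%:E)%E &
    a * (lam * \prod_(i < m) sig i) <= 2 ^+ m.+1 * fine S].
Proof.
move=> a0 ns0 ni0 nsL niL hS Sfin.
have P0 : (0 < \prod_(i < m) ni i)%E by apply: prode_gt0.
have {}hS : (a%:E * (ns * \prod_(i < m) ni i) <= S)%E.
  apply: le_trans hS; rewrite -muleA lee_pmul2l ?lte_fin//; apply: lee_pmul => //.
  - exact: ltW.
  - exact: ltW.
  - by apply: lee_prod => // i; exact: ltW.
have nP0 := mule_gt0 ns0 P0.
have aE0 : (0 < a%:E)%E by rewrite lte_fin.
have [_ hfin] := mule_lty aE0 nP0 (le_lt_trans hS Sfin).
have [nsfin Pfin] := mule_lty ns0 P0 hfin.
have nifin i : (ni i < +oo)%E.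
  move: Pfin; rewrite (bigD1 i)//= => h; case: (mule_lty _ _ h) => //.
  exact: prode_gt0.
have nsE : ns = (fine ns)%:E by rewrite fineK// ge0_fin_numE// ltW.
have niE i : ni i = (fine (ni i))%:E by rewrite fineK// ge0_fin_numE// ltW.
have fns0 : 0 < fine ns by rewrite fine_gt0// ns0.
have fni0 i : 0 < fine (ni i) by rewrite fine_gt0// ni0 nifin.
have S0 : (0 <= S)%E by apply: le_trans hS; rewrite mule_ge0 ?lee_fin ?(ltW a0) ?(ltW nP0).
exists (2 * fine ns), (fun i => 2 * fine (ni i)); split.
- by split=> [|i]; rewrite mulr_gt0.
- by rewrite {1}nsE lte_fin ltr_pMl// ltr1n.
- by move=> i; rewrite {1}niE lte_fin ltr_pMl// ltr1n.
have -> : a * (2 * fine ns * \prod_(i < m) (2 * fine (ni i))) =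
    2 ^+ m.+1 * (a * (fine ns * \prod_(i < m) fine (ni i))).
  rewrite big_split/= prodr_const card_ord exprS.
  by move: (\prod_(i < m) _) (2 ^+ m) => X Y; ring.
rewrite ler_pM2l ?exprn_gt0// -lee_fin fineK ?ge0_fin_numE//.
apply: le_trans hS; rewrite !EFinM -nsE -prodEFin lee_pmul2l// lee_pmul2l//.
  by rewrite (eq_bigr (fun i => ni i))// => i _; rewrite -niE.
by rewrite ge0_fin_numE// ltW.
Qed.

Section weights_extraction.
Context (R : realType) (n : nat).
Local Notation E := (Rn R n).
Local Notation mu := (@leb R n).
Implicit Types (p : E -> R).

Lemma dcube_sub_ball j (x : E) (r : R) : n%:R * side R j < r ->
  dcube (@didx R n) j x `<=` eucl_ball x r.
Proof.
move=> jr y yx; apply: le_lt_trans jr; apply: eucl_dist_le; first exact/ltW/side_gt0.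
move=> i; have /andP[h1 h2] := didx_itv j x i; have /andP[h3 h4] := didx_itv j y i.
move: h3 h4; rewrite yx => h3 h4; move: h2 h4; rewrite intrD mulrDl mul1r => h2 h4.
by rewrite ler_norml; apply/andP; split; lra.
Qed.

Lemma leb_ball_gt0 (x : E) (r : R) : 0 < r -> (0 < mu (eucl_ball x r))%E.
Proof.
move=> r0; have e0 : 0 < r / (n%:R + 1) by rewrite divr_gt0// ltr_wpDl.
have [N hN] := @side_small R _ e0.
have s0 := side_gt0 R (- N%:Z).
apply: (@lt_le_trans _ _ (mu (dcube (@didx R n) (- N%:Z) x))).
  by rewrite leb_dcube lte_fin dvol_gt0.
rewrite le_measure ?inE//; first exact: measurable_ddcube.
  exact: measurable_ball.
apply: dcube_sub_ball; move: hN; rewrite ler_pdivlMr ?ltr_wpDl// mulrDr mulr1 mulrC.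
by apply: lt_le_trans; rewrite ltrDl.
Qed.

Lemma leb_ball_fin (x : E) (r : R) : 0 < r -> mu (eucl_ball x r) \is a fin_num.
Proof.
by move=> r0; rewrite ge0_fin_numE//; apply: le_lt_trans (leb_ball_le x r0) _; rewrite ltry.
Qed.

Lemma modular_le_Lnorm p (f : E -> R) (g : E -> \bar R) (D : set E) (l : R) :
  measurable D -> measurable_fun [set: E] p -> measurable_fun [set: E] f ->
  (forall x, 0 <= f x) -> {ae mu, forall x, D x -> `|g x|%E = (f x)%:E} -> 0 < l ->
  (modular mu p f D l <= \int[mu]_x (`|g x| / l%:E) `^ p x)%E.
Proof.
move=> mD mp mf f0 fg l0.
have pw0 (y : \bar R) (e : R) : (0 <= y `^ e)%E by exact: poweR_ge0.
apply: (@le_trans _ _ (\int[mu]_(x in D) (`|g x| / l%:E) `^ p x)%E); last first.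
  exact: ge0_subset_integral_nomeas.
apply: ae_le_integral_measl; [exact: mD|exact: measurable_modular| | |].
- by move=> x _; rewrite lee_fin powR_ge0.
- by move=> x _.
apply: filterS fg => x h Dx; rewrite h// inver gt_eqF// -EFinM poweR_EFin lexx//.
Qed.

Lemma mnorm_le_Lnorm p (f : E -> R) (g : E -> \bar R) (D : set E) :
  measurable D -> measurable_fun [set: E] p -> measurable_fun [set: E] f ->
  (forall x, 0 <= f x) -> {ae mu, forall x, D x -> `|g x|%E = (f x)%:E} ->
  (mnorm mu p f D <= Lnorm_var p g)%E.
Proof.
move=> mD mp mf f0 fg; apply: le_ereal_inf => _ [l [l0 h] <-]; exists l => //; split=> //.
by apply: le_trans h; exact: modular_le_Lnorm.
Qed.

Definition wprod m (u : 'I_m -> E -> R) : E -> R := fun y => \prod_(i < m) u i y.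

Definition winv (u : E -> R) : E -> R := fun y => (u y)^-1.

Lemma measurable_wprod m (u : 'I_m -> E -> R) :
  (forall i, measurable_fun [set: E] (u i)) -> measurable_fun [set: E] (wprod u).
Proof. by move=> mu'; apply: measurable_prod => i _; exact: mu'. Qed.

Lemma measurable_winv (u : E -> R) : (forall y, 0 < u y) ->
  measurable_fun [set: E] u -> measurable_fun [set: E] (winv u).
Proof.
move=> u0 mu'; have -> : winv u = (fun y => u y `^ (-1)).
  by apply/funext => y; rewrite powR_inv1// ltW.
by apply: measurable_powR2.
Qed.

(** The class bounds only the product of the norms, but on a ball each norm is positive, hence
    finite, and can be replaced by a real scale. Weights enter through integrals, so they may be
    changed on a null set. *)
Lemma A_class_real m (r : 'I_m -> E -> R) (s : E -> R) (beta : R)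
    (v : 'I_m -> E -> \bar R) (u : 'I_m -> E -> R) (c0 : R) :
  0 < c0 -> measurable_fun [set: E] s -> (forall x, c0 <= s x) ->
  (forall i, measurable_fun [set: E] (conj_exp (r i))) ->
  (forall i x, c0 <= conj_exp (r i) x) ->
  (forall i, measurable_fun [set: E] (u i)) -> (forall i x, 0 < u i x) ->
  (forall i, {ae mu, forall x, v i x = (u i x)%:E}) ->
  A_class r s beta v ->
  exists2 A : R, 0 < A & forall (x : E) (rr : R), 0 < rr -> exists lam (sig : 'I_m -> R),
   [/\ 0 < lam /\ (forall i, 0 < sig i),
       (modular mu s (wprod u) (eucl_ball x rr) lam <= 1)%E,
       forall i, (modular mu (conj_exp (r i)) (winv (u i)) (eucl_ball x rr) (sig i) <= 1)%E &
       fine (mu (eucl_ball x rr)) `^ (beta / n%:R - m%:R) * (lam * \prod_(i < m) sig i) <= A].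
Proof.
move=> c00 ms sc mc cc muu u0 vu [_]; set S := ereal_sup _ => Sfin.
have mprod : measurable_fun [set: E] (wprod u) by exact: measurable_wprod.
have prod0 y : 0 < wprod u y by apply: prodr_gt0 => i _; exact: u0.
have minv i : measurable_fun [set: E] (winv (u i)) by exact: measurable_winv.
have inv0 i y : 0 < winv (u i) y by rewrite invr_gt0.
have s0 y : 0 < s y by exact: lt_le_trans (sc y).
have cc0 i y : 0 < conj_exp (r i) y by exact: lt_le_trans (cc i y).
have S1 : fine S <= `|fine S| + 1 by rewrite ler_wpDr// ler_norm.
exists (2 ^+ m.+1 * (`|fine S| + 1)); first by rewrite mulr_gt0 ?exprn_gt0// ltr_wpDl.
move=> x rr rr0; set B := eucl_ball x rr.
have mB : measurable B by exact: measurable_ball.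
have muB0 := leb_ball_gt0 x rr0; have muBf := leb_ball_fin x rr0.
pose ns := mnorm mu s (wprod u) B.
pose ni i := mnorm mu (conj_exp (r i)) (winv (u i)) B.
have ns0 : (0 < ns)%E.
  exact: (mnorm_gt0 ms mprod (fun y => ltW (prod0 y)) s0 c00 sc mB (fun y _ => prod0 y)).
have ni0 i : (0 < ni i)%E.
  exact: (mnorm_gt0 (mc i) (minv i) (fun y => ltW (inv0 i y)) (cc0 i) c00 (cc i) mB
    (fun y _ => inv0 i y)).
have nsL : (ns <= Lnorm_var s ((fun x => \prod_(i < m) v i x) \_ B)%E)%E.
  apply: (mnorm_le_Lnorm mB ms mprod) => [y|]; first exact: ltW.
  have /filter_forall : forall i, {ae mu, forall x, v i x = (u i x)%:E} by exact: vu.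
  apply: filterS => y h By; rewrite /patch mem_set//.
  rewrite (eq_bigr (fun i => (u i y)%:E)); last by move=> i _; exact: h.
  by rewrite prodEFin gee0_abs// lee_fin ltW// prod0.
have niL i : (ni i <= Lnorm_var (conj_exp (r i)) ((fun x => (v i x)^-1) \_ B)%E)%E.
  apply: (mnorm_le_Lnorm mB (mc i) (minv i)) => [y|]; first exact: ltW.
  apply: filterS (vu i) => y h By; rewrite /patch mem_set// h inver gt_eqF//.
  by rewrite gee0_abs// lee_fin invr_ge0 ltW.
set a := fine (mu B) `^ _.
have a0 : 0 < a by rewrite powR_gt0// fine_gt0// muB0/= -ge0_fin_numE.
have aE : (mu B `^ (beta / n%:R - m%:R) = a%:E)%E by rewrite -(fineK muBf) poweR_EFin.
have hS : (a%:E * Lnorm_var s ((fun x => \prod_(i < m) v i x) \_ B) *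
     \prod_(i < m) Lnorm_var (conj_exp (r i)) ((fun x => (v i x)^-1) \_ B) <= S)%E.
  by rewrite -aE; apply: ereal_sup_ubound; exists B => //; exists x => //; exists rr.
have [lam [sig [pos hn1 hn2 hn3]]] :=
  ereal_prod_bound a0 ns0 ni0 nsL niL hS Sfin.
exists lam, sig; split=> //.
- exact: (modular_le1 (fun y => ltW (prod0 y)) s0 hn1).
- by move=> i; exact: (modular_le1 (fun y => ltW (inv0 i y)) (cc0 i) (hn2 i)).
by apply: le_trans hn3 _; rewrite ler_pM2l// exprn_gt0.
Qed.

End weights_extraction.

(** * Log-Hoelder continuity on dyadic cubes *)

Section log_holder.
Context (R : realType) (n : nat).
Local Notation E := (Rn R n).
Local Notation side := (side R).
Local Notation dcube := (dcube (@didx R n)).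
Implicit Types (x y : E) (k : int) (p : E -> R).

(** The union of the 2^n cubes of scale [k] that have the origin as a vertex or corner point. *)
Definition nearbox k : set E := [set x | forall i, - side k <= tnth x i < side k].

(** The cubes on which log-Hoelder continuity freezes exponents for quantities of polynomial size:
    side at most 1, or distance from the origin not small against the side. *)
Definition local_cube k x := (k <= 0)%R \/ ~ nearbox k x.

Lemma nearboxE k x : nearbox k x <-> forall i, -1 <= didx k x i < 1.
Proof.
have s0 := side_gt0 R k.
split=> h i; have := h i; rewrite ffunE.
  rewrite floor_ge_int floor_lt_int => /andP[h1 h2].
  by rewrite ler_pdivlMr// ltr_pdivrMr// mulN1r mul1r h1.
rewrite floor_ge_int floor_lt_int => /andP[h1 h2].
by move: h1 h2; rewrite ler_pdivlMr// ltr_pdivrMr// mulN1r mul1r => -> ->.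
Qed.

Lemma saturated_nearbox j k : (j <= k)%R -> saturated (@didx R n) j (nearbox k).
Proof.
move=> jk; apply: (saturated_le (@didx_nest R n) jk) => x y e /nearboxE h.
by apply/nearboxE => i; rewrite -e.
Qed.

Lemma measurable_nearbox k : measurable (nearbox k).
Proof. exact: (measurable_saturated (@didx_measurable R n)) (saturated_nearbox (lexx k)). Qed.

Lemma nearbox_le j k : (j <= k)%R -> nearbox j `<=` nearbox k.
Proof.
move=> /(side_le R) jk x h i; have /andP[h1 h2] := h i.
by rewrite (lt_le_trans h2 jk) andbT; apply: le_trans h1; rewrite lerN2.
Qed.

Lemma local_cube_down j k x y :
  local_cube k x -> (j <= k)%R -> dcube k x y -> local_cube j y.
Proof.
move=> [k0|nk] jk xy; first by left; exact: le_trans k0.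
right => /(nearbox_le jk) h; apply: nk.
exact: (saturated_nearbox (lexx k)) h.
Qed.

Lemma far_norm k x : ~ nearbox k x -> side k <= eucl_norm x.
Proof.
move=> /existsNP[i /negP]; rewrite negb_and -ltNge -leNgt => h.
apply: le_trans (eucl_norm_ge x i); rewrite ler_normr.
by move: h => /orP[/ltW|->//]; rewrite lerNr => ->; rewrite orbT.
Qed.

Let le1 x : 1 <= ln (expR 1 + eucl_norm x).
Proof.
rewrite -[1 in leLHS](expRK (1 : R)) ler_ln ?posrE ?expR_gt0//.
  by rewrite lerDl sqrtr_ge0.
by rewrite ltr_wpDr ?expR_gt0// sqrtr_ge0.
Qed.

Lemma LH_unif p (eta : R) : log_Holder p -> 0 < eta -> exists2 k0, (k0 <= 0)%R &
  forall k x y, (k <= k0)%R -> tcube k x y -> `|p x - p y| <= eta.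
Proof.
move=> [C [pinf [C0 _ h1 _]]] eta0.
pose e := Num.min (1 / 4) (expR (- (C / eta))).
have e0 : 0 < e by rewrite lt_min expR_gt0 andbT.
have e1 : 0 < e / (2 * n%:R + 1) by rewrite divr_gt0// ltr_wpDl.
have [N hN] := @side_small R _ e1.
exists (- N%:Z); first by rewrite oppr_le0.
move=> k x y kN /(tcube_ball (n:=n)); rewrite /eucl_ball /= => hd.
have {}hd : eucl_dist x y < e.
  apply: (lt_le_trans hd); rewrite /brad -ler_pdivlMl ?ltr_wpDl// mulrC.
  exact: le_trans (side_le R kN) hN.
have d2 : eucl_dist x y < 1 / 2.
  apply: (lt_le_trans hd); apply: (@le_trans _ _ (1 / 4)); last by lra.
  by rewrite ge_min lexx.
apply: le_trans (h1 _ _ d2) _.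
have [d0|d0] := leP (eucl_dist x y) 0; first by rewrite ln0// oppr0 invr0 mulr0 ltW.
have l : C / eta <= - ln (eucl_dist x y).
  rewrite lerNr -[leRHS]expRK ler_ln ?posrE ?expR_gt0//.
  by apply: le_trans (ltW hd) _; rewrite ge_min lexx orbT.
have Ce : 0 < C / eta by rewrite divr_gt0.
rewrite ler_pdivrMr; last exact: lt_le_trans l.
by rewrite mulrC -ler_pdivrMr.
Qed.

Lemma LH_infty p (eta : R) : log_Holder p -> 0 < eta -> exists2 J, (0 <= J)%R &
  forall x y, ~ nearbox J x -> ~ nearbox J y -> `|p x - p y| <= eta.
Proof.
move=> [C [pinf [C0 _ _ h2]]] eta0.
have [N hN] := @side_small R _ (expR_gt0 (- (2 * C / eta))).
exists N%:Z => // x y nx ny.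
have h x' : ~ nearbox N%:Z x' -> `|p x' - pinf| <= eta / 2.
  move=> nx'; apply: le_trans (h2 x') _.
  have l : 2 * C / eta <= ln (expR 1 + eucl_norm x').
    rewrite -[leLHS]expRK ler_ln ?posrE ?expR_gt0//; last first.
      by rewrite ltr_wpDr ?expR_gt0// sqrtr_ge0.
    apply: (@le_trans _ _ (eucl_norm x')); last by rewrite lerDr expR_ge0.
    apply: le_trans (far_norm nx').
    by move: hN; rewrite sideN expRN lef_pV2 ?posrE ?expR_gt0 ?side_gt0.
  rewrite ler_pdivrMr; last exact: lt_le_trans (le1 x').
  rewrite mulrAC ler_pdivlMr// mulrC (mulrC eta) -ler_pdivrMr//.
rewrite -(subrKA pinf) [leRHS]splitr; apply: le_trans (ler_normD _ _) _.
by apply: lerD; [exact: h|rewrite distrC; exact: h].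
Qed.

(** The second factor dominates the logarithm of anything polynomial in |x| and in the reciprocal of
    the side, so such a quantity may be raised to [p x] or to [p y] alike. Decay at infinity handles
    the first summand, as |x| is controlled by |y| on the cube; local continuity handles the
    second. *)
Lemma LH_local p : log_Holder p -> exists2 C : R, 0 < C &
  forall k x y, local_cube k x -> dcube k x y ->
   `|p x - p y| * (ln (expR 1 + eucl_norm x) + Num.max 0 (- ln (side k))) <= C.
Proof.
move=> [C [pinf [C0 _ h1 h2]]].
have N1 : 1 <= 2 * n%:R + 1 :> R by rewrite lerDr mulr_ge0.
have N2 : 1 <= 2 * (n%:R + 1) :> R by rewrite -[1 in leLHS]mulr1 ler_pM ?ler1n ?lerDr.
pose K1 : R := ln (2 * n%:R + 1) + 1; pose cN : R := ln (2 * (n%:R + 1)).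
have lK : 0 <= ln (2 * n%:R + 1) :> R by rewrite ln_ge0.
have cN0 : 0 <= cN by rewrite ln_ge0.
exists (C * (1 + K1) + (2 * C + 4 * C * cN)).
  have h3 := mulr_ge0 (ltW C0) cN0.
  have h4 : 0 <= C * (1 + K1) by rewrite mulr_ge0 ?(ltW C0)// /K1; lra.
  by lra.
move=> k x y lx xy.
have ly : local_cube k y by exact: local_cube_down xy.
set a := ln (expR 1 + eucl_norm x); set s := Num.max 0 _.
pose b := ln (expR 1 + eucl_norm y).
have a1 : 1 <= a by exact: le1.
have b1 : 1 <= b by exact: le1.
have s0 : 0 <= s by rewrite le_max lexx.
have sk0 := side_gt0 R k.
have ny0 : 0 <= eucl_norm y by exact: sqrtr_ge0.
have nx0 : 0 <= eucl_norm x by exact: sqrtr_ge0.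
have e1 : 1 <= expR 1 :> R by rewrite -expR0 ler_expR.
have cd i : `|tnth x i - tnth y i| <= side k.
  have /andP[u1 u2] := didx_itv k x i; have /andP[u3 u4] := didx_itv k y i.
  move: u3 u4; rewrite xy => u3 u4; move: u2 u4; rewrite intrD mulrDl mul1r => u2 u4.
  by rewrite ler_norml; apply/andP; split; lra.
have sky : side k <= 1 + eucl_norm y.
  case: ly => [k0|/far_norm]; last by move=> h; apply: le_trans h _; rewrite lerDr.
  by apply: (@le_trans _ _ 1); [rewrite -(side0 R); exact: side_le|rewrite lerDl].
have xy_norm : expR 1 + eucl_norm x <= (2 * n%:R + 1) * (expR 1 + eucl_norm y).
  have : eucl_norm x <= n%:R * (2 * eucl_norm y + 1).
    apply: eucl_norm_le => [|i]; first by rewrite addr_ge0// mulr_ge0.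
    rewrite -[tnth x i](subrK (tnth y i)); apply: le_trans (ler_normD _ _) _.
    have := cd i; have := eucl_norm_ge y i; lra.
  have : 0 <= n%:R :> R by [].
  move: (n%:R : R) (eucl_norm x) (eucl_norm y) ny0 (expR 1 : R) e1 => N X Y Y0 e e1 N0 h.
  have : N <= N * (2 * e) by rewrite ler_peMr//; lra.
  by move: h; rewrite mulrDr mulr1 !mulrDl !mulrDr; lra.
have aK : a <= K1 * b.
  have : a <= ln (2 * n%:R + 1) + b.
    rewrite -lnM ?posrE; last 2 first.
    - by rewrite (lt_le_trans ltr01).
    - by rewrite ltr_wpDr ?expR_gt0.
    rewrite ler_ln ?posrE//; first by rewrite ltr_wpDr ?expR_gt0.
    by rewrite mulr_gt0// ?ltr_wpDr ?expR_gt0// (lt_le_trans ltr01).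
  have h5 : ln (2 * n%:R + 1) <= ln (2 * n%:R + 1) * b by rewrite ler_peMr.
  by move=> h; rewrite /K1 mulrDl; lra.
have hab : `|p x - p y| <= C / a + C / b.
  rewrite -(subrKA pinf); apply: le_trans (ler_normD _ _) _.
  by apply: lerD; [exact: h2|rewrite distrC; exact: h2].
have a0 : 0 < a by exact: lt_le_trans a1.
have b0 : 0 < b by exact: lt_le_trans b1.
have K10 : 0 < K1 by rewrite ltr_wpDl.
rewrite mulrDr; apply: lerD.
  apply: (@le_trans _ _ ((C / a + C / b) * a)); first by rewrite ler_wpM2r// ltW.
  rewrite mulrDl divfK ?gt_eqF// mulrDr mulr1 lerD2l -mulrA ler_pM2l//.
  by rewrite mulrC ler_pdivrMr.
have hC : `|p x - p y| <= 2 * C.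
  apply: le_trans hab _; rewrite mulr_natl mulr2n; apply: lerD.
    by rewrite ler_pdivrMr// ler_peMr// ltW.
  by rewrite ler_pdivrMr// ler_peMr// ltW.
(* Below [2 * cN] the bound [2 * C] on the difference is enough; above it the points are closer than
   1 / 2 and minus the logarithm of their distance is at least s / 2. *)
have [s2|s2] := leP (2 * cN) s; last first.
  apply: (@le_trans _ _ (2 * C * (2 * cN))).
    by apply: ler_pM => //; exact: ltW.
  by rewrite ler_wpDl ?mulr_ge0 ?(ltW C0)//; lra.
have [sz|sz] := leP s 0.
  have -> : s = 0 by lra.
  by rewrite mulr0 addr_ge0// !mulr_ge0 ?(ltW C0).
have sE : s = - ln (side k).
  by move: sz; rewrite /s lt_max ltxx/= => h; apply/max_idPr; exact: ltW.
apply: (@le_trans _ _ (2 * C)); last by rewrite lerDl !mulr_ge0 ?(ltW C0).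
have hd : eucl_dist x y <= (n%:R + 1) * side k.
  apply: le_trans (eucl_dist_le (ltW sk0) cd) _.
  by rewrite ler_pM2r// lerDl.
have [d0|d0] := leP (eucl_dist x y) 0.
  have d2 : eucl_dist x y < 1 / 2 by apply: (le_lt_trans d0); lra.
  have := h1 x y d2; rewrite ln0// oppr0 invr0 mulr0 => h.
  have -> : `|p x - p y| = 0 by apply/le_anti; rewrite h normr_ge0.
  by rewrite mul0r mulr_ge0// ltW.
have lnd : ln (eucl_dist x y) <= ln (n%:R + 1) - s.
  have n1 : 0 < n%:R + 1 :> R by rewrite ltr_wpDl.
  rewrite sE opprK -lnM ?posrE// ler_ln ?posrE//.
  exact: mulr_gt0.
have lnc : ln (n%:R + 1 : R) + ln 2 = cN.
  by rewrite /cN lnM ?posrE ?ltr_wpDl// addrC.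
have ln2 : 0 < ln 2 :> R by rewrite ln_gt0// ltr1n.
have d2 : eucl_dist x y < 1 / 2.
  by rewrite -ltr_ln ?posrE ?divr_gt0// div1r lnV ?posrE//; lra.
apply: (@le_trans _ _ (C / - ln (eucl_dist x y) * s)).
  by apply: ler_wpM2r => //; exact: h1.
have ld0 : 0 < - ln (eucl_dist x y) by lra.
rewrite mulrAC ler_pdivrMr// -mulrA mulrCA ler_pM2l//; lra.
Qed.

End log_holder.

(** * Weighted oscillation and summation over the scales *)

Section weight_norms.
Context (R : realType) (n m : nat).
Local Notation E := (Rn R n).
Local Notation mu := (@leb R n).
Local Notation side := (side R).
Local Notation dcube := (dcube (@didx R n)).
Local Notation dvol := (dvol R n).
Implicit Types (x y : E) (k : int).
Variables (q om : E -> R) (w s : 'I_m -> E -> R) (M A q0 q1 : R).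
Hypotheses (hn : (0 < n)%N) (mq : measurable_fun [set: E] q)
  (mom : measurable_fun [set: E] om) (mw : forall i, measurable_fun [set: E] (w i))
  (ms : forall i, measurable_fun [set: E] (s i)) (om0 : forall x, 0 < om x)
  (w0 : forall i x, 0 < w i x) (q00 : 0 < q0) (q0q : forall x, q0 <= q x)
  (qq1 : forall x, q x <= q1) (s0 : forall i x, 0 < s i x) (M0 : 0 < M) (A0 : 0 < A)
  (prod1 : forall x, om x * \prod_(i < m) w i x = 1)
  (expM : forall x, (q x)^-1 + \sum_(i < m) (s i x)^-1 = M).
Hypothesis (hA : forall x (r : R), 0 < r -> exists (lam : R) (sig : 'I_m -> R),
   [/\ 0 < lam /\ (forall i, 0 < sig i),
       (modular mu q om (eucl_ball x r) lam <= 1)%E,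
       forall i, (modular mu (s i) (w i) (eucl_ball x r) (sig i) <= 1)%E &
       fine (mu (eucl_ball x r)) `^ (- M) * (lam * \prod_(i < m) sig i) <= A]).

Local Notation mod := (modular mu q om).

Let q_gt0 x : 0 < q x. Proof. exact: lt_le_trans (q0q x). Qed.
Let om_ge0 x : 0 <= om x. Proof. exact: ltW. Qed.

Definition nrm (X : set E) : R := fine (mnorm mu q om X).

Let mball k x : measurable (eucl_ball x (brad R n k)).
Proof. exact: measurable_ball (brad_gt0 _ _ _). Qed.

Lemma mnorm_tcube_fin k x (X : set E) : measurable X -> X `<=` tcube k x ->
  (mnorm mu q om X < +oo)%E.
Proof.
move=> mX Xt; have [lam [sig [[lam0 _] h _ _]]] := hA x (brad_gt0 R n k).
apply: (@le_lt_trans _ _ lam%:E); last by rewrite ltry.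
apply: mnorm_le => //; apply: le_trans h.
apply: modular_sub => //; exact: subset_trans Xt (@tcube_ball R n k x).
Qed.

Lemma nrmE k x (X : set E) : measurable X -> X `<=` tcube k x ->
  mnorm mu q om X = (nrm X)%:E.
Proof.
move=> mX Xt; rewrite fineK// ge0_fin_numE ?mnorm_ge0//.
exact: mnorm_tcube_fin Xt.
Qed.

Lemma nrm_gt0 k x (X : set E) : measurable X -> X `<=` tcube k x -> (0 < mu X)%E ->
  0 < nrm X.
Proof.
move=> mX Xt X0; rewrite -lte_fin -(nrmE mX Xt).
exact: (mnorm_gt0 mq mom om_ge0 q_gt0 q00 q0q mX (fun y _ => om0 y) X0).
Qed.

Lemma nrm_le k x (X Y : set E) : measurable X -> measurable Y -> X `<=` Y ->
  Y `<=` tcube k x -> nrm X <= nrm Y.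
Proof.
move=> mX mY XY Yt; rewrite -lee_fin -(nrmE mY Yt) -(nrmE mX (subset_trans XY Yt)).
exact: (mnorm_sub mu mq mom mX mY XY).
Qed.

Lemma mod_le1 k x (X : set E) (l : R) : measurable X -> X `<=` tcube k x -> nrm X < l ->
  (mod X l <= 1)%E.
Proof.
move=> mX Xt h; apply: (modular_le1 om_ge0 q_gt0).
by rewrite (nrmE mX Xt) lte_fin.
Qed.

Lemma nrm_le_mod k x (X : set E) (l : R) : measurable X -> X `<=` tcube k x -> 0 < l ->
  (mod X l <= 1)%E -> nrm X <= l.
Proof. by move=> mX Xt l0 h; rewrite -lee_fin -(nrmE mX Xt); exact: mnorm_le. Qed.

Lemma leb_fine k x (X : set E) : measurable X -> X `<=` tcube k x ->
  mu X = (fine (mu X))%:E.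
Proof.
move=> mX Xt; rewrite fineK// ge0_fin_numE//; apply: (@le_lt_trans _ _ (mu (tcube k x))).
  by rewrite le_measure ?inE//; exact: measurable_tcube.
by rewrite leb_tcube ltry.
Qed.

(** Hoelder's inequality on [F] bounds its measure by the norms of [om] on [F] and of the [w i] on a
    ball around 3Q; the weight condition on that ball trades the latter for the norm of [om] on
    3Q. *)
Lemma A_infty : exists2 C1 : R, 1 <= C1 & forall k x (F : set E) (l : R), measurable F ->
  F `<=` tcube k x -> 0 < l -> (mod F l <= 1)%E ->
  nrm (tcube k x) * (fine (mu F) / dvol k) `^ M <= C1 * l.
Proof.
(* [D * dvol k] bounds the volume of a ball of radius [brad]. *)
pose D : R := (2 * (2 * n%:R + 1)) ^+ n.
have D0 : 0 < D by rewrite exprn_gt0// mulr_gt0// ltr_wpDl.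
pose C1 := (m.+1%:R * D) `^ M * A.
have C10 : 0 < C1 by rewrite mulr_gt0// powR_gt0// mulr_gt0.
exists (C1 + 1); first by rewrite lerDr ltW.
move=> k x F l mF Ft l0 hF.
have [lam [sig [[lam0 sig0] hlam hsig hAl]]] := hA x (brad_gt0 R n k).
have tb := @tcube_ball R n k x; have mt := @measurable_tcube R n k x.
have Fb := subset_trans Ft tb.
have hs i : (modular mu (s i) (w i) F (sig i) <= 1)%E.
  by apply: le_trans (hsig i); apply: modular_sub.
have hmu : fine (mu F) <= m.+1%:R * (l * \prod_(i < m) sig i) `^ M^-1.
  rewrite -lee_fin -(leb_fine mF Ft).
  exact: (holder_weights mF mom mq mw ms om0 w0 q_gt0 s0 M0 l0 sig0 prod1 expM hF hs).
have ntl : nrm (tcube k x) <= lam.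
  have h2 : (modular mu q om (tcube k x) lam <= 1)%E.
    exact: le_trans (modular_sub mu mq mom lam mt (mball k x) tb) hlam.
  exact: (nrm_le_mod mt (@subset_refl _ _) lam0 h2).
set b := fine (mu (eucl_ball _ _)) in hAl.
have bE : mu (eucl_ball x (brad R n k)) = b%:E.
  by rewrite /b fineK// leb_ball_fin// brad_gt0.
have b0 : 0 < b by rewrite -lte_fin -bE leb_ball_gt0// brad_gt0.
have bD : b <= D * dvol k.
  rewrite -lee_fin -bE; apply: le_trans (leb_ball_le x (brad_gt0 R n k)) _.
  by rewrite lee_fin /brad /D mulrA exprMn.
have P0 : 0 < \prod_(i < m) sig i by apply: prodr_gt0 => i _; exact: sig0.
have {}hAl : lam * \prod_(i < m) sig i <= A * b `^ M.
  by move: hAl; rewrite powRN mulrC ler_pdivrMr ?powR_gt0.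
set f := fine (mu F) in hmu *.
have f0 : 0 <= f by apply: fine_ge0.
have fM : f `^ M <= m.+1%:R `^ M * (l * \prod_(i < m) sig i).
  apply: le_trans (le_powR (ltW M0) f0 hmu) _.
  rewrite powRM ?powR_ge0// -powRrM mulVf ?gt_eqF// powRr1//.
  by rewrite mulr_ge0 ?ltW.
have v0 := dvol_gt0 R n k.
rewrite powRM ?invr_ge0 ?(ltW v0)//.
have vM : 0 < dvol k `^ M by rewrite powR_gt0.
have -> : (dvol k)^-1 `^ M = (dvol k `^ M)^-1.
  by rewrite -powR_inv1 ?(ltW v0)// powRAC powR_inv1// powR_ge0.
rewrite mulrA ler_pdivrMr//.
apply: (@le_trans _ _ (lam * (m.+1%:R `^ M * (l * \prod_(i < m) sig i)))).
  by apply: ler_pM => //; rewrite ?powR_ge0//; apply: fine_ge0; exact: mnorm_ge0.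
have -> : lam * (m.+1%:R `^ M * (l * \prod_(i < m) sig i)) =
    m.+1%:R `^ M * l * (lam * \prod_(i < m) sig i) by ring.
apply: (@le_trans _ _ (m.+1%:R `^ M * l * (A * (D * dvol k) `^ M))).
  apply: ler_wpM2l; first by rewrite mulr_ge0 ?powR_ge0 ?ltW.
  apply: le_trans hAl _; apply: ler_wpM2l; first exact: ltW.
  by apply: le_powR => //; exact: ltW.
rewrite powRM ?(ltW D0) ?(ltW v0)//.
have -> : m.+1%:R `^ M * l * (A * (D `^ M * dvol k `^ M)) = C1 * l * dvol k `^ M.
  by rewrite /C1 powRM ?(ltW D0)//; ring.
by rewrite ler_pM2r// ler_pM2r// lerDl.
Qed.

Lemma A_infty' : exists2 C1 : R, 1 <= C1 & forall k x (F : set E), measurable F ->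
  F `<=` tcube k x -> (0 < mu F)%E ->
  nrm (tcube k x) * (fine (mu F) / dvol k) `^ M <= C1 * nrm F.
Proof.
have [C1 C11 h] := A_infty.
exists (2 * C1).
  by move: C11 => ?; lra.
move=> k x F mF Ft F0; have nF0 := nrm_gt0 mF Ft F0.
have nF2 : nrm F < 2 * nrm F by rewrite mulr_natl mulr2n ltrDl.
have l0 := lt_trans nF0 nF2.
have := h k x F (2 * nrm F) mF Ft l0 (mod_le1 mF Ft nF2).
by rewrite mulrA [C1 * 2]mulrC.
Qed.

(** Doubling puts the scale strictly above the norm, where the modular is at most 1. *)
Definition lam k x : R := 2 * nrm (dcube k x).

Lemma lam_eq k x y : dcube k x y -> lam k y = lam k x.
Proof. by move=> xy; rewrite /lam (eq_dcube xy). Qed.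

Let dpos k x : (0 < mu (dcube k x))%E.
Proof. by rewrite leb_dcube lte_fin dvol_gt0. Qed.

Lemma nrm_dcube_gt0 k x : 0 < nrm (dcube k x).
Proof. exact: (nrm_gt0 (measurable_ddcube k x) (@sub_dcube_tcube R n k x) (dpos k x)). Qed.

Lemma lam_gt0 k x : 0 < lam k x.
Proof. by rewrite mulr_gt0// nrm_dcube_gt0. Qed.

Lemma mod_lam k x (F : set E) : measurable F -> F `<=` dcube k x ->
  (mod F (lam k x) <= 1)%E.
Proof.
move=> mF Fd; have md := @measurable_ddcube R n k x.
apply: (@le_trans _ _ (mod (dcube k x) (lam k x))).
  exact: (modular_sub mu mq mom (lam k x) mF md Fd).
apply: (mod_le1 md (@sub_dcube_tcube R n k x)).
by rewrite /lam mulr_natl mulr2n ltrDl nrm_dcube_gt0.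
Qed.

Lemma mod_compl_ge : exists2 c : R, 0 < c < 1 & forall k x (F : set E), measurable F ->
  F `<=` dcube k x -> (mu F <= (dvol k / 2)%:E)%E ->
  (c%:E <= mod (dcube k x `\` F) (lam k x))%E.
Proof.
have [C1 C11 h] := A_infty; have C10 : 0 < C1 by apply: lt_le_trans C11.
have q10 : 0 < q1 by apply: lt_le_trans q00 _; apply: le_trans (q0q [tuple 0 | i < n]) (qq1 _).
(* With this value [C1 * (lam k x * K)] is half of the norm on the cube times 2^-M, which gives a
   strict contradiction. *)
pose K : R := 2^-1 `^ M / (4 * C1).
have h21 : (2^-1 : R) `^ M < 1.
  by apply: powR_lt1 => //; lra.
have K0 : 0 < K by rewrite divr_gt0 ?powR_gt0 ?mulr_gt0.
have K1 : K < 1 by rewrite ltr_pdivrMr ?mulr_gt0// mul1r; lra.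
exists (K `^ q1).
  by rewrite powR_gt0//= powR_lt1// ltW.
move=> k x F mF Fd hF; rewrite leNgt; apply/negP => hc.
have md := @measurable_ddcube R n k x; have mt := @measurable_tcube R n k x.
have dt := @sub_dcube_tcube R n k x.
set G := dcube k x `\` F in hc; have mG : measurable G by exact: measurableD.
have Gd : G `<=` dcube k x by move=> y [].
have Gt := subset_trans Gd dt.
have lK0 : 0 < lam k x * K by rewrite mulr_gt0 ?lam_gt0.
have hG : (mod G (lam k x * K) <= 1)%E.
  apply: (@le_trans _ _ ((K `^ (- q1))%:E * mod G (lam k x))%E).
    apply: (modular_scale mu mq mom om_ge0 mG (lam_gt0 k x) K0 (powR_ge0 _ _)) => y _.
    by rewrite !powRN lef_pV2 ?posrE ?powR_gt0// ger_powR// K0 ltW.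
  apply: (@le_trans _ _ ((K `^ (- q1))%:E * (K `^ q1)%:E)%E).
    by apply: lee_wpmul2l; rewrite ?lee_fin ?powR_ge0// ltW.
  by rewrite -EFinM -powRD_gt0// addNr powRr0.
have := h k x G _ mG Gt lK0 hG.
have Ge : mu (dcube k x) = (mu F + mu G)%E.
  rewrite -measureU//; last by rewrite setDIK.
  by rewrite setDUK.
have hmG : dvol k / 2 <= fine (mu G).
  have v0 := dvol_gt0 R n k.
  rewrite leb_dcube (leb_fine mG Gt) (leb_fine mF (subset_trans Fd dt)) -EFinD in Ge.
  move: hF; case: Ge => Ge; rewrite (leb_fine mF (subset_trans Fd dt)) lee_fin; lra.
rewrite leNgt => /negP; apply.
have nt0 : 0 < nrm (tcube k x) by apply: lt_le_trans (nrm_dcube_gt0 k x) (nrm_le md mt dt (@subset_refl _ _)).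
apply: (@lt_le_trans _ _ (nrm (tcube k x) * 2^-1 `^ M)).
  apply: (@le_lt_trans _ _ (nrm (tcube k x) * (2^-1 `^ M / 2))).
    rewrite /K /lam.
    have -> : C1 * (2 * nrm (dcube k x) * (2^-1 `^ M / (4 * C1))) = nrm (dcube k x) * (2^-1 `^ M / 2).
      by field; rewrite gt_eqF.
    apply: ler_wpM2r; first by rewrite divr_ge0 ?powR_ge0.
    exact: (nrm_le md mt dt (@subset_refl _ _)).
  by rewrite ltr_pM2l// ltr_pdivrMr// ltr_pMr ?powR_gt0// ltr1n.
apply: ler_wpM2l; first exact: ltW.
apply: le_powR; rewrite ?invr_ge0 ?(ltW M0)// ler_pdivlMr ?dvol_gt0//.
by rewrite mulrC.
Qed.

Lemma dvol_half k : dvol k <= dvol (k + 1) / 2.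
Proof.
rewrite (dvolS R n (k + 1)) addrK; have := dvol_gt0 R n k => v0.
rewrite ler_pdivlMr// mulrC ler_pM2r// -[leLHS]expr1 ler_eXn2l// ltr1n//.
Qed.

(** A child fills at most half of its parent, as [n] is positive. The rest of the parent keeps
    modular [c], so the child has at most 1 - c, and the scale can shrink by [g] before its modular
    reaches 1. *)
Lemma lam_step : exists2 g : R, 0 < g < 1 & forall k x, lam k x <= g * lam (k + 1) x.
Proof.
have [c /andP[c0 c1] hc] := mod_compl_ge.
have q10 : 0 < q1 by apply: lt_le_trans q00 _; apply: le_trans (q0q [tuple 0 | i < n]) (qq1 _).
pose g := (1 - c) `^ q1^-1.
have c1' : 0 < 1 - c by rewrite subr_gt0.
have g0 : 0 < g by rewrite powR_gt0.
have g1 : g < 1 by apply: powR_lt1; rewrite ?invr_gt0 ?(ltW c1')// gtrBl.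
have gq : g `^ q1 = 1 - c by rewrite -powRrM mulVf ?gt_eqF// powRr1// ltW.
exists g; first by rewrite g0.
move=> k x; rewrite /lam mulrCA ler_pM2l//.
have md := @measurable_ddcube R n k x; have mQ := @measurable_ddcube R n (k + 1) x.
have dt := @sub_dcube_tcube R n k x; have Qt := @sub_dcube_tcube R n (k + 1) x.
have dQ : dcube k x `<=` dcube (k + 1) x.
  by apply: (sub_dcube (@didx_nest R n)); rewrite ?lerDl//; exact: dcube_refl.
rewrite -ler_pdivrMl//; apply/ler_addgt0Pr => e e0.
have N0 := nrm_dcube_gt0 (k + 1) x.
(* Strictly above the norm of the parent but at most [lam], so that both modular bounds are
   available. *)
pose l := nrm (dcube (k + 1) x) + Num.min e (nrm (dcube (k + 1) x)).
have m0 : 0 < Num.min e (nrm (dcube (k + 1) x)) by rewrite lt_min e0.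
have lN : nrm (dcube (k + 1) x) < l by rewrite ltrDl.
have l0 : 0 < l := lt_trans N0 lN.
have hl : l <= lam (k + 1) x by rewrite /lam mulr_natl mulr2n lerD2l ge_min lexx orbT.
apply: (@le_trans _ _ l); last by rewrite lerD2l ge_min lexx.
rewrite ler_pdivrMl// mulrC.
have lg0 : 0 < l * g by rewrite mulr_gt0.
apply: (nrm_le_mod md dt lg0).
have h1 : (mod (dcube (k + 1) x) l <= 1)%E := mod_le1 mQ Qt lN.
rewrite (modular_setD mu mq mom l mQ md dQ) in h1.
have hv : (mu (dcube k x) <= (dvol (k + 1) / 2)%:E)%E by rewrite leb_dcube lee_fin dvol_half.
have h2 : (c%:E <= mod (dcube (k + 1) x `\` dcube k x) l)%E.
  apply: le_trans (hc (k + 1) x (dcube k x) md dQ hv) _.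
  exact: (modular_le mu om_ge0 q_gt0 _ l0 hl).
have h3 : (mod (dcube k x) l <= (1 - c)%:E)%E.
  rewrite EFinB leeBrDr//; apply: le_trans h1; exact: leeD2l.
have hp y : dcube k x y -> g `^ (- q y) <= (1 - c)^-1.
  move=> _; rewrite -gq -powRN ger_powR ?lerN2 ?qq1// g0 ltW//.
apply: le_trans (modular_scale mu mq mom om_ge0 md l0 g0 _ hp) _.
  by rewrite invr_ge0 ltW.
apply: le_trans (lee_wpmul2l _ h3) _; first by rewrite lee_fin invr_ge0 ltW.
by rewrite -EFinM mulVf// gt_eqF.
Qed.

Local Notation nearbox := (@nearbox R n).
Let z0 : E := [tuple 0 | i < n].

Let didx0 k : didx k z0 = [ffun=> 0].
Proof. by apply/ffunP => i; rewrite !ffunE tnth_mktuple mul0r floor0. Qed.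

Let nearbox_tcube (J : int) x : nearbox J x -> tcube J z0 x.
Proof.
move=> /nearboxE h i; rewrite didx0 [X in _ - X]ffunE subr0.
by have := h i; rewrite ler_norml; lia.
Qed.

Lemma nearbox_ex x : exists2 J : nat, nearbox J%:Z x &
  J = 0%N \/ ~ nearbox (J%:Z - 1) x.
Proof.
have hex : exists J : nat, `[< nearbox J%:Z x >].
  have [N hN] : exists N : nat, eucl_norm x < N%:R.
    exists (Num.bound (eucl_norm x)); apply: archi_boundP; exact: sqrtr_ge0.
  exists N; apply/asboolP => i.
  have := eucl_norm_ge x i => h; have hs : (N%:R : R) <= side N%:Z.
    by rewrite side_nat -natrX ler_nat ltnW// ltn_expl.
  have : `|tnth x i| < side N%:Z by apply: le_lt_trans h (lt_le_trans hN hs).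
  by rewrite ltr_norml => /andP[a ->]; rewrite (ltW a).
case: (ex_minnP hex) => J /asboolP hJ hmin; exists J => //.
case: J hJ hmin => [|J] hJ hmin; [by left|right => h].
have : (J < J)%N.
  by apply: hmin; apply/asboolP; rewrite -[J%:Z](_ : J.+1%:Z - 1 = _)//; lia.
by rewrite ltnn.
Qed.

(** The cube and the unit cube at the origin lie in a common triple cube at the origin whose side is
    at most of order e + |x|; there [A_infty] compares the norms up to a power of the ratio of the
    sides. *)
Lemma lam_poly : exists2 C : R, 0 < C & forall k x, local_cube k x ->
  `|ln (lam k x)| <= C * (ln (expR 1 + eucl_norm x) + Num.max 0 (- ln (side k))).
Proof.
have [C1 C11 h] := A_infty'; have C10 : 0 < C1 by apply: lt_le_trans C11.
have mt k x := @measurable_tcube R n k x.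
have md k x := @measurable_ddcube R n k x.
have tt k x : tcube k x `<=` tcube k x by [].
pose N0 := nrm (dcube 0 z0); have N00 : 0 < N0 := nrm_dcube_gt0 0 z0.
have d0J (J : nat) : dcube 0 z0 `<=` tcube J z0.
  move=> y hy; apply: nearbox_tcube; apply: (@nearbox_le R n 0 J) => //.
  by apply/nearboxE => i; rewrite (hy : _ = _) didx0 ffunE; lia.
have ln2 : 0 < ln 2 :> R by rewrite ln_gt0// ltr1n.
have lC1 : 0 <= ln C1 by rewrite ln_ge0.
have Mn0 : 0 <= M * n%:R by rewrite mulr_ge0// ltW.
pose C := ln 2 + `|ln N0| + ln C1 + M * n%:R * ln 2 + M * n%:R.
have C0 : 0 < C by rewrite /C; have := normr_ge0 (ln N0); nra.
exists C => // k x lkx.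
have [J hJ hJ'] := nearbox_ex x.
set Lx := ln (expR 1 + eucl_norm x); set mx := Num.max 0 _.
have nx0 : 0 <= eucl_norm x := sqrtr_ge0 _.
have Lx1 : 1 <= Lx.
  by rewrite /Lx -[leLHS](@expRK R) ler_ln ?posrE ?expR_gt0 ?ltr_wpDr ?expR_gt0// lerDl.
have mx0 : 0 <= mx by rewrite le_max lexx.
have mxk : - ln (side k) <= mx by rewrite le_max lexx orbT.
have e1 : 1 <= expR 1 :> R by apply: le_trans (expR_ge1Dx 1); rewrite lerDl.
have sJ : side J <= 2 * (expR 1 + eucl_norm x).
  case: hJ' => [->|/far_norm h']; first by rewrite side0; lra.
  rewrite -[J%:Z](subrK 1) sideD side1; lra.
have lsJ : ln (side J) <= ln 2 + Lx.
  have ex0 : 0 < expR 1 + eucl_norm x by lra.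
  rewrite -lnM ?posrE//; apply: (le_trans _ (lexx _)).
  by rewrite ler_ln ?posrE ?side_gt0 ?mulr_gt0.
have kJ : (k <= J%:Z)%R.
  case: lkx => [k0|nk]; first by apply: le_trans k0 _.
  by rewrite leNgt; apply/negP => /ltW Jk; apply: nk; exact: nearbox_le Jk _ hJ.
have dJ : dcube k x `<=` tcube J z0.
  apply: (@subset_trans _ (dcube J x)); last exact: sub_tcubeS (nearbox_tcube hJ).
  by apply: (sub_dcube (@didx_nest R n) kJ); exact: dcube_refl.
have dpos' k' x' := dpos k' x'.
have hlow := h J z0 (dcube k x) (md k x) dJ (dpos k x).
have hup := h J z0 (dcube 0 z0) (md 0 z0) (@d0J J) (dpos 0 z0).
have n1 : nrm (dcube k x) <= nrm (tcube J z0) := nrm_le (md _ _) (mt J z0) dJ (tt _ _).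
have n2 : N0 <= nrm (tcube J z0) := nrm_le (md _ _) (mt J z0) (@d0J J) (tt _ _).
rewrite !leb_dcube /fine in hlow hup.
have N1 := nrm_dcube_gt0 k x; have vk := dvol_gt0 R n k; have vJ := dvol_gt0 R n J.
have lnv k' : ln (dvol k') = n%:R * ln (side k').
  by rewrite /dvol lnXn ?side_gt0// mulr_natl.
have nt0 := lt_le_trans N00 n2.
have lo := ln_powR_le N00 C10 N1 vk vJ (le_trans (ler_wpM2r (powR_ge0 _ _) n2) hlow).
have up := ln_powR_le nt0 C10 N00 (dvol_gt0 R n 0) vJ hup.
have nle : ln (nrm (dcube k x)) <= ln (nrm (tcube J z0)).
  by move: n1 N1 nt0; move: (nrm _) (nrm _) => u v uv u0 v0; rewrite ler_ln ?posrE.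
rewrite !lnv -mulrBr mulrA in lo; rewrite !lnv side0 ln1 -mulrBr mulrA in up.
have lamE : ln (lam k x) = ln 2 + ln (nrm (dcube k x)).
  by rewrite /lam; move: (nrm _) N1 => u u0; rewrite lnM ?posrE.
rewrite lamE; exact: (poly_log_bound (ltW ln2) lC1 Mn0 Lx1 mx0 mxk lsJ lo up nle).
Qed.

Hypothesis hLH : exists2 C : R, 0 < C & forall k x y, local_cube k x -> dcube k x y ->
  `|q x - q y| * (ln (expR 1 + eucl_norm x) + Num.max 0 (- ln (side k))) <= C.

(** The logarithm of [lam] has exactly the size that [hLH] absorbs. *)
Lemma lam_local : exists2 C : R, 1 <= C & forall k x y, local_cube k x -> dcube k x y ->
  lam k x `^ q y <= C * lam k x `^ q x /\ lam k x `^ q x <= C * lam k x `^ q y.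
Proof.
have [C C0 h] := lam_poly; have [D D0 h'] := hLH.
have CD0 : 0 < C * D by rewrite mulr_gt0.
exists (expR (C * D)); first by rewrite -[leLHS](@expR0 R) ler_expR ltW.
move=> k x y lkx xy; have l0 := lam_gt0 k x.
have key : `|(q y - q x) * ln (lam k x)| <= C * D.
  rewrite normrM distrC; have h1 := h k x lkx; have h2 := h' k x y lkx xy.
  set S := ln (expR 1 + _) + _ in h1 h2.
  apply: (@le_trans _ _ (`|q x - q y| * (C * S))); first by rewrite ler_wpM2l.
  by rewrite mulrCA ler_wpM2l// ltW.
have hE a b : a * ln (lam k x) - b * ln (lam k x) <= C * D ->
    lam k x `^ a <= expR (C * D) * lam k x `^ b.
  by move=> hab; rewrite /powR gt_eqF// -expRD ler_expR; lra.
move: key; rewrite ler_norml mulrBl => /andP[k1 k2].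
by split; apply: hE; lra.
Qed.

(** The density omega^q normalized to the cube: by [mod_lam] its integral there is at most 1. *)
Definition kap k x y : R := (om y / lam k x) `^ q y.

Lemma kap_ge0 k x y : 0 <= kap k x y. Proof. exact: powR_ge0. Qed.

Lemma measurable_kap k x (D : set E) : measurable_fun D (fun y => (kap k x y)%:E).
Proof. exact: measurable_modular. Qed.

Let V y := om y `^ q y.

Let V0 y : 0 <= V y. Proof. exact: powR_ge0. Qed.
Let mV : measurable_fun [set: E] V. Proof. exact: measurable_powR2. Qed.

Let VE k x y : V y = lam k x `^ q y * kap k x y.
Proof.
rewrite /V /kap -powRM ?divr_ge0 ?om_ge0 ?(ltW (lam_gt0 k x))//.
by rewrite mulrC divfK// gt_eqF// lam_gt0.
Qed.

(** On local cubes [kap] is a constant multiple of [V] up to bounded factors. The John-Nirenberg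
    argument needs one density for a cube and all its subcubes, which [V] is and [kap] is not. *)
Let kapV : exists2 C : R, 1 <= C & forall k x y, local_cube k x -> dcube k x y ->
  V y <= C * lam k x `^ q x * kap k x y /\ lam k x `^ q x * kap k x y <= C * V y.
Proof.
have [C C1 h] := lam_local; exists C => // k x y lkx xy.
have [h1 h2] := h k x y lkx xy; have kk := kap_ge0 k x y.
rewrite (VE k x); split; first by rewrite ler_wpM2r.
by rewrite mulrA ler_wpM2r.
Qed.

Let mkap k x : measurable_fun [set: E] (kap k x).
Proof. by apply/measurable_EFinP; exact: measurable_kap. Qed.

Lemma V_bounds : exists2 C : R, 1 <= C & forall k x (F : set E), local_cube k x ->
  measurable F -> F `<=` dcube k x ->
  (\int[mu]_(y in F) (V y)%:E <= (C * lam k x `^ q x)%:E * mod F (lam k x))%E /\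
  ((lam k x `^ q x)%:E * mod F (lam k x) <= C%:E * \int[mu]_(y in F) (V y)%:E)%E.
Proof.
have [C C1 h] := kapV; exists C => // k x F lkx mF Fd.
have C0 : 0 <= C by apply: le_trans C1.
rewrite -(integralZl_real mu mF C0 mV V0) -[modular _ _ _ _ _]/(\int[mu]_(y in F) (kap k x y)%:E)%E.
have p0 : 0 <= lam k x `^ q x by exact: powR_ge0.
rewrite -(integralZl_real mu mF (mulr_ge0 C0 p0) (mkap k x) (kap_ge0 k x)).
rewrite -(integralZl_real mu mF p0 (mkap k x) (kap_ge0 k x)).
split; apply: ge0_le_integral_nomeas => y Fy; rewrite lee_fin.
- exact: V0.
- exact: (h k x y lkx (Fd y Fy)).1.
- by rewrite mulr_ge0// kap_ge0.
- exact: (h k x y lkx (Fd y Fy)).2.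
Qed.

Lemma V_small : exists2 c : R, 0 < c < 1 & forall k x (F : set E), local_cube k x ->
  measurable F -> F `<=` dcube k x -> (mu F <= (dvol k / 2)%:E)%E ->
  (\int[mu]_(y in F) (V y)%:E <= (1 - c)%:E * \int[mu]_(y in dcube k x) (V y)%:E)%E.
Proof.
have [C C1 h] := V_bounds; have C0 : 0 < C by apply: lt_le_trans C1.
have [c /andP[c0 c1] hc] := mod_compl_ge.
have CC1 : 1 <= C * C by rewrite -[leLHS]mulr1 ler_pM.
exists (c / (C * C)).
  rewrite divr_gt0 ?mulr_gt0//= ltr_pdivrMr ?mulr_gt0// mul1r.
  exact: lt_le_trans c1 _.
move=> k x F lkx mF Fd hF.
have md := @measurable_ddcube R n k x.
have mG : measurable (dcube k x `\` F) by exact: measurableD.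
have Gd : dcube k x `\` F `<=` dcube k x by move=> y [].
have h1 := (h k x _ lkx md (@subset_refl _ _)).1.
have h2 := (h k x _ lkx mG Gd).2.
have h3 := hc k x F mF Fd hF.
have h4 := mod_lam md (@subset_refl _ (dcube k x)).
have QE := integral_setDE mu md mF Fd mV V0.
have i1 : (0 <= \int[mu]_(y in F) (V y)%:E)%E.
  by apply: integral_ge0 => y _; rewrite lee_fin; exact: V0.
have i2 : (0 <= \int[mu]_(y in dcube k x `\` F) (V y)%:E)%E.
  by apply: integral_ge0 => y _; rewrite lee_fin; exact: V0.
have l0 : 0 < lam k x `^ q x by exact: powR_gt0 (lam_gt0 k x).
exact: (small_part_le C1 l0 c0 i1 i2 QE h1 h2 h3 h4).
Qed.

(** * John-Nirenberg inequalities with the weight *)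

Local Notation davg := (davg mu (@didx R n) dvol).

(** Oscillation normalized to 1; the last clause serves the passage between neighbours inside 3Q. *)
Definition dyadic_bmo (b : E -> R) : Prop :=
  [/\ measurable_fun [set: E] b, forall k x, mu.-integrable (dcube k x) (EFin \o b),
      forall k x, (\int[mu]_(y in dcube k x) `|b y - davg b k x|%:E <= (dvol k)%:E)%E &
      forall k x y, tcube k x y -> `|davg b k y - davg b k x| <= 1].

Let dcube_JN (V' : E -> R) (c eps : R) (L : int -> E -> Prop) (b : E -> R) :
  dyadic_bmo b -> (forall y, 0 <= V' y) -> measurable_fun [set: E] V' -> 0 < c -> c < 1 ->
  0 <= eps -> (forall (j : int) k x y, L k x -> (j <= k)%R -> dcube k x y -> L j y) ->
  (forall k x, L k x -> (\int[mu]_(y in dcube k x) (V' y)%:E < +oo)%E) ->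
  (forall k x F, L k x -> measurable F -> F `<=` dcube k x -> (mu F <= (dvol k / 2)%:E)%E ->
    (\int[mu]_(y in F) (V' y)%:E <= (1 - c)%:E * \int[mu]_(y in dcube k x) (V' y)%:E)%E) ->
  expR (eps * (2 + 2 ^+ n)) * (1 - c) <= 1 - c / 2 -> forall k x, L k x ->
  (\int[mu]_(y in dcube k x) (expR (eps * `|b y - davg b k x|) * V' y)%:E <=
   (expR (2 * eps) * (2 / c))%:E * \int[mu]_(y in dcube k x) (V' y)%:E)%E.
Proof.
move=> [mb ib osc _]; apply: (john_nirenberg (@didx_measurable R n) (@didx_nest R n)
  (@dvol_gt0 R n) (@leb_dcube R n) _ (@dvolS R n) _ mb ib osc).
- by move=> k x P eta mP PQ e0; exact: dcube_approx.
- by rewrite -natrX ler1n expn_gt0.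
Qed.

Let eps_choice (c : R) : 0 < c < 1 -> exists2 e0 : R, 0 < e0 &
  forall eps : R, eps <= e0 -> expR (eps * (2 + 2 ^+ n)) * (1 - c) <= 1 - c / 2.
Proof.
move=> /andP[c0 c1]; have K0 : 0 < 2 + 2 ^+ n :> R by rewrite ltr_wpDr ?exprn_ge0.
have r1 : 1 < (1 - c / 2) / (1 - c) by rewrite ltr_pdivlMr; lra.
exists (ln ((1 - c / 2) / (1 - c)) / (2 + 2 ^+ n)); first by rewrite divr_gt0// ln_gt0.
move=> eps he; rewrite -ler_pdivlMr; last by lra.
rewrite -[leRHS]lnK ?posrE; last by lra.
by rewrite ler_expR -ler_pdivlMr.
Qed.

Let JN_local : exists2 e0 : R, 0 < e0 & exists2 C : R, 0 <= C &
  forall eps b k x, 0 <= eps -> eps <= e0 -> dyadic_bmo b -> local_cube k x ->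
  (\int[mu]_(y in dcube k x) (expR (eps * `|b y - davg b k x|) * kap k x y)%:E <= C%:E)%E.
Proof.
have [c c01 hc] := V_small; have /andP[c0 c1] := c01.
have [e0 e00 he] := eps_choice c01.
have [CV CV1 hV] := V_bounds; have [CK CK1 hK] := kapV.
have CV0 : 0 <= CV by apply: le_trans CV1.
have CK0 : 0 <= CK by apply: le_trans CK1.
pose A' := expR (2 * e0) * (2 / c).
have A'0 : 0 <= A' by rewrite mulr_ge0 ?expR_ge0// divr_ge0 ?ltW.
exists e0 => //; exists (CK * A' * CV); first by do 2!apply: mulr_ge0 => //.
move=> eps b k x eps0 epse nb lkx.
have mb : measurable_fun [set: E] b by case: nb.
have md := @measurable_ddcube R n k x.
have dd := @subset_refl _ (dcube k x).
have Vle k' x' : local_cube k' x' ->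
    (\int[mu]_(y in dcube k' x') (V y)%:E <= (CV * lam k' x' `^ q x')%:E)%E.
  move=> l'; apply: le_trans (hV k' x' _ l' (@measurable_ddcube R n k' x') (@subset_refl _ _)).1 _.
  rewrite -[leRHS]mule1; apply: lee_wpmul2l; first by rewrite lee_fin mulr_ge0// powR_ge0.
  exact: (mod_lam (@measurable_ddcube R n k' x') (@subset_refl _ _)).
have Vfin k' x' : local_cube k' x' -> (\int[mu]_(y in dcube k' x') (V y)%:E < +oo)%E.
  by move=> l'; apply: le_lt_trans (Vle k' x' l') _; rewrite ltry.
have := dcube_JN nb V0 mV c0 c1 eps0 (@local_cube_down R n) Vfin hc (he eps epse) lkx.
have l0 : 0 < lam k x `^ q x by exact: powR_gt0 (lam_gt0 k x).
pose f y := expR (eps * `|b y - davg b k x|) * V y.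
have mf : measurable_fun [set: E] f.
  exact: (measurable_funM (measurable_expR_dist (davg b k x) eps mb) mV).
have f0 y : 0 <= f y by apply: mulr_ge0; [exact: expR_ge0|exact: V0].
rewrite -/(\int[mu]_(y in dcube k x) (f y)%:E)%E => h.
apply: (@le_trans _ _ (\int[mu]_(y in dcube k x) (CK / lam k x `^ q x * f y)%:E)%E).
  apply: ge0_le_integral_nomeas => y xy; rewrite lee_fin.
    by apply: mulr_ge0; [exact: expR_ge0|exact: kap_ge0].
  have := (hK k x y lkx xy).2; rewrite /f mulrCA => hh.
  apply: ler_wpM2l; first exact: expR_ge0.
  by rewrite mulrAC ler_pdivlMr// mulrC.
rewrite (integralZl_real mu md _ mf f0); last by rewrite divr_ge0// ltW.
apply: (@le_trans _ _ ((CK / lam k x `^ q x)%:E * (A'%:E * (CV * lam k x `^ q x)%:E))%E).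
  apply: lee_wpmul2l; first by rewrite lee_fin divr_ge0// ltW.
  apply: le_trans h _; apply: lee_pmul; rewrite ?lee_fin.
  - by rewrite mulr_ge0 ?expR_ge0// divr_ge0 ?ltW.
  - by apply: integral_ge0 => y _; rewrite lee_fin; exact: V0.
  - by rewrite /A'; apply: ler_wpM2r; rewrite ?divr_ge0 ?(ltW c0)// ler_expR ler_pM2l.
  - exact: Vle.
rewrite -!EFinM lee_fin le_eqVlt; apply/orP; left; apply/eqP; field.
by rewrite gt_eqF.
Qed.

Let le_absz (k : int) : (k <= `|k|%N%:Z)%R. Proof. by rewrite abszE ler_norm. Qed.

Let pred_le (k : int) (N : nat) : (k <= N.+1%:Z)%R -> (k - 1 <= N%:Z)%R.
Proof. by rewrite -addn1 PoszD -lerBlDr. Qed.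

Let powR_ratio_le (g a l1 l2 r r0 : R) : 0 < g -> g < 1 -> 0 <= a -> 0 < l1 -> 0 < l2 ->
  0 < r0 -> r0 <= r -> l2 <= g * l1 -> (a / l1) `^ r <= g `^ r0 * (a / l2) `^ r.
Proof.
move=> g0 g1 a0 l10 l20 r00 rr h; have r_0 := lt_le_trans r00 rr.
apply: (@le_trans _ _ ((g * (a / l2)) `^ r)).
  apply: le_powR (ltW r_0) _ _; first by rewrite divr_ge0 ?(ltW l10).
  rewrite mulrCA; apply: ler_wpM2l => //.
  by rewrite ler_pdivlMr// mulrC ler_pdivrMr.
rewrite powRM ?(ltW g0) ?divr_ge0 ?(ltW l20)//.
apply: ler_wpM2r; first exact: powR_ge0.
by rewrite ger_powR ?g0 ?(ltW g1).
Qed.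

Let JN_step (g : R) : 0 < g -> g < 1 -> (forall k x, lam k x <= g * lam (k + 1) x) ->
  forall (eps : R) b k x y, 0 <= eps -> dyadic_bmo b -> dcube k x y ->
  (\int[mu]_(z in dcube (k - 1) y) (expR (eps * `|b z - davg b k x|) * kap k x z)%:E <=
   (expR (eps * 2 ^+ n) * g `^ q0)%:E *
   \int[mu]_(z in dcube (k - 1) y) (expR (eps * `|b z - davg b (k - 1) y|) * kap (k - 1) y z)%:E)%E.
Proof.
move=> g0 g1 hg eps b k x y eps0 [mb ib osc _] xy.
have md := @measurable_ddcube R n (k - 1) y.
have m1 := measurable_funM (measurable_expR_dist (davg b (k - 1) y) eps mb) (mkap (k - 1) y).
have c0 : 0 <= expR (eps * 2 ^+ n) * g `^ q0 by apply: mulr_ge0; rewrite ?expR_ge0 ?powR_ge0.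
rewrite -(integralZl_real mu md c0 m1); last first.
  by move=> z; apply: mulr_ge0; [exact: expR_ge0|exact: kap_ge0].
apply: ge0_le_integral_nomeas => z yz; rewrite lee_fin.
  by apply: mulr_ge0; [exact: expR_ge0|exact: kap_ge0].
rewrite mulrACA -expRD; apply: ler_pM; rewrite ?expR_ge0 ?kap_ge0//.
  rewrite ler_expR -mulrDr; apply: ler_wpM2l => //.
  have hc := davg_child (@didx_measurable R n) (@didx_nest R n) (@dvol_gt0 R n)
    (@leb_dcube R n) (@dvolS R n) mb ib osc xy.
  apply: le_trans (ler_distD (davg b (k - 1) y) _ _) _.
  by rewrite addrC lerD2r.
have l1 := lam_gt0 k x; have l2 := lam_gt0 (k - 1) y.
have hl : lam (k - 1) y <= g * lam k x.
  by have := hg (k - 1) y; rewrite subrK (lam_eq xy).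
exact: (powR_ratio_le g0 g1 (om_ge0 z) l1 l2 q00 (q0q z) hl).
Qed.

(** Inside one parent the signs of the coordinates are fixed, and a sign pattern determines a cube
    of the smaller box. *)
Let nearbox_child k x y z : dcube k x y -> dcube k x z -> nearbox (k - 1) y ->
  nearbox (k - 1) z -> dcube (k - 1) y z.
Proof.
move=> xy xz /nearboxE hy /nearboxE hz; apply/ffunP => i.
have := hy i; have := hz i; have kyz : didx k y = didx k z by rewrite (xy : _ = _) (xz : _ = _).
move: (congr1 (fun f : {ffun 'I_n -> int} => f i) kyz).
have Sgn (z1 : E) : didx k z1 i < 0 <-> didx (k - 1) z1 i < 0.
  by rewrite !ffunE !floor_lt_int !ltr_pdivrMr ?side_gt0// !mul0r.
have := Sgn y; have := Sgn z.
move: (didx (k - 1) y i) (didx (k - 1) z i) (didx k y i) (didx k z i) => a b c e.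
move=> h1 h2 ce; rewrite ce in h2 => h3 h4.
case: (ltrP e 0) => he.
  by have := h1.1 he; have := h2.1 he; lia.
have : ~ b < 0 by move=> /h1.2; lia.
have : ~ a < 0 by move=> /h2.2; lia.
lia.
Qed.

(** A cube that is not local has at most one child that is not local. By induction on the scale that
    child contributes the bound times [rho < 1], the other children are covered by [JN_local], and
    the recursion closes. *)
Lemma weighted_JN : exists2 e0 : R, 0 < e0 & exists2 C : R, 0 <= C &
  forall b k x, dyadic_bmo b ->
  (\int[mu]_(y in dcube k x) (expR (e0 * `|b y - davg b k x|) * kap k x y)%:E <= C%:E)%E.
Proof.
have [e1 e10 [C C0 hloc]] := JN_local.
have [g /andP[g0 g1] hg] := lam_step.
have K0 : 0 < 2 ^+ n :> R by rewrite exprn_gt0.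
pose e2 := - (q0 / 2 * ln g) / 2 ^+ n.
have e20 : 0 < e2.
  by rewrite divr_gt0// oppr_gt0 pmulr_rlt0 ?divr_gt0//; apply: ln_lt0; rewrite g0 g1.
pose eps := Num.min e1 e2.
have eps0 : 0 < eps by rewrite lt_min e10.
pose rho := g `^ (q0 / 2).
have rho0 : 0 < rho by exact: powR_gt0.
have rho1 : rho < 1 by apply: powR_lt1; rewrite ?(ltW g0) ?divr_gt0.
have hrho : expR (eps * 2 ^+ n) * g `^ q0 <= rho.
  rewrite /rho /powR gt_eqF// -expRD ler_expR.
  have : eps * 2 ^+ n <= - (q0 / 2 * ln g) by rewrite -ler_pdivlMr// ge_min lexx orbT.
  by lra.
(* Dominates [C] and satisfies [rho * C' + rho * C * 2 ^+ n <= C']. *)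
pose C' := (C + rho * C * 2 ^+ n) / (1 - rho).
have r10 : 0 < 1 - rho by rewrite subr_gt0.
have Cn0 : 0 <= rho * C * 2 ^+ n by rewrite mulr_ge0 ?mulr_ge0 ?(ltW rho0) ?(ltW K0).
have CC' : C <= C'.
  rewrite ler_pdivlMr//; apply: (@le_trans _ _ C); last by rewrite lerDl.
  by rewrite ler_piMr// gerBl ltW.
have C'0 : 0 <= C' by apply: le_trans CC'.
have stepC : rho * C' + rho * C * 2 ^+ n <= C'.
  have : C' * (1 - rho) = C + rho * C * 2 ^+ n by rewrite divfK// gt_eqF.
  by rewrite mulrBr mulr1; lra.
exists eps => //; exists C' => // b k x nb.
suff: forall N : nat, forall k x, (k <= N%:Z)%R -> (\int[mu]_(y in dcube k x)
    (expR (eps * `|b y - davg b k x|) * kap k x y)%:E <= C'%:E)%E.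
  by move=> h; exact: h (le_absz k).
have hloc' k' x' : local_cube k' x' -> (\int[mu]_(y in dcube k' x')
    (expR (eps * `|b y - davg b k' x'|) * kap k' x' y)%:E <= C%:E)%E.
  move=> l'; apply: hloc => //; [exact: ltW|by rewrite ge_min lexx].
elim=> [|N IH] {}k {}x.
  move=> k0; apply: (@le_trans _ _ C%:E); last by rewrite lee_fin.
  by apply: hloc'; left.
move=> kN; case: (pselect (local_cube k x)) => [lkx|nl].
  by apply: (@le_trans _ _ C%:E); rewrite ?lee_fin//; exact: hloc'.
have k1N := pred_le kN.
have [mb ib osc _] := nb.
have md := @measurable_ddcube R n k x.
pose f z := expR (eps * `|b z - davg b k x|) * kap k x z.
have mf : measurable_fun [set: E] f.
  exact: (measurable_funM (measurable_expR_dist (davg b k x) eps mb) (mkap k x)).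
have f0 z : 0 <= f z by apply: mulr_ge0; [exact: expR_ge0|exact: kap_ge0].
have mfE D : measurable_fun D (fun z => (f z)%:E).
  by apply/measurable_EFinP; exact: measurable_funTS.
rewrite -/(\int[mu]_(y in dcube k x) (f y)%:E)%E.
have hchild y : dcube k x y -> (\int[mu]_(z in dcube (k - 1) y) (f z)%:E <=
    rho%:E * \int[mu]_(z in dcube (k - 1) y)
      (expR (eps * `|b z - davg b (k - 1) y|) * kap (k - 1) y z)%:E)%E.
  move=> xy; apply: le_trans (JN_step g0 g1 hg (ltW eps0) nb xy) _.
  apply: lee_wpmul2r; last by rewrite lee_fin.
  apply: integral_ge0 => z _; rewrite lee_fin.
  by apply: mulr_ge0; [exact: expR_ge0|exact: kap_ge0].
pose F := dcube k x `&` nearbox (k - 1).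
have Fd : F `<=` dcube k x by move=> z [].
have mF : measurable F by apply: measurableI md (@measurable_nearbox R n (k - 1)).
have mG : measurable (dcube k x `\` F) by exact: measurableD.
rewrite (integral_setDE mu md mF Fd mf f0).
apply: (@le_trans _ _ ((rho * C')%:E + (rho * C * 2 ^+ n)%:E)%E); last first.
  by rewrite -EFinD lee_fin.
apply: leeD.
  case: (pselect (exists y, F y)) => [[y Fy]|nF]; last first.
    have -> : F = set0 by apply/seteqP; split => // y Fy; case: nF; exists y.
    by rewrite integral_set0 lee_fin mulr_ge0// ltW.
  apply: (@le_trans _ _ (\int[mu]_(z in dcube (k - 1) y) (f z)%:E)%E).
    apply: (integral_sub mu mF (measurable_ddcube (k - 1) y) _ mf f0).
    by move=> z Fz; exact: nearbox_child Fy.1 Fz.1 Fy.2 Fz.2.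
  apply: le_trans (hchild y Fy.1) _; rewrite EFinM.
  apply: lee_wpmul2l; [by rewrite lee_fin ltW|exact: IH].
have v0 := dvol_gt0 R n (k - 1).
have c0 : 0 <= rho * C / dvol (k - 1) by rewrite divr_ge0 ?mulr_ge0 ?(ltW rho0) ?(ltW v0).
apply: (@le_trans _ _ (\int[mu]_(z in dcube k x `\` F) (rho * C / dvol (k - 1))%:E)%E).
  have kk : (k - 1 <= k)%R by rewrite gerBl.
  have satG : saturated (@didx R n) (k - 1) (dcube k x `\` F).
    move=> y z yz [xy nFy]; have xz := saturated_dcube (@didx_nest R n) kk yz xy.
    split=> // Fz; apply: nFy; split=> //.
    exact: saturated_nearbox (lexx _) _ _ (esym yz) Fz.2.
  have mc : measurable_fun (dcube k x `\` F) (fun _ : E => (rho * C / dvol (k - 1))%:E).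
    exact: measurable_cst.
  apply: (integral_saturated_le (@didx_measurable R n) satG (mfE _) mc).
  - by move=> z _; rewrite lee_fin.
  - by move=> z _; rewrite lee_fin.
  - move=> y [xy nFy].
    rewrite integral_cst; last exact: measurable_ddcube.
    rewrite [X in (_ <= _ * X)%E](_ : _ = (dvol (k - 1))%:E); last exact: leb_dcube.
    rewrite -EFinM divfK ?gt_eqF//.
    apply: le_trans (hchild y xy) _; rewrite EFinM.
    apply: lee_wpmul2l; first by rewrite lee_fin ltW.
    by apply: hloc'; right => h; apply: nFy.
rewrite integral_cst//; apply: (@le_trans _ _ ((rho * C / dvol (k - 1))%:E * (dvol k)%:E)%E).
  apply: lee_wpmul2l; first by rewrite lee_fin.
  by rewrite -(leb_dcube k x) le_measure ?inE// => z [].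
rewrite -EFinM lee_fin (dvolS R n k) [2 ^+ n * _]mulrC mulrA divfK ?gt_eqF//.
Qed.

Let powR_le_expR (r e : R) : 0 <= r -> 0 < e -> exists2 C : R, 0 <= C &
  forall t : R, 0 <= t -> (1 + t) `^ r <= C * expR (e * t).
Proof.
rewrite le_eqVlt => /predU1P[<- e0|r0 e0].
  exists 1 => // t t0; rewrite powRr0 mul1r -[leLHS](@expR0 R) ler_expR.
  by rewrite mulr_ge0// ltW.
(* With this [D], 1 + t is at most D (1 + (e / r) t), and the bracket is below its exponential. *)
pose D := Num.max 1 (r / e); have D1 : 1 <= D by rewrite le_max lexx.
have Dr : r / e <= D by rewrite le_max lexx orbT.
have D0 : 0 <= D by apply: le_trans D1.
exists (D `^ r); first exact: powR_ge0.
move=> t t0; have er : 0 < e / r by rewrite divr_gt0.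
apply: (@le_trans _ _ ((D * expR (e / r * t)) `^ r)).
  apply: le_powR; [exact: ltW|by rewrite addr_ge0|].
  apply: (@le_trans _ _ (D * (1 + e / r * t))); last first.
    by apply: ler_wpM2l => //; exact: expR_ge1Dx.
  rewrite mulrDr mulr1 mulrA; apply: lerD => //; rewrite ler_peMl// mulrA.
  by rewrite ler_pdivlMr// mul1r -ler_pdivrMr.
rewrite powRM ?expR_ge0// ler_wpM2l ?powR_ge0// -expRM.
by rewrite le_eqVlt; apply/orP; left; apply/eqP; congr expR; field; rewrite gt_eqF.
Qed.

(** For Lebesgue measure the small-part hypothesis holds with c = 1 / 2; on 3Q the averages of the
    neighbours are within 1 of the central one. *)
Let lebesgue_JN : exists2 e0 : R, 0 < e0 & exists2 C : R, 0 <= C &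
  forall b k x, dyadic_bmo b ->
  (\int[mu]_(y in tcube k x) (expR (e0 * `|b y - davg b k x|))%:E <= (C * dvol k)%:E)%E.
Proof.
pose hlf : R := 2^-1; have c01 : 0 < hlf < 1.
  by rewrite /hlf invr_gt0 ltr0n/= invr_lt1 ?unitfE ?pnatr_eq0 ?ltr1n//.
have [e0 e00 he] := eps_choice c01.
pose C := expR (2 * e0) * (2 / hlf).
have /andP[hlf0 hlf1] := c01.
have C0 : 0 <= C by rewrite mulr_ge0 ?expR_ge0// divr_ge0// ltW.
have ee0 : 0 <= expR e0 by exact: expR_ge0.
exists e0 => //; exists (3 ^+ n * (expR e0 * C)).
  by rewrite mulr_ge0 ?exprn_ge0// mulr_ge0.
move=> b k x nb; have [mb ib osc hnb] := nb.
have v0 := ltW (dvol_gt0 R n k).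
have mf := measurable_expR_dist (davg b k x) e0 mb.
have mfE : measurable_fun [set: E] (fun y => (expR (e0 * `|b y - davg b k x|))%:E).
  by apply/measurable_EFinP.
have hJN y : (\int[mu]_(z in dcube k y) (expR (e0 * `|b z - davg b k y|))%:E <= (C * dvol k)%:E)%E.
  pose V1 := fun _ : E => (1 : R).
  have V10 z : 0 <= V1 z by rewrite /V1.
  have mV1 : measurable_fun [set: E] V1 by exact: measurable_cst.
  have iV1 D : measurable D -> (\int[mu]_(z in D) (V1 z)%:E = mu D)%E.
    by move=> mD; rewrite /V1 integral_cst// mul1e.
  have iV1d k' x' : (\int[mu]_(z in dcube k' x') (V1 z)%:E = (dvol k')%:E)%E.
    by rewrite iV1; [exact: leb_dcube|exact: measurable_ddcube].
  have Ld (j k' : int) (x' y' : E) : True -> (j <= k')%R -> dcube k' x' y' -> True by [].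
  have V1f k' x' : True -> (\int[mu]_(z in dcube k' x') (V1 z)%:E < +oo)%E.
    by move=> _; rewrite iV1d ltry.
  have V1s k' x' F : True -> measurable F -> F `<=` dcube k' x' ->
      (mu F <= (dvol k' / 2)%:E)%E ->
      (\int[mu]_(z in F) (V1 z)%:E <= (1 - hlf)%:E * \int[mu]_(z in dcube k' x') (V1 z)%:E)%E.
    move=> _ mF Fd hF; rewrite iV1d iV1// -EFinM; apply: le_trans hF _.
    by rewrite lee_fin /hlf; lra.
  have := @dcube_JN V1 hlf e0 (fun _ _ => True) b nb V10 mV1 hlf0 hlf1 (ltW e00) Ld V1f V1s
    (he e0 (lexx _)) k y I.
  by rewrite iV1d -EFinM; under eq_integral do rewrite mulr1.
have CK0 : 0 <= expR e0 * (C * dvol k) := mulr_ge0 ee0 (mulr_ge0 C0 v0).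
rewrite -mulrA -[expR e0 * C * _]mulrA.
apply: (integral_tcube_le CK0 mfE) => [y|]; first by rewrite lee_fin expR_ge0.
move=> y xy; have md := @measurable_ddcube R n k y.
rewrite [leRHS]EFinM; apply: le_trans (lee_wpmul2l _ (hJN y)); last by rewrite lee_fin.
have mf' := measurable_expR_dist (davg b k y) e0 mb.
rewrite -(integralZl_real mu md ee0 mf'); last by move=> z; exact: expR_ge0.
apply: ge0_le_integral_nomeas => z _; rewrite lee_fin ?expR_ge0//.
rewrite -expRD ler_expR -[X in _ <= X + _]mulr1 -mulrDr; apply: ler_wpM2l; first exact: ltW.
apply: le_trans (ler_distD (davg b k y) _ _) _.
by rewrite addrC lerD2r; exact: hnb.
Qed.

Lemma bmo_moment (r : R) : 0 <= r -> exists2 C : R, 0 <= C &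
  forall b k x, dyadic_bmo b ->
  (\int[mu]_(y in tcube k x) ((1 + `|b y - davg b k x|) `^ r)%:E <= (C * dvol k)%:E)%E.
Proof.
move=> r0; have [e0 e00 [C C0 h]] := lebesgue_JN.
have [D D0 hD] := powR_le_expR r0 e00.
exists (D * C); first exact: mulr_ge0.
move=> b k x nb; have [mb ib osc hnb] := nb.
have mt := @measurable_tcube R n k x.
have mf := measurable_expR_dist (davg b k x) e0 mb.
rewrite -mulrA EFinM; apply: le_trans (lee_wpmul2l _ (h b k x nb)); last by rewrite lee_fin.
rewrite -(integralZl_real mu mt D0 mf); last by move=> z; exact: expR_ge0.
by apply: ge0_le_integral_nomeas => z _; rewrite lee_fin ?powR_ge0// hD.
Qed.

Lemma weighted_bmo_moment : exists2 C : R, 0 <= C &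
  forall b k x, dyadic_bmo b ->
  (\int[mu]_(y in dcube k x) ((1 + `|b y - davg b k x|) `^ q y * kap k x y)%:E <= C%:E)%E.
Proof.
have [e0 e00 [C C0 h]] := weighted_JN.
have q10 : 0 <= q1 by apply: ltW; apply: lt_le_trans (q_gt0 z0) (qq1 z0).
have [D D0 hD] := powR_le_expR q10 e00.
exists (D * C); first exact: mulr_ge0.
move=> b k x nb; have [mb ib osc hnb] := nb.
have md := @measurable_ddcube R n k x.
have mf := measurable_funM (measurable_expR_dist (davg b k x) e0 mb) (mkap k x).
rewrite EFinM; apply: le_trans (lee_wpmul2l _ (h b k x nb)); last by rewrite lee_fin.
rewrite -(integralZl_real mu md D0 mf); last first.
  by move=> z; apply: mulr_ge0; [exact: expR_ge0|exact: kap_ge0].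
apply: ge0_le_integral_nomeas => z _; rewrite lee_fin.
  by apply: mulr_ge0; [exact: powR_ge0|exact: kap_ge0].
rewrite mulrA; apply: ler_wpM2r; first exact: kap_ge0.
by apply: le_trans (hD _ (normr_ge0 _)); apply: ler_powR; rewrite ?qq1// lerDl.
Qed.

(** * Normalized functions on triple cubes *)

Variables (p sb : 'I_m -> E -> R) (t pp M2 A2 al de eps : R) (J k0 : int).
Hypotheses (mp : forall i, measurable_fun [set: E] (p i))
  (msb : forall i, measurable_fun [set: E] (sb i)) (p1 : forall i x, 1 <= p i x)
  (ppp : forall i x, p i x <= pp) (sb0 : forall i x, 0 < sb i x)
  (psb : forall i x, (p i x)^-1 + (sb i x)^-1 = t^-1)
  (al0 : 0 < al) (qp : forall x, \sum_(i < m) (p i x)^-1 = (q x)^-1 + al)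
  (M20 : 0 < M2) (MM2 : M = M2 + m%:R * (1 - t^-1)) (A20 : 0 < A2)
  (de0 : 0 < de) (de1 : de < 1 - t^-1) (de11 : de < 1) (depp : de * pp < 1) (eps0 : 0 < eps)
  (epsal : eps <= q0 * al / 2) (J0 : (0 <= J)%R) (k00 : (k0 <= 0)%R)
  (hunif : forall i k x y, (k <= k0)%R -> tcube k x y ->
     aexp (p i) (- de) y <= p i x * (1 + eps))
  (hinfty : forall i x y, ~ nearbox J x -> ~ nearbox J y ->
     aexp (p i) (- de) y <= p i x * (1 + eps)).
Hypothesis (hB : forall x (r : R), 0 < r -> exists (lam : R) (sig : 'I_m -> R),
   [/\ 0 < lam /\ (forall i, 0 < sig i),
       (modular mu q om (eucl_ball x r) lam <= 1)%E,
       forall i, (modular mu (sb i) (w i) (eucl_ball x r) (sig i) <= 1)%E &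
       fine (mu (eucl_ball x r)) `^ (- M2) * (lam * \prod_(i < m) sig i) <= A2]).

(** The reciprocals of [sb i] and of the conjugate of [p i] differ by [1 - t^-1]: this is the room
    that Hoelder's inequality gives to the oscillation, and [hB] controls the weights at these
    exponents. *)
Lemma bump_tcube : exists2 A3 : R, 0 < A3 & forall k x, exists tau : 'I_m -> R,
  [/\ forall i, 0 < tau i, forall i, (modular mu (sb i) (w i) (tcube k x) (tau i) <= 1)%E &
      dvol k `^ (- M2) * (lam k x * \prod_(i < m) tau i) <= A3].
Proof.
pose D : R := (2 * (2 * n%:R + 1)) ^+ n.
have D0 : 0 < D by rewrite exprn_gt0// mulr_gt0// ltr_wpDl.
have M20' := M20; have A20' := A20.
exists (2 * D `^ M2 * A2); first by rewrite !mulr_gt0// powR_gt0.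
move=> k x; have [la [sig [[la0 sig0] hla hsig hA2]]] := hB x (brad_gt0 R n k).
have tb := @tcube_ball R n k x; have mt := @measurable_tcube R n k x.
exists sig; split; [exact: sig0|move=> i|].
  exact: le_trans (modular_sub mu (msb i) (mw i) (sig i) mt (mball k x) tb) (hsig i).
have ntl : nrm (tcube k x) <= la.
  have h2 : (modular mu q om (tcube k x) la <= 1)%E.
    exact: le_trans (modular_sub mu mq mom la mt (mball k x) tb) hla.
  exact: (nrm_le_mod mt (@subset_refl _ _) la0 h2).
have nd : nrm (dcube k x) <= nrm (tcube k x).
  exact: (nrm_le (measurable_ddcube k x) mt (@sub_dcube_tcube R n k x) (@subset_refl _ _)).
have P0 : 0 < \prod_(i < m) sig i by apply: prodr_gt0 => i _; exact: sig0.
set b := fine (mu (eucl_ball _ _)) in hA2.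
have bE : mu (eucl_ball x (brad R n k)) = b%:E.
  by rewrite /b fineK// leb_ball_fin// brad_gt0.
have b0 : 0 < b by rewrite -lte_fin -bE leb_ball_gt0// brad_gt0.
have bD : b <= D * dvol k.
  rewrite -lee_fin -bE; apply: le_trans (leb_ball_le x (brad_gt0 R n k)) _.
  by rewrite lee_fin /brad /D mulrA exprMn.
have v0 := dvol_gt0 R n k.
rewrite powRN mulrC ler_pdivrMr ?powR_gt0//.
apply: (@le_trans _ _ (2 * la * \prod_(i < m) sig i)).
  by rewrite ler_pM2r// /lam ler_pM2l// (le_trans nd).
rewrite powRN mulrC ler_pdivrMr ?powR_gt0// in hA2.
rewrite -mulrA -!mulrA ler_pM2l//; apply: le_trans hA2 _.
rewrite [D `^ M2 * _]mulrCA ler_pM2l// -powRM ?(ltW D0) ?(ltW v0)//.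
by apply: le_powR bD; exact: ltW.
Qed.

(** In the [j]-th summand of the commutator only the [j]-th function meets an oscillation. *)
Definition osc_weight (b : E -> R) (j i : 'I_m) k x y : R :=
  if i == j then 1 + `|b y - davg b k x| else 1.

Lemma osc_weight_ge1 b j i k x y : 1 <= osc_weight b j i k x y.
Proof. by rewrite /osc_weight; case: ifP => // _; rewrite lerDl. Qed.

Lemma measurable_osc_weight b j i k x : dyadic_bmo b ->
  measurable_fun [set: E] (osc_weight b j i k x).
Proof.
move=> [mb _ _ _]; rewrite /osc_weight; case: (i == j); last exact: measurable_cst.
exact: (measurable_funD (@measurable_cst _ _ E R setT 1) (measurable_dist (davg b k x) mb)).
Qed.

Let r1 : R := (1 - t^-1 - de)^-1.
Let r10 : 0 < r1. Proof. by rewrite invr_gt0 subr_gt0. Qed.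

Let osc_moment : exists2 CB : R, 0 <= CB & forall b j i k x, dyadic_bmo b ->
  (\int[mu]_(y in tcube k x) (osc_weight b j i k x y `^ r1)%:E <= (CB * dvol k)%:E)%E.
Proof.
have [C C0 h] := bmo_moment (ltW r10).
exists (C + 3 ^+ n); first by rewrite addr_ge0// exprn_ge0.
move=> b j i k x nb; have v0 := dvol_gt0 R n k.
rewrite /osc_weight; case: (i == j).
  apply: le_trans (h b k x nb) _; rewrite lee_fin ler_pM2r// lerDl exprn_ge0//.
under eq_integral do rewrite powR1.
rewrite integral_cst; last exact: measurable_tcube.
rewrite mul1e [X in (X <= _)%E](_ : _ = (3 ^+ n * dvol k)%:E); last exact: leb_tcube.
by rewrite lee_fin ler_pM2r// lerDr.
Qed.

Definition normalized (g : 'I_m -> E -> R) : Prop :=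
  [/\ forall i, measurable_fun [set: E] (g i), forall i y, 0 <= g i y &
      forall i, (modular mu (p i) (g i) [set: E] 1 <= 1)%E].

(** Artificial mass on the box where exponents cannot be frozen at scales above [k0]. It decays fast
    enough to be summable over the scales and slowly enough to dominate the gain of
    [exceptional_cube]. *)
Definition bump k y : R := (if (k0 < k)%R then dvol k `^ (- de) else 0) * \1_(nearbox J) y.

Definition Psi (g : 'I_m -> E -> R) k y : R :=
  \sum_(i < m) g i y `^ p i y * gain de (dvol k * g i y `^ p i y) + bump k y.

Lemma gain_ge0 (X : R) : 0 <= gain de X.
Proof. by rewrite /gain le_min !powR_ge0. Qed.

Lemma measurable_gain (f : E -> R) : measurable_fun [set: E] f ->
  measurable_fun [set: E] (fun y => gain de (f y)).
Proof.
move=> mf; have mP (c : R) : measurable_fun [set: E] (fun y => f y `^ c).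
  by apply: measurable_powR2 mf _; exact: measurable_cst.
exact: (measurable_minr (mP _) (mP _)).
Qed.

Lemma measurable_bump k : measurable_fun [set: E] (bump k).
Proof.
apply: measurable_funM; first exact: measurable_cst.
exact: (measurable_indic (@measurable_nearbox R n J)).
Qed.

Lemma bump_ge0 k y : 0 <= bump k y.
Proof. by rewrite mulr_ge0//; case: ifP => // _; exact: powR_ge0. Qed.

Lemma measurable_power g i : normalized g -> measurable_fun [set: E] (fun y => g i y `^ p i y).
Proof. by move=> [mg _ _]; exact: measurable_powR2 (mg i) (mp i). Qed.

Lemma measurable_Psi g k : normalized g -> measurable_fun [set: E] (Psi g k).
Proof.
move=> ng; apply: measurable_funD (measurable_bump k).
apply: measurable_sum => i; have mz := measurable_power i ng.
apply: (measurable_funM mz); apply: measurable_gain.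
exact: measurable_funM (measurable_cst _) mz.
Qed.

Lemma Psi_ge0 g k y : 0 <= Psi g k y.
Proof.
rewrite addr_ge0 ?bump_ge0//; apply: sumr_ge0 => i _.
by apply: mulr_ge0; [exact: powR_ge0|exact: gain_ge0].
Qed.

Lemma gain_le_Psi g k i y :
  g i y `^ p i y * gain de (dvol k * g i y `^ p i y) <= Psi g k y.
Proof.
rewrite /Psi (bigD1 i)//= -addrA lerDl addr_ge0 ?bump_ge0//; apply: sumr_ge0 => l _.
by apply: mulr_ge0; [exact: powR_ge0|exact: gain_ge0].
Qed.

Lemma bump_le_Psi g k y : bump k y <= Psi g k y.
Proof.
rewrite /Psi lerDr; apply: sumr_ge0 => l _.
by apply: mulr_ge0; [exact: powR_ge0|exact: gain_ge0].
Qed.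

Let mNB := @measurable_nearbox R n J.

Lemma leb_nearbox : (mu (nearbox J) <= (3 ^+ n * dvol J)%:E)%E.
Proof.
rewrite -(leb_tcube J z0) le_measure ?inE//; first exact: measurable_tcube.
by move=> x; exact: nearbox_tcube.
Qed.

Let ppos i y : 0 < p i y. Proof. exact: lt_le_trans (p1 i y). Qed.

Let aexp_neg_gt0 i y : 0 < (p i y)^-1 + - de.
Proof.
rewrite subr_gt0 -[de]invrK ltf_pV2 ?posrE ?invr_gt0//.
rewrite -[ltRHS]mul1r ltr_pdivlMr// mulrC.
by apply: le_lt_trans depp; rewrite ler_pM2l.
Qed.

Let aexp_le i y : aexp (p i) de y <= aexp (p i) (- de) y.
Proof.
rewrite /aexp lef_pV2 ?posrE ?aexp_neg_gt0//; last by rewrite addr_gt0 ?invr_gt0.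
by rewrite lerD2l; have de0' := de0; lra.
Qed.

Let e_ge1 i y : 1 <= p i y * (1 + eps).
Proof. by rewrite -[leLHS]mulr1 ler_pM// lerDl ltW. Qed.

(** On small cubes, and outside [nearbox J] when [x] is outside, [good_cube] applies. The part of a
    large 3Q inside the box has bounded measure: [exceptional_cube] gains a power of the volume
    there, and the mass of [bump] converts it into the required power of [mm]. *)
Lemma cube_bounds (C0 : R) : 1 <= C0 -> exists2 C : R, 0 < C &
  forall b j g k x i (tau : R), dyadic_bmo b -> normalized g -> 0 < tau ->
  (modular mu (sb i) (w i) (tcube k x) tau <= 1)%E ->
  (\int[mu]_(y in tcube k x) (osc_weight b j i k x y * g i y * w i y)%:E <=
     (C * (dvol k `^ (1 - t^-1) * tau))%:E)%E /\
  forall mm : R, 0 < mm -> mm <= C0 ->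
    (\int[mu]_(y in tcube k x) (Psi g k y)%:E <= mm%:E)%E ->
    ((k <= k0)%R \/ ~ nearbox J x) ->
    (\int[mu]_(y in tcube k x) (osc_weight b j i k x y * g i y * w i y)%:E <=
     (C * (dvol k `^ (1 - t^-1) * tau * (mm / C0) `^ (p i x * (1 + eps))^-1))%:E)%E.
Proof.
move=> C01; have C00 : 0 < C0 by apply: lt_le_trans C01.
have [CB CB0 hCB] := osc_moment.
pose cN : R := 3 ^+ n * dvol J.
have cN0 : 0 <= cN by exact: mulr_ge0 (exprn_ge0 n (ler0n R 3)) (ltW (dvol_gt0 R n J)).
pose dk := dvol k0; have dk0 : 0 < dk := dvol_gt0 R n k0.
have dk1 : dk <= 1.
  by rewrite /dk /dvol exprn_ile1 ?(ltW (side_gt0 _ _))// -(side0 R) side_le.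
pose C1 := 2 * (CB + C0 + 1); pose C2 := CB + (cN + 1) + 1; pose C3 := C2 * (C0 / dk).
have C10 : 0 < C1 by rewrite /C1; lra.
have C20 : 0 < C2 by rewrite /C2; lra.
have C30 : 0 < C3 by rewrite mulr_gt0// divr_gt0.
have CM : CB + 1 + 1 <= C1 + C2 + C3 + (CB + 1 + 1) by lra.
have C1S : C1 <= C1 + C2 + C3 + (CB + 1 + 1) by lra.
have C31S : C3 + C1 <= C1 + C2 + C3 + (CB + 1 + 1) by lra.
exists (C1 + C2 + C3 + (CB + 1 + 1)); first by lra.
move=> b j g k x i tau nb ng tau0 htau.
have [mg g0 hg] := ng.
have v0 := dvol_gt0 R n k; have mt := @measurable_tcube R n k x.
have mB := measurable_osc_weight j i k x nb.
have B1 := osc_weight_ge1 b j i k x.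
have wi0 y : 0 <= w i y by exact: ltW.
have hm := hCB b j i k x nb.
have sT (D : set E) : D `<=` [set: E] by [].
have hgD (D : set E) : measurable D -> (modular mu (p i) (g i) D 1 <= 1)%E.
  by move=> mD; exact: le_trans (modular_sub mu (mp i) (mg i) 1 mD measurableT (sT D)) (hg i).
have Vt0 : 0 < dvol k `^ (1 - t^-1) * tau by rewrite mulr_gt0// powR_gt0.
split.
  have := any_cube mt mB (mg i) (mw i) (mp i) (msb i) B1 (g0 i) wi0 (p1 i) (sb0 i)
    (psb i) v0 tau0 (ltW de0) de1 (hgD _ mt) hm htau.
  move=> h; apply: le_trans h _; rewrite lee_fin mulrC; exact: (ler_wpM2r (ltW Vt0) CM).
move=> mm mm0 mmC hmm good.
set W := dvol k `^ (1 - t^-1) * tau * (mm / C0) `^ _.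
have W0 : 0 < W by rewrite mulr_gt0// powR_gt0// divr_gt0.
have ei0 : 0 < p i x * (1 + eps) by exact: lt_le_trans (e_ge1 i x).
have mPsi := measurable_Psi k ng; have P0 := Psi_ge0 g k.
have hsub (D : set E) (f : E -> R) (c : \bar R) : measurable D -> D `<=` tcube k x ->
    measurable_fun [set: E] f -> (forall x, 0 <= f x) ->
    (\int[mu]_(y in tcube k x) (f y)%:E <= c)%E -> (\int[mu]_(y in D) (f y)%:E <= c)%E.
  move=> mD Dt mf f0; apply: le_trans; exact: (integral_sub mu mD mt Dt mf f0).
have mBr : measurable_fun [set: E] (fun y => osc_weight b j i k x y `^ r1).
  by apply: measurable_powR2 mB _; exact: measurable_cst.
have Br0 y : 0 <= osc_weight b j i k x y `^ r1 by exact: powR_ge0.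
have goodD (D : set E) : measurable D -> D `<=` tcube k x ->
    (forall y, D y -> aexp (p i) (- de) y <= p i x * (1 + eps)) ->
    (\int[mu]_(y in D) (osc_weight b j i k x y * g i y * w i y)%:E <= (C1 * W)%:E)%E.
  move=> mD Dt hD.
  apply: (good_cube mD mB (mg i) (mw i) (mp i) (msb i) B1 (g0 i) wi0 (p1 i) (ppp i) (sb0 i)
    (psb i) v0 tau0 de0 de1 depp mm0 mmC ei0 CB0 mPsi P0 _ _ hD (hsub D _ _ mD Dt mPsi P0 hmm)
    (hsub D _ _ mD Dt mBr Br0 hm)).
  - by move=> y _; exact: gain_le_Psi.
  - by move=> y Dy; exact: le_trans (aexp_le i y) (hD y Dy).
  - exact: le_trans (modular_sub mu (msb i) (mw i) tau mD mt Dt) htau.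
have mBgw : measurable_fun [set: E] (fun y => osc_weight b j i k x y * g i y * w i y).
  exact: measurable_funM (measurable_funM mB (mg i)) (mw i).
have Bgw0 y : 0 <= osc_weight b j i k x y * g i y * w i y.
  apply: mulr_ge0 (wi0 y); apply: mulr_ge0 (g0 i y); exact: le_trans (B1 y).
have fin1 : C1 * W <= (C1 + C2 + C3 + (CB + 1 + 1)) * W by exact: (ler_wpM2r (ltW W0) C1S).
case: (lerP k k0) => kk0.
  apply: le_trans (goodD _ mt (@subset_refl _ _) _) _; last by rewrite lee_fin.
  by move=> y xy; exact: hunif xy.
case: good => [kk|nNB]; first by move: kk0; rewrite ltNge kk.
pose F := tcube k x `&` nearbox J.
have mF : measurable F by exact: measurableI.
have Ft : F `<=` tcube k x by move=> y [].
have mG : measurable (tcube k x `\` F) by exact: measurableD.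
have Gt : tcube k x `\` F `<=` tcube k x by move=> y [].
rewrite (integral_setDE mu mt mF Ft mBgw Bgw0).
have h1 : (\int[mu]_(y in tcube k x `\` F) (osc_weight b j i k x y * g i y * w i y)%:E <= (C1 * W)%:E)%E.
  apply: goodD mG Gt _ => y [ty nFy]; apply: hinfty => // h; exact: nFy.
suff h2 : (\int[mu]_(y in F) (osc_weight b j i k x y * g i y * w i y)%:E <= (C3 * W)%:E)%E.
  apply: le_trans (leeD h2 h1) _; rewrite -EFinD lee_fin -mulrDl; exact: (ler_wpM2r (ltW W0) C31S).
case: (pselect (exists y, F y)) => [[y [ty Ny]]|nF]; last first.
  have -> : F = set0 by apply/seteqP; split => // y Fy; case: nF; exists y.
  by rewrite integral_set0 lee_fin mulr_ge0// ltW.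
have hF : (mu F <= cN%:E)%E.
  by apply: le_trans leb_nearbox; rewrite le_measure ?inE//; move=> z [].
have := exceptional_cube mF mB (mg i) (mw i) (mp i) (msb i) B1 (g0 i) wi0 (p1 i) (sb0 i)
    (psb i) v0 tau0 (ltW de0) de1 hF (hgD _ mF) (hsub F _ _ mF Ft mBr Br0 hm)
    (le_trans (modular_sub mu (msb i) (mw i) tau mF mt Ft) htau).
move=> h; apply: le_trans h _; rewrite lee_fin -/C2.
have dF : dcube k0 y `<=` F.
  move=> z yz; split.
    apply: (sub_tcubeS ty); apply: (sub_dcube (@didx_nest R n) (ltW kk0) _ yz).
    exact: dcube_refl.
  apply: (saturated_nearbox (le_trans k00 J0)) Ny; exact: esym yz.
(* The mass of [bump] on one cube of scale [k0] inside [F], hence a lower bound for [mm]. *)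
pose X := dvol k `^ (- de) * dk.
have X0 : 0 < X by rewrite mulr_gt0// powR_gt0.
have hX : X <= mm.
  rewrite -lee_fin; apply: le_trans hmm.
  apply: (@le_trans _ _ (\int[mu]_(y in dcube k0 y) (dvol k `^ (- de))%:E)%E).
    rewrite integral_cst; last exact: measurable_ddcube.
    by rewrite [X in (_ <= _ * X)%E](_ : _ = dk%:E); [rewrite -EFinM|exact: leb_dcube].
  have md := @measurable_ddcube R n k0 y.
  apply: (@le_trans _ _ (\int[mu]_(y in dcube k0 y) (Psi g k y)%:E)%E).
    apply: ge0_le_integral_nomeas => z yz; rewrite lee_fin ?powR_ge0//.
    apply: le_trans (bump_le_Psi g k z).
    by rewrite /bump kk0 indicE mem_set ?mulr1//; exact: (dF z yz).2.
  exact: (integral_sub mu md mt (subset_trans dF Ft) mPsi P0).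
have X1 : X <= 1.
  rewrite /X; apply: (@le_trans _ _ (dk `^ (- de) * dk)).
    have dkk : dk <= dvol k.
      by apply: lerXn2r; rewrite ?nnegrE ?(ltW (side_gt0 _ _))//; exact: side_le (ltW kk0).
    exact: ler_wpM2r (ltW dk0) _ _ (le_powRN (ltW de0) dk0 dkk).
  rewrite -{2}[dk]powRr1 ?(ltW dk0)// -powRD_gt0//.
  rewrite -[leRHS](powRr0 dk) ger_powR ?dk0//; by rewrite addrC subr_ge0 ltW.
(* As [X / C0 <= 1], it is at most its own power with exponent below 1, and [X <= mm]. *)
have Y : dvol k `^ (- de) <= C0 / dk * (mm / C0) `^ (p i x * (1 + eps))^-1.
  have XC0 : 0 < X / C0 by rewrite divr_gt0.
  have XC1 : X / C0 <= 1 by rewrite ler_pdivrMr// mul1r (le_trans X1).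
  have -> : dvol k `^ (- de) = C0 / dk * (X / C0).
    by rewrite /X; field; rewrite !gt_eqF.
  rewrite ler_pM2l ?divr_gt0//.
  apply: (@le_trans _ _ ((X / C0) `^ (p i x * (1 + eps))^-1)).
    rewrite -[leLHS]powRr1 ?(ltW XC0)// ger_powR ?XC0//.
    by rewrite invf_le1.
  apply: le_powR; rewrite ?invr_ge0 ?(ltW ei0) ?(ltW XC0)//.
  by rewrite ler_pM2r ?invr_gt0.
rewrite powRD_gt0// /C3 /W.
have -> : C2 * (C0 / dk) * (dvol k `^ (1 - t^-1) * tau * (mm / C0) `^ (p i x * (1 + eps))^-1) =
  dvol k `^ (1 - t^-1) * tau * C2 * (C0 / dk * (mm / C0) `^ (p i x * (1 + eps))^-1) by ring.
have -> : dvol k `^ (1 - t^-1) * dvol k `^ (- de) * tau * C2 =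
  dvol k `^ (1 - t^-1) * tau * C2 * dvol k `^ (- de) by ring.
by rewrite ler_pM2l// mulr_gt0.
Qed.

Definition cube_mean b j g k x i : R :=
  fine (\int[mu]_(y in tcube k x) (osc_weight b j i k x y * g i y * w i y)%:E)%E.

Definition beta b k x : R := 1 + `|b x - davg b k x|.

(** The sequence in [k] to which [sum_power_le] is applied. *)
Definition ratio b k x : R := beta b k x / lam k x.

Definition term b j g k x : R :=
  dvol k `^ (- M) * (beta b k x * \prod_(i < m) cube_mean b j g k x i).

Lemma beta_ge1 b k x : 1 <= beta b k x. Proof. by rewrite lerDl. Qed.

Lemma ratio_gt0 b k x : 0 < ratio b k x.
Proof. exact: divr_gt0 (lt_le_trans ltr01 (beta_ge1 b k x)) (lam_gt0 k x). Qed.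

Let meanE_ge0 b j g k x i : normalized g ->
  (0 <= \int[mu]_(y in tcube k x) (osc_weight b j i k x y * g i y * w i y)%:E)%E.
Proof.
move=> [_ g0 _]; apply: integral_ge0 => y _; rewrite lee_fin.
apply: mulr_ge0 (ltW (w0 i y)); apply: mulr_ge0 (g0 i y).
exact: le_trans (osc_weight_ge1 b j i k x y).
Qed.

Lemma cube_mean_ge0 b j g k x i : normalized g -> 0 <= cube_mean b j g k x i.
Proof. by move=> ng; apply: fine_ge0; exact: meanE_ge0. Qed.

Lemma term_ge0 b j g k x : normalized g -> 0 <= term b j g k x.
Proof.
move=> ng; apply: mulr_ge0; first exact: powR_ge0.
apply: mulr_ge0; first exact: le_trans (beta_ge1 b k x).
by apply: prodr_ge0 => i _; exact: cube_mean_ge0.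
Qed.

(** The powers of the volume match, - M + m (1 - t^-1) = - M2, so that the bound on the weights at
    the exponents [sb i] can be inserted. *)
Let prod_assembly (v C A3 la be : R) (tau Y F : 'I_m -> R) : 0 < v -> 0 <= C -> 0 < la ->
  0 <= be -> (forall i, 0 <= tau i) -> (forall i, 0 <= F i) -> (forall i, 0 <= Y i) ->
  (forall i, F i <= C * (v `^ (1 - t^-1) * tau i * Y i)) ->
  v `^ (- M2) * (la * \prod_(i < m) tau i) <= A3 ->
  v `^ (- M) * (be * \prod_(i < m) F i) <= C ^+ m * A3 * (be / la * \prod_(i < m) Y i).
Proof.
move=> v0 C0 la0 be0 ta0 F0 Y0 hF hA3.
have hP : \prod_(i < m) F i <= C ^+ m * (v `^ (1 - t^-1)) ^+ m *
    (\prod_(i < m) tau i * \prod_(i < m) Y i).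
  apply: (@le_trans _ _ (\prod_(i < m) (C * (v `^ (1 - t^-1) * tau i * Y i)))).
    by apply: ler_prod => i _; rewrite F0 hF.
  by rewrite big_split /= prodr_const card_ord big_split /= big_split /= prodr_const card_ord !mulrA.
have PY0 : 0 <= \prod_(i < m) Y i by apply: prodr_ge0.
apply: (@le_trans _ _ (v `^ (- M) * (be * (C ^+ m * (v `^ (1 - t^-1)) ^+ m *
    (\prod_(i < m) tau i * \prod_(i < m) Y i))))).
  by apply: ler_wpM2l; [exact: powR_ge0|exact: ler_wpM2l].
have vE : v `^ (- M) * (v `^ (1 - t^-1)) ^+ m = v `^ (- M2).
  rewrite -powR_mulrn ?powR_ge0// -powRrM -powRD_gt0//; congr powR.
  by have MM2' := MM2; rewrite MM2'; ring.
have -> : v `^ (- M) * (be * (C ^+ m * (v `^ (1 - t^-1)) ^+ m *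
    (\prod_(i < m) tau i * \prod_(i < m) Y i))) =
  C ^+ m * (v `^ (- M) * (v `^ (1 - t^-1)) ^+ m * (la * \prod_(i < m) tau i)) *
    (be / la * \prod_(i < m) Y i) by field; rewrite gt_eqF.
rewrite vE; apply: ler_wpM2r; first by rewrite mulr_ge0// divr_ge0// ltW.
by apply: ler_wpM2l hA3; exact: exprn_ge0.
Qed.

Definition Pinv x : R := \sum_(i < m) (p i x * (1 + eps))^-1.

Lemma term_bounds (C0 : R) : 1 <= C0 -> exists2 C : R, 0 < C &
  forall b j g k x, dyadic_bmo b -> normalized g -> term b j g k x <= C * ratio b k x /\
  forall mm : R, 0 < mm -> mm <= C0 ->
    (\int[mu]_(y in tcube k x) (Psi g k y)%:E <= mm%:E)%E ->
    ((k <= k0)%R \/ ~ nearbox J x) ->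
    term b j g k x <= C * (ratio b k x * (mm / C0) `^ Pinv x).
Proof.
move=> C01; have C00 : 0 < C0 by apply: lt_le_trans C01.
have [C Cp h] := cube_bounds C01; have [A3 A30 hA3] := bump_tcube.
exists (C ^+ m * A3); first by rewrite mulr_gt0// exprn_gt0.
move=> b j g k x nb ng; have [tau [tau0 htau htA]] := hA3 k x.
have v0 := dvol_gt0 R n k; have be0 := le_trans ler01 (beta_ge1 b k x).
have ta0 i : 0 <= tau i by exact: ltW.
have F0 i := cube_mean_ge0 b j k x i ng.
have fineb i (c : R) : (\int[mu]_(y in tcube k x) (osc_weight b j i k x y * g i y * w i y)%:E <= c%:E)%E ->
    cube_mean b j g k x i <= c.
  rewrite /cube_mean => hc; rewrite -lee_fin fineK// ge0_fin_numE ?meanE_ge0//.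
  by apply: le_lt_trans hc _; rewrite ltry.
split.
  have hF i : cube_mean b j g k x i <= C * (dvol k `^ (1 - t^-1) * tau i * 1).
    by apply: fineb; rewrite mulr1; exact: (h b j g k x i (tau i) nb ng (tau0 i) (htau i)).1.
  have := prod_assembly v0 (ltW Cp) (lam_gt0 k x) be0 ta0 F0 (fun=> ler01) hF htA.
  by rewrite prodr_const expr1n mulr1.
move=> mm mm0 mmC hmm good; have X0 : 0 < mm / C0 by rewrite divr_gt0.
have hF i : cube_mean b j g k x i <=
    C * (dvol k `^ (1 - t^-1) * tau i * (mm / C0) `^ (p i x * (1 + eps))^-1).
  apply: fineb.
  exact: ((h b j g k x i (tau i) nb ng (tau0 i) (htau i)).2 mm mm0 mmC hmm good).
have Y0 i : 0 <= (mm / C0) `^ (p i x * (1 + eps))^-1 by exact: powR_ge0.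
have := prod_assembly v0 (ltW Cp) (lam_gt0 k x) be0 ta0 F0 Y0 hF htA.
by rewrite prod_powR.
Qed.

Let bernoulli (h : R) (i : nat) : 0 <= h -> 1 + i%:R * h <= (1 + h) ^+ i.
Proof.
move=> h0; elim: i => [|i IH]; first by rewrite mul0r addr0 expr0.
rewrite exprS; apply: (@le_trans _ _ ((1 + h) * (1 + i%:R * h))).
  rewrite -natr1; have : 0 <= i%:R * h * h by rewrite !mulr_ge0.
  lra.
by apply: ler_wpM2l => //; rewrite addr_ge0.
Qed.

Let addS (k : int) (i : nat) : k + i.+1%:Z = k + i%:Z + 1.
Proof. by rewrite -addn1 PoszD addrA. Qed.

Let ratio_step (be be' la la' c gi X : R) : be' <= c * be -> la <= gi * la' -> 0 < la ->
  0 < la' -> 0 < be -> 0 <= c -> c * gi <= X -> be' / la' <= X * (be / la).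
Proof.
move=> hb hl l1 l2 be0 c0 key; rewrite ler_pdivrMr//; apply: (le_trans hb).
apply: (@le_trans _ _ (c * be * (gi * la' / la))).
  by rewrite ler_peMr ?mulr_ge0 ?(ltW be0)// ler_pdivlMr// mul1r.
have -> : c * be * (gi * la' / la) = c * gi * (be / la * la') by ring.
rewrite -[leRHS]mulrA; apply: ler_wpM2r key.
by apply: mulr_ge0 (ltW l2); exact: divr_ge0 (ltW be0) (ltW l1).
Qed.

(** Going up, [lam] grows geometrically while [beta] grows at most linearly. Half of the decay,
    whence the square root, absorbs the linear growth by Bernoulli's inequality. *)
Lemma ratio_growth : exists2 rho : R, 0 < rho < 1 & exists2 A : R, 1 <= A &
  forall b k x (i : nat), dyadic_bmo b -> ratio b (k + i%:Z) x <= A * rho ^+ i * ratio b k x.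
Proof.
have [g /andP[g0 g1] hg] := lam_step.
pose rho := Num.sqrt g; have rho0 : 0 < rho by rewrite sqrtr_gt0.
have rho2 : rho ^+ 2 = g by rewrite sqr_sqrtr// ltW.
have rho1 : rho < 1 by rewrite -sqrtr1 ltr_sqrt.
pose h := rho^-1 - 1; have h0 : 0 < h by rewrite subr_gt0 invf_gt1.
pose c : R := 2 ^+ n; have c0 : 0 <= c by rewrite exprn_ge0.
pose B := Num.max 1 (c / h); have B1 : 1 <= B by rewrite le_max lexx.
have Ac : c <= B * h by rewrite -ler_pdivrMr// le_max lexx orbT.
exists rho; first by rewrite rho0.
exists B => // b k x i nb.
have hb : beta b (k + i%:Z) x <= (1 + i%:R * c) * beta b k x.
  have : beta b (k + i%:Z) x <= beta b k x + i%:R * c.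
    elim: i => [|i IH]; first by rewrite addr0 mul0r addr0.
    have [mb ib osc _] := nb.
    have hc := davg_child (@didx_measurable R n) (@didx_nest R n) (@dvol_gt0 R n)
      (@leb_dcube R n) (@dvolS R n) mb ib osc (@dcube_refl _ _ _ (@didx R n) (k + i.+1%:Z) x).
    have kE : k + i.+1%:Z - 1 = k + i%:Z by rewrite addS addrK.
    rewrite kE in hc.
    have hd := ler_distD (davg b (k + i%:Z) x) (b x) (davg b (k + i.+1%:Z) x).
    rewrite /beta in IH *; rewrite -natr1 mulrDl mul1r addrA.
    by apply: le_trans (lerD IH hc); rewrite -addrA lerD2l.
  move=> h'; apply: le_trans h' _; rewrite mulrDl mul1r lerD2l.
  by rewrite ler_peMr ?beta_ge1// mulr_ge0.
have hl : lam k x <= g ^+ i * lam (k + i%:Z) x.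
  elim: i {hb} => [|i IH]; first by rewrite addr0 expr0 mul1r.
  apply: le_trans IH _; rewrite exprSr -mulrA; apply: ler_wpM2l.
    by apply: exprn_ge0; exact: ltW.
  by rewrite addS; exact: hg.
have l1 := lam_gt0 k x; have l2 := lam_gt0 (k + i%:Z) x.
have be0 := lt_le_trans ltr01 (beta_ge1 b k x).
have key : (1 + i%:R * c) * g ^+ i <= B * rho ^+ i.
  rewrite -rho2 exprAC expr2 mulrA; apply: ler_wpM2r; first by apply: exprn_ge0; exact: ltW.
  have hB' : 1 + i%:R * h <= rho^-1 ^+ i.
    by have := bernoulli i (ltW h0); rewrite {2}/h [1 + (_ - _)]addrC subrK.
  rewrite -ler_pdivlMr ?exprn_gt0// -exprVn.
  apply: (@le_trans _ _ (B * (1 + i%:R * h))); last by apply: ler_wpM2l hB'; exact: le_trans B1.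
  rewrite mulrDr mulr1; apply: lerD => //; rewrite mulrCA; apply: ler_wpM2l => //.
have ci0 : 0 <= 1 + i%:R * c by rewrite addr_ge0 ?mulr_ge0.
exact: (ratio_step hb hl l1 l2 be0 ci0 key).
Qed.

(** * Summation over the scales *)

Definition scale (N l : nat) : int := l%:Z - N%:Z.

Let scale_add N l i : scale N (l + i) = scale N l + i%:Z.
Proof. by rewrite /scale PoszD addrAC. Qed.

Let dvol_le k k' : (k <= k')%R -> dvol k <= dvol k'.
Proof.
by move=> kk; apply: lerXn2r; rewrite ?nnegrE ?(ltW (side_gt0 _ _))//; exact: side_le.
Qed.

Let dvol_add k (i : nat) : dvol (k + i%:Z) = dvol k * (2 ^+ n) ^+ i.
Proof. by rewrite /dvol sideD side_nat exprMn -!exprM [(i * n)%N]mulnC. Qed.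

Let dvol_pow (d : R) k (i : nat) :
  dvol (k + i%:Z) `^ d = ((2 ^+ n : R) `^ d) ^+ i * dvol k `^ d.
Proof.
have e0 : 0 <= 2 ^+ n :> R by rewrite exprn_ge0.
rewrite dvol_add (powRM d (ltW (dvol_gt0 R n k)) (exprn_ge0 i e0)) mulrC; congr (_ * _).
by rewrite -(powR_mulrn _ e0) -(powR_mulrn _ (powR_ge0 _ _)) powRAC.
Qed.

Let pow2_lt1 (d : R) : 0 < d -> (2 ^+ n : R) `^ (- d) < 1.
Proof.
move=> d0; have n1 : 1 < 2 ^+ n :> R by rewrite exprn_egt1 ?ltr1n// -lt0n.
have n0 : 0 < 2 ^+ n :> R by exact: lt_trans n1.
rewrite powRN invf_lt1 ?powR_gt0// -[ltLHS](_ : (1 : R) `^ d = 1); last by rewrite powR1.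
by apply: gt0_ltr_powR; rewrite ?nnegrE ?ler01 ?(ltW n0).
Qed.

Let pow2_gt0 (d : R) : 0 < (2 ^+ n : R) `^ d. Proof. by rewrite powR_gt0 ?exprn_gt0. Qed.

(** In terms of x = (v z)^(-c) the gain is the minimum of x and 1 / x, and x decays geometrically in
    the scale. *)
Let gain_sum : exists2 D : R, 0 < D & forall N L (z : R), 0 <= z ->
  \sum_(l < L) z * gain de (dvol (scale N l) * z) <= D * z.
Proof.
pose c := de / (1 + de); have c0 : 0 < c by rewrite divr_gt0// addr_gt0.
have [D D0 hD] := sum_min_le 1 (pow2_gt0 (- c)) (pow2_lt1 c0) (lexx 1) (ltr01 : (0 : R) < 1).
exists D => // N L z; rewrite le_eqVlt => /predU1P[<-|zp].
  by rewrite big1 ?mulr0// => l _; rewrite mul0r.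
have v0 k := dvol_gt0 R n k; have vz0 k : 0 < dvol k * z by exact: mulr_gt0.
rewrite -mulr_sumr mulrC ler_pM2r//.
have := hD L (fun l => (dvol (scale N l) * z) `^ (- c)) 1 (lexx _) (lexx _).
move=> /(_ (fun l => powR_gt0 _ (vz0 _))) h.
apply: le_trans (h _).
  apply: ler_sum => l _; rewrite /gain -/c -powRrM mulrN1 opprK.
  by rewrite minC.
move=> l i; rewrite mul1r scale_add !powRM ?(ltW (v0 _)) ?(ltW zp)//.
by rewrite dvol_pow mulrA.
Qed.

Let bump_sum : exists2 D : R, 0 < D & forall N L y,
  \sum_(l < L) bump (scale N l) y <= D * \1_(nearbox J) y.
Proof.
have v0 := dvol_gt0 R n k0; have vd0 : 0 < dvol k0 `^ (- de) by rewrite powR_gt0.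
have r0 := pow2_gt0 (- de); have rl1 := pow2_lt1 de0.
have r11 : 0 < 1 - (2 ^+ n : R) `^ (- de) by rewrite subr_gt0.
exists (dvol k0 `^ (- de) * (1 / (1 - (2 ^+ n : R) `^ (- de)))).
  by rewrite mulr_gt0// divr_gt0.
move=> N L y; rewrite /bump -mulr_suml; apply: ler_wpM2r; first by rewrite indicE; case: (_ \in _).
pose X l := dvol (scale N l) `^ (- de) / dvol k0 `^ (- de).
have X0 l : 0 < X l by exact: divr_gt0 (powR_gt0 _ (dvol_gt0 R n _)) vd0.
have hX l i : X (l + i)%N <= 1 * ((2 ^+ n : R) `^ (- de)) ^+ i * X l.
  by rewrite /X mul1r scale_add dvol_pow mulrA.
apply: le_trans (ler_wpM2l (ltW vd0) (sum_small_le L r0 rl1 ler01 X0 hX)).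
rewrite mulr_sumr; apply: ler_sum => l _.
case: (ltrP k0 (scale N l)) => h; last by rewrite mulr_ge0 ?(ltW vd0)//; case: ifP => // _; exact: ltW.
have -> : X l <= 1.
  rewrite /X ler_pdivrMr// mul1r.
  exact: le_powRN (ltW de0) v0 (dvol_le (ltW h)).
rewrite mulrC /X (divfK (lt0r_neq0 vd0)); exact: lexx.
Qed.

(** At every point the sum over the scales is bounded by the modular densities of the [g i] and the
    indicator of the box, both integrable. *)
Lemma Psi_total : exists2 C : R, 0 < C & forall g N L, normalized g ->
  (\sum_(l < L) \int[mu]_y (Psi g (scale N l) y)%:E <= C%:E)%E.
Proof.
have [D1 D10 h1] := gain_sum; have [D2 D20 h2] := bump_sum.
pose cN : R := 3 ^+ n * dvol J.
have cN0 : 0 <= cN by exact: mulr_ge0 (exprn_ge0 n (ler0n R 3)) (ltW (dvol_gt0 R n J)).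
exists (D1 * m%:R + D2 * cN + 1).
  by rewrite ltr_wpDl// addr_ge0// mulr_ge0// ltW.
move=> g N L ng; have mz i := measurable_power i ng; have [_ g0 hg] := ng.
have mPsi k := measurable_Psi k ng.
rewrite -(integral_sumR mu _ measurableT (fun l : 'I_L => mPsi (scale N l))
  (fun l y => Psi_ge0 g (scale N l) y)).
have mz' i : measurable_fun [set: E] (fun y => D1 * g i y `^ p i y).
  exact: measurable_funM (measurable_cst _) (mz i).
have mN : measurable_fun [set: E] (fun y => D2 * \1_(nearbox J) y : R).
  exact: measurable_funM (measurable_cst _) (measurable_indic mNB).
have zp i y : 0 <= D1 * g i y `^ p i y by rewrite mulr_ge0 ?powR_ge0// ltW.
have N0 y : 0 <= D2 * \1_(nearbox J) y :> R.
  by rewrite mulr_ge0 ?(ltW D20)// indicE; case: (_ \in _).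
have mS : measurable_fun [set: E] (fun y => \sum_(i < m) D1 * g i y `^ p i y).
  by apply: measurable_sum => i; exact: mz'.
have S0 y : 0 <= \sum_(i < m) D1 * g i y `^ p i y by apply: sumr_ge0 => i _; exact: zp.
apply: (@le_trans _ _ (\int[mu]_y (\sum_(i < m) D1 * g i y `^ p i y + D2 * \1_(nearbox J) y)%:E)%E).
  apply: ge0_le_integral_nomeas => y _; rewrite lee_fin.
    by apply: sumr_ge0 => l _; exact: Psi_ge0.
  rewrite /Psi big_split /=; apply: lerD; last exact: h2.
  by rewrite exchange_big /=; apply: ler_sum => i _; exact: h1 (powR_ge0 _ _).
rewrite (integralDR mu measurableT mS mN S0 N0) (integral_sumR mu _ measurableT mz' zp).
rewrite -addrA EFinD; apply: leeD.
  apply: (@le_trans _ _ (\sum_(i < m) D1%:E)%E).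
    apply: lee_sum => i _; rewrite (integralZl_real mu measurableT (ltW D10) (mz i)); last first.
      by move=> y; exact: powR_ge0.
    rewrite -[leRHS]mule1; apply: lee_wpmul2l; first by rewrite lee_fin ltW.
    by have := hg i; rewrite /modular; under eq_integral do rewrite divr1.
  by rewrite sumEFin sumr_const card_ord mulr_natr.
have mI : measurable_fun [set: E] (\1_(nearbox J) : E -> R) by exact: measurable_indic mNB.
rewrite (integralZl_real mu measurableT (ltW D20) mI); last first.
  by move=> y; rewrite indicE; case: (_ \in _).
rewrite integral_indic// setIT; apply: le_trans (lee_wpmul2l _ leb_nearbox) _.
  by rewrite lee_fin ltW.
by rewrite -EFinM lee_fin lerDl.
Qed.

Let scale_ex (k : int) : exists l : 'I_(absz k + absz k).+1, scale (absz k) l = k.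
Proof.
case: k => i; first by exists ord_max; rewrite /scale /= PoszD addrK.
by exists ord0; rewrite /scale /= sub0r NegzE.
Qed.

Let int_split (k k' : int) : (k' <= k)%R -> k = k' + (absz (k - k'))%:Z.
Proof. by move=> h; rewrite gez0_abs ?subr_ge0// addrCA subrr addr0. Qed.

Definition mass g k x : R := fine (\int[mu]_(y in tcube k x) (Psi g k y)%:E)%E.

Lemma mass_bound : exists2 C : R, 1 <= C & forall g k x, normalized g ->
  (\int[mu]_(y in tcube k x) (Psi g k y)%:E = (mass g k x)%:E)%E /\ 0 <= mass g k x <= C.
Proof.
have [C C0 h] := Psi_total; exists (C + 1); first by rewrite lerDr ltW.
move=> g k x ng; set I := (\int[mu]_(y in _) _)%E.
have I0 : (0 <= I)%E by apply: integral_ge0 => y _; rewrite lee_fin; exact: Psi_ge0.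
have IC : (I <= C%:E)%E.
  apply: le_trans (h g `|k|%N (`|k|%N + `|k|%N).+1 ng).
  have [l hl] := scale_ex k.
  rewrite (bigD1 l)//= hl; apply: (@le_trans _ _ (\int[mu]_y (Psi g k y)%:E)%E).
    exact: (integral_sub mu (measurable_tcube k x) measurableT _ (measurable_Psi k ng) (Psi_ge0 g k)).
  apply: leeDl; apply: sume_ge0 => i _; apply: integral_ge0 => y _.
  by rewrite lee_fin; exact: Psi_ge0.
have If : I \is a fin_num by rewrite ge0_fin_numE//; apply: le_lt_trans IC _; rewrite ltry.
rewrite /mass -/I fineK//; split=> //; rewrite fine_ge0//= -lee_fin fineK//.
by apply: le_trans IC _; rewrite lee_fin lerDl.
Qed.

(** The masses may vanish whereas the estimates ask for positive ones: they are raised by [e], which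
    then tends to 0. *)
Let lim_le (L r K : R) : 0 <= K -> (forall e : R, 0 < e -> e <= 1 -> L <= r + e * K) -> L <= r.
Proof.
move=> K0 h; apply/ler_addgt0Pr => e e0.
have K1 : 0 < K + 1 by rewrite ltr_wpDl.
pose d := Num.min 1 (e / (K + 1)).
have d0 : 0 < d by rewrite lt_min ltr01 divr_gt0.
have d1 : d <= 1 by rewrite ge_min lexx.
apply: le_trans (h d d0 d1) _; rewrite lerD2l.
apply: (@le_trans _ _ (e / (K + 1) * K)); first by apply: ler_wpM2r => //; rewrite ge_min lexx orbT.
by rewrite mulrAC ler_pdivrMr// ler_pM2l// lerDl.
Qed.

Let powR_add (a b r : R) : 0 <= a -> 0 <= b -> 0 <= r -> r <= q1 ->
  (a + b) `^ r <= 2 `^ q1 * (a `^ r + b `^ r).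
Proof.
move=> a0 b0 r0 rq; pose c := Num.max a b; have c0 : 0 <= c by rewrite le_max a0.
have h2 : 2 `^ r <= 2 `^ q1 :> R by rewrite ler_powR// ler1n.
apply: (@le_trans _ _ ((2 * c) `^ r)).
  apply: le_powR => //; first exact: addr_ge0.
  by rewrite mulr_natl mulr2n lerD// le_max lexx ?orbT.
rewrite powRM//; apply: ler_pM; rewrite ?powR_ge0// /c.
by case: (leP a b) => _; rewrite ?lerDr ?lerDl powR_ge0.
Qed.

Let Pinv_gt0 x : 0 < Pinv x.
Proof.
have e1 : 0 < (1 + eps)^-1 by rewrite invr_gt0 addr_gt0.
have -> : Pinv x = (\sum_(i < m) (p i x)^-1) / (1 + eps).
  by rewrite mulr_suml; apply: eq_bigr => i _; rewrite invfM.
by rewrite mulr_gt0// qp addr_gt0 ?invr_gt0.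
Qed.

(** The product of [q x] and [Pinv x] is (1 + q al) / (1 + eps), and by [epsal] eps is at most half
    of q al. This is where alpha > 0 enters. *)
Let exponent_gap x : eps / (1 + eps) <= q x / (Pinv x)^-1 - 1 <= q1 * al + 1.
Proof.
have e1 : 0 < 1 + eps by rewrite addr_gt0.
have PE : Pinv x = ((q x)^-1 + al) / (1 + eps).
  by rewrite -qp mulr_suml; apply: eq_bigr => i _; rewrite invfM.
have qn0 : q x != 0 by rewrite gt_eqF.
rewrite invrK PE; have -> : q x * (((q x)^-1 + al) / (1 + eps)) - 1 = (q x * al - eps) / (1 + eps).
  by field; rewrite qn0 gt_eqF.
have h1 : q0 * al <= q x * al by rewrite ler_pM2r.
have h2 : q x * al <= q1 * al by rewrite ler_pM2r.
have h3 : 0 <= q x * al by rewrite mulr_ge0 ?ltW.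
have ea := epsal; have e0 := eps0.
rewrite ler_pM2r ?invr_gt0//; apply/andP; split; first by lra.
rewrite ler_pdivrMr// mulrDr mulr1.
have : 0 <= (q1 * al + 1) * eps by rewrite mulr_ge0 ?(ltW e0)//; lra.
lra.
Qed.

(** Good scales are summed by [sum_power_le] with the power [Pinv x]. The others are above [k0] and
    occur only for [x] in the box, where the decay of [ratio] bounds their sum by its value at
    [k0]. *)
Lemma pointwise_sum : exists2 C : R, 0 < C & forall b j g N L x, dyadic_bmo b -> normalized g ->
  (\sum_(l < L) term b j g (scale N l) x) `^ q x <=
  C * (\sum_(l < L) ratio b (scale N l) x `^ q x * mass g (scale N l) x +
       \1_(nearbox J) x * ratio b k0 x `^ q x).
Proof.
(* The added 1 leaves room for raising the masses by [e <= 1]. *)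
have [C1 C11 hm] := mass_bound; pose C0 := C1 + 1.
have C01 : 1 <= C0 by rewrite lerDr (le_trans ler01).
have C00 : 0 < C0 by apply: lt_le_trans C01.
have [Ct Ct0 ht] := term_bounds C01.
have [rho /andP[r0 rl1] [B B1 hB']] := ratio_growth.
have B0 : 0 < B by apply: lt_le_trans B1.
have eps1 : 0 < eps / (1 + eps) by rewrite divr_gt0// addr_gt0.
have [Cs Cs0 hs] := sum_power_le q1 (q1 * al + 1) r0 rl1 B1 q00 eps1.
have q10 : 0 < q1 by apply: lt_le_trans (q_gt0 z0) (qq1 z0).
pose C2 := Num.max 1 Ct; have C21 : 1 <= C2 by rewrite le_max lexx.
have CtC2 : Ct <= C2 by rewrite le_max lexx orbT.
have C20 : 0 <= C2 by apply: le_trans C21.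
pose S1 := B / (1 - rho).
have S11 : 1 <= S1 by rewrite /S1 ler_pdivlMr ?subr_gt0// mul1r (le_trans _ B1)// gerBl ltW.
have S10 : 0 <= S1 by apply: le_trans S11.
pose C3 := C2 * (B * S1); have C30 : 0 <= C3 := mulr_ge0 C20 (mulr_ge0 (ltW B0) S10).
have C31 : 1 <= C3 by rewrite /C3 -[leLHS]mulr1 ler_pM// -[leLHS]mulr1 ler_pM.
pose Cf := 2 `^ q1 * (C2 `^ q1 * Cs + C3 `^ q1).
have Cf0 : 0 < Cf.
  rewrite mulr_gt0 ?powR_gt0// addr_gt0 ?mulr_gt0 ?powR_gt0//.
    exact: lt_le_trans C21.
  exact: lt_le_trans C31.
exists Cf => // b j g N L x nb ng.
set k := scale N; set u := fun l => ratio b (k l) x.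
have u0 l : 0 < u l := ratio_gt0 b (k l) x.
have qx0 := q_gt0 x.
have hu l i : u (l + i)%N <= B * rho ^+ i * u l by rewrite /u /k scale_add; exact: hB'.
have uq0 (l : nat) : 0 <= u l `^ q x by exact: powR_ge0.
apply: (@lim_le _ _ (Cf * \sum_(l < L) u l `^ q x)).
  by rewrite mulr_ge0 ?(ltW Cf0)// sumr_ge0.
move=> e e0 e1.
pose mm l := (mass g (k l) x + e) / C0.
have mm0 l : 0 < mass g (k l) x + e.
  by have [_ /andP[h _]] := hm g (k l) x ng; rewrite ltr_wpDl.
have mmC l : mass g (k l) x + e <= C0.
  by have [_ /andP[_ h]] := hm g (k l) x ng; rewrite lerD.
have mm1 l : 0 < mm l <= 1 by rewrite divr_gt0//= ler_pdivrMr// mul1r.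
pose isgood l := (k l <= k0)%R || ~~ `[< nearbox J x >].
have tgood l : isgood l -> term b j g (k l) x <= C2 * (u l * mm l `^ Pinv x).
  move=> gl; have good : (k l <= k0)%R \/ ~ nearbox J x.
    by case/orP: gl => [->|/asboolP]; [left|right].
  have [hmE _] := hm g (k l) x ng.
  have hle : (\int[mu]_(y in tcube (k l) x) (Psi g (k l) y)%:E <= (mass g (k l) x + e)%:E)%E.
    by rewrite hmE lee_fin lerDl ltW.
  have := (ht b j g (k l) x nb ng).2 _ (mm0 l) (mmC l) hle good.
  move=> h; apply: le_trans h _; apply: ler_wpM2r => //.
  exact: mulr_ge0 (ltW (u0 l)) (powR_ge0 _ _).
have tany l : term b j g (k l) x <= C2 * u l.
  apply: le_trans (ht b j g (k l) x nb ng).1 _.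
  by apply: (ler_wpM2r (ltW (u0 l))).
pose a := \sum_(l < L) u l * mm l `^ Pinv x.
pose c := \sum_(l < L) (if isgood l then 0 else u l).
have a0 : 0 <= a by apply: sumr_ge0 => l _; exact: mulr_ge0 (ltW (u0 l)) (powR_ge0 _ _).
have c0 : 0 <= c by apply: sumr_ge0 => l _; case: ifP => // _; exact: (ltW (u0 l)).
have hsum : \sum_(l < L) term b j g (k l) x <= C2 * a + C2 * c.
  rewrite /a /c !mulr_sumr -big_split /=; apply: ler_sum => l _.
  case: (boolP (isgood l)) => gl; first by rewrite mulr0 addr0; exact: tgood.
  apply: le_trans (tany l) _; rewrite lerDr; apply: mulr_ge0 => //; exact: mulr_ge0 (ltW (u0 l)) (powR_ge0 _ _).
have ha : a `^ q x <= Cs * \sum_(l < L) u l `^ q x * (mass g (k l) x + e).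
  have /andP[g1 g2] := exponent_gap x.
  have := hs L u mm (q x) (Pinv x)^-1 (q0q x) (qq1 x) _ g1 g2 u0 hu mm1.
  rewrite invr_gt0 invrK => /(_ (Pinv_gt0 x)) h; apply: le_trans h _.
  apply: ler_wpM2l; first exact: ltW.
  apply: ler_sum => l _; apply: ler_wpM2l => //.
  by rewrite /mm ler_pdivrMr// ler_peMr// ltW.
have hc : c <= B * S1 * (\1_(nearbox J) x * ratio b k0 x).
  have rk0 := ratio_gt0 b k0 x.
  case: (pselect (nearbox J x)) => [Nx|nNx]; last first.
    rewrite indicE memNset// mul0r mulr0 /c big1// => l _.
    by rewrite /isgood (introN (asboolP _) nNx) orbT.
  rewrite indicE mem_set// mul1r.
  (* Relative to [B * ratio b k0 x] all terms above scale [k0] are at most 1, so [sum_small_le]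
     counts them. *)
  pose X l := u l / (B * ratio b k0 x).
  have Br0 : 0 < B * ratio b k0 x by rewrite mulr_gt0.
  have X0 l : 0 < X l by exact: (divr_gt0 (u0 l) Br0).
  have hX l i : X (l + i)%N <= B * rho ^+ i * X l.
    by rewrite /X mulrA; apply: ler_wpM2r (hu l i); rewrite invr_ge0 ltW.
  have := sum_small_le L r0 rl1 (ltW B0) X0 hX.
  rewrite -(ler_pM2l Br0) => h.
  apply: (@le_trans _ _ (B * ratio b k0 x * (\sum_(l < L) (if X l <= 1 then X l else 0)))).
    rewrite mulr_sumr; apply: ler_sum => l _; rewrite /isgood.
    case: (lerP (k l) k0) => h' /=; first by rewrite mulr_ge0 ?(ltW Br0)//; case: ifP => // _; exact: (ltW (X0 l)).
    have -> : `[< nearbox J x >] by apply/asboolP.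
    have hXl : X l <= 1.
      rewrite /X ler_pdivrMr// mul1r.
      have kE := int_split (ltW h').
      have := hB' b k0 x (absz (k l - k0)) nb; rewrite -kE => h2.
      apply: le_trans h2 _; apply: ler_wpM2r; first exact: ltW.
      by rewrite ler_piMr ?(ltW B0)// exprn_ile1// ltW.
    rewrite hXl /X mulrC (divfK (lt0r_neq0 Br0)); exact: lexx.
  by apply: le_trans h _; rewrite -/S1 mulrAC.
apply: (@le_trans _ _ ((C2 * a + C2 * c) `^ q x)).
  apply: (le_powR (ltW qx0)); last exact: hsum.
  by apply: sumr_ge0 => l _; exact: term_ge0.
apply: le_trans (powR_add (mulr_ge0 C20 a0) (mulr_ge0 C20 c0) (ltW qx0) (qq1 x)) _.
set X := \sum_(l < L) u l `^ q x * mass g (k l) x.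
set Z := \1_(nearbox J) x * ratio b k0 x `^ q x.
set U := \sum_(l < L) u l `^ q x.
have U0 : 0 <= U by apply: sumr_ge0.
have XE : \sum_(l < L) u l `^ q x * (mass g (k l) x + e) = X + e * U.
  by rewrite /X /U mulr_sumr -big_split /=; apply: eq_bigr => l _; ring.
rewrite XE in ha.
have X0 : 0 <= X by apply: sumr_ge0 => l _; rewrite mulr_ge0//; have [_ /andP[]] := hm g (k l) x ng.
have Z0 : 0 <= Z by rewrite mulr_ge0 ?powR_ge0// indicE; case: (_ \in _).
have h1 : (C2 * a) `^ q x <= C2 `^ q1 * Cs * (X + e * U).
  rewrite powRM// -mulrA; apply: ler_pM; rewrite ?powR_ge0//.
  by apply: ler_powR.
have h2 : (C2 * c) `^ q x <= C3 `^ q1 * Z.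
  have Y0 : 0 <= \1_(nearbox J) x * ratio b k0 x.
    by rewrite mulr_ge0 ?(ltW (ratio_gt0 b k0 x))// indicE; case: (_ \in _).
  apply: (@le_trans _ _ ((C3 * (\1_(nearbox J) x * ratio b k0 x)) `^ q x)).
    apply: (le_powR (ltW qx0)); first exact: mulr_ge0.
    by rewrite /C3 -mulrA; apply: ler_wpM2l.
  rewrite powRM//; apply: ler_pM; rewrite ?powR_ge0//.
    by apply: ler_powR.
  rewrite /Z indicE; case: (_ \in _); rewrite ?mul1r ?mul0r ?powR0 ?gt_eqF//.
apply: (@le_trans _ _ (2 `^ q1 * (C2 `^ q1 * Cs * (X + e * U) + C3 `^ q1 * Z))).
  by apply: ler_wpM2l; [exact: powR_ge0|exact: lerD].
have -> : Cf * (X + Z) + e * (Cf * U) = Cf * (X + e * U + Z) by ring.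
rewrite /Cf -[leRHS]mulrA; apply: ler_wpM2l; first exact: powR_ge0.
have K1 : 0 <= C2 `^ q1 * Cs by rewrite mulr_ge0 ?powR_ge0// ltW.
have K2 : 0 <= C3 `^ q1 by exact: powR_ge0.
have W0 : 0 <= X + e * U by rewrite addr_ge0// mulr_ge0// ltW.
rewrite [leRHS]mulrDr; apply: lerD; apply: ler_wpM2r => //; rewrite ?lerDl ?lerDr//.
Qed.

(** This is [om] times [ratio] to the power [q]; its integral over a cube is a weighted moment of
    the oscillation. *)
Definition local_mass b k x : R := beta b k x `^ q x * kap k x x.

Let local_massE b k x y : dcube k x y ->
  local_mass b k y = (1 + `|b y - davg b k x|) `^ q y * kap k x y.
Proof.
move=> xy; rewrite /local_mass /beta /kap (lam_eq xy).
by rewrite (davg_eq mu dvol b (xy : didx k y = didx k x)).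
Qed.

Let local_mass_ge0 b k x : 0 <= local_mass b k x.
Proof. exact: mulr_ge0 (powR_ge0 _ _) (powR_ge0 _ _). Qed.

Let measurable_lam k : measurable_fun [set: E] (lam k).
Proof.
apply: (measurable_fun_dcube (@didx_measurable R n) (k := k)) => x y xy.
exact: lam_eq xy.
Qed.

Let measurable_local_mass b k : dyadic_bmo b -> measurable_fun [set: E] (local_mass b k).
Proof.
move=> [mb _ _ _].
have ma : measurable_fun [set: E] (davg b k).
  apply: (measurable_fun_dcube (@didx_measurable R n) (k := k)) => x y xy.
  exact: davg_eq.
have mbeta : measurable_fun [set: E] (beta b k).
  exact: (measurable_funD (@measurable_cst _ _ E R setT 1) (measurable_absB mb ma)).
have mli : measurable_fun [set: E] (fun x => (lam k x)^-1).
  by apply: measurable_invr; [exact: lam_gt0|exact: measurable_lam].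
apply: measurable_funM; first exact: measurable_powR2 mbeta mq.
exact: measurable_powR2 (measurable_funM mom mli) mq.
Qed.

Let measurable_mass g k : measurable_fun [set: E] (mass g k).
Proof.
apply: (measurable_fun_dcube (@didx_measurable R n) (k := k)) => x y xy.
by rewrite /mass (eq_tcube xy).
Qed.

Let local_mass_moment : exists2 C : R, 0 <= C & forall b k x, dyadic_bmo b ->
  (\int[mu]_(y in dcube k x) (local_mass b k y)%:E <= C%:E)%E.
Proof.
have [C C0 h] := weighted_bmo_moment; exists C; first exact: C0.
move=> b k x nb.
apply: le_trans (h b k x nb); apply: ge0_le_integral_nomeas => y xy; rewrite lee_fin.
  exact: local_mass_ge0.
by rewrite (local_massE b xy); exact: lexx.
Qed.

(** On each cube [mass] is constant, so [local_mass] can be replaced there by its average bound;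
    integrating [mass] over the space then counts every point once per neighbour. *)
Lemma integral_local_mass : exists2 C : R, 0 <= C & forall b g k, dyadic_bmo b -> normalized g ->
  (\int[mu]_x (local_mass b k x * mass g k x)%:E <= C%:E * \int[mu]_y (Psi g k y)%:E)%E.
Proof.
have [C C0 h] := local_mass_moment; have [C1 C11 hm] := mass_bound.
exists (C * 3 ^+ n); first by rewrite mulr_ge0// exprn_ge0.
move=> b g k nb ng; have v0 := dvol_gt0 R n k.
have mW := measurable_local_mass k nb; have mm := measurable_mass g k.
have W0 := local_mass_ge0 b k; have m0 x : 0 <= mass g k x by have [_ /andP[]] := hm g k x ng.
have Cv0 : 0 <= C / dvol k by exact: divr_ge0 C0 (ltW v0).
have mE D (f : E -> R) : measurable_fun [set: E] f -> measurable_fun D (fun y => (f y)%:E).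
  by move=> mf; apply/measurable_EFinP; exact: measurable_funTS.
have sT : saturated (@didx R n) k [set: E] by [].
have mWm : measurable_fun [set: E] (fun x => local_mass b k x * mass g k x).
  exact: measurable_funM.
have mCm : measurable_fun [set: E] (fun x => C / dvol k * mass g k x).
  exact: measurable_funM (measurable_cst _) mm.
apply: (@le_trans _ _ (\int[mu]_x (C / dvol k * mass g k x)%:E)%E).
  apply: (integral_saturated_le (@didx_measurable R n) sT (mE _ _ mWm) (mE _ _ mCm)).
  - by move=> x _; rewrite lee_fin mulr_ge0.
  - by move=> x _; rewrite lee_fin mulr_ge0.
  move=> x _; have md := @measurable_ddcube R n k x.
  have massE y : dcube k x y -> mass g k y = mass g k x.
    by move=> xy; rewrite /mass (eq_tcube xy).
  apply: (@le_trans _ _ (\int[mu]_(y in dcube k x) (mass g k x * local_mass b k y)%:E)%E).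
    apply: ge0_le_integral_nomeas => y xy; rewrite lee_fin; first exact: mulr_ge0.
    by rewrite (massE y xy) mulrC; exact: lexx.
  rewrite (integralZl_real mu md (m0 x) mW W0).
  apply: le_trans (lee_wpmul2l _ (h b k x nb)) _; first by rewrite lee_fin.
  apply: (@le_trans _ _ (\int[mu]_(y in dcube k x) (C / dvol k * mass g k x)%:E)%E).
    rewrite integral_cst// [X in (_ <= _ * X)%E](_ : _ = (dvol k)%:E); last exact: leb_dcube.
    rewrite -!EFinM lee_fin mulrAC (divfK (lt0r_neq0 v0)) mulrC; exact: lexx.
  apply: ge0_le_integral_nomeas => y xy; rewrite lee_fin; first exact: mulr_ge0.
  by rewrite (massE y xy); exact: lexx.
rewrite (integralZl_real mu measurableT Cv0 mm m0).
have -> : (\int[mu]_x (mass g k x)%:E = (3 ^+ n * dvol k)%:E * \int[mu]_y (Psi g k y)%:E)%E.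
  rewrite -(integral_neighbours k (measurable_Psi k ng) (Psi_ge0 g k)).
  by apply: eq_integral => x _; rewrite (hm g k x ng).1.
rewrite muleA -EFinM; have -> : C / dvol k * (3 ^+ n * dvol k) = C * 3 ^+ n.
  by field; exact: lt0r_neq0.
exact: lexx.
Qed.

Lemma integral_sum_terms : exists2 C : R, 0 < C & forall b j g N L, dyadic_bmo b ->
  normalized g ->
  (\int[mu]_x ((om x * \sum_(l < L) term b j g (scale N l) x) `^ q x)%:E <= C%:E)%E.
Proof.
have [Cp Cp0 hp] := pointwise_sum; have [Cm Cm0 hm] := integral_local_mass.
have [CP CP0 hP] := Psi_total; have [Cl Cl0 hl] := local_mass_moment.
have [C1 C11 hmass] := mass_bound.
pose cN : R := 3 ^+ n * dvol J.
have cN0 : 0 <= cN by exact: mulr_ge0 (exprn_ge0 n (ler0n R 3)) (ltW (dvol_gt0 R n J)).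
have v0 := dvol_gt0 R n k0.
have Clv0 : 0 <= Cl / dvol k0 by exact: divr_ge0 Cl0 (ltW v0).
exists (Cp * (Cm * CP + Cl / dvol k0 * cN) + 1).
  apply: ltr_wpDl => //; apply: mulr_ge0; first exact: ltW.
  by apply: addr_ge0; apply: mulr_ge0 => //; exact: ltW.
move=> b j g N L nb ng; set k := scale N.
have W0 l := local_mass_ge0 b l; have m0 l x : 0 <= mass g l x by have [_ /andP[]] := hmass g l x ng.
have mW l := measurable_local_mass l nb.
have mE D (f : E -> R) : measurable_fun [set: E] f -> measurable_fun D (fun y => (f y)%:E).
  by move=> mf; apply/measurable_EFinP; exact: measurable_funTS.
have mN : measurable_fun [set: E] (\1_(nearbox J) : E -> R) by exact: measurable_indic mNB.
have N0 x : 0 <= \1_(nearbox J) x :> R by rewrite indicE; case: (_ \in _).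
pose F x : R := \sum_(l < L) local_mass b (k l) x * mass g (k l) x.
pose G x : R := \1_(nearbox J) x * local_mass b k0 x.
have mWm l : measurable_fun [set: E] (fun x => local_mass b l x * mass g l x).
  exact: measurable_funM (mW l) (measurable_mass g l).
have Wm0 l x : 0 <= local_mass b l x * mass g l x by exact: mulr_ge0.
have mF : measurable_fun [set: E] F by apply: measurable_sum => l; exact: mWm.
have mG : measurable_fun [set: E] G by exact: measurable_funM mN (mW k0).
have F0 x : 0 <= F x by apply: sumr_ge0.
have G0 x : 0 <= G x by exact: mulr_ge0.
apply: (@le_trans _ _ (\int[mu]_x (Cp * (F x + G x))%:E)%E).
  apply: ge0_le_integral_nomeas => x _; rewrite lee_fin; first exact: powR_ge0.
  have S0 : 0 <= \sum_(l < L) term b j g (k l) x by apply: sumr_ge0 => l _; exact: term_ge0.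
  rewrite powRM//.
  have key l : om x `^ q x * ratio b l x `^ q x = local_mass b l x.
    have be0 := le_trans ler01 (beta_ge1 b l x).
    rewrite /local_mass /kap /ratio !powRM ?invr_ge0 ?(ltW (lam_gt0 l x)) ?om_ge0//.
    ring.
  apply: (le_trans (ler_wpM2l (powR_ge0 _ _) (hp b j g N L x nb ng))).
  rewrite mulrCA; apply: ler_wpM2l; first exact: ltW.
  rewrite mulrDr /F /G mulr_sumr; apply: lerD.
    by apply: ler_sum => l _; rewrite mulrA key; exact: lexx.
  rewrite mulrCA key; exact: lexx.
have mFG : measurable_fun [set: E] (fun x => F x + G x) by exact: measurable_funD.
rewrite (integralZl_real mu measurableT (ltW Cp0) mFG); last by move=> x; exact: addr_ge0.
rewrite (integralDR mu measurableT mF mG F0 G0).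
have hF : (\int[mu]_x (F x)%:E <= (Cm * CP)%:E)%E.
  rewrite /F (integral_sumR mu _ measurableT (fun l : 'I_L => mWm (k l)) (fun l => Wm0 (k l))).
  apply: (@le_trans _ _ (\sum_(l < L) Cm%:E * \int[mu]_y (Psi g (k l) y)%:E)%E).
    by apply: lee_sum => l _; exact: hm.
  rewrite -ge0_sume_distrr; last first.
    by move=> l _; apply: integral_ge0 => y _; rewrite lee_fin; exact: Psi_ge0.
  by rewrite EFinM; apply: lee_wpmul2l; [rewrite lee_fin|exact: hP].
have hG : (\int[mu]_x (G x)%:E <= (Cl / dvol k0 * cN)%:E)%E.
  have -> : (\int[mu]_x (G x)%:E = \int[mu]_(x in nearbox J) (local_mass b k0 x)%:E)%E.
    rewrite [RHS]integral_mkcond; apply: eq_integral => x _.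
    by rewrite patchE /G indicE; case: (_ \in _); rewrite ?mul1r ?mul0r.
  (* Since [k0 <= 0 <= J], the box is a union of cubes of scale [k0]. *)
  have satN : saturated (@didx R n) k0 (nearbox J).
    exact: saturated_nearbox (le_trans k00 J0).
  apply: (@le_trans _ _ (\int[mu]_(x in nearbox J) (Cl / dvol k0)%:E)%E).
    have mc : measurable_fun (nearbox J) (fun _ : E => (Cl / dvol k0)%:E) by exact: measurable_cst.
    apply: (integral_saturated_le (@didx_measurable R n) satN (mE _ _ (mW k0)) mc).
    - by move=> x _; rewrite lee_fin.
    - by move=> x _; rewrite lee_fin.
    move=> x _; apply: le_trans (hl b k0 x nb) _.
    rewrite integral_cst; last exact: measurable_ddcube.
    rewrite [X in (_ <= _ * X)%E](_ : _ = (dvol k0)%:E); last exact: leb_dcube.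
    rewrite -EFinM (divfK (lt0r_neq0 v0)); exact: lexx.
  rewrite integral_cst// [leRHS]EFinM; apply: lee_wpmul2l; [by rewrite lee_fin|exact: leb_nearbox].
apply: le_trans (lee_wpmul2l _ (leeD hF hG)) _; first by rewrite lee_fin ltW.
by rewrite -EFinD -EFinM lee_fin lerDl.
Qed.

(** Finiteness of the integral, which [fine] conceals in [cube_mean]. *)
Lemma cube_meanE b j g k x i : dyadic_bmo b -> normalized g ->
  (\int[mu]_(y in tcube k x) (osc_weight b j i k x y * g i y * w i y)%:E =
   (cube_mean b j g k x i)%:E)%E.
Proof.
move=> nb ng; have [C C0 h] := cube_bounds (lexx 1); have [A3 A30 hA3] := bump_tcube.
have [tau [tau0 htau _]] := hA3 k x.
rewrite /cube_mean fineK// ge0_fin_numE; last exact: meanE_ge0.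
by apply: le_lt_trans (h b j g k x i (tau i) nb ng (tau0 i) (htau i)).1 _; rewrite ltry.
Qed.

End weight_norms.

(** * Pointwise bounds for the exponents *)

Lemma midpoint_absurd (R : realType) (a b c : R) :
  a < c -> b - (c - a) / 2 <= a -> c <= b -> False.
Proof. by move=> *; lra. Qed.

Lemma le_sum_absz m (f : 'I_m -> int) i :
  (- (\sum_(l < m) absz (f l))%N%:Z <= f i)%R /\ (f i <= (\sum_(l < m) absz (f l))%N%:Z)%R.
Proof.
have h : (`|f i| <= (\sum_(l < m) absz (f l))%N%:Z)%R.
  by rewrite -abszE lez_nat (bigD1 i)//= leq_addr.
by move: h; rewrite ler_norml => /andP[].
Qed.

Section exponents.
Context (R : realType) (n m : nat).
Local Notation E := (Rn R n).
Local Notation mu := (@leb R n).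
Local Notation side := (side R).
Local Notation dcube := (dcube (@didx R n)).
Implicit Types (x y : E) (k : int).

Definition cube_continuous (h : E -> R) : Prop :=
  forall x (e : R), 0 < e -> exists k, forall y, dcube k x y -> `|h x - h y| <= e.

(** A violation would persist on a whole cube, which has positive measure. *)
Lemma ae_le_everywhere (h : E -> R) (c : R) : cube_continuous h ->
  {ae mu, forall x, c <= h x} -> forall x, c <= h x.
Proof.
move=> hc [N [mN N0 hN]] x; rewrite leNgt; apply/negP => hx.
have e0 : 0 < (c - h x) / 2 by rewrite divr_gt0// subr_gt0.
have [k hk] := hc x _ e0.
have dN : dcube k x `<=` N.
  move=> y xy; apply: hN => /= hy; have := hk y xy; rewrite ler_distl => /andP[h1 _].
  exact: midpoint_absurd hx h1 hy.
have := le_measure mu (mem_set (measurable_ddcube k x)) (mem_set mN) dN.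
have v0 := dvol_gt0 R n k.
rewrite [X in (X <= _)%E](_ : _ = (dvol R n k)%:E); last exact: leb_dcube.
rewrite [X in (_ <= X)%E](_ : _ = 0%E); last exact: N0.
by rewrite lee_fin leNgt v0.
Qed.

Lemma log_Holder_continuous p : log_Holder p -> cube_continuous p.
Proof.
move=> hp x e e0; have [k0 _ h] := LH_unif hp e0.
by exists k0 => y xy; apply: (h k0) => //; exact: sub_dcube_tcube.
Qed.

Lemma sum_inv_continuous (p : 'I_m -> E -> R) : (forall i x, 1 <= p i x) ->
  (forall i, log_Holder (p i)) -> cube_continuous (fun x => \sum_(i < m) (p i x)^-1).
Proof.
move=> p1 hp x e e0; have em0 : 0 < e / (m%:R + 1) by rewrite divr_gt0// ltr_wpDl.
have [kf hkf] := choice (fun i => log_Holder_continuous (hp i) x em0).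
exists (- (\sum_(i < m) absz (kf i))%N%:Z) => y xy.
rewrite -sumrB; apply: le_trans (ler_norm_sum _ _ _) _.
apply: (@le_trans _ _ (\sum_(i < m) e / (m%:R + 1))).
  apply: ler_sum => i _; have xi : 0 < p i x by exact: lt_le_trans (p1 i x).
  have yi : 0 < p i y by exact: lt_le_trans (p1 i y).
  have -> : (p i x)^-1 - (p i y)^-1 = (p i y - p i x) / (p i x * p i y).
    by field; rewrite !gt_eqF.
  rewrite normrM (gtr0_norm (_ : 0 < (p i x * p i y)^-1)) ?invr_gt0 ?mulr_gt0//.
  apply: (@le_trans _ _ `|p i y - p i x|).
    by rewrite ler_piMr// invf_le1 ?mulr_gt0// -[leLHS]mulr1 ler_pM.
  rewrite distrC; apply: hkf; apply: (sub_dcube (@didx_nest R n) _ _ xy); last exact: dcube_refl.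
  exact: (le_sum_absz kf i).1.
rewrite sumr_const card_ord -[leLHS]mulr_natr -mulrA ler_piMr ?(ltW e0)//.
by rewrite mulrC ler_pdivrMr ?ltr_wpDl// mul1r lerDl.
Qed.

(** If p x and p y differ by at most eps / 2, then p y <= p x (1 + eps / 2) as p x >= 1, and [de] is
    small enough for 1 / p y - de to stay above 1 / (p x (1 + eps)). *)
Lemma exponent_parameters (p : 'I_m -> E -> R) (pp t eps : R) :
  (forall i, log_Holder (p i)) -> (forall i x, 1 <= p i x) -> (forall i x, p i x <= pp) ->
  1 <= pp -> 1 < t -> 0 < eps -> exists (de : R) (J k0 : int),
  [/\ [/\ 0 < de, de < 1 - t^-1, de < 1 & de * pp < 1], (0 <= J)%R, (k0 <= 0)%R,
    forall i k x y, (k <= k0)%R -> tcube k x y ->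
      aexp (p i) (- de) y <= p i x * (1 + eps) &
    forall i x y, ~ nearbox J x -> ~ nearbox J y ->
      aexp (p i) (- de) y <= p i x * (1 + eps)].
Proof.
move=> hp p1 ppp pp1 t1 e0; have pp0 : 0 < pp by exact: lt_le_trans pp1.
have ti0 : 0 < 1 - t^-1 by rewrite subr_gt0 invf_lt1// (lt_trans _ t1).
have ti1 : 1 - t^-1 < 1 by rewrite gtrBl invr_gt0 (lt_trans _ t1).
(* The difference between 1 / (P (1 + eps / 2)) and 1 / (P (1 + eps)) at P = [pp], where it is
   smallest. *)
pose d0 := eps / 2 / (pp * ((1 + eps / 2) * (1 + eps))).
have D0 : 0 < (1 + eps / 2) * (1 + eps) by rewrite mulr_gt0// addr_gt0// divr_gt0.
have d00 : 0 < d0 by rewrite !divr_gt0// mulr_gt0.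
have d0p : d0 * pp < 1.
  have -> : d0 * pp = eps / 2 / ((1 + eps / 2) * (1 + eps)).
    by rewrite /d0; field; rewrite !gt_eqF// addr_gt0// divr_gt0.
  by rewrite ltr_pdivrMr// mul1r; nra.
pose de := Num.min d0 ((1 - t^-1) / 2).
have de0 : 0 < de by rewrite lt_min d00 divr_gt0.
have ded0 : de <= d0 by rewrite ge_min lexx.
have det : de < 1 - t^-1.
  apply: (@le_lt_trans _ _ ((1 - t^-1) / 2)); first by rewrite ge_min lexx orbT.
  by rewrite ltr_pdivrMr// mulr_natr mulr2n ltrDl.
have eta0 : 0 < eps / 2 by rewrite divr_gt0.
have key i x y : `|p i x - p i y| <= eps / 2 -> aexp (p i) (- de) y <= p i x * (1 + eps).
  rewrite ler_distl lerBlDr => /andP[h _]; have x1 := p1 i x; have y1 := p1 i y; have xp := ppp i x.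
  have x0 : 0 < p i x by exact: lt_le_trans x1.
  have y0 : 0 < p i y by exact: lt_le_trans y1.
  rewrite /aexp; set X := p i x * (1 + eps).
  have X0 : 0 < X by rewrite mulr_gt0// addr_gt0.
  rewrite -[X]invrK; have a0 : X^-1 <= (p i y)^-1 + - de.
    rewrite lerBrDr; apply: (@le_trans _ _ ((p i x * (1 + eps / 2))^-1)); last first.
      rewrite lef_pV2 ?posrE ?mulr_gt0 ?addr_gt0//.
      by rewrite mulrDr mulr1 (le_trans h)// lerD2l ler_peMl// ltW.
    have -> : (p i x * (1 + eps / 2))^-1 =
        X^-1 + eps / 2 / (p i x * ((1 + eps / 2) * (1 + eps))).
      by rewrite /X; field; rewrite !gt_eqF// addr_gt0.
    rewrite lerD2l; apply: le_trans ded0 _; rewrite /d0 ler_pM2l//.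
    have m1 := mulr_gt0 pp0 D0; have m2 := mulr_gt0 x0 D0.
    by rewrite lef_pV2 ?posrE// ler_pM2r.
  have Xi0 : 0 < X^-1 by rewrite invr_gt0.
  by rewrite lef_pV2 ?posrE// (lt_le_trans Xi0).
have [kf hkf] := choice (fun i => let: ex_intro2 k a b := LH_unif (hp i) eta0 in
  ex_intro (fun k => (k <= 0)%R /\ forall k' x y, (k' <= k)%R -> tcube k' x y ->
    `|p i x - p i y| <= eps / 2) k (conj a b)).
have [Jf hJf] := choice (fun i => let: ex_intro2 k a b := LH_infty (hp i) eta0 in
  ex_intro (fun k => (0 <= k)%R /\ forall x y, ~ nearbox k x -> ~ nearbox k y ->
    `|p i x - p i y| <= eps / 2) k (conj a b)).
(* Sums of absolute values serve all indices [i] at once. *)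
exists de, (\sum_(i < m) absz (Jf i))%N%:Z, (- (\sum_(i < m) absz (kf i))%N%:Z).
split=> //.
- split=> //; first exact: lt_trans ti1.
  by apply: le_lt_trans d0p; rewrite ler_pM2r.
- move=> i k x y kk xy; apply: key; apply: (hkf i).2 xy; apply: le_trans kk _.
  exact: (le_sum_absz kf i).1.
- have sub i : nearbox (Jf i) `<=` @nearbox R n (\sum_(i < m) absz (Jf i))%N%:Z.
    apply: nearbox_le.
    exact: (le_sum_absz Jf i).2.
  by move=> i x y nx ny; apply: key; apply: (hJf i).2 => /(sub i).
Qed.

(** Passing to reciprocals is Lipschitz for exponents that are at least 1, and passing back is
    Lipschitz because [q] is bounded; the constant [al] cancels in differences. *)
Lemma q_local (p : 'I_m -> E -> R) (q : E -> R) (al q1 : R) :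
  (forall i, log_Holder (p i)) -> (forall i x, 1 <= p i x) -> (forall x, 0 < q x <= q1) ->
  (forall x, \sum_(i < m) (p i x)^-1 = (q x)^-1 + al) ->
  exists2 C : R, 0 < C & forall k x y, local_cube k x -> dcube k x y ->
  `|q x - q y| * (ln (expR 1 + eucl_norm x) + Num.max 0 (- ln (side k))) <= C.
Proof.
move=> hp p1 hq hpq.
have [Cf hCf] := choice (fun i => let: ex_intro2 k a b := LH_local (hp i) in
  ex_intro (fun C => 0 < C /\ forall k x y, local_cube k x -> dcube k x y ->
   `|p i x - p i y| * (ln (expR 1 + eucl_norm x) + Num.max 0 (- ln (side k))) <= C) k (conj a b)).
have S0 : 0 <= \sum_(i < m) Cf i by apply: sumr_ge0 => i _; exact: ltW (hCf i).1.
exists (q1 ^+ 2 * (\sum_(i < m) Cf i) + 1).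
  by rewrite ltr_wpDl// mulr_ge0// sqr_ge0.
move=> k x y lkx xy; set L := ln _ + _.
have L0 : 0 <= L.
  rewrite addr_ge0// ?le_max ?lexx// ln_ge0//.
  apply: (@le_trans _ _ (expR 1)); first by rewrite -[leLHS](@expR0 R) ler_expR.
  by rewrite lerDl sqrtr_ge0.
have /andP[qx0 qx1] := hq x; have /andP[qy0 qy1] := hq y.
have q10 : 0 <= q1 by apply: le_trans qx1; exact: ltW.
have hqd : `|q x - q y| <= q1 ^+ 2 * \sum_(i < m) `|p i x - p i y|.
  have -> : q x - q y = q x * q y * \sum_(i < m) ((p i y)^-1 - (p i x)^-1).
    by rewrite sumrB !hpq; field; rewrite !gt_eqF.
  rewrite normrM (gtr0_norm (mulr_gt0 qx0 qy0)); apply: ler_pM => //.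
  - by rewrite mulr_ge0// ltW.
  - by rewrite expr2; apply: ler_pM => //; exact: ltW.
  apply: le_trans (ler_norm_sum _ _ _) _; apply: ler_sum => i _.
  have xi : 0 < p i x by exact: lt_le_trans (p1 i x).
  have yi : 0 < p i y by exact: lt_le_trans (p1 i y).
  have -> : (p i y)^-1 - (p i x)^-1 = (p i x - p i y) / (p i x * p i y).
    by field; rewrite !gt_eqF.
  rewrite normrM (gtr0_norm (_ : 0 < (p i x * p i y)^-1)) ?invr_gt0 ?mulr_gt0//.
  by rewrite ler_piMr// invf_le1 ?mulr_gt0// -[leLHS]mulr1 ler_pM.
apply: (le_trans (ler_wpM2r L0 hqd)); rewrite -mulrA mulr_suml.
apply: (@le_trans _ _ (q1 ^+ 2 * \sum_(i < m) Cf i)); last by rewrite lerDl.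
apply: ler_wpM2l; first exact: sqr_ge0.
by apply: ler_sum => i _; exact: (hCf i).2.
Qed.

End exponents.

(** * From BMO to normalized dyadic oscillation *)

Lemma half_add_le (R : realType) (v a : R) : 0 <= v -> a <= 1 / 2 -> v / 2 + a * v <= v.
Proof. by move=> v0 h; have := ler_wpM2r v0 h; lra. Qed.

Section normalized_bmo.
Context (R : realType) (n : nat).
Local Notation E := (Rn R n).
Local Notation mu := (@leb R n).
Local Notation dcube := (dcube (@didx R n)).
Local Notation dvol := (dvol R n).
Local Notation davg := (davg mu (@didx R n) dvol).

(** One constant [a] serves the cube and all its neighbours: each average is within 1 / 2 of it, so
    two such halves give both the oscillation bound and the bound between neighbours. *)
Lemma dyadic_bmo_ball (b : E -> R) : measurable_fun [set: E] b ->
  (forall k x, mu.-integrable (eucl_ball x (brad R n k)) (EFin \o b)) ->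
  (forall k x, exists a : R,
    (\int[mu]_(y in eucl_ball x (brad R n k)) `|b y - a|%:E <= (dvol k / 2)%:E)%E) ->
  dyadic_bmo b.
Proof.
move=> mb ib hb.
have md k (x : E) := @measurable_ddcube R n k x.
have mB k (x : E) : measurable (eucl_ball x (brad R n k)) by exact: measurable_ball (brad_gt0 _ _ _).
have sub k x y : tcube k x y -> dcube k y `<=` eucl_ball x (brad R n k).
  by move=> xy; exact: subset_trans (sub_tcubeS xy) (@tcube_ball R n k x).
have id k x : mu.-integrable (dcube k x) (EFin \o b).
  exact: (integrableS (mB k x) (md k x) (sub k x x (tcube_refl k x)) (ib k x)).
have key k x (a : R) y : tcube k x y ->
    (\int[mu]_(y in eucl_ball x (brad R n k)) `|b y - a|%:E <= (dvol k / 2)%:E)%E ->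
    (\int[mu]_(z in dcube k y) `|b z - a|%:E <= (dvol k / 2)%:E)%E /\ `|davg b k y - a| <= 1 / 2.
  move=> xy ha; have v0 := dvol_gt0 R n k.
  have h1 : (\int[mu]_(z in dcube k y) `|b z - a|%:E <= (dvol k / 2)%:E)%E.
    have m1 := measurable_dist a mb; have n1 z : 0 <= `|b z - a| by exact: normr_ge0.
    exact: le_trans (integral_sub mu (md k y) (mB k x) (sub k x y xy) m1 n1) ha.
  split=> //; have h2 := davg_vol_le (@didx_measurable R n) (@didx_nest R n) (@dvol_gt0 R n)
     (@leb_dcube R n) mb id k y a.
  have := le_trans h2 h1; rewrite lee_fin -ler_pdivlMr// mulrAC divff ?gt_eqF//.
split=> // [k x|k x y xy].
  have [a ha] := hb k x; have [h1 h2] := key k x a x (tcube_refl k x) ha.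
  have v0 := dvol_gt0 R n k; have mab := measurable_dist a mb.
  apply: (@le_trans _ _ (\int[mu]_(y in dcube k x) (`|b y - a| + `|davg b k x - a|)%:E)%E).
    apply: ge0_le_integral_nomeas => y _; rewrite lee_fin//.
    by rewrite [`|davg b k x - a|]distrC; exact: ler_distD.
  rewrite (integralDR mu (md k x) mab (@measurable_cst _ _ E R setT `|davg b k x - a|)
    (fun=> normr_ge0 _) (fun=> normr_ge0 _)).
  have cE : (\int[mu]_(z in dcube k x) (`|davg b k x - a|)%:E = (`|davg b k x - a| * dvol k)%:E)%E.
    by rewrite integral_cst; [rewrite EFinM; congr (_ * _)%E; exact: leb_dcube|exact: md].
  rewrite [X in (_ + X <= _)%E]cE.
  apply: le_trans (leeD h1 (lexx _)) _; rewrite -EFinD lee_fin.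
  exact: half_add_le (ltW v0) h2.
have [a ha] := hb k x; have [_ h1] := key k x a x (tcube_refl k x) ha.
have [_ h2] := key k x a y xy ha.
apply: le_trans (ler_distD a _ _) _; rewrite [`|a - _|]distrC.
by apply: le_trans (lerD h2 h1) _; rewrite -splitr.
Qed.

Lemma BMO_ball (b : E -> R) (nu : R) (x : E) (r : R) : in_BMO b -> (BMO_norm b <= nu%:E)%E ->
  0 < r -> (\int[mu]_(y in eucl_ball x r) `|b y - ball_avg b (eucl_ball x r)|%:E <=
    (nu * fine (mu (eucl_ball x r)))%:E)%E.
Proof.
move=> hb hn r0; have B0 := leb_ball_gt0 x r0; have Bf := leb_ball_fin x r0.
have f0 : 0 < fine (mu (eucl_ball x r)) by rewrite fine_gt0// B0 ltey_eq Bf.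
have : ((mu (eucl_ball x r))^-1 * \int[mu]_(y in eucl_ball x r)
    `|b y - ball_avg b (eucl_ball x r)|%:E <= nu%:E)%E.
  by apply: le_trans hn; apply: ereal_sup_ubound; exists (eucl_ball x r) => //; exists x => //; exists r.
have bE : mu (eucl_ball x r) = (fine (mu (eucl_ball x r)))%:E by rewrite fineK.
rewrite {1}bE inver gt_eqF// => h.
have := lee_wpmul2l (_ : (0 <= (fine (mu (eucl_ball x r)))%:E)%E) h.
rewrite lee_fin (ltW f0) => /(_ isT); rewrite muleA -EFinM divff ?gt_eqF// mul1e.
by rewrite -EFinM mulrC.
Qed.

(** The constant compares the ball of radius [brad] with the cube; the factor 2 yields the half that
    [dyadic_bmo_ball] asks for. *)
Lemma BMO_dyadic : exists2 D : R, 0 < D & forall (b : E -> R) (nu : R), 0 < nu ->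
  in_BMO b -> (BMO_norm b <= nu%:E)%E -> dyadic_bmo (fun y => b y / (D * nu)).
Proof.
pose D : R := (2 * (2 * n%:R + 1)) ^+ n.
have D0 : 0 < D by rewrite exprn_gt0// mulr_gt0// ltr_wpDl.
exists (2 * D); first by rewrite mulr_gt0.
move=> b nu nu0 hb hn; have [[mb ib] _] := hb.
have c0 : 0 < 2 * D * nu by rewrite !mulr_gt0.
have mb' : measurable_fun [set: E] b by apply/measurable_EFinP.
have mbd : measurable_fun [set: E] (fun y => b y / (2 * D * nu)) by exact: measurable_funM.
apply: dyadic_bmo_ball => //.
  move=> k x; have hB : eucl_balls (eucl_ball x (brad R n k)).
    by exists x => //; exists (brad R n k) => //; exact: brad_gt0.
  have := integrableZr (measurable_ball x (brad_gt0 R n k)) (2 * D * nu)^-1 (ib _ hB).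
  by apply: eq_integrable => //; exact: measurable_ball (brad_gt0 _ _ _).
move=> k x; set B := eucl_ball x _; exists (ball_avg b B / (2 * D * nu)).
have mB : measurable B by exact: measurable_ball (brad_gt0 _ _ _).
have ci0 : 0 <= (2 * D * nu)^-1 by rewrite invr_ge0 ltW.
have h := BMO_ball x hb hn (brad_gt0 R n k).
have mab := measurable_dist (ball_avg b B) mb'.
under eq_integral do rewrite -mulrBl normrM (gtr0_norm (_ : 0 < (2 * D * nu)^-1)) ?invr_gt0// mulrC.
rewrite (integralZl_real mu mB ci0 mab (fun=> normr_ge0 _)).
apply: le_trans (lee_wpmul2l _ h) _; first by rewrite lee_fin.
have bD : fine (mu B) <= D * dvol k.
  rewrite -lee_fin fineK ?leb_ball_fin ?brad_gt0//.
  apply: le_trans (leb_ball_le x (brad_gt0 R n k)) _.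
  by rewrite lee_fin /brad /D mulrA exprMn.
rewrite -EFinM lee_fin; apply: (@le_trans _ _ ((2 * D * nu)^-1 * (nu * (D * dvol k)))).
  by apply: ler_wpM2l => //; rewrite ler_pM2l.
rewrite le_eqVlt; apply/orP; left; apply/eqP; field; rewrite !gt_eqF//.
Qed.

End normalized_bmo.

Lemma measurable_absR d (T : measurableType d) (R : realType) (f : T -> R) :
  measurable_fun [set: T] f -> measurable_fun [set: T] (fun z => `|f z|).
Proof. by move=> mf; exact: measurableT_comp. Qed.

(** * Dyadic domination of the operators *)

Section operator_bounds.
Context (R : realType) (n m : nat).
Local Notation E := (Rn R n).
Local Notation mu := (@leb R n).
Local Notation dcube := (dcube (@didx R n)).
Implicit Types (x : E) (k : int).

(** One scale is added at each end, so partial sums of nonnegative terms increase and exhaust all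
    scales. *)
Lemma scale_sumS (V : nmodType) (f : int -> V) N :
  \sum_(l < N.+1.*2.+1) f (scale N.+1 l) =
  f (- N.+1%:Z) + (\sum_(l < N.*2.+1) f (scale N l) + f N.+1%:Z).
Proof.
rewrite doubleS big_ord_recl big_ord_recr /=; congr (f _ + (_ + f _)).
- by rewrite /scale sub0r.
- apply: eq_bigr => l _; congr f; rewrite /scale /fintype.bump /=; lia.
- by rewrite /scale /fintype.bump /= -addnn; lia.
Qed.

Lemma scale_mem k : exists l : 'I_((absz k).*2.+1), scale (absz k) l = k.
Proof.
rewrite -addnn; case: k => i; first by exists ord_max; rewrite /scale /= PoszD addrK.
by exists ord0; rewrite /scale /= sub0r NegzE.
Qed.

Lemma scale_sum_homo (f : int -> \bar R) : (forall k, 0 <= f k)%E ->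
  {homo (fun N : nat => \sum_(l < N.*2.+1) f (scale N l))%E : a b / (a <= b)%N >-> (a <= b)%E}.
Proof.
move=> f0; apply/nondecreasing_seqP => N; rewrite scale_sumS.
by apply: le_trans (leeDr _ (f0 _)); exact: leeDl.
Qed.

Lemma le_scale_sum (f : int -> \bar R) k : (forall k, 0 <= f k)%E ->
  (f k <= \sum_(l < (absz k).*2.+1) f (scale (absz k) l))%E.
Proof.
move=> f0; have [l hl] := scale_mem k; rewrite (bigD1 l)//= hl leeDl// sume_ge0//.
Qed.

Lemma scale_between (r : R) : 0 < r -> exists k, side R (k - 1) <= r < side R k.
Proof.
move=> r0; have l2 : 0 < ln 2 :> R by rewrite ln_gt0// ltr1n.
pose a := ln r / ln 2; have aE : a * ln 2 = ln r by rewrite divfK ?gt_eqF.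
have sE k : side R k = expR (k%:~R * ln 2) by rewrite /side /powR gt_eqF.
have hr : expR (a * ln 2) = r by rewrite aE lnK ?posrE.
exists (Num.floor a + 1); rewrite addrK !sE -hr ler_expR ltr_expR.
by rewrite ler_pM2r// ltr_pM2r// -floor_ge_int -floor_lt_int lexx ltzD1 lexx.
Qed.

Definition dyadic_sum (M : R) (G : 'I_m -> E -> \bar R) (N : nat) x : \bar R :=
  (\sum_(l < N.*2.+1) ((dvol R n (scale N l) `^ (- M))%:E *
     \prod_(i < m) \int[mu]_(y in tcube (scale N l) x) G i y))%E.

Let summand_ge0 M (G : 'I_m -> E -> \bar R) x k : (forall i y, 0 <= G i y)%E ->
  (0 <= (dvol R n k `^ (- M))%:E * \prod_(i < m) \int[mu]_(y in tcube k x) G i y)%E.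
Proof.
move=> G0; apply: mule_ge0; first by rewrite lee_fin powR_ge0.
by apply: prode_ge0_seq => i; apply: integral_ge0 => y _.
Qed.

Definition dyadic_sup M G x : \bar R := ereal_sup (range (fun N => dyadic_sum M G N x)).

Lemma le_dyadic_sup M G x k : (forall i y, 0 <= G i y)%E ->
  ((dvol R n k `^ (- M))%:E * \prod_(i < m) \int[mu]_(y in tcube k x) G i y <= dyadic_sup M G x)%E.
Proof.
move=> G0; apply: (@le_trans _ _ (dyadic_sum M G (absz k) x)); last first.
  by apply: ereal_sup_ubound; exists (absz k).
exact: (@le_scale_sum (fun k => ((dvol R n k `^ (- M))%:E *
  \prod_(i < m) \int[mu]_(y in tcube k x) G i y)%E) k (fun k => summand_ge0 M x k G0)).
Qed.

(** For 2^(k-1) <= r < 2^k the ball lies in 3Q and contains a cube n + 1 scales below, as n < 2^n;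
    [c] is the ratio of the volumes of the two cubes. *)
Lemma frac_maximal_bound (alpha : R) : 0 <= m%:R - alpha / n%:R -> exists2 C : R, 0 < C &
  forall (F : 'I_m -> E -> R) x, (forall i, measurable_fun [set: E] (F i)) ->
  (`|frac_maximal alpha F x| <=
    C%:E * dyadic_sup (m%:R - alpha / n%:R) (fun i y => `|F i y|%:E) x)%E.
Proof.
set M := m%:R - _ => M0; pose c : R := (2 ^+ n) ^+ n.+1; have c0 : 0 < c by rewrite !exprn_gt0.
exists (c `^ M); first by rewrite powR_gt0.
move=> F x mF; have G0 i y : (0 <= `|F i y|%:E)%E by rewrite lee_fin.
have key (r : R) : 0 < r -> ((\prod_(i < m) \int[mu]_(y in eucl_ball x r) `|F i y|%:E) /
    mu (eucl_ball x r) `^ M <= (c `^ M)%:E * dyadic_sup M (fun i y => `|F i y|%:E) x)%E.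
  move=> r0; have [k /andP[k1 k2]] := scale_between r0.
  have Bt : eucl_ball x r `<=` tcube k x.
    apply: subset_trans (@ball_tcube R n k x) => y /= h; exact: lt_trans k2.
  have bE : mu (eucl_ball x r) = (fine (mu (eucl_ball x r)))%:E by rewrite fineK// leb_ball_fin.
  set b := fine _ in bE; have b0 : 0 < b by rewrite -lte_fin -bE leb_ball_gt0.
  have mB := @measurable_ball R n x r r0.
  have hb : dvol R n k / c <= b.
    have nn : n%:R * side R (k - n.+1%:Z) < r.
      apply: lt_le_trans k1; have -> : k - n.+1%:Z = - n%:Z + (k - 1) by rewrite -addn1 PoszD; lia.
      have -> : side R (- n%:Z + (k - 1)) = (2 ^+ n)^-1 * side R (k - 1).
        by rewrite -side_nat -sideN -sideD.
      rewrite mulrA -[ltRHS]mul1r ltr_pM2r ?side_gt0//.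
      by rewrite ltr_pdivrMr ?exprn_gt0// mul1r -natrX ltr_nat ltn_expl.
    have := le_measure mu (mem_set (measurable_ddcube (k - n.+1%:Z) x)) (mem_set mB) (dcube_sub_ball nn).
    rewrite [X in (X <= _)%E](_ : _ = (dvol R n (k - n.+1%:Z))%:E); last exact: leb_dcube.
    rewrite [X in (_ <= X)%E](_ : _ = b%:E); last exact: bE.
    rewrite lee_fin => h; apply: le_trans h.
    have -> : dvol R n k / c = dvol R n (k - n.+1%:Z); last exact: lexx.
    have sE2 : side R (k - n.+1%:Z) = side R k / 2 ^+ n.+1 by rewrite -side_nat -sideN -sideD.
    by rewrite /dvol sE2 exprMn exprVn /c -!exprM mulnC.
  rewrite bE poweR_EFin inver gt_eqF ?powR_gt0//.
  apply: (@le_trans _ _ ((\prod_(i < m) \int[mu]_(y in tcube k x) `|F i y|%:E) *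
      (c `^ M * dvol R n k `^ (- M))%:E)%E).
    apply: lee_pmul.
    - by apply: prode_ge0_seq => i; apply: integral_ge0 => y _.
    - by rewrite lee_fin invr_ge0 powR_ge0.
    - apply: lee_prod => i; first by apply: integral_ge0 => y _.
      exact: (integral_sub mu mB (measurable_tcube k x) Bt (measurable_absR (mF i))
        (fun=> normr_ge0 _)).
    rewrite lee_fin -powRN; have v0 := dvol_gt0 R n k.
    have -> : c `^ M * dvol R n k `^ (- M) = (dvol R n k / c) `^ (- M).
      by rewrite powRM ?invr_ge0 ?(ltW v0) ?(ltW c0)// powR_invN// mulrC.
    by apply: le_powRN => //; rewrite divr_gt0.
  rewrite EFinM muleCA; apply: lee_wpmul2l; first by rewrite lee_fin powR_ge0.
  by rewrite muleC; exact: le_dyadic_sup.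
rewrite gee0_abs; first by apply: ge_ereal_sup => _ [r r0 <-]; exact: key.
apply: (@le_trans _ _ ((\prod_(i < m) \int[mu]_(y in eucl_ball x 1) `|F i y|%:E) /
    mu (eucl_ball x 1) `^ M)%E); last by apply: ereal_sup_ubound; exists 1 => //=; exact: ltr01.
apply: mule_ge0; first by apply: prode_ge0_seq => i; apply: integral_ge0 => y _.
by rewrite inve_ge0 poweR_ge0.
Qed.

(** Both parts of [f] are below its absolute value, with no measurability involved, and for finite
    [C] the difference of their integrals is well defined. *)
Lemma abse_integral_dom d (T : measurableType d) (mu' : {measure set T -> \bar R})
    (f : T -> \bar R) (C : \bar R) :
  (\int[mu']_y `|f y| <= C)%E -> (`|\int[mu']_y f y| <= C)%E.
Proof.
move=> h; have hp : (\int[mu']_y (f^\+ y) <= C)%E.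
  apply: le_trans h; apply: ge0_le_integral_nomeas => y _; first exact: funepos_ge0.
  rewrite funeposE; case: (leP 0 (f y))%E => f0; first by rewrite gee0_abs// ge_max lexx.
  exact: abse_ge0.
have hn : (\int[mu']_y (f^\- y) <= C)%E.
  apply: le_trans h; apply: ge0_le_integral_nomeas => y _; first exact: funeneg_ge0.
  rewrite funenegE ge_max abse_ge0 andbT -abseN; exact: lee_abs.
have p0 : (0 <= \int[mu']_y (f^\+ y))%E by apply: integral_ge0 => y _; exact: funepos_ge0.
have n0 : (0 <= \int[mu']_y (f^\- y))%E by apply: integral_ge0 => y _; exact: funeneg_ge0.
rewrite integralE; move: hp hn p0 n0.
move: (\int[mu']_y (f^\+ y))%E (\int[mu']_y (f^\- y))%E => a b.
move: a b C {h} => [a| |] [b| |] [C| |] //=; rewrite ?lee_fin ?leey// => ha hb a0 b0.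
by rewrite ler_norml; apply/andP; split; lra.
Qed.

(** If 2^(k-1) <= rho < 2^k for the sum rho of the distances, all points lie in 3Q and the kernel is
    at most a constant times the factor of scale [k]. Summing over the scales and integrating the
    products gives [dyadic_sum]. *)
Lemma frac_integral_bound (alpha : R) : (0 < n)%N -> 0 < m%:R - alpha / n%:R ->
  exists2 C : R, 0 < C &
  forall (F : 'I_m -> E -> R) x, (forall i, measurable_fun [set: E] (F i)) ->
  (`|frac_integral alpha F x| <=
    C%:E * dyadic_sup (m%:R - alpha / n%:R) (fun i y => `|F i y|%:E) x)%E.
Proof.
move=> hn; set M := m%:R - _ => M0; pose e : R := m%:R * n%:R - alpha.
have nr0 : 0 < n%:R :> R by rewrite ltr0n.
have eE : e = n%:R * M by rewrite /e /M; field; rewrite gt_eqF.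
have e0 : 0 < e by rewrite eE mulr_gt0.
(* The side at scale [k] is at most twice [rho]. *)
pose C : R := 2 `^ e; have C0 : 0 < C by rewrite powR_gt0.
exists C => // F x mF; have G0 i y : (0 <= `|F i y|%:E)%E by rewrite lee_fin.
apply: abse_integral_dom.
pose h k i (z : E) : \bar R := (\1_(tcube k x) z * `|F i z|)%:E.
have h0 k i z : (0 <= h k i z)%E by rewrite lee_fin mulr_ge0// indicE; case: (_ \in _).
have mh k i : measurable_fun [set: E] (h k i).
  apply/measurable_EFinP; apply: measurable_funM (measurable_absR (mF i)).
  exact: measurable_indic (measurable_tcube k x).
pose s k (y : m.-tuple E) : \bar R :=
  ((C * dvol R n k `^ (- M))%:E * \prod_(i < m) h k i (tnth y i))%E.
have s0 k y : (0 <= s k y)%E.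
  apply: mule_ge0; first by rewrite lee_fin mulr_ge0 ?powR_ge0// ltW.
  by apply: prode_ge0_seq => i.
have ms k : measurable_fun [set: m.-tuple E] (s k).
  apply: measurable_funeM; apply: emeasurable_prod => i.
  exact: measurableT_comp (mh k i) (@measurable_tnth _ E m i).
pose g (N : nat) y := (\sum_(l < N.*2.+1) s (scale N l) y)%E.
have g_homo y : {homo (fun N => g N y) : a b / (a <= b)%N >-> (a <= b)%E}.
  exact: (@scale_sum_homo (fun k => s k y) (fun k => s0 k y)).
have mg N : measurable_fun [set: m.-tuple E] (g N).
  by apply: emeasurable_sum => l; exact: ms.
have hE k i : (\int[mu]_z h k i z = \int[mu]_(z in tcube k x) `|F i z|%:E)%E.
  rewrite [RHS]integral_mkcond; apply: eq_integral => z _.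
  by rewrite patchE /h indicE; case: (_ \in _); rewrite ?mul1r ?mul0r.
have int_g N : (\int[tuple_measure mu m]_y g N y = C%:E * dyadic_sum M (fun i y => `|F i y|%:E) N x)%E.
  rewrite /g ge0_integral_sum//.
  rewrite /dyadic_sum ge0_sume_distrr; last by move=> l _; exact: summand_ge0.
  apply: eq_bigr => l _; rewrite /s ge0_integralZl_EFin//; last 3 first.
  - by move=> y _; apply: prode_ge0_seq => i.
  - apply: emeasurable_prod => i.
    exact: measurableT_comp (mh _ i) (@measurable_tnth _ E m i).
  - by rewrite mulr_ge0 ?powR_ge0// ltW.
  rewrite ge0_integral_tuple_prod// EFinM -muleA; congr (_ * (_ * _))%E.
  by apply: eq_bigr => i _; exact: hE.
pose gs y := ereal_sup (range (fun N => g N y)).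
apply: (@le_trans _ _ (\int[tuple_measure mu m]_y gs y)%E).
  apply: ge0_le_integral_nomeas => y _; first exact: abse_ge0.
  set rho := \sum_(i < m) _; have rho0 : 0 <= rho by apply: sumr_ge0 => i _; exact: sqrtr_ge0.
  have gsle k : (s k y <= gs y)%E.
    apply: (@le_trans _ _ (g (absz k) y)); last by apply: ereal_sup_ubound; exists (absz k).
    exact: (@le_scale_sum (fun k => s k y) k (fun k => s0 k y)).
  (* At [rho = 0] the integrand is 0, because the inverse of 0 is 0. *)
  have [->|rn0] := eqVneq rho 0.
    by rewrite powR0 ?gt_eqF// invr0 mulr0 abse0; apply: le_trans (gsle 0).
  have rp : 0 < rho by rewrite lt_neqAle eq_sym rn0.
  have [k /andP[k1 k2]] := scale_between rp.
  apply: le_trans (gsle k); have yt i : tcube k x (tnth y i).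
    apply: (@ball_tcube R n k x) => /=; apply: le_lt_trans k2.
    rewrite /rho (bigD1 i)//= lerDl; apply: sumr_ge0 => l _; exact: sqrtr_ge0.
  have -> : s k y = (C * dvol R n k `^ (- M) * \prod_(i < m) `|F i (tnth y i)|)%:E.
    rewrite EFinM -prodEFin; congr (_ * _)%E; apply: eq_bigr => i _.
    by rewrite /h indicE mem_set ?mul1r//; exact: yt.
  rewrite abse_EFin lee_fin normrM normr_prod mulrC; apply: ler_wpM2r.
    by apply: prodr_ge0 => i _.
  rewrite normfV ger0_norm ?powR_ge0// -powRN.
  have -> : C * dvol R n k `^ (- M) = side R (k - 1) `^ (- e).
    rewrite /C /dvol -powR_mulrn ?(ltW (side_gt0 _ _))// -powRrM.
    have -> : side R k = 2 * side R (k - 1) by rewrite -(@side1 R) -sideD addrC subrK.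
    have -> : n%:R * - M = - e by rewrite eE mulrN.
    rewrite powRM ?(ltW (side_gt0 _ _))// mulrA -powRD_gt0// subrr powRr0 mul1r.
    by [].
  exact: (le_powRN (ltW e0) (side_gt0 _ _) k1).
apply: (@ge0_integral_le_cvg _ _ _ _ setT g).
- exact: measurableT.
- exact: mg.
- by move=> N y _; apply: sume_ge0.
- by move=> y _; exact: g_homo.
- by move=> y _; apply: ereal_nondecreasing_cvgn; exact: g_homo.
move=> N; rewrite int_g; apply: lee_wpmul2l; first by rewrite lee_fin ltW.
by apply: ereal_sup_ubound; exists N.
Qed.

End operator_bounds.

(** Turns modulars of the powered weights, at exponents divided by [t], into modulars of the weights
    themselves. *)
Lemma powR_rescale (R : realType) (a l t r : R) : 0 <= a -> 0 < l -> 0 < t ->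
  (a `^ t / l) `^ (r / t) = (a / l `^ t^-1) `^ r.
Proof.
move=> a0 l0 t0; have lt0 : 0 < l `^ t^-1 by rewrite powR_gt0.
have -> : a `^ t / l = (a / l `^ t^-1) `^ t.
  rewrite powRM ?invr_ge0 ?(ltW lt0)//; congr (_ * _).
  rewrite -[(l `^ _)^-1]powR_inv1 ?(ltW lt0)// -!powRrM mulN1r mulrN mulVf ?gt_eqF//.
  by rewrite powR_inv1// ltW.
by rewrite -powRrM mulrCA divff ?gt_eqF// mulr1.
Qed.

(** * Terms of the commutator and suprema over the scales *)

Section commutator_terms.
Context (R : realType) (n m : nat).
Local Notation E := (Rn R n).
Local Notation mu := (@leb R n).
Local Notation davg := (davg mu (@didx R n) (dvol R n)).
Variables (M : R) (w : 'I_m -> E -> R).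
Hypothesis w0 : forall i x, 0 < w i x.

Lemma measurable_term b j g k : dyadic_bmo b -> measurable_fun [set: E] (term w M b j g k).
Proof.
move=> [mb _ _ _]; have ma : measurable_fun [set: E] (davg b k).
  apply: (measurable_fun_dcube (@didx_measurable R n) (k := k)) => x y xy.
  exact: davg_eq.
have mbeta : measurable_fun [set: E] (beta b k).
  exact: (measurable_funD (@measurable_cst _ _ E R setT 1) (measurable_absB mb ma)).
apply: measurable_funM; first exact: measurable_cst.
apply: (measurable_funM mbeta); apply: measurable_prod => i _.
apply: (measurable_fun_dcube (@didx_measurable R n) (k := k)) => x y xy.
rewrite /cube_mean /osc_weight (eq_tcube xy).
by rewrite (davg_eq mu (dvol R n) b (xy : didx k x = didx k y)).
Qed.

(** The oscillation splits at the average over the cube: the factor in [x] leaves the integral as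
    [beta], the factor in [y] becomes [osc_weight], and [nu] undoes the normalization of [b]. *)
Lemma dyadic_sum_term (b' b : E -> R) (j : 'I_m) (g f : 'I_m -> E -> R) (nu : R)
    (Lam : 'I_m -> R) x N : 0 <= nu -> (forall i, 0 <= Lam i) -> (forall i y, 0 <= g i y) ->
  (forall i, measurable_fun [set: E] (f i)) -> (forall i, measurable_fun [set: E] (g i)) ->
  (forall i, measurable_fun [set: E] (w i)) -> dyadic_bmo b' ->
  (forall k i, (\int[mu]_(y in tcube k x) (osc_weight b' j i k x y * g i y * w i y)%:E =
    (cube_mean w b' j g k x i)%:E)%E) ->
  (forall y, b y = nu * b' y) -> (forall i y, `|f i y| = Lam i * (g i y * w i y)) ->
  (dyadic_sum M (fun i y => `|[eta f with j |-> fun y => (b x - b y) * f j y] i y|%:E) N x <=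
   (nu * \prod_(i < m) Lam i * \sum_(l < N.*2.+1) term w M b' j g (scale N l) x)%:E)%E.
Proof.
move=> nu0 L0 g0 mf mg mw nb hcm hb hf.
rewrite mulr_sumr -sumEFin; apply: lee_sum => l _; set k := scale N l.
pose c i := Lam i * (if i == j then nu * beta b' k x else 1).
have be0 : 0 <= beta b' k x by exact: le_trans (beta_ge1 b' k x).
have c0 i : 0 <= c i by rewrite mulr_ge0//; case: ifP => // _; exact: mulr_ge0.
have hi i : (\int[mu]_(y in tcube k x)
    `|[eta f with j |-> fun y => (b x - b y) * f j y] i y|%:E <=
    (c i * cube_mean w b' j g k x i)%:E)%E.
  have mo := measurable_osc_weight j i k x nb.
  have mogw : measurable_fun [set: E] (fun y => osc_weight b' j i k x y * g i y * w i y).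
    exact: measurable_funM (measurable_funM mo (mg i)) (mw i).
  have ogw0 y : 0 <= osc_weight b' j i k x y * g i y * w i y.
    apply: mulr_ge0 (ltW (w0 i y)); apply: mulr_ge0 (g0 i y).
    exact: le_trans (osc_weight_ge1 b' j i k x y).
  rewrite EFinM -hcm -(integralZl_real mu (measurable_tcube k x) (c0 i) mogw ogw0).
  apply: ge0_le_integral_nomeas => y _; rewrite lee_fin ?normr_ge0//.
  rewrite /c /osc_weight /= ; case: eqP => [->|_]; last first.
    by rewrite hf mulr1 mul1r; exact: lexx.
  rewrite normrM hf.
  have gw0 : 0 <= Lam j * (g j y * w j y).
    by apply: mulr_ge0 => //; apply: mulr_ge0 (g0 j y) (ltW (w0 j y)).
  have hd : `|b x - b y| <= nu * (beta b' k x * (1 + `|b' y - davg b' k x|)).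
    rewrite !hb -mulrBr normrM (ger0_norm nu0); apply: ler_wpM2l => //.
    apply: le_trans (ler_distD (davg b' k x) _ _) _; rewrite [`|_ - b' y|]distrC /beta.
    move: (normr_ge0 (b' x - davg b' k x)) (normr_ge0 (b' y - davg b' k x)).
    move: (`|b' x - _|) (`|b' y - _|) => u v u0 v0.
    by have := mulr_ge0 u0 v0; rewrite mulrDl mul1r mulrDr mulr1 => uv; lra.
  have -> : Lam j * (nu * beta b' k x) * ((1 + `|b' y - davg b' k x|) * g j y * w j y) =
     nu * (beta b' k x * (1 + `|b' y - davg b' k x|)) * (Lam j * (g j y * w j y)) by ring.
  exact: (ler_wpM2r gw0 hd).
have hprod : (\prod_(i < m) \int[mu]_(y in tcube k x)
    `|[eta f with j |-> fun y => (b x - b y) * f j y] i y|%:E <=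
    (\prod_(i < m) (c i * cube_mean w b' j g k x i))%:E)%E.
  rewrite -prodEFin; apply: lee_prod => // i.
  by apply: integral_ge0 => y _; rewrite lee_fin.
apply: le_trans (lee_wpmul2l _ hprod) _; first by rewrite lee_fin powR_ge0.
rewrite -EFinM lee_fin /term big_split /= big_split /= -big_mkcond big_pred1_eq.
rewrite le_eqVlt; apply/orP; left; apply/eqP; ring.
Qed.

End commutator_terms.

Section suprema.
Context d (T : measurableType d) (R : realType) (mu : {measure set T -> \bar R}).
Variables (om q : T -> R) (U : nat -> T -> R) (q0 : R).
Hypotheses (mom : measurable_fun [set: T] om) (mq : measurable_fun [set: T] q)
  (mU : forall N, measurable_fun [set: T] (U N)) (om0 : forall x, 0 < om x)
  (q00 : 0 < q0) (q0q : forall x, q0 <= q x)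
  (U0 : forall N x, 0 <= U N x) (Uh : forall x, {homo U^~ x : a b / (a <= b)%N >-> a <= b}).

Definition sup_power x : \bar R := ereal_sup (range (fun N => ((om x * U N x) `^ q x)%:E)).

Lemma integral_sup_power (C : \bar R) :
  (forall N, \int[mu]_x ((om x * U N x) `^ q x)%:E <= C)%E ->
  (\int[mu]_x sup_power x <= C)%E.
Proof.
move=> h; have hom x : {homo (fun N => ((om x * U N x) `^ q x)%:E) : a b / (a <= b)%N >-> (a <= b)%E}.
  move=> a b ab; rewrite lee_fin; apply: le_powR; first exact: le_trans (ltW q00) (q0q x).
    by rewrite mulr_ge0// ltW.
  by rewrite ler_pM2l//; exact: Uh.
apply: (@ge0_integral_le_cvg _ _ _ mu setT (fun N x => ((om x * U N x) `^ q x)%:E)) => //.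
- move=> N; apply/measurable_EFinP; apply: measurable_powR2 => //; exact: measurable_funM.
- by move=> N x _; rewrite lee_fin powR_ge0.
- by move=> x _; apply: ereal_nondecreasing_cvgn; exact: hom.
Qed.

Lemma measurable_sup_power : measurable_fun [set: T] sup_power.
Proof.
have -> : sup_power = fun x => ereal_sup [set ((om x * U k x) `^ q x)%:E | k in [set k | (0 <= k)%N]].
  by apply/funext => x; congr ereal_sup; apply/seteqP; split => _ [N _ <-]; exists N.
apply: (@measurable_fun_esups _ _ R [set: T] (fun N x => ((om x * U N x) `^ q x)%:E)).
move=> N; apply/measurable_EFinP; apply: measurable_powR2 => //; exact: measurable_funM.
Qed.

Lemma sup_power_ge0 x : (0 <= sup_power x)%E.
Proof.
apply: (@le_trans _ _ ((om x * U 0%N x) `^ q x)%:E); first by rewrite lee_fin powR_ge0.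
by apply: ereal_sup_ubound; exists 0%N.
Qed.

(** Where [sup_power] is finite, its root bounds every [U N x] and hence [X]; [K >= 1] and
    [q x >= q0] turn the division by [K] into one constant factor. *)
Lemma le_sup_power (X : \bar R) (K : R) x : 1 <= K -> (0 <= X)%E ->
  (X <= ereal_sup (range (fun N => (U N x)%:E)))%E ->
  (((om x)%:E * X / K%:E) `^ q x <= (K `^ (- q0))%:E * sup_power x)%E.
Proof.
move=> K1 X0 hX; have K0 : 0 < K by exact: lt_le_trans K1.
have qx0 : 0 < q x by exact: lt_le_trans (q0q x).
have Kq : 0 < K `^ (- q0) by rewrite powR_gt0.
have := sup_power_ge0 x; case E : (sup_power x) => [h| |] // h0; last first.
  by rewrite gt0_muley ?leey// lte_fin.
rewrite lee_fin in h0; pose a := h `^ (q x)^-1; have a0 : 0 <= a by exact: powR_ge0.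
have hU N : U N x <= a / om x.
  rewrite ler_pdivlMr// mulrC -[leLHS]powRr1 ?mulr_ge0 ?(ltW (om0 x))// -[1](divff (lt0r_neq0 qx0)).
  rewrite powRrM; apply: le_powR; rewrite ?invr_ge0 ?(ltW qx0) ?powR_ge0//.
  by rewrite -lee_fin -E; apply: ereal_sup_ubound; exists N.
have {}hX : (X <= (a / om x)%:E)%E.
  by apply: le_trans hX _; apply: ge_ereal_sup => _ [N _ <-]; rewrite lee_fin.
have Xf : X \is a fin_num by rewrite ge0_fin_numE//; apply: le_lt_trans hX _; rewrite ltry.
move: X0 hX; rewrite -(fineK Xf) !lee_fin; move: (fine X) => y y0 hy.
rewrite inver gt_eqF// -!EFinM poweR_EFin lee_fin.
apply: (@le_trans _ _ ((a / K) `^ q x)).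
  apply: le_powR; rewrite ?(ltW qx0) ?divr_ge0 ?mulr_ge0 ?(ltW K0) ?(ltW (om0 x))//.
  by rewrite ler_pM2r ?invr_gt0// mulrC -ler_pdivlMr.
rewrite powRM ?invr_ge0 ?(ltW K0)// /a -powRrM mulVf ?gt_eqF// powRr1// mulrC.
apply: ler_wpM2r => //; rewrite -[K^-1]powR_inv1 ?(ltW K0)// -powRrM mulN1r.
by apply: ler_powR => //; rewrite lerN2.
Qed.

End suprema.

Lemma prod_addr_le (R : realType) (I : Type) (s : seq I) (L : I -> R) : (forall i, 0 <= L i) ->
  exists2 K : R, 0 <= K & forall e : R, 0 <= e -> e <= 1 ->
  \prod_(i <- s) (L i + e) <= \prod_(i <- s) L i + e * K.
Proof.
move=> L0; elim: s => [|i s [K K0 IH]].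
  by exists 0 => // e e0 e1; rewrite !big_nil mulr0 addr0.
have P0 : 0 <= \prod_(i <- s) L i by apply: prodr_ge0.
exists (L i * K + \prod_(i <- s) L i + K); first by rewrite !addr_ge0 ?mulr_ge0.
move=> e e0 e1; rewrite !big_cons.
apply: le_trans (ler_wpM2l (addr_ge0 (L0 i) e0) (IH e e0 e1)) _.
have : e * (e * K) <= e * K by rewrite ler_piMl ?mulr_ge0.
move: (\prod_(i <- s) L i) P0 => P P0 h; rewrite mulrDl mulrDr [e * (P + _)]mulrDr; lra.
Qed.

Lemma inv_conj_exp_scaled (R : realFieldType) (a t : R) : 0 < t -> t < a ->
  a^-1 + (t * ((a / t) / (a / t - 1)))^-1 = t^-1.
Proof.
move=> t0 ta; have a0 := lt_trans t0 ta.
have h1 : a - t != 0 by rewrite subr_eq0 gt_eqF.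
have -> : a / t - 1 = (a - t) / t by rewrite mulrBl divff// gt_eqF.
by field; rewrite h1 (gt_eqF t0) (gt_eqF a0).
Qed.

Lemma ge_minl (R : realType) (a b : R) : Num.min a b <= a. Proof. by rewrite ge_min lexx. Qed.
Lemma ge_minr (R : realType) (a b : R) : Num.min a b <= b. Proof. by rewrite ge_min lexx orbT. Qed.

Lemma measurable_conj_exp (R : realType) (n : nat) (r : Rn R n -> R) :
  measurable_fun [set: Rn R n] r -> (forall x, 1 < r x) ->
  measurable_fun [set: Rn R n] (conj_exp r).
Proof.
move=> mr r1; have m1 : measurable_fun [set: Rn R n] (fun x => r x - 1).
  exact: (measurable_funB mr (@measurable_cst _ _ (Rn R n) R setT 1)).
have mi : measurable_fun [set: Rn R n] (fun x => (r x - 1)^-1).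
  by apply: (measurable_invr _ m1) => x; rewrite subr_gt0.
exact: (measurable_funM mr mi).
Qed.

Lemma conj_exp_ge1 (R : realType) (n : nat) (r : Rn R n -> R) x : 1 < r x -> 1 <= conj_exp r x.
Proof. by move=> r1; rewrite /conj_exp ler_pdivlMr ?subr_gt0// mul1r gerBl. Qed.

(** * The commutator *)

Section setting.
Context (R : realType) (n m : nat).
Local Notation E := (Rn R n).
Local Notation mu := (@leb R n).
Variables (p : 'I_m -> E -> R) (t alpha : R) (q : E -> R) (w : 'I_m -> E -> \bar R).
Hypotheses (hn : (0 < n)%N) (hm : (0 < m)%N)
  (hp : forall i, log_Holder (p i) /\ exponent_P (p i)) (ht1 : 1 < t)
  (htp : forall i, (t%:E < exp_inf (p i))%E) (hq : exponent_P0 q)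
  (hpq : forall x, alpha / n%:R = (harmonic_exp p x)^-1 - (q x)^-1)
  (halpha : 0 < alpha / n%:R < m%:R / t).

Let al : R := alpha / n%:R.
Let t0 : 0 < t. Proof. exact: lt_trans ltr01 ht1. Qed.

Lemma exponent_bounds (f : E -> R) (a b : R) : (0 < a%:E)%E -> (a%:E <= exp_inf f)%E ->
  (exp_sup f <= b%:E)%E -> {ae mu, forall x, a <= f x <= b}.
Proof.
move=> a0 ha hb; have h1 := ess_inf_le mu (EFin \o f); have h2 := ess_sup_ge mu (EFin \o f).
apply: (filterS2 _ _ h1 h2) => x x1 x2; apply/andP; split; rewrite -lee_fin.
  exact: le_trans ha x1.
exact: le_trans x2 hb.
Qed.

(** By continuity the essential bounds hold at every point; the upper one is obtained from
    [- p i]. *)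
Lemma p_bounds i : exists b : R, forall x, t < p i x <= b.
Proof.
have [hl [mp p0 p1 pe ps]] := hp i.
have inf : exp_inf (p i) \is a fin_num.
  by rewrite fin_numElt (lt_trans _ p1) ?ltNyr//= (le_lt_trans pe ps).
have supf : exp_sup (p i) \is a fin_num.
  by rewrite fin_numElt (lt_trans _ (lt_le_trans p1 pe)) ?ltNyr.
have ti : t < fine (exp_inf (p i)) by rewrite -lte_fin fineK.
have hae := @exponent_bounds (p i) (fine (exp_inf (p i))) (fine (exp_sup (p i))).
have {}hae : {ae mu, forall x, fine (exp_inf (p i)) <= p i x <= fine (exp_sup (p i))}.
  apply: hae; first by rewrite lte_fin (lt_trans t0).
    by rewrite fineK.
  by rewrite fineK.
have cp := log_Holder_continuous hl.
exists (fine (exp_sup (p i))) => x; apply/andP; split.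
  apply: lt_le_trans ti _; apply: (ae_le_everywhere cp).
  by apply: filterS hae => y /andP[].
have cn : cube_continuous (fun y => - p i y).
  move=> y e e0; have [k hk] := cp y e e0; exists k => z yz.
  by rewrite -opprD normrN; exact: hk.
have := @ae_le_everywhere _ _ _ (- fine (exp_sup (p i))) cn.
rewrite -lerN2; apply.
by apply: filterS hae => y /andP[_ h]; rewrite lerN2.
Qed.

Lemma p_gt i x : t < p i x. Proof. by have [b /(_ x)/andP[]] := p_bounds i. Qed.
Lemma p_ge1 i x : 1 <= p i x. Proof. exact: ltW (lt_trans ht1 (p_gt i x)). Qed.
Let p_gt0 i x : 0 < p i x. Proof. exact: lt_trans t0 (p_gt i x). Qed.

Lemma p_le : exists2 pp : R, 1 <= pp & forall i x, p i x <= pp.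
Proof.
have [bf hb] := choice p_bounds.
exists (\sum_i `|bf i| + 1); first by rewrite lerDr sumr_ge0.
move=> i x; have /andP[_ h] := hb i x; apply: le_trans h _.
apply: le_trans (ler_norm _) _; rewrite (bigD1 i)//= -addrA lerDl addr_ge0// sumr_ge0//.
Qed.

Lemma sum_pinv x : \sum_(i < m) (p i x)^-1 = (q x)^-1 + al.
Proof. by rewrite /al (hpq x) /harmonic_exp invrK addrC subrK. Qed.

Lemma q_pos x : 0 < q x. Proof. by have [_] := hq. Qed.

(** 1 / q is at most a sum of m reciprocals, each at most 1. *)
Lemma q_ge x : m%:R^-1 <= q x.
Proof.
have m0 : 0 < m%:R :> R by rewrite ltr0n.
rewrite -[q x]invrK lef_pV2 ?posrE ?invr_gt0 ?q_pos//.
apply: (@le_trans _ _ (\sum_(i < m) (p i x)^-1)).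
  by have /andP[h _] := halpha; rewrite sum_pinv lerDl ltW.
apply: (@le_trans _ _ (\sum_(i < m) (1 : R))).
  by apply: ler_sum => i _; rewrite invf_le1 ?p_ge1.
by rewrite sumr_const card_ord.
Qed.

(** Continuity is at hand for the sum of the reciprocals of the p_i, which is 1 / q + al, so the
    essential bound is made pointwise there. *)
Lemma q_le : exists2 q1 : R, 0 < q1 & forall x, q x <= q1.
Proof.
have [mq q0 qi qe qs] := hq.
have sf : exp_sup q \is a fin_num.
  by rewrite fin_numElt (lt_trans _ (lt_le_trans qi qe)) ?ltNyr.
have S0 : 0 < fine (exp_sup q) by rewrite -lte_fin fineK// (lt_le_trans qi qe).
exists (fine (exp_sup q)) => // x; rewrite -[leRHS]invrK -[leLHS]invrK.
rewrite lef_pV2 ?posrE ?invr_gt0 ?q_pos//.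
rewrite -(lerD2r al) -sum_pinv.
apply: (@ae_le_everywhere _ _ (fun x => \sum_(i < m) (p i x)^-1)).
  by apply: sum_inv_continuous p_ge1 _ => i; exact: (hp i).1.
have h2 := ess_sup_ge mu (EFin \o q).
apply: filterS h2 => y h; rewrite sum_pinv lerD2r lef_pV2 ?posrE ?q_pos//.
by rewrite -lee_fin fineK.
Qed.

(* The value 1 is only taken on a null set. *)
Definition real_weight i x : R := if (0 < w i x < +oo)%E then fine (w i x) else 1.

Lemma real_weight_gt0 i x : 0 < real_weight i x.
Proof.
rewrite /real_weight; case: ifP => [/andP[h1 h2]|_]; last exact: ltr01.
by apply: fine_gt0; rewrite h1.
Qed.

Hypothesis (mw : forall i, is_weight (w i)).

Lemma measurable_real_weight i : measurable_fun [set: E] (real_weight i).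
Proof.
have [_ [mwi _] _] := mw i.
apply: measurable_fun_ifT.
- apply: (measurable_fun_bool true).
  have -> : [set: E] `&` (fun x => (0 < w i x < +oo)%E) @^-1` [set true] =
      [set: E] `&` w i @^-1` `]0%E, +oo%E[%classic.
    by apply/seteqP; split => x [_ /=]; rewrite in_itv/=.
  by apply: mwi => //; exact: emeasurable_itv.
- exact: measurableT_comp (fine_measurable measurableT) mwi.
- exact: measurable_cst.
Qed.

Lemma real_weight_ae i : {ae mu, forall x, w i x = (real_weight i x)%:E}.
Proof.
have [_ _ h] := mw i; apply: filterS h => x h; rewrite /real_weight h fineK//.
by case/andP: h => h1 h2; rewrite fin_numElt h2 (lt_trans _ h1)// ltNy0.
Qed.

Definition om := wprod real_weight.
Definition iw i := winv (real_weight i).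

Lemma om_gt0 x : 0 < om x. Proof. by apply: prodr_gt0 => i _; exact: real_weight_gt0. Qed.
Lemma iw_gt0 i x : 0 < iw i x. Proof. by rewrite invr_gt0 real_weight_gt0. Qed.
Lemma measurable_om : measurable_fun [set: E] om.
Proof. by apply: measurable_wprod => i; exact: measurable_real_weight. Qed.
Lemma measurable_iw i : measurable_fun [set: E] (iw i).
Proof. by apply: measurable_winv; [exact: real_weight_gt0|exact: measurable_real_weight]. Qed.

Let mp i : measurable_fun [set: E] (p i). Proof. by have [_ []] := hp i. Qed.
Let mq : measurable_fun [set: E] q. Proof. by have [] := hq. Qed.
Let m0 : 0 < m%:R :> R. Proof. by rewrite ltr0n. Qed.

Let pt_gt1 i x : 1 < p i x / t. Proof. by rewrite ltr_pdivlMr// mul1r p_gt. Qed.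
Let p_gt1 i x : 1 < p i x. Proof. exact: lt_trans ht1 (p_gt i x). Qed.

Let sb i : E -> R := fun x => t * conj_exp (fun y => p i y / t) x.
Let M : R := m%:R - al.
Let M2 : R := m%:R / t - al.

Lemma A_class_balls : A_class p q alpha w ->
  exists2 A : R, 0 < A & forall (x : E) (r : R), 0 < r ->
    exists (lam : R) (sig : 'I_m -> R), [/\ 0 < lam /\ (forall i, 0 < sig i),
     (modular mu q om (eucl_ball x r) lam <= 1)%E,
     forall i, (modular mu (conj_exp (p i)) (iw i) (eucl_ball x r) (sig i) <= 1)%E &
     fine (mu (eucl_ball x r)) `^ (- M) * (lam * \prod_(i < m) sig i) <= A].
Proof.
move=> hw.
  have c0 : 0 < Num.min 1 (m%:R^-1 : R) by rewrite lt_min ltr01 invr_gt0.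
  have [A A0 hA] := A_class_real c0 mq (fun x => le_trans (ge_minr _ _) (q_ge x))
    (fun i => measurable_conj_exp (mp i) (p_gt1 i))
    (fun i x => le_trans (ge_minl _ _) (conj_exp_ge1 (p_gt1 i x)))
    measurable_real_weight real_weight_gt0 real_weight_ae hw.
  exists A => // x r r0; have := hA x r r0.
  by have -> : alpha / n%:R - m%:R = - M by rewrite /M /al opprB.
Qed.

(** Taking t-th roots of all scales turns the condition on the powered weights into one on the
    weights, at the exponents [q] and [sb i]. *)
Lemma A_class_powered_balls : A_class (fun i x => p i x / t) (fun x => q x / t) (t * alpha)
    (fun i x => (w i x `^ t)%E) ->
  exists2 A : R, 0 < A & forall (x : E) (r : R), 0 < r ->
    exists (lam : R) (sig : 'I_m -> R), [/\ 0 < lam /\ (forall i, 0 < sig i),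
     (modular mu q om (eucl_ball x r) lam <= 1)%E,
     forall i, (modular mu (sb i) (iw i)
       (eucl_ball x r) (sig i) <= 1)%E &
     fine (mu (eucl_ball x r)) `^ (- M2) * (lam * \prod_(i < m) sig i) <= A].
Proof.
move=> hwt.
have ti0 : 0 < t^-1 by rewrite invr_gt0.
  have c0 : 0 < Num.min 1 (m%:R^-1 / t : R) by rewrite lt_min ltr01 divr_gt0// invr_gt0.
  have mut i : measurable_fun [set: E] (fun x => real_weight i x `^ t).
    exact: measurable_powR2 (measurable_real_weight i) (@measurable_cst _ _ E R setT t).
  have qt x : Num.min 1 (m%:R^-1 / t : R) <= q x / t.
    by apply: le_trans (ge_minr _ _) _; rewrite ler_pM2r// q_ge.
  have utae i : {ae mu, forall x, (w i x `^ t)%E = (real_weight i x `^ t)%:E}.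
    by apply: filterS (real_weight_ae i) => x ->; rewrite poweR_EFin.
  have mpt i : measurable_fun [set: E] (fun x => p i x / t).
    exact: measurable_funM (mp i) (@measurable_cst _ _ E R setT t^-1).
  have [A' A'0 hA'] := A_class_real c0 (measurable_funM mq (@measurable_cst _ _ E R setT t^-1)) qt
    (fun i => measurable_conj_exp (mpt i) (pt_gt1 i))
    (fun i x => le_trans (ge_minl _ _) (conj_exp_ge1 (pt_gt1 i x)))
    mut (fun i x => powR_gt0 t (real_weight_gt0 i x)) utae hwt.
  exists (A' `^ t^-1); first by rewrite powR_gt0.
  move=> x r r0; have [lam [sig [[lam0 sig0] h1 h2 h3]]] := hA' x r r0.
  exists (lam `^ t^-1), (fun i => sig i `^ t^-1); split.
  - by split=> [|i]; rewrite powR_gt0.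
  - apply: le_trans h1; apply: ge0_le_integral_nomeas => y _; rewrite lee_fin ?powR_ge0//.
    have -> : wprod (fun i x => real_weight i x `^ t) y = om y `^ t.
      by rewrite /om /wprod powR_prod// => i; exact: ltW (real_weight_gt0 i y).
    by rewrite powR_rescale// ltW// om_gt0.
  - move=> i; apply: le_trans (h2 i); apply: ge0_le_integral_nomeas => y _.
      by rewrite lee_fin powR_ge0.
    have -> : winv (fun x => real_weight i x `^ t) y = iw i y `^ t.
      rewrite /iw /winv -[(real_weight i y)^-1]powR_inv1 ?(ltW (real_weight_gt0 i y))//.
      by rewrite -powRrM mulN1r powRN.
    set c := conj_exp _ y; have -> : c = t * c / t by rewrite mulrAC divff ?mul1r ?gt_eqF.
    by rewrite lee_fin powR_rescale// ltW// iw_gt0.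
  have B0 : 0 <= fine (mu (eucl_ball x r)) by exact: fine_ge0.
  have P0 i : 0 <= sig i by exact: ltW.
  have -> : fine (mu (eucl_ball x r)) `^ (- M2) * (lam `^ t^-1 * \prod_(i < m) sig i `^ t^-1) =
      (fine (mu (eucl_ball x r)) `^ (t * alpha / n%:R - m%:R) * (lam * \prod_(i < m) sig i)) `^ t^-1.
    rewrite powRM ?powR_ge0 ?mulr_ge0 ?(ltW lam0) ?prodr_ge0// powRM ?(ltW lam0) ?prodr_ge0//.
    rewrite powR_prod// -powRrM; congr (_ `^ _ * _).
    by rewrite /M2 /al; field; rewrite !gt_eqF// ltr0n.
  apply: le_powR h3; first exact: ltW.
  by rewrite mulr_ge0 ?powR_ge0// mulr_ge0 ?(ltW lam0) ?prodr_ge0.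
Qed.

Lemma core_estimate : A_class p q alpha w ->
  A_class (fun i x => p i x / t) (fun x => q x / t) (t * alpha)
    (fun i x => (w i x `^ t)%E) ->
  exists2 C : R, 0 < C & forall b j g N, dyadic_bmo b -> normalized p g ->
  (\int[mu]_x ((om x * \sum_(l < N.*2.+1) term iw M b j g (scale N l) x) `^ q x)%:E <= C%:E)%E /\
  forall k x i, (\int[mu]_(y in tcube k x) (osc_weight b j i k x y * g i y * iw i y)%:E =
    (cube_mean iw b j g k x i)%:E)%E.
Proof.
move=> /A_class_balls[A A0 hA] /A_class_powered_balls[A2 A20 hB].
have [pp pp1 ppp] := p_le; have [q1 q10 qq1] := q_le; have /andP[al0 alm] := halpha.
have ti0 : 0 < t^-1 by rewrite invr_gt0.
have ti1 : t^-1 < 1 by rewrite invf_lt1.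
have M20 : 0 < M2 by rewrite /M2 subr_gt0.
have M0 : 0 < M.
  by rewrite /M subr_gt0 (lt_trans alm)// ltr_pdivrMr// ltr_pMr.
pose q0 : R := m%:R^-1; have q00 : 0 < q0 by rewrite invr_gt0.
(* The largest value for which [exponent_gap] holds under [epsal]. *)
pose eps := q0 * al / 2; have eps0 : 0 < eps by rewrite divr_gt0// mulr_gt0.
have [de [J [k0 [[de0 de1 de11 depp] J0 k00 hu hi]]]] :=
  exponent_parameters (fun i => (hp i).1) p_ge1 ppp pp1 ht1 eps0.
have hLH := q_local (fun i => (hp i).1) p_ge1
  (fun x => (introT andP (conj (q_pos x) (qq1 x)))) sum_pinv.
have prod1 x : om x * \prod_(i < m) iw i x = 1.
  by rewrite /om /wprod -big_split /=; apply: big1 => i _; rewrite mulfV// gt_eqF// real_weight_gt0.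
have expM x : (q x)^-1 + \sum_(i < m) (conj_exp (p i) x)^-1 = M.
  have -> : \sum_(i < m) (conj_exp (p i) x)^-1 = \sum_(i < m) (1 - (p i x)^-1).
    apply: eq_bigr => i _; rewrite /conj_exp invf_div mulrBl divff ?mul1r// gt_eqF//.
  by rewrite sumrB sumr_const card_ord sum_pinv /M; ring.
have psb i x : (p i x)^-1 + (sb i x)^-1 = t^-1.
  exact: inv_conj_exp_scaled t0 (p_gt i x).
have mcp i := measurable_conj_exp (mp i) (p_gt1 i).
have msb i : measurable_fun [set: E] (sb i).
  apply: measurable_funM; first exact: measurable_cst.
  apply: (measurable_conj_exp _ (pt_gt1 i)).
  exact: measurable_funM (mp i) (@measurable_cst _ _ E R setT t^-1).
have cp0 i x : 0 < conj_exp (p i) x by exact: lt_le_trans (conj_exp_ge1 (p_gt1 i x)).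
have sb0 i x : 0 < sb i x.
  by apply: mulr_gt0 => //; exact: lt_le_trans (conj_exp_ge1 (pt_gt1 i x)).
have MM2 : M = M2 + m%:R * (1 - t^-1) by rewrite /M /M2; ring.
have de1' : de < 1 - t^-1 := de1.
have [C C0 hC] := integral_sum_terms hn mq measurable_om measurable_iw mcp om_gt0 iw_gt0 q00 q_ge
  qq1 cp0 M0 A0 prod1 expM hA hLH mp msb p_ge1 ppp sb0 psb al0 sum_pinv M20 MM2 A20
  de0 de1' de11 depp eps0 (lexx _) J0 k00 hu hi hB.
exists C => // b j g N nb ng; split; first exact: hC.
move=> k x i.
exact: (cube_meanE hn mq measurable_om measurable_iw iw_gt0 q00 M0 A0 hA mp msb p_ge1 ppp
  sb0 psb M20 A20 de0 de1' de11 depp eps0 J0 k00 hu hi hB j k x i nb ng).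
Qed.

End setting.

Lemma le_poweR (R : realType) (x y : \bar R) (r : R) : 0 <= r -> (0 <= x)%E -> (x <= y)%E ->
  (x `^ r <= y `^ r)%E.
Proof.
move=> r0 x0 xy; apply: gt0_ler_poweR => //; rewrite in_itv/= leey andbT//.
exact: le_trans xy.
Qed.

Lemma ereal_argmax (R : realType) (m : nat) (s : 'I_m -> \bar R) : (0 < m)%N ->
  exists j, forall i, (s i <= s j)%E.
Proof.
move=> hm; have := @Order.TotalTheory.arg_maxP _ _ _ (Ordinal hm) xpredT s isT.
by case=> j _ hj; exists j => i; exact: hj.
Qed.

Lemma BMO_norm_ge0 (R : realType) (n : nat) (b : Rn R n -> R) : (0 <= BMO_norm b)%E.
Proof.
pose x0 : Rn R n := [tuple of nseq n 0]; pose B := eucl_ball x0 1.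
have hB : eucl_balls B by exists x0 => //; exists 1 => //=; exact: ltr01.
have h : ((@leb R n B)^-1 * \int[@leb R n]_(x in B) `|b x - ball_avg b B|%:E <= BMO_norm b)%E.
  by apply: ereal_sup_ubound; exists B.
apply: (le_trans _ h); apply: mule_ge0; first by rewrite inve_ge0; exact: measure_ge0.
by apply: integral_ge0 => x _; rewrite lee_fin.
Qed.

Section commutator_estimate.
Context (R : realType) (n m : nat).
Local Notation E := (Rn R n).
Local Notation mu := (@leb R n).
Variables (p : 'I_m -> E -> R) (q : E -> R) (u : 'I_m -> E -> R) (w : 'I_m -> E -> \bar R).
Variables (T : ('I_m -> E -> R) -> E -> \bar R) (q0 M C CT : R).
Hypotheses (mp : forall i, measurable_fun [set: E] (p i)) (p0 : forall i x, 0 < p i x)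
  (mq : measurable_fun [set: E] q) (q00 : 0 < q0) (q0q : forall x, q0 <= q x)
  (muu : forall i, measurable_fun [set: E] (u i)) (u0 : forall i x, 0 < u i x)
  (wu : forall i, {ae mu, forall x, w i x = (u i x)%:E}) (C0 : 0 < C) (CT0 : 0 < CT).
Let iw i := winv (u i).
Let omu := wprod u.
Hypothesis core : forall b j g N, dyadic_bmo b -> normalized p g ->
  (\int[mu]_x ((omu x * \sum_(l < N.*2.+1) term iw M b j g (scale N l) x) `^ q x)%:E <= C%:E)%E /\
  forall k x i, (\int[mu]_(y in tcube k x) (osc_weight b j i k x y * g i y * iw i y)%:E =
    (cube_mean iw b j g k x i)%:E)%E.
Hypothesis hT : forall (F : 'I_m -> E -> R) x, (forall i, measurable_fun [set: E] (F i)) ->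
  (`|T F x| <= CT%:E * dyadic_sup M (fun i y => `|F i y|%:E) x)%E.

Let omu0 x : 0 < omu x. Proof. by apply: prodr_gt0 => i _. Qed.
Let momu : measurable_fun [set: E] omu. Proof. exact: measurable_wprod. Qed.
Let iw0 i x : 0 < iw i x. Proof. by rewrite invr_gt0. Qed.
Let miw i : measurable_fun [set: E] (iw i). Proof. exact: measurable_winv. Qed.
Let q_gt0 x : 0 < q x. Proof. exact: lt_le_trans (q0q x). Qed.

Definition wabs i (f : E -> R) : E -> R := fun x => u i x * `|f x|.

Lemma modular_lt_wLnorm i (f : E -> R) (Lam : R) : measurable_fun [set: E] f ->
  (wLnorm (p i) (w i) (EFin \o f) < Lam%:E)%E ->
  (modular mu (p i) (wabs i f) [set: E] Lam <= 1)%E.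
Proof.
move=> mf /ereal_inf_lt[_ [l [l0 hl] <-]]; rewrite lte_fin => lL.
have mg : measurable_fun [set: E] (wabs i f).
  exact: measurable_funM (muu i) (measurable_absR mf).
have g0 x : 0 <= wabs i f x by rewrite mulr_ge0// ltW.
apply: (le_trans (modular_le mu g0 (p0 i) [set: E] l0 (ltW lL))).
apply: le_trans hl; apply: (modular_le_Lnorm measurableT (mp i) mg g0 _ l0).
by apply: filterS (wu i) => x -> _ /=; rewrite /wabs normrM (ger0_norm (ltW (u0 i x))).
Qed.

Let K0 : R := (m%:R * C + 1) `^ q0^-1.
Let a_ge1 : 1 <= m%:R * C + 1. Proof. by rewrite lerDr mulr_ge0// ltW. Qed.
Let a_gt0 : 0 < m%:R * C + 1. Proof. exact: lt_le_trans a_ge1. Qed.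
Let K0_ge1 : 1 <= K0.
Proof.
apply: (@le_trans _ _ (1 `^ q0^-1)); first by rewrite powR1.
by apply: le_powR => //; rewrite invr_ge0 ltW.
Qed.
Let K0_gt0 : 0 < K0. Proof. exact: lt_le_trans K0_ge1. Qed.
Let K0E : K0 `^ (- q0) = (m%:R * C + 1)^-1.
Proof. by rewrite /K0 -powRrM mulrN mulVf ?gt_eqF// powR_inv1// ltW. Qed.

Section fixed_data.
Variables (b f : 'I_m -> E -> R) (nu Lam : 'I_m -> R).
Hypotheses (nu0 : forall j, 0 < nu j) (hb : forall j, dyadic_bmo (fun y => b j y / nu j))
  (mf : forall i, measurable_fun [set: E] (f i)) (L0 : forall i, 0 < Lam i)
  (hf : forall i, (modular mu (p i) (wabs i (f i)) [set: E] (Lam i) <= 1)%E).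

Let g i y := u i y * `|f i y| / Lam i.
Let b' j y := b j y / nu j.
Let U j N x := \sum_(l < N.*2.+1) term iw M (b' j) j g (scale N l) x.
Let S j x := ereal_sup (range (fun N => (U j N x)%:E)).
Let c : R := CT * \prod_(i < m) Lam i * \sum_(j < m) nu j.

Let ng : normalized p g.
Proof.
split=> [i|i y|i].
- apply: measurable_funM (@measurable_cst _ _ E R setT (Lam i)^-1).
  exact: measurable_funM (muu i) (measurable_absR (mf i)).
- by rewrite divr_ge0 ?mulr_ge0 ?(ltW (u0 i y)) ?(ltW (L0 i)).
- apply: le_trans (hf i); apply: ge0_le_integral_nomeas => y _; first by rewrite lee_fin powR_ge0.
  by rewrite /g /wabs divr1; exact: lexx.
Qed.

Let term0 j k x : 0 <= term iw M (b' j) j g k x.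
Proof. exact: (term_ge0 M iw0 (b' j) j k x ng). Qed.
Let U0 j N x : 0 <= U j N x. Proof. by apply: sumr_ge0 => l _. Qed.
Let Uh j x : {homo (fun N => U j N x) : k l / (k <= l)%N >-> k <= l}.
Proof.
apply/nondecreasing_seqP => N; rewrite /U.
rewrite (scale_sumS (fun k => term iw M (b' j) j g k x)).
by apply: ler_wpDl => //; rewrite lerDl.
Qed.
Let mU j N : measurable_fun [set: E] (U j N).
Proof. by apply: measurable_sum => l; apply: measurable_term; exact: (hb j). Qed.
Let S0 j x : (0 <= S j x)%E.
Proof.
apply: (@le_trans _ _ (U j 0%N x)%:E); first by rewrite lee_fin.
by apply: ereal_sup_ubound; exists 0%N.
Qed.

Let summand_le j x :
  (`|T [eta f with j |-> fun y => (b j x - b j y) * f j y]%R x| <=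
   (CT * (nu j * \prod_(i < m) Lam i))%:E * S j x)%E.
Proof.
have nu_ne0 : nu j != 0 by rewrite gt_eqF.
have mb : measurable_fun [set: E] (b j).
  have [mb' _ _ _] := hb j.
  have -> : b j = fun y => b j y / nu j * nu j by apply/funext => y; rewrite divfK.
  exact: measurable_funM mb' (@measurable_cst _ _ E R setT (nu j)).
have mF i : measurable_fun [set: E] ([eta f with j |-> fun y => (b j x - b j y) * f j y] i).
  rewrite /=; case: eqP => _; last exact: mf.
  apply: measurable_funM (mf j).
  exact: measurable_funB (@measurable_cst _ _ E R setT (b j x)) mb.
apply: (le_trans (hT x mF)); rewrite EFinM -muleA; apply: lee_wpmul2l.
  by rewrite lee_fin ltW.
apply: ge_ereal_sup => _ [N _ <-].
have [mg g0 _] := ng; have [_ hcm] := core j N (hb j) ng.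
apply: (@le_trans _ _ (nu j * \prod_(i < m) Lam i * U j N x)%:E).
  apply: (dyadic_sum_term M iw0 (b' := b' j) (g := g) N (ltW (nu0 j)) (fun i => ltW (L0 i)) g0 mf mg
    miw (hb j) (fun k i => hcm k x i)).
    by move=> y; rewrite /b' mulrCA divff ?mulr1.
  move=> i y; rewrite /g /iw /winv; have := gt_eqF (u0 i y); have := gt_eqF (L0 i) => Ln un.
  by field; rewrite Ln un.
rewrite EFinM; apply: lee_wpmul2l.
  by rewrite lee_fin mulr_ge0 ?(ltW (nu0 j))// prodr_ge0// => i _; exact: ltW.
by apply: ereal_sup_ubound; exists N.
Qed.

(** The power [q] is later applied to a single [S j x], with [j] depending on [x], and the sum over
    [j] is taken afterwards; this keeps the constant linear in the [nu j]. *)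
Let commutator_le (hm : (0 < m)%N) x : exists j, (`|commutator T b f x| <= c%:E * S j x)%E.
Proof.
have [j hj] := ereal_argmax (S ^~ x) hm.
exists j; apply: (le_trans (lee_abs_sum _ _ _)).
apply: (@le_trans _ _ (\sum_(i < m) (CT * (nu i * \prod_(i < m) Lam i))%:E * S j x)%E).
  apply: lee_sum => i _; apply: (le_trans (summand_le i x)); apply: lee_wpmul2l => //.
  rewrite lee_fin; apply: mulr_ge0; first exact: ltW.
  by rewrite mulr_ge0 ?(ltW (nu0 i))// prodr_ge0// => l _; exact: ltW.
rewrite -ge0_sume_distrl; last first.
  move=> i _; rewrite lee_fin; apply: mulr_ge0; first exact: ltW.
  by rewrite mulr_ge0 ?(ltW (nu0 i))// prodr_ge0// => l _; exact: ltW.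
rewrite sumEFin (_ : \sum_(i < m) _ = c); first exact: lexx.
by rewrite -mulr_sumr -mulr_suml /c; ring.
Qed.

Lemma commutator_wLnorm (hm : (0 < m)%N) :
  (wLnorm q (fun x => \prod_(i < m) w i x)%E (commutator T b f) <=
   (K0 * CT * \prod_(i < m) Lam i * \sum_(j < m) nu j)%:E)%E.
Proof.
have c0 : 0 < c.
  rewrite /c mulr_gt0 ?mulr_gt0 ?prodr_gt0//.
  by rewrite (bigD1 (Ordinal hm))//= ltr_wpDr// sumr_ge0// => i _; exact: ltW.
have -> : K0 * CT * \prod_(i < m) Lam i * \sum_(j < m) nu j = K0 * c by rewrite /c; ring.
apply: ereal_inf_lbound; exists (K0 * c) => //; split; first exact: mulr_gt0.
have K00 : 0 <= K0 `^ (- q0) by exact: powR_ge0.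
pose sp j x := sup_power omu q (U j) x.
have sp0 j x : (0 <= sp j x)%E by exact: sup_power_ge0.
have msp j : measurable_fun [set: E] (sp j) by exact: measurable_sup_power.
have spS0 x : (0 <= \sum_(j < m) sp j x)%E by exact: sume_ge0.
have mW : measurable_fun [set: E] (fun x => \sum_(j < m) sp j x)%E by exact: emeasurable_sum.
have hle : {ae mu, forall x, setT x ->
    ((`|(\prod_(i < m) w i x) * commutator T b f x| / (K0 * c)%:E) `^ q x <=
     (K0 `^ (- q0))%:E * \sum_(j < m) sp j x)%E}.
  have /filter_forall : forall i, {ae mu, forall x, w i x = (u i x)%:E} by exact: wu.
  apply: filterS => x hx _; have [j hj] := commutator_le hm x.
  have -> : (\prod_(i < m) w i x = (omu x)%:E)%E.
    by rewrite /omu /wprod -prodEFin; apply: eq_bigr => i _; exact: hx.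
  apply: (@le_trans _ _ (((omu x)%:E * S j x / K0%:E) `^ q x)%E); last first.
    apply: (le_trans (le_sup_power (U := U j) omu0 q00 q0q (U0 j) K0_ge1 (S0 j x) (lexx _))).
    apply: lee_wpmul2l; first by rewrite lee_fin.
    by rewrite (bigD1 j)//= leeDl// sume_ge0.
  apply: le_poweR; first exact: ltW.
    by apply: mule_ge0; rewrite ?inve_ge0 ?lee_fin// mulr_ge0// ltW.
  have -> : (`|(omu x)%:E * commutator T b f x| = (omu x)%:E * `|commutator T b f x|)%E.
    by rewrite abseM gee0_abs// lee_fin ltW.
  have -> : ((K0 * c)%:E^-1 = ((K0 * c)^-1)%:E)%E by rewrite inver gt_eqF// mulr_gt0.
  have -> : (K0%:E^-1 = (K0^-1)%:E)%E by rewrite inver gt_eqF.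
  apply: (@le_trans _ _ ((omu x)%:E * (c%:E * S j x) * ((K0 * c)^-1)%:E)%E).
    apply: lee_wpmul2r; first by rewrite lee_fin invr_ge0 mulr_ge0// ltW.
    by apply: lee_wpmul2l hj; rewrite lee_fin ltW.
  have -> : ((omu x)%:E * (c%:E * S j x) * ((K0 * c)^-1)%:E =
      (omu x)%:E * S j x * (c%:E * ((K0 * c)^-1)%:E))%E by rewrite [(c%:E * S j x)%E]muleC !muleA.
  by rewrite -EFinM invfM mulrCA divff ?mulr1 ?gt_eqF.
have hpos x : (0 <= (K0 `^ (- q0))%:E * \sum_(j < m) sp j x)%E.
  by apply: mule_ge0; [rewrite lee_fin|exact: sume_ge0].
have mR : measurable_fun [set: E] (fun x => (K0 `^ (- q0))%:E * \sum_(j < m) sp j x)%E.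
  exact: measurable_funeM.
(* Measurability is known only for the majorant. *)
apply: (le_trans (ae_le_integral_measr measurableT mR (fun x _ => poweR_ge0 _ _)
  (fun x _ => hpos x) hle)).
rewrite (ge0_integralZl_EFin mu measurableT (fun x _ => spS0 x) mW K00).
rewrite (ge0_integral_sum mu measurableT msp (fun j x _ => sp0 j x)).
apply: (@le_trans _ _ ((K0 `^ (- q0))%:E * \sum_(j < m) C%:E)%E).
  apply: lee_wpmul2l; first by rewrite lee_fin.
  apply: lee_sum => j _.
  apply: (integral_sup_power momu mq (mU j) omu0 q00 q0q (U0 j) (Uh j)) => N.
  exact: (core j N (hb j) ng).1.
rewrite sumEFin -EFinM lee_fin sumr_const card_ord K0E mulrC -[C *+ m]mulr_natl.
by rewrite ler_pdivrMr// mul1r lerDl.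
Qed.

End fixed_data.

(** The norms of the [f i] may be 0 and are infima, so the larger scales [L i + e1] are used, and e1
    tends to 0 through [prod_addr_le]. *)
Lemma commutator_operator_norm (hm : (0 < m)%N) (b : 'I_m -> E -> R) (nu : 'I_m -> R) :
  (forall j, 0 < nu j) -> (forall j, dyadic_bmo (fun y => b j y / nu j)) ->
  (operator_norm p w q (fun x => \prod_(i < m) w i x)%E (commutator T b) <=
   (K0 * CT * \sum_(j < m) nu j)%:E)%E.
Proof.
move=> nu0 hb; set c := K0 * CT * _.
have c0 : 0 <= c by rewrite /c !mulr_ge0 ?(ltW K0_gt0) ?(ltW CT0)// sumr_ge0// => j _; exact: ltW.
apply: ereal_inf_lbound; exists c => //; split=> // f hf.
pose L i := fine (wLnorm (p i) (w i) (EFin \o f i)).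
have LE i : wLnorm (p i) (w i) (EFin \o f i) = (L i)%:E.
  have [_ h] := hf i; rewrite fineK// ge0_fin_numE//.
  by apply: le_ereal_inf_tmp => _ [l [l0 _] <-]; rewrite lee_fin ltW.
have Lge0 i : 0 <= L i.
  rewrite -lee_fin -LE; by apply: le_ereal_inf_tmp => _ [l [l0 _] <-]; rewrite lee_fin ltW.
rewrite (eq_bigr _ (fun i _ => LE i)) prodEFin.
have [K K_ge0 hK] := prod_addr_le (index_enum 'I_m) Lge0.
apply/lee_addgt0Pr => e e0.
have d0 : 0 < c * K + 1 by rewrite ltr_wpDl// mulr_ge0.
pose e1 := Num.min 1 (e / (c * K + 1)).
have e10 : 0 < e1 by rewrite lt_min ltr01 divr_gt0.
have e11 : e1 <= 1 by exact: ge_minl.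
have e1K : c * (e1 * K) <= e.
  apply: (@le_trans _ _ (e / (c * K + 1) * (c * K))).
    by rewrite mulrCA; apply: ler_wpM2r; [exact: mulr_ge0|exact: ge_minr].
  by rewrite mulrAC ler_pdivrMr// ler_pM2l// lerDl.
have Lp i : 0 < L i + e1 by rewrite ltr_wpDl.
apply: (le_trans (commutator_wLnorm nu0 hb (fun i => (hf i).1) Lp _ hm)).
  move=> i; apply: modular_lt_wLnorm (hf i).1 _.
  by rewrite LE lte_fin ltrDl.
rewrite -EFinM -EFinD lee_fin.
have -> : K0 * CT * \prod_(i < m) (L i + e1) * \sum_(j < m) nu j = c * \prod_(i < m) (L i + e1).
  by rewrite /c; ring.
apply: (le_trans (ler_wpM2l c0 (hK e1 (ltW e10) e11))).
by rewrite mulrDr lerD2l.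
Qed.

(** A constant function has BMO norm 0, while normalization divides by a positive number: the norms
    are raised by [e1], whose contribution is at most an arbitrary [e]. *)
Lemma commutator_bound (hm : (0 < m)%N) : exists C : R, 0 < C /\
  forall b : 'I_m -> E -> R, (forall i, in_BMO (b i)) ->
    (operator_norm p w q (fun x => \prod_(i < m) w i x) (commutator T b)
       <= C%:E * \sum_(i < m) BMO_norm (b i))%E.
Proof.
have [D D0 hD] := BMO_dyadic R n.
exists (K0 * CT * D); split; first by rewrite !mulr_gt0.
move=> b hb; pose B i := fine (BMO_norm (b i)).
have Bge0 i := BMO_norm_ge0 (b i).
have BE i : BMO_norm (b i) = (B i)%:E.
  by have [_ h] := hb i; rewrite fineK// ge0_fin_numE.
have B0 i : 0 <= B i by rewrite -lee_fin -BE.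
rewrite (eq_bigr _ (fun i _ => BE i)) sumEFin -EFinM.
apply/lee_addgt0Pr => e e0; set c := K0 * CT * D; have c0 : 0 < c by rewrite !mulr_gt0.
have d0 : 0 < c * m%:R + 1 by rewrite ltr_wpDl// mulr_ge0// ltW.
pose e1 := e / (c * m%:R + 1); have e10 : 0 < e1 by rewrite divr_gt0.
have B1 i : 0 < B i + e1 by rewrite ltr_wpDl.
have hnu j : 0 < D * (B j + e1) by rewrite mulr_gt0.
have hdy j : dyadic_bmo (fun y => b j y / (D * (B j + e1))).
  by apply: hD => //; rewrite BE lee_fin lerDl ltW.
apply: (le_trans (commutator_operator_norm hm hnu hdy)).
rewrite -EFinD lee_fin -mulr_sumr big_split /= sumr_const card_ord.
have -> : K0 * CT * (D * (\sum_(i < m) B i + e1 *+ m)) = c * \sum_(i < m) B i + c * (e1 *+ m).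
  by rewrite /c; ring.
rewrite lerD2l -[e1 *+ m]mulr_natr mulrCA /e1 mulrAC.
by rewrite ler_pdivrMr// ler_pM2l// lerDl.
Qed.

End commutator_estimate.

Theorem theorem2p4 (R : realType) (n m : nat) (hn : (0 < n)%N) (hm : (0 < m)%N)
    (p : 'I_m -> Rn R n -> R) (hp : forall i, log_Holder (p i) /\ exponent_P (p i))
    (t : R) (ht1 : 1 < t) (htp : forall i, (t%:E < exp_inf (p i))%E)
    (alpha : R) (q : Rn R n -> R) (hq : exponent_P0 q)
    (hpq : forall x, alpha / n%:R = (harmonic_exp p x)^-1 - (q x)^-1)
    (halpha : 0 < alpha / n%:R < m%:R / t)
    (w : 'I_m -> Rn R n -> \bar R)
    (hw : A_class p q alpha w)
    (hwt : A_class (fun i x => p i x / t) (fun x => q x / t) (t * alpha)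
             (fun i x => (w i x `^ t)%E))
    (T : ('I_m -> Rn R n -> R) -> Rn R n -> \bar R)
    (hT : T = frac_maximal alpha \/ T = frac_integral alpha) :
  exists C : R, 0 < C /\
    forall b : 'I_m -> Rn R n -> R, (forall i, in_BMO (b i)) ->
      (operator_norm p w q (fun x => \prod_(i < m) w i x) (commutator T b)
         <= C%:E * \sum_(i < m) BMO_norm (b i))%E.
Proof.
have mw := hw.1.
have [C C0 core] := core_estimate hn hm hp ht1 htp hq hpq halpha mw hw hwt.
have t0 : 0 < t := lt_trans ltr01 ht1.
have mR0 : 0 < m%:R :> R by rewrite ltr0n.
have M0 : 0 < m%:R - alpha / n%:R.
  case/andP: halpha => _ h; rewrite subr_gt0; apply: (lt_trans h).
  by rewrite ltr_pdivrMr// ltr_pMr.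
(* The two operators enter only through this pointwise domination. *)
have [CT CT0 hCT] : exists2 CT : R, 0 < CT & forall (F : 'I_m -> Rn R n -> R) x,
    (forall i, measurable_fun [set: Rn R n] (F i)) ->
    (`|T F x| <= CT%:E * dyadic_sup (m%:R - alpha / n%:R) (fun i y => `|F i y|%:E) x)%E.
  case: hT => ->; first exact: frac_maximal_bound (ltW M0).
  exact: frac_integral_bound hn M0.
have q00 : 0 < m%:R^-1 :> R by rewrite invr_gt0.
have mp i : measurable_fun [set: Rn R n] (p i) by have [_ []] := hp i.
have p0 i x : 0 < p i x by exact: lt_trans t0 (p_gt hp ht1 htp i x).
have mq : measurable_fun [set: Rn R n] q by have [] := hq.
exact: (commutator_bound mp p0 mq q00 (q_ge hm hp ht1 htp hq hpq halpha)
  (measurable_real_weight mw) (real_weight_gt0 w) (real_weight_ae mw) C0 CT0 core hCT hm).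
Qed.
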